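(* Assume that $\Omega\subset\mathbb{R}^2$ is a bounded domain with $C^2$ boundary; $A\in L^\infty(\Omega;\mathbb{R}^{2\times2})$ is uniformly elliptic and satisfies the Cordes condition with parameter $\varepsilon\in(0,1]$; $\ell$ is a $C^1$ unit vector field on $\partial\Omega$ with $\theta(L)=\theta(0)$; and $\chi_0:=\min_{\partial\Omega}(\dot\theta-\chi)>0$. Let $\mathcal{T}_h$ be an exact conforming triangulation of $\Omega$. Then $$b_h(v_h,v_h)\ge(1-\sqrt{1-\varepsilon})\,\|v_h\|_h^2\qquad\text{for all }v_h\in V_h.$$
   Context: **Data.** $\partial\Omega$ is a closed $C^2$ curve parametrized by arc length $\boldsymbol{x}=(x_1,x_2):[0,L]\to\mathbb{R}^2$, $\boldsymbol{x}(0)=\boldsymbol{x}(L)$, oriented so that the unit outward normal is $n=(\dot x_2,-\dot x_1)$; a dot denotes the derivative with respect to arc length. $\chi:=\ddot x_1\dot x_2-\ddot x_2\dot x_1$. $\theta:[0,L]\to\mathbb{R}$ is the $C^1$ oriented (anticlockwise) angle from $n$ to $\ell$. $\frac{\partial v}{\partial\ell}:=\ell_1\partial_1v+\ell_2\partial_2v$, $\frac{\partial v}{\partial\ell^\perp}:=-\ell_2\partial_1v+\ell_1\partial_2v$. Uniform ellipticity: there are $\underline\nu,\bar\nu>0$ with $\underline\nu|\xi|^2\le\xi^tA(x)\xi\le\bar\nu|\xi|^2$ for all $\xi\in\mathbb{R}^2$, a.e. $x\in\Omega$. Cordes condition with parameter $\varepsilon$: $|A|^2/(\operatorname{tr}A)^2\le1/(1+\varepsilon)$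 a.e. in $\Omega$ ($|\cdot|$ the Frobenius norm). $\gamma:=\operatorname{tr}A/|A|^2$; $A:B:=\sum_{i,j}A_{ij}B_{ij}$. **Triangulation.** A closed set $K\subset\mathbb{R}^2$ is a curved triangle if $K=F_K(\hat K)$, where $\hat K$ is a fixed straight reference triangle and $F_K=\tilde F_K+\Phi_K$ is a $C^1$ map, with $\tilde F_K(\hat x)=B_K\hat x+b_K$ an invertible affine map and $\sup_{\hat x\in\hat K}\|D\Phi_K(\hat x)B_K^{-1}\|<1$. An exact conforming triangulation $\mathcal{T}_h$ of $\Omega$ is a conforming partition of $\overline\Omega$ into curved triangles such that each element has at most one truly curved edge, any truly curved edge lies on $\partial\Omega$, and all other edges are straight; for each straight edge $F$ of $K$, $F_K$ restricted to the corresponding edge of $\hat K$ is affine onto $F$. The maps $F_K$ are of class $C^2$. $\mathcal{F}_h^\partial$ is the set of edges contained in $\partial\Omega$, $\mathcal{F}_h^i$ the set of interior edges. **Finite element space** ($k\ge3$). $P_K:=\{\hat v\circ F_K^{-1}:\hat v\in\mathcal{P}_k(\hat K)\}$, where $\mathcal{P}_k$ denotes polynomials of total degree $\le k$; $V_h:=\{v\in H^1(\Omega):v|_K\in P_K\ \forall K\in\mathcal{T}_h,\ v\text{ is }C^1\text{ at all vertices}\}$ (''$C^1$ at a vertex'': values of $v|_K$ and $\nabla(v|_K)$ there agree for all $K$ containing it). **Forms and norm.** For an interior edge $F=\partial K^+\cap\partial K^-$, $[\frac{\partial v}{\partial n}]:=\frac{\partial v^+}{\partial n^+}+\frac{\partial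 v^-}{\partial n^-}$ with $v^\pm=v|_{K^\pm}$ and $n^\pm$ the unit outward normal of $K^\pm$; $t_F$ is a fixed unit tangent of $F$. For $w,v\in V_h$, $$s_h(w,v):=-2\sum_{F\in\mathcal{F}_h^i}\int_F\Big[\frac{\partial w}{\partial n}\Big]\frac{\partial^2v}{\partial t_F^2}\,\mathrm{d}s+2\sum_{F\in\mathcal{F}_h^\partial}\int_F\dot{\Big(\frac{\partial w}{\partial\ell}\Big)}\frac{\partial v}{\partial\ell^\perp}\,\mathrm{d}s,$$ $$b_h(w,v):=\sum_{K\in\mathcal{T}_h}\int_K\gamma (A:D^2w)\,\Delta v\,\mathrm{d}x+\frac{2-\sqrt{1-\varepsilon}}{2}s_h(w,v),$$ $$\|v\|_h^2:=\sum_{K\in\mathcal{T}_h}|v|_{H^2(K)}^2+\chi_0\sum_{F\in\mathcal{F}_h^\partial}\int_F|\nabla v|^2\,\mathrm{d}s,$$ where $|v|_{H^2(K)}^2=\int_K|D^2v|^2\,\mathrm{d}x$. *)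

(* Defs.v *)
From HB Require Import structures.
From mathcomp Require Import all_boot all_order all_algebra.
From mathcomp Require Import all_classical all_reals all_analysis.

Set Implicit Arguments.
Unset Strict Implicit.
Unset Printing Implicit Defensive.

Import Order.TTheory GRing.Theory Num.Theory.
Import numFieldNormedType.Exports.

Local Open Scope classical_set_scope.
Local Open Scope ring_scope.

(* Points of the plane are pairs.  The library norm on [R * R] is the max norm;
   it is used for the topology only, Euclidean lengths are [enorm]. *)
Section Plane.
Context {R : realType}.
Implicit Types (p q : R * R) (f : R * R -> R) (M : 'M[R]_2).

Definition dot p q : R := p.1 * q.1 + p.2 * q.2.

Definition enorm p : R := Num.sqrt (dot p p).

(* rotation by +pi/2 *)
Definition perp p : R * R := (- p.2, p.1).

Definition coord (i : 'I_2) p : R := if i == 0 then p.1 else p.2.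

Definition basis (i : 'I_2) : R * R := if i == 0 then (1, 0) else (0, 1).

Definition mxact M p : R * R :=
  (M 0 0 * p.1 + M 0 1 * p.2, M 1 0 * p.1 + M 1 1 * p.2).

Definition mxfrob (M N : 'M[R]_2) : R := \sum_i \sum_j M i j * N i j.

Definition grad f p : R * R := ('D_(basis 0) f p, 'D_(basis 1) f p).

Definition hess f p : 'M[R]_2 :=
  \matrix_(i, j) 'D_(basis j) ('D_(basis i) f) p.

Definition laplace f p : R := \tr (hess f p).

Definition jac (G : R * R -> R * R) p : 'M[R]_2 :=
  \matrix_(i, j) 'D_(basis j) (coord i \o G) p.

Fixpoint Ck_on (n : nat) (U : set (R * R)) f : Prop :=
  match n with
  | 0 => forall p, U p -> {for p, continuous f}
  | m.+1 => forall i : 'I_2,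
      (forall p, U p -> derivable f p (basis i)) /\ Ck_on m U ('D_(basis i) f)
  end.

(* C^n up to the boundary of a closed set D: C^n on an open neighbourhood *)
Definition Ck_map (n : nat) (D : set (R * R)) (G : R * R -> R * R) : Prop :=
  exists U : set (R * R), [/\ open U, D `<=` U &
    forall i : 'I_2, Ck_on n U (coord i \o G)].

Fixpoint Ck_line (n : nat) (f : R -> R) : Prop :=
  match n with
  | 0 => continuous f
  | m.+1 => (forall s, derivable f s 1) /\ Ck_line m (derive1 f)
  end.

Definition Ck_curve (n : nat) (c : R -> R * R) : Prop :=
  forall i : 'I_2, Ck_line n (coord i \o c).

Definition frontier (D : set (R * R)) : set (R * R) := closure D `\` interior D.

Definition segment p q : set (R * R) :=
  [set (1 - t) *: p + t *: q | t in `[0, 1]%classic].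

Definition is_segment (F : set (R * R)) : Prop := exists p q, F = segment p q.

(* Value at p of the continuous extension of f from the set D; for f = a
   derivative of v and D = the interior of an element K, this is the value at
   p in K, boundary included, of the corresponding derivative of v|_K. *)
Definition trace (D : set (R * R)) f p : R := lim (f @ within D (nbhs p)).

Definition grad_trace (D : set (R * R)) f p : R * R :=
  (trace D ('D_(basis 0) f) p, trace D ('D_(basis 1) f) p).

Definition lebesgue2 := (@lebesgue_measure R \x @lebesgue_measure R)%E.

(* integral of g along the part lying in F of a curve c parametrized by arc
   length s in D *)
Definition arc_int (c : R -> R * R) (D : set R) (F : set (R * R))
    (g : R -> R) : R :=
  Rintegral (@lebesgue_measure R) [set s | D s /\ F (c s)] g.

End Plane.

Section Sobolev.
Context {R : realType}.
Variable Omega : set (R * R).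
Implicit Types (v phi : R * R -> R).

Definition L2 v : Prop :=
  measurable_fun Omega v /\
  (@lebesgue2 R).-integrable Omega (fun x => (v x ^+ 2)%:E).

Definition test_function phi : Prop :=
  (forall n, Ck_on n setT phi) /\
  exists C : set (R * R), [/\ compact C, C `<=` Omega &
    forall x, ~ C x -> phi x = 0].

Definition H1 v : Prop :=
  L2 v /\ forall i : 'I_2, exists2 g : R * R -> R, L2 g &
    forall phi, test_function phi ->
      Rintegral (@lebesgue2 R) Omega (fun x => v x * 'D_(basis i) phi x) =
      - Rintegral (@lebesgue2 R) Omega (fun x => g x * phi x).

End Sobolev.

Section Boundary.
Context {R : realType}.
Variables (Omega : set (R * R)) (xb : R -> R * R) (L : R).

Definition tangent (s : R) : R * R :=
  (derive1 (coord 0 \o xb) s, derive1 (coord 1 \o xb) s).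

Definition normal (s : R) : R * R := ((tangent s).2, - (tangent s).1).

Definition chi (s : R) : R :=
  derive1n 2 (coord 0 \o xb) s * (tangent s).2 -
  derive1n 2 (coord 1 \o xb) s * (tangent s).1.

(* Omega is a bounded domain whose boundary is a closed C^2 curve, which xb
   parametrizes by arc length on [0, L]; being a closed C^2 curve, xb is seen
   as an L-periodic C^2 function on the line.  The last clause says that Omega
   lies on one side of its boundary and that [normal] points outwards. *)
Record C2_domain : Prop := {
  dom_nonempty : Omega !=set0;
  dom_open : open Omega;
  dom_connected : connected Omega;
  dom_bounded : bounded_set Omega;
  dom_length : 0 < L;
  dom_C2 : Ck_curve 2 xb;
  dom_periodic : forall s, xb (s + L) = xb s;
  dom_simple : {in `[0, L[ &, injective xb};
  dom_arclength : forall s, enorm (tangent s) = 1;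
  dom_boundary : xb @` `[0, L]%classic = frontier Omega;
  dom_outward : forall s, \forall t \near 0^'+,
    Omega (xb s - t *: normal s) /\ ~ closure Omega (xb s + t *: normal s) }.

Variables (ell : R * R -> R * R) (theta : R -> R).

(* a C^1 unit field on the boundary, and a C^1 determination on [0, L] of the
   oriented angle from the outward normal to it *)
Record oblique_field : Prop := {
  obl_C1 : Ck_curve 1 (ell \o xb);
  obl_unit : forall x, frontier Omega x -> enorm (ell x) = 1;
  obl_angle_C1 : Ck_line 1 theta;
  obl_angle : forall s, s \in `[0, L] ->
    ell (xb s) = cos (theta s) *: normal s + sin (theta s) *: perp (normal s);
  obl_angle_closed : theta L = theta 0 }.

Definition is_chi0 (chi0 : R) : Prop :=
  (exists2 s, s \in `[0, L] & chi0 = derive1 theta s - chi s) /\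
  (forall s, s \in `[0, L] -> chi0 <= derive1 theta s - chi s).

End Boundary.

Section Coefficient.
Context {R : realType}.
Variables (Omega : set (R * R)) (A : R * R -> 'M[R]_2).

Definition Linfty_coef : Prop := forall i j,
  measurable_fun Omega (fun x => A x i j) /\
  exists M : R, {ae @lebesgue2 R, forall x, Omega x -> `|A x i j| <= M}.

Definition uniformly_elliptic : Prop := exists nu0 nu1 : R,
  [/\ 0 < nu0, 0 < nu1 &
    {ae @lebesgue2 R, forall x, Omega x -> forall xi : R * R,
      nu0 * enorm xi ^+ 2 <= dot xi (mxact (A x) xi) <= nu1 * enorm xi ^+ 2}].

Definition cordes (eps : R) : Prop :=
  {ae @lebesgue2 R, forall x, Omega x ->
    mxfrob (A x) (A x) / (\tr (A x)) ^+ 2 <= (1 + eps)^-1}.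

Definition cordes_gamma (x : R * R) : R := \tr (A x) / mxfrob (A x) (A x).

End Coefficient.

(* tri_vert: vertices of the reference triangle; edge i of a triangle joins its
   vertices i + 1 and i + 2 (mod 3).  Only the restriction of [tri_map K] to the
   reference triangle is relevant. *)
Structure triangulation (R : realType) := Triangulation {
  tri_vert : 'I_3 -> R * R;
  tri_elt :> finType;
  tri_map : tri_elt -> R * R -> R * R }.

Section Mesh.
Context {R : realType}.
Variables (Omega : set (R * R)) (Th : triangulation R).
Implicit Types (K : Th) (i : 'I_3) (F : set (R * R)).

Definition ref_triangle : set (R * R) :=
  [set p | exists lam : 'I_3 -> R, [/\ forall i, 0 <= lam i, \sum_i lam i = 1 &
    p = \sum_i lam i *: tri_vert Th i]].

Definition ref_edge i : set (R * R) :=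
  segment (tri_vert Th (i + 1)) (tri_vert Th (i + 2%:R)).

Definition elt K : set (R * R) := tri_map K @` ref_triangle.

Definition vertex K i : R * R := tri_map K (tri_vert Th i).

Definition edge K i : set (R * R) := tri_map K @` ref_edge i.

Definition is_edge K F : Prop := exists i, F = edge K i.

Definition ref_nondegenerate : Prop :=
  dot (tri_vert Th 1 - tri_vert Th 0) (perp (tri_vert Th 2%:R - tri_vert Th 0))
    != 0.

(* tri_map K = affine map + Phi with sup ||DPhi B^-1|| < 1, ||.|| being the
   operator norm for the Euclidean norm *)
Definition curved_triangle K : Prop :=
  Ck_map 1 ref_triangle (tri_map K) /\
  exists (B : 'M[R]_2) (b : R * R), B \in unitmx /\
    let Phi := fun p => tri_map K p - (mxact B p + b) in
    exists2 c : R, c < 1 & forall p, ref_triangle p -> forall xi : R * R,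
      enorm (mxact (jac Phi p *m invmx B) xi) <= c * enorm xi.

Record exact_conforming : Prop := {
  mesh_ref : ref_nondegenerate;
  mesh_curved : forall K, curved_triangle K;
  mesh_C2 : forall K, Ck_map 2 ref_triangle (tri_map K);
  mesh_cover : \bigcup_K elt K = closure Omega;
  mesh_disjoint : forall K K', K != K' ->
    interior (elt K) `&` interior (elt K') = set0;
  mesh_conforming : forall K K', K != K' ->
    [\/ elt K `&` elt K' = set0,
        exists i j, elt K `&` elt K' = [set vertex K i] /\
                    vertex K i = vertex K' j |
        exists i j, elt K `&` elt K' = edge K i /\ edge K i = edge K' j];
  mesh_one_curved : forall K i j,
    ~ is_segment (edge K i) -> ~ is_segment (edge K j) -> i = j;
  mesh_curved_boundary : forall K i,
    ~ is_segment (edge K i) -> edge K i `<=` frontier Omega;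
  mesh_straight_affine : forall K i, is_segment (edge K i) ->
    forall t : R, t \in `[0, 1] ->
      tri_map K ((1 - t) *: tri_vert Th (i + 1) + t *: tri_vert Th (i + 2%:R)) =
      (1 - t) *: vertex K (i + 1) + t *: vertex K (i + 2%:R) }.

Definition boundary_edges : set (set (R * R)) :=
  [set F | (exists K, is_edge K F) /\ F `<=` frontier Omega].

Definition interior_edges : set (set (R * R)) :=
  [set F | exists K1 K2 : Th, [/\ K1 != K2, is_edge K1 F & is_edge K2 F]].

(* outward unit normal of a closed set K along a straight part F of its
   boundary *)
Definition outward_unit_normal (K F : set (R * R)) (n : R * R) : Prop :=
  [/\ enorm n = 1, forall p q, F p -> F q -> dot n (p - q) = 0 &
    forall p, F p -> \forall t \near 0^'+, ~ K (p + t *: n)].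

Definition unit_tangent (F : set (R * R)) (t : R * R) : Prop :=
  enorm t = 1 /\ forall p q, F p -> F q -> dot (perp t) (p - q) = 0.

(* An element of V_h is identified with its continuous representative on the
   closure of Omega, so that v|_K is a function on the closed set K. *)
Definition in_PK (k : nat) K (v : R * R -> R) : Prop :=
  exists c : nat -> nat -> R, forall p, ref_triangle p ->
    v (tri_map K p) =
      \sum_(i < k.+1) \sum_(j < k.+1 | (i + j <= k)%N)
        c i j * p.1 ^+ i * p.2 ^+ j.

Definition C1_at_vertices (v : R * R -> R) : Prop :=
  forall K K' i j, vertex K i = vertex K' j ->
    trace (interior (elt K)) v (vertex K i) =
      trace (interior (elt K')) v (vertex K i) /\
    grad_trace (interior (elt K)) v (vertex K i) =
      grad_trace (interior (elt K')) v (vertex K i).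

Definition Vh (k : nat) (v : R * R -> R) : Prop :=
  [/\ H1 Omega v, forall K, in_PK k K v & C1_at_vertices v].

(* broken gradient on the boundary, i.e. the gradient of v|_K on a boundary
   edge of K *)
Definition bgrad (v : R * R -> R) (x : R * R) : R * R :=
  grad_trace (\bigcup_K interior (elt K)) v x.

Variables (nK : Th -> set (R * R) -> R * R) (tF : set (R * R) -> R * R).

(* [dw/dn] = dw^+/dn^+ + dw^-/dn^-: F is an edge of exactly two elements K^+-,
   and nK K F is the outward unit normal of K along F *)
Definition normal_jump (w : R * R -> R) (F : set (R * R)) (x : R * R) : R :=
  \sum_(K : Th | `[< is_edge K F >])
    dot (nK K F) (grad_trace (interior (elt K)) w x).

(* integral over a straight edge, parametrized by arc length from any of its
   points *)
Definition straight_edge_int (F : set (R * R)) (g : R * R -> R) : R :=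
  let c := fun s : R => get F + s *: tF F in arc_int c setT F (g \o c).

Variables (xb : R -> R * R) (L : R) (ell : R * R -> R * R).

Definition boundary_edge_int (F : set (R * R)) (g : R -> R) : R :=
  arc_int xb `[0, L]%classic F g.

Definition d_ell (v : R * R -> R) (s : R) : R :=
  dot (ell (xb s)) (bgrad v (xb s)).

Definition d_ellperp (v : R * R -> R) (s : R) : R :=
  dot (perp (ell (xb s))) (bgrad v (xb s)).

Definition sh (w v : R * R -> R) : R :=
  - 2 * (\sum_(F \in interior_edges)
          straight_edge_int F (fun x =>
            normal_jump w F x * 'D_(tF F) ('D_(tF F) v) x))
  + 2 * (\sum_(F \in boundary_edges)
          boundary_edge_int F (fun s => derive1 (d_ell w) s * d_ellperp v s)).

(* Integrals over K are taken on its interior, K minus a null set. *)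
Definition elt_int K (g : R * R -> R) : R :=
  Rintegral (@lebesgue2 R) (interior (elt K)) g.

Definition bh (A : R * R -> 'M[R]_2) (eps : R) (w v : R * R -> R) : R :=
  \sum_(K : Th) elt_int K (fun x =>
    cordes_gamma A x * mxfrob (A x) (hess w x) * laplace v x)
  + (2 - Num.sqrt (1 - eps)) / 2 * sh w v.

Definition normh_sq (chi0 : R) (v : R * R -> R) : R :=
  \sum_(K : Th) elt_int K (fun x => mxfrob (hess v x) (hess v x))
  + chi0 * (\sum_(F \in boundary_edges)
      boundary_edge_int F (fun s => enorm (bgrad v (xb s)) ^+ 2)).

End Mesh.

(* Main.v *)
(* Let H be the Hessian of v on an element and sigma = sqrt (1 - eps).  Cordes'
   condition says |gamma A - I| <= sigma, hence
     gamma (A : H) tr H >= (1 - sigma / 2) (tr H)^2 - (sigma / 2) |H|^2,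
   and (tr H)^2 = |H|^2 + 2 det H.  It remains to bound
   sum_K 2 int_K det D^2 v + s_h (v, v) from below by chi0 times the boundary
   integral of |grad v|^2.  With g = grad v on K, Green's formula turns
   2 int_K det D^2 v into the integral of g1 dg2 - g2 dg1 along the boundary of K.
   On a straight edge this form is 2 v_n d(v_t) - d(v_n v_t); the tangential
   derivatives from both sides agree, the exact parts cancel because v is C^1 at
   the vertices, and the jump term of s_h is left.  On the boundary curve, with
   a = dv/dl and b = dv/dl^perp, the form is
     (theta' - chi) |g|^2 ds - 2 b da + d(a b):
   the exact parts telescope around the curve, - 2 b da is compensated by s_h, and
   theta' - chi >= chi0.
     Green's formula on an element rests on a shear X = x + al y that is injective
   with a chord bound on each of the three edges: then the element is the region
   between the graph over X of one edge and that of the other two. *)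

Require Import Defs.
From mathcomp Require Import all_boot all_order all_algebra.
From mathcomp Require Import all_classical all_reals all_analysis.
From mathcomp Require Import measurable_realfun ring lra.
(* again, because the libraries also define [basis] *)
Import Defs.

Set Implicit Arguments.
Unset Strict Implicit.
Unset Printing Implicit Defensive.

Import Order.TTheory GRing.Theory Num.Theory.
Import numFieldNormedType.Exports.
Local Open Scope classical_set_scope.
Local Open Scope ring_scope.

(** * Functions of class C^1 and C^2 up to the boundary of a set *)

Section Calculus.
Context {R : realType}.
Implicit Types (D : set (R * R)) (f g : R * R -> R) (p q : R * R).

(** On a curved element [v] is only C^2, so its gradient is merely C^1, and it is given on a closed
    set. Derivatives are therefore relative to a set, in a form that composes with every curve
    inside the set, boundary included. Green's formula is needed for [u dw] with [w] of class C^1,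
    where no mixed second derivative of [w] may appear: difference quotients are integrated by parts
    before the limit is taken. The exact parts d(a b) on the boundary are not summed by ordering the
    edges along the curve. A C^1 function Q on the plane is interpolated through the values of a b
    at the vertices; the increment of a b over an edge is then the integral of dQ, and these
    integrals add up to that of dQ over the closed curve, which is 0. The direction of the shear is
    close to the image of the reference edge under the linear part of the element map, and is
    perturbed along a parabola in order to avoid the finitely many degenerate choices. The weight (2
    - sigma) / 2 of s_h is the coefficient 1 - sigma / 2 that stands before 2 det H once (tr H)^2 is
    expanded. *)

Lemma near_slope_is_derive (f g : R -> R) (x a : R) :
  g z @[z --> x] --> a ->
  (\forall z \near x, f z - f x = g z * (z - x)) -> is_derive x 1 f a.
Proof.
move=> ga fg; apply/is_derive1_caratheodory.
exists (fun z => if z == x then a else (f z - f x) / (z - x)); split.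
- move=> z; case: eqP => [->|/eqP zx]; first by rewrite !subrr mulr0.
  by rewrite divfK// subr_eq0.
- apply/cvgrPdist_le => e e0; rewrite eqxx.
  move/cvgrPdist_le : ga => /(_ _ e0); apply: filterS2 fg => z fz gz.
  case: (eqVneq z x) => [_|zx]; first by rewrite subrr normr0 ltW.
  by rewrite fz mulfK ?subr_eq0.
- by rewrite eqxx.
Qed.

(** Continuity of the restriction of [f] to [D]: values off [D] do not matter, as suits functions
    given on a closed element. *)
Definition cin D f := forall p, D p -> f @ within D (nbhs p) --> f p.

(* Differentiability at [p] relative to [D], in Caratheodory's form. *)
Definition wdiff D f (d1 d2 : R) p := exists A1 A2 : R * R -> R,
  [/\ A1 @ within D (nbhs p) --> d1, A2 @ within D (nbhs p) --> d2 &
      \forall q \near within D (nbhs p),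
        f q = f p + (A1 q * (q.1 - p.1) + A2 q * (q.2 - p.2))].

Lemma cvg_within_fst D p : (q.1 @[q --> within D (nbhs p)]) --> p.1.
Proof. by apply: cvg_within_filter; exact: cvg_fst. Qed.

Lemma cvg_within_snd D p : (q.2 @[q --> within D (nbhs p)]) --> p.2.
Proof. by apply: cvg_within_filter; exact: cvg_snd. Qed.

Lemma wdiff_cvg D f d1 d2 p : wdiff D f d1 d2 p ->
  f @ within D (nbhs p) --> f p.
Proof.
move=> [A1 [A2 [A1p A2p fE]]].
rewrite -[X in _ --> X]addr0 -[X in _ + X]addr0 -[X in _ + (X + _)](mulr0 d1).
rewrite -[X in _ + (_ + X)](mulr0 d2) -[X in d1 * X](subrr p.1).
rewrite -[X in d2 * X](subrr p.2).
apply: (cvg_trans (near_eq_cvg _)).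
  by move: fE; apply: filterS => q ->.
apply: cvgD; first exact: cvg_cst.
apply: cvgD; apply: cvgM => //; apply: cvgB; try exact: cvg_cst.
- exact: cvg_within_fst.
- exact: cvg_within_snd.
Unshelve. all: by end_near. Qed.

Lemma wdiffS D D' f d1 d2 p : D' `<=` D -> wdiff D f d1 d2 p ->
  wdiff D' f d1 d2 p.
Proof.
move=> D'D [A1 [A2 [A1p A2p fE]]]; exists A1, A2.
have sub : within D' (nbhs p) `=>` within D (nbhs p).
  move=> S; rewrite /within /= => SD; near=> q => /D'D.
  by near: q.
split; last exact: sub.
- by apply: cvg_trans A1p; exact: cvg_app.
- by apply: cvg_trans A2p; exact: cvg_app.
Unshelve. all: by end_near. Qed.

Lemma wdiff_cst D (a : R) p : wdiff D (cst a) 0 0 p.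
Proof.
exists (cst 0), (cst 0); split; try exact: cvg_cst.
by near=> q; rewrite /= !mul0r !addr0.
Unshelve. all: by end_near. Qed.

Lemma wdiff_fst D p : wdiff D fst 1 0 p.
Proof.
exists (cst 1), (cst 0); split; try exact: cvg_cst.
by near=> q; rewrite /= mul1r mul0r addr0 addrC subrK.
Unshelve. all: by end_near. Qed.

Lemma wdiff_snd D p : wdiff D snd 0 1 p.
Proof.
exists (cst 0), (cst 1); split; try exact: cvg_cst.
by near=> q; rewrite /= mul1r mul0r add0r addrC subrK.
Unshelve. all: by end_near. Qed.

Lemma wdiffD D f g a1 a2 b1 b2 p : wdiff D f a1 a2 p -> wdiff D g b1 b2 p ->
  wdiff D (fun q => f q + g q) (a1 + b1) (a2 + b2) p.
Proof.
move=> [A1 [A2 [A1p A2p fE]]] [B1 [B2 [B1p B2p gE]]].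
exists (fun q => A1 q + B1 q), (fun q => A2 q + B2 q); split; try exact: cvgD.
near=> q; rewrite (near fE q)// (near gE q)//; ring.
Unshelve. all: by end_near. Qed.

Lemma wdiffM D f g a1 a2 b1 b2 p : wdiff D f a1 a2 p -> wdiff D g b1 b2 p ->
  wdiff D (fun q => f q * g q) (a1 * g p + f p * b1) (a2 * g p + f p * b2) p.
Proof.
move=> df dg; have fp := wdiff_cvg df.
case: df dg => [A1 [A2 [A1p A2p fE]]] [B1 [B2 [B1p B2p gE]]].
exists (fun q => A1 q * g p + f q * B1 q), (fun q => A2 q * g p + f q * B2 q).
split.
- by apply: cvgD; apply: cvgM => //; exact: cvg_cst.
- by apply: cvgD; apply: cvgM => //; exact: cvg_cst.
- near=> q; rewrite (near gE q)// [in LHS](near fE q)// [f q](near fE q)//; ring.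
Unshelve. all: by end_near. Qed.

Lemma wdiffV D f a1 a2 p : f p != 0 -> wdiff D f a1 a2 p ->
  wdiff D (fun q => (f q)^-1) (- (a1 / f p ^+ 2)) (- (a2 / f p ^+ 2)) p.
Proof.
move=> fp0 df; have fp := wdiff_cvg df.
case: df => [A1 [A2 [A1p A2p fE]]].
have fV : (f q)^-1 @[q --> within D (nbhs p)] --> (f p)^-1 by exact: cvgV.
have fVp : (f q)^-1 / f p @[q --> within D (nbhs p)] --> (f p ^+ 2)^-1.
  by rewrite expr2 invfM; apply: cvgM => //; exact: cvg_cst.
exists (fun q => - (A1 q * ((f q)^-1 / f p))), (fun q => - (A2 q * ((f q)^-1 / f p))).
split; try by apply: cvgN; exact: cvgM.
have f0 : \forall q \near within D (nbhs p), f q != 0.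
  move/cvgrPdist_lt : fp => /(_ `|f p|); rewrite normr_gt0 => /(_ fp0).
  apply: filterS => q; apply: contraTN => /eqP ->.
  by rewrite subr0 ltxx.
near=> q.
have fq0 : f q != 0 by near: q.
have H : A1 q * (q.1 - p.1) + A2 q * (q.2 - p.2) = f q - f p.
  by rewrite [f q](near fE q)//; ring.
rewrite !mulNr -opprD !(mulrAC _ (_ / f p)) -mulrDl H; field.
by rewrite fp0 fq0.
Unshelve. all: by end_near. Qed.

Lemma wdiff_eq D f d1 d2 e1 e2 p : wdiff D f d1 d2 p -> d1 = e1 -> d2 = e2 ->
  wdiff D f e1 e2 p.
Proof. by move=> ? <- <-. Qed.

Lemma wdiff_ext D f g d1 d2 p : D p -> (forall q, D q -> f q = g q) ->
  wdiff D f d1 d2 p -> wdiff D g d1 d2 p.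
Proof.
move=> Dp fg [A1 [A2 [A1p A2p fE]]]; exists A1, A2; split => //.
have {}fE : \forall q \near p, D q -> f q = f p +
  (A1 q * (q.1 - p.1) + A2 q * (q.2 - p.2)) by [].
suff : \forall q \near p, D q -> g q = g p +
  (A1 q * (q.1 - p.1) + A2 q * (q.2 - p.2)) by [].
by apply: filterS fE => q fE Dq; rewrite -!fg//; exact: fE.
Qed.

(** Caratheodory slopes have limits along [D], so they compose with a curve in [D] and combine with
    the slopes of the curve. The curve may run along the boundary of [D]. *)
Lemma wdiff_curve D f d1 d2 (c1 c2 : R -> R) s (a b : R) :
  wdiff D f d1 d2 (c1 s, c2 s) ->
  is_derive s 1 c1 a -> is_derive s 1 c2 b ->
  (\forall t \near s, D (c1 t, c2 t)) ->
  is_derive s 1 (fun t => f (c1 t, c2 t)) (d1 * a + d2 * b).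
Proof.
move=> [A1 [A2 [A1p A2p fE]]] dc1 dc2 Dc.
have c1c : {for s, continuous c1}.
  by apply/differentiable_continuous/derivable1_diffP; exact: ex_derive.
have c2c : {for s, continuous c2}.
  by apply/differentiable_continuous/derivable1_diffP; exact: ex_derive.
move/is_derive1_caratheodory : dc1 => [k1 [k1E k1c <-]].
move/is_derive1_caratheodory : dc2 => [k2 [k2E k2c <-]].
have cD : (c1 t, c2 t) @[t --> s] --> within D (nbhs (c1 s, c2 s)).
  move=> S; rewrite /within /= => SD.
  have h : (c1 t, c2 t) @[t --> s] --> (c1 s, c2 s).
    exact: cvg_pair c1c c2c.
  have := h _ SD; rewrite /= /nbhs /=; apply: filterS2 Dc => t Dt; exact.
apply: (@near_slope_is_derive _
  (fun t => A1 (c1 t, c2 t) * k1 t + A2 (c1 t, c2 t) * k2 t)).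
- apply: cvgD; apply: cvgM; [|exact: k1c| |exact: k2c].
  + exact: (cvg_comp _ _ cD A1p).
  + exact: (cvg_comp _ _ cD A2p).
- have fEc := cD _ fE.
  near=> t.
  have -> : f (c1 t, c2 t) = f (c1 s, c2 s) + (A1 (c1 t, c2 t) * (c1 t - c1 s) +
    A2 (c1 t, c2 t) * (c2 t - c2 s)) by near: t.
  rewrite k1E k2E; ring.
Unshelve. all: by end_near. Qed.

Lemma near_boxP p (P : set (R * R)) : (\forall q \near p, P q) <->
  exists2 r : R, 0 < r & forall q, `|q.1 - p.1| < r -> `|q.2 - p.2| < r -> P q.
Proof.
split.
  move/nbhs_ballP => [r /= r0 rP]; exists r => // q q1 q2; apply: rP.
  by split; rewrite /ball /= distrC.
move=> [r r0 rP]; apply/nbhs_ballP; exists r => // -[x y] [/= q1 q2].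
by apply: rP => /=; rewrite distrC.
Qed.

Lemma is_deriveP (V : normedModType R) (f : V -> R) (p v : V) d :
  is_derive p v f d <-> is_derive (0 : R) 1 (fun h : R => f (h *: v + p)) d.
Proof.
have E : (fun h : R => h^-1 *: ((f \o shift p) (h *: v) - f p)) =
  (fun h : R => h^-1 *: (((fun h : R => f (h *: v + p)) \o shift 0) (h *: 1) -
     f (0 *: v + p))).
  by apply/funext => h /=; rewrite scale0r add0r addr0 /GRing.scale /= mulr1.
by split => -[]; rewrite /derivable /derive => df dE; split;
  rewrite /derivable /derive; [rewrite -E|rewrite -E|rewrite E|rewrite E].
Qed.

Lemma addr_basis0 (h : R) p : h *: basis 0 + p = (h + p.1, p.2).
Proof.
case: p => a b; have -> : h *: basis 0 + (a, b) = (h * 1 + a, h * 0 + b) by [].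
by rewrite mulr1 mulr0 add0r.
Qed.

Lemma addr_basis1 (h : R) p : h *: basis 1 + p = (p.1, h + p.2).
Proof.
case: p => a b; have -> : h *: basis 1 + (a, b) = (h * 0 + a, h * 1 + b) by [].
by rewrite mulr1 mulr0 add0r.
Qed.

Lemma is_derive_addr (a x : R) : is_derive x 1 (fun h : R => h + a) 1.
Proof. exact: is_derive_shift. Qed.

(** At an interior point both coordinate lines stay in [D] for a while and serve as curves. This is
    the bridge to the directional derivatives ['D_] of the definitions. *)
Lemma wdiff_interior D f d1 d2 p : interior D p -> wdiff D f d1 d2 p ->
  is_derive p (basis 0) f d1 /\ is_derive p (basis 1) f d2.
Proof.
move=> Dp df.
have Dp' : \forall q \near p, D q by [].
move/near_boxP : Dp' => [r r0 rD].
have near0 : \forall h \near (0:R), `|h| < r by apply: nbhs0_lt.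
split; apply/is_deriveP.
- have -> : (fun h : R => f (h *: (basis 0 : R * R) + p)) =
    (fun h : R => f (h + p.1, cst p.2 h)).
    by apply/funext => h; rewrite addr_basis0.
  have dx := is_derive_addr p.1 0.
  rewrite (_ : d1 = d1 * 1 + d2 * 0); last by rewrite mulr1 mulr0 addr0.
  apply: (wdiff_curve (D := D)); first by rewrite add0r -surjective_pairing.
  apply: filterS near0 => h hr; apply: rD; first by rewrite /= addrK.
  by rewrite /= subrr normr0.
- have -> : (fun h : R => f (h *: (basis 1 : R * R) + p)) =
    (fun h : R => f (cst p.1 h, h + p.2)).
    by apply/funext => h; rewrite addr_basis1.
  have dx := is_derive_addr p.2 0.
  rewrite (_ : d2 = d1 * 0 + d2 * 1); last by rewrite mulr1 mulr0 add0r.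
  apply: (wdiff_curve (D := D)); first by rewrite add0r -surjective_pairing.
  apply: filterS near0 => h hr; apply: rD; last by rewrite /= addrK.
  by rewrite /= subrr normr0.
Qed.

Lemma is_derive_continuous (f : R -> R) (x d : R) : is_derive x 1 f d ->
  {for x, continuous f}.
Proof.
by move=> df; apply/differentiable_continuous/derivable1_diffP; exact: ex_derive.
Qed.

Lemma mvt_between (f df : R -> R) (a b : R) :
  (forall x, Order.min a b <= x <= Order.max a b -> is_derive x 1 f (df x)) ->
  exists2 c, Order.min a b <= c <= Order.max a b & f b - f a = df c * (b - a).
Proof.
wlog ab : a b / a <= b.
  move=> H d; case/orP: (le_total a b) => [ab|ba]; first exact: H.
  have [//||c ca cE] := H b a.
    by move=> x xab; apply: d; rewrite minC maxC.
  exists c; first by rewrite minC maxC.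
  by rewrite -opprB cE -mulrN opprB.
rewrite (min_l ab) (max_r ab) => d.
have {}d (x : R) : x \in `[a, b]%R -> is_derive x 1 f (df x).
  by rewrite in_itv; exact: d.
have cf : {within `[a, b], continuous f}.
  by apply: derivable_within_continuous => x /d dx; exact: ex_derive.
have doo (x : R) : x \in `]a, b[%R -> is_derive x 1 f (df x).
  by move=> xab; apply: d; exact: subset_itv_oo_cc.
have [c cab cE] := MVT_segment ab doo cf.
by exists c => //; move: cab; rewrite in_itv.
Qed.

Lemma between_dist (a b c r : R) : Order.min a b <= c <= Order.max a b ->
  `|b - a| < r -> `|c - a| < r.
Proof.
rewrite minEle maxEle; case: ifPn => [ab|]; last rewrite -ltNge => /ltW ab.
  by move=> /andP[ac cb]; rewrite !ger0_norm ?subr_ge0//; lra.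
by move=> /andP[bc ca]; rewrite !ler0_norm ?subr_le0//; lra.
Qed.

Lemma is_derive1P (f : R -> R) (x d : R) :
  is_derive x 1 f d <-> is_derive (0 : R) 1 (fun h => f (h + x)) d.
Proof.
have -> : (fun h => f (h + x)) = (fun h : R => f (h *: 1 + x)).
  by apply/funext => h; rewrite /GRing.scale /= mulr1.
exact: is_deriveP.
Qed.

Lemma is_derive_fst f p d : is_derive p (basis 0) f d <->
  is_derive p.1 1 (fun t => f (t, p.2)) d.
Proof.
have E : (fun h : R => f (h *: basis 0 + p)) = (fun h => f (h + p.1, p.2)).
  by apply/funext => h; rewrite addr_basis0.
split=> [/is_deriveP|/is_derive1P H]; first by rewrite E => H; apply/is_derive1P.
by apply/is_deriveP; rewrite E.
Qed.

Lemma is_derive_snd f p d : is_derive p (basis 1) f d <->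
  is_derive p.2 1 (fun t => f (p.1, t)) d.
Proof.
have E : (fun h : R => f (h *: basis 1 + p)) = (fun h => f (p.1, h + p.2)).
  by apply/funext => h; rewrite addr_basis1.
split=> [/is_deriveP|/is_derive1P H]; first by rewrite E => H; apply/is_derive1P.
by apply/is_deriveP; rewrite E.
Qed.

(** The increment from [p] to [q] is split at the corner [(p.1, q.2)]; the slopes are the difference
    quotients on the two legs, which the mean value theorem turns into values of the partial
    derivatives near [p]. *)
Lemma C1_wdiff D f p :
  (\forall q \near p, derivable f q (basis 0)) ->
  (\forall q \near p, derivable f q (basis 1)) ->
  {for p, continuous ('D_(basis 0) f)} -> {for p, continuous ('D_(basis 1) f)} ->
  wdiff D f ('D_(basis 0) f p) ('D_(basis 1) f p) p.
Proof.
move=> /near_boxP[r1 r10 der1] /near_boxP[r2 r20 der2] c1 c2.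
apply: (@wdiffS setT) => //.
(* On a degenerate leg the slope is free; the derivative at [p] keeps the limit right. *)
pose A1 q := if q.1 == p.1 then 'D_(basis 0) f p else
  (f q - f (p.1, q.2)) / (q.1 - p.1).
pose A2 q := if q.2 == p.2 then 'D_(basis 1) f p else
  (f (p.1, q.2) - f p) / (q.2 - p.2).
exists A1, A2; split.
- apply: cvg_within_filter; apply/cvgrPdist_le => e e0.
  move/cvgrPdist_le : c1 => /(_ _ e0) /near_boxP[r r0 rc].
  apply/near_boxP; exists (Order.min r r1); first by rewrite lt_min r0 r10.
  move=> q; rewrite !lt_min => /andP[q1r q1r1] /andP[q2r q2r1].
  rewrite /A1; case: (eqVneq q.1 p.1) => [_|qp]; first by rewrite subrr normr0 ltW.
  have [|x xpq] := @mvt_between (fun t => f (t, q.2))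
     (fun t => 'D_(basis 0) f (t, q.2)) p.1 q.1.
    move=> x xpq; apply/(is_derive_fst f (x, q.2)).
    by apply: derivableP; apply: der1 => //=; exact: between_dist q1r1.
  rewrite -surjective_pairing => ->.
  rewrite mulfK ?subr_eq0//; apply: rc => //=; exact: between_dist q1r.
- apply: cvg_within_filter; apply/cvgrPdist_le => e e0.
  move/cvgrPdist_le : c2 => /(_ _ e0) /near_boxP[r r0 rc].
  apply/near_boxP; exists (Order.min r r2); first by rewrite lt_min r0 r20.
  move=> q; rewrite !lt_min => /andP[q1r q1r2] /andP[q2r q2r2].
  rewrite /A2; case: (eqVneq q.2 p.2) => [_|qp]; first by rewrite subrr normr0 ltW.
  have [|x xpq] := @mvt_between (fun t => f (p.1, t))
     (fun t => 'D_(basis 1) f (p.1, t)) p.2 q.2.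
    move=> x xpq; apply/(is_derive_snd f (p.1, x)).
    apply: derivableP; apply: der2 => //=; first by rewrite subrr normr0.
    exact: between_dist q2r2.
  rewrite -surjective_pairing => ->.
  rewrite mulfK ?subr_eq0//; apply: rc => /=; first by rewrite subrr normr0.
  exact: between_dist q2r.
- near=> q; rewrite /A1 /A2.
  have -> : (if q.1 == p.1 then 'D_(basis 0) f p else
      (f q - f (p.1, q.2)) / (q.1 - p.1)) * (q.1 - p.1) = f q - f (p.1, q.2).
    case: eqP => [E|/eqP ?]; last by rewrite divfK ?subr_eq0.
    by rewrite -E -surjective_pairing !subrr mulr0.
  have -> : (if q.2 == p.2 then 'D_(basis 1) f p else
      (f (p.1, q.2) - f p) / (q.2 - p.2)) * (q.2 - p.2) = f (p.1, q.2) - f p.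
    case: eqP => [->|/eqP ?]; last by rewrite divfK ?subr_eq0.
    by rewrite -surjective_pairing !subrr mulr0.
  ring.
Unshelve. all: by end_near. Qed.

Definition wC1 D f d1 d2 :=
  [/\ forall p, D p -> wdiff D f (d1 p) (d2 p) p, cin D d1 & cin D d2].

(** The suffix [e] hides the derivatives, which are not unique on an arbitrary [D]. *)
Definition wC1e D f := exists d1 d2, wC1 D f d1 d2.

Definition wC2e D f := exists d1 d2, [/\ wC1 D f d1 d2, wC1e D d1 & wC1e D d2].

Lemma cinD D f g : cin D f -> cin D g -> cin D (fun q => f q + g q).
Proof. by move=> cf cg p Dp; apply: cvgD; [exact: cf|exact: cg]. Qed.

Lemma cinN D f : cin D f -> cin D (fun q => - f q).
Proof. by move=> cf p Dp; apply: cvgN; exact: cf. Qed.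

Lemma cinM D f g : cin D f -> cin D g -> cin D (fun q => f q * g q).
Proof. by move=> cf cg p Dp; apply: cvgM; [exact: cf|exact: cg]. Qed.

Lemma cinV D f : (forall q, D q -> f q != 0) -> cin D f ->
  cin D (fun q => (f q)^-1).
Proof. by move=> f0 cf p Dp; apply: cvgV; [exact: f0|exact: cf]. Qed.

Lemma cin_cst D (a : R) : cin D (cst a).
Proof. by move=> p _; exact: cvg_cst. Qed.

Lemma wC1_cin D f d1 d2 : wC1 D f d1 d2 -> cin D f.
Proof. by move=> [df _ _] p /df; exact: wdiff_cvg. Qed.

Lemma wC1e_cin D f : wC1e D f -> cin D f.
Proof. by move=> [d1 [d2]]; exact: wC1_cin. Qed.

Lemma wC1e_cst D (a : R) : wC1e D (cst a).
Proof.
exists (cst 0), (cst 0); split; try exact: cin_cst.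
by move=> p _; exact: wdiff_cst.
Qed.

Lemma wC1D D f g a1 a2 b1 b2 : wC1 D f a1 a2 -> wC1 D g b1 b2 ->
  wC1 D (fun q => f q + g q) (fun q => a1 q + b1 q) (fun q => a2 q + b2 q).
Proof.
move=> [df a1c a2c] [dg b1c b2c]; split; try exact: cinD.
by move=> p Dp; apply: wdiffD; [exact: df|exact: dg].
Qed.

Lemma wC1M D f g a1 a2 b1 b2 : wC1 D f a1 a2 -> wC1 D g b1 b2 ->
  wC1 D (fun q => f q * g q) (fun q => a1 q * g q + f q * b1 q)
    (fun q => a2 q * g q + f q * b2 q).
Proof.
move=> fC gC; have fc := wC1_cin fC; have gc := wC1_cin gC.
case: fC gC => [df a1c a2c] [dg b1c b2c]; split; try by apply: cinD; exact: cinM.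
by move=> p Dp; apply: wdiffM; [exact: df|exact: dg].
Qed.

Lemma wC1eD D f g : wC1e D f -> wC1e D g -> wC1e D (fun q => f q + g q).
Proof. by move=> [? [? fC]] [? [? gC]]; do 2 eexists; exact: wC1D fC gC. Qed.

Lemma wC1eM D f g : wC1e D f -> wC1e D g -> wC1e D (fun q => f q * g q).
Proof. by move=> [? [? fC]] [? [? gC]]; do 2 eexists; exact: wC1M fC gC. Qed.

Lemma wC1eV D f : (forall q, D q -> f q != 0) -> wC1e D f ->
  wC1e D (fun q => (f q)^-1).
Proof.
move=> f0 fC; have fc := wC1e_cin fC; case: fC => [a1 [a2 [df a1c a2c]]].
have ffc : cin D (fun q => (f q ^+ 2)^-1).
  by apply: cinV; [move=> q Dq; rewrite expf_neq0 ?f0|exact: cinM].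
exists (fun q => - (a1 q / f q ^+ 2)), (fun q => - (a2 q / f q ^+ 2)); split.
- by move=> p Dp; apply: wdiffV; [exact: f0|exact: df].
- by apply: cinN; exact: cinM.
- by apply: cinN; exact: cinM.
Qed.

Lemma wC1eB D f g : wC1e D f -> wC1e D g -> wC1e D (fun q => f q - g q).
Proof.
move=> fC gC; have := wC1eD fC (wC1eM (wC1e_cst D (-1)) gC).
by congr (wC1e D); apply/funext => q /=; rewrite mulN1r.
Qed.

Lemma wC2eD D f g : wC2e D f -> wC2e D g -> wC2e D (fun q => f q + g q).
Proof.
move=> [a1 [a2 [fC a1C a2C]]] [b1 [b2 [gC b1C b2C]]].
exists (fun q => a1 q + b1 q), (fun q => a2 q + b2 q); split.
- exact: wC1D.
- exact: wC1eD.
- exact: wC1eD.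
Qed.

Lemma wC2eM D f g : wC2e D f -> wC2e D g -> wC2e D (fun q => f q * g q).
Proof.
move=> [a1 [a2 [fC a1C a2C]]] [b1 [b2 [gC b1C b2C]]].
have fe : wC1e D f by do 2 eexists; exact: fC.
have ge : wC1e D g by do 2 eexists; exact: gC.
exists (fun q => a1 q * g q + f q * b1 q), (fun q => a2 q * g q + f q * b2 q).
split; first exact: wC1M.
- by apply: wC1eD; exact: wC1eM.
- by apply: wC1eD; exact: wC1eM.
Qed.

Lemma wC2e_cst D (a : R) : wC2e D (cst a).
Proof.
exists (cst 0), (cst 0); split; try exact: wC1e_cst.
split; try exact: cin_cst.
by move=> p _; exact: wdiff_cst.
Qed.

Lemma wC2e_fst D : wC2e D fst.
Proof.
exists (cst 1), (cst 0); split; try exact: wC1e_cst.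
split; try exact: cin_cst.
by move=> p _; exact: wdiff_fst.
Qed.

Lemma wC2e_snd D : wC2e D snd.
Proof.
exists (cst 0), (cst 1); split; try exact: wC1e_cst.
split; try exact: cin_cst.
by move=> p _; exact: wdiff_snd.
Qed.

Lemma wC1_ext D f g d1 d2 : (forall q, D q -> f q = g q) ->
  wC1 D f d1 d2 -> wC1 D g d1 d2.
Proof.
move=> fg [df d1c d2c]; split => // p Dp.
exact: wdiff_ext fg (df _ Dp).
Qed.

Lemma Ck_on_wC1 (U : set (R * R)) D f : open U -> D `<=` U -> Ck_on 1 U f ->
  wC1 D f ('D_(basis 0) f) ('D_(basis 1) f).
Proof.
move=> oU DU fC; have [d1 c1] := fC 0; have [d2 c2] := fC 1.
split.
- move=> p /DU Up; have Un : \forall q \near p, U q by apply: open_nbhs_nbhs.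
  apply: C1_wdiff; [| |exact: c1|exact: c2].
  + exact: filterS d1 Un.
  + exact: filterS d2 Un.
- by move=> p /DU Up; apply: cvg_within_filter; exact: c1.
- by move=> p /DU Up; apply: cvg_within_filter; exact: c2.
Qed.

Lemma Ck_on_wC2 (U : set (R * R)) D f : open U -> D `<=` U -> Ck_on 2 U f ->
  exists d1 d2, [/\ d1 = 'D_(basis 0) f, d2 = 'D_(basis 1) f, wC1 D f d1 d2,
    wC1e D d1 & wC1e D d2].
Proof.
move=> oU DU fC; exists ('D_(basis 0) f), ('D_(basis 1) f).
have f1 : Ck_on 1 U f.
  move=> i; have [di] := fC i; rewrite -/(Ck_on 1 U ('D_(basis i) f)) => ci.
  split => // p Up.
  (* [Ck_on] asks continuity of the derivatives of top order only; that of the first derivatives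
     comes from their own differentiability. *)
  have := @Ck_on_wC1 U U _ oU (@subset_refl _ U) ci.
  by move=> /wC1_cin /(_ p Up); rewrite within_interior//; exact: open_nbhs_nbhs.
split => //; first exact: Ck_on_wC1 f1.
- by have [_ c] := fC 0; do 2 eexists; exact: (Ck_on_wC1 oU DU c).
- by have [_ c] := fC 1; do 2 eexists; exact: (Ck_on_wC1 oU DU c).
Qed.
End Calculus.

(** * Symmetry of second derivatives and inverse maps *)

Section Calculus2.
Context {R : realType}.
Implicit Types (D : set (R * R)) (f g : R * R -> R) (p q : R * R).

(** The mean value theorem is applied to [f x (b + h) - f x b] as a function of [x], then to [d x].
    The mixed derivative occurs in one order only; exchanging the variables gives the other. *)
Lemma second_difference (f d d' : R -> R -> R) (a b h : R) : 0 < h ->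
  (forall x y, a <= x <= a + h -> b <= y <= b + h ->
    is_derive x 1 (f^~ y) (d x y)) ->
  (forall x y, a <= x <= a + h -> b <= y <= b + h ->
    is_derive y 1 (d x) (d' x y)) ->
  exists x y, [/\ a <= x <= a + h, b <= y <= b + h &
    f (a + h) (b + h) - f (a + h) b - f a (b + h) + f a b = d' x y * h ^+ 2].
Proof.
move=> h0 df dd.
have ah : a <= a + h by rewrite lerDl ltW.
have bh : b <= b + h by rewrite lerDl ltW.
have [x|x] := @mvt_between _ (fun x => f x (b + h) - f x b)
  (fun x => d x (b + h) - d x b) a (a + h).
  rewrite (min_l ah) (max_r ah) => xab.
  by apply: is_deriveB; apply: df => //; rewrite lexx ?bh.
rewrite (min_l ah) (max_r ah) => xab fE.
have [y|y] := @mvt_between _ (d x) (d' x) b (b + h).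
  by rewrite (min_l bh) (max_r bh) => ybh; exact: dd.
rewrite (min_l bh) (max_r bh) => ybh dE.
exists x, y; split => //; move: fE; rewrite dE => fE.
have -> : d' x y * h ^+ 2 = d' x y * (b + h - b) * (a + h - a) by ring.
rewrite -fE; ring.
Qed.

(** One and the same second difference over a small square is its area times [d12] at one point and
    times [d21] at another; both functions are continuous at [p]. *)
Lemma wC1_schwarz D f d1 d2 d11 d12 d21 d22 p : interior D p ->
  wC1 D f d1 d2 -> wC1 D d1 d11 d12 -> wC1 D d2 d21 d22 -> d12 p = d21 p.
Proof.
move=> Dp [df _ _] [dd1 _ c12] [dd2 c21 _].
have Dp1 := interior_subset Dp.
apply/eqP/contraT => ne.
(* A third of the assumed gap: two errors of [e] cannot make up [3 * e]. *)
pose e := `|d12 p - d21 p| / 3.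
have e0 : 0 < e by rewrite divr_gt0// normr_gt0 subr_eq0.
have n12 : \forall q \near p, D q -> `|d12 p - d12 q| <= e.
  by move/cvgrPdist_le : (c12 _ Dp1) => /(_ _ e0).
have n21 : \forall q \near p, D q -> `|d21 p - d21 q| <= e.
  by move/cvgrPdist_le : (c21 _ Dp1) => /(_ _ e0).
have nD : \forall q \near p, interior D q.
  by apply: open_nbhs_nbhs; split => //; exact: open_interior.
have /near_boxP[r r0 rP] : \forall q \near p, [/\ interior D q,
    D q -> `|d12 p - d12 q| <= e & D q -> `|d21 p - d21 q| <= e].
  by apply: filterS3 nD n12 n21.
have h0 : 0 < r / 2 by rewrite divr_gt0.
have box x y : p.1 <= x <= p.1 + r / 2 -> p.2 <= y <= p.2 + r / 2 ->
    [/\ interior D (x, y), D (x, y), `|d12 p - d12 (x, y)| <= e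
     & `|d21 p - d21 (x, y)| <= e].
  move=> px py; have [] := rP (x, y).
  - by rewrite /= ger0_norm; lra.
  - by rewrite /= ger0_norm; lra.
  - by move=> iD h1 h2; have DD := interior_subset iD; split; auto.
have [||x [y [xp yp E]]] := @second_difference (fun x y => f (x, y))
    (fun x y => d1 (x, y)) (fun x y => d12 (x, y)) p.1 p.2 (r / 2) h0.
- move=> x y xp yp; have [iD DD _ _] := box _ _ xp yp.
  by have [/is_derive_fst] := wdiff_interior iD (df _ DD).
- move=> x y xp yp; have [iD DD _ _] := box _ _ xp yp.
  by have [_ /is_derive_snd] := wdiff_interior iD (dd1 _ DD).
have [||y' [x' [yp' xp' E']]] := @second_difference (fun y x => f (x, y))
    (fun y x => d2 (x, y)) (fun y x => d21 (x, y)) p.2 p.1 (r / 2) h0.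
- move=> y' x' yp' xp'; have [iD DD _ _] := box _ _ xp' yp'.
  by have [_ /is_derive_snd] := wdiff_interior iD (df _ DD).
- move=> y' x' yp' xp'; have [iD DD _ _] := box _ _ xp' yp'.
  by have [/is_derive_fst] := wdiff_interior iD (dd2 _ DD).
have [_ _ e12 _] := box _ _ xp yp; have [_ _ _ e21] := box _ _ xp' yp'.
have E12 : d12 (x, y) = d21 (x', y').
  apply: (@mulIf _ ((r / 2) ^+ 2)); first by rewrite expf_neq0 ?gt_eqF.
  rewrite -E -E'; ring.
have : `|d12 p - d21 p| <= e + e.
  rewrite (_ : d12 p - d21 p = (d12 p - d12 (x, y)) - (d21 p - d12 (x, y)));
    last by ring.
  by apply: le_trans (ler_normB _ _) _; rewrite lerD// E12.
have : `|d12 p - d21 p| = 3 * e by rewrite /e; field.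
lra.
Qed.

Section Inverse.
Variables (D K : set (R * R)) (F1 F2 a11 a12 a21 a22 : R * R -> R).
Variable Fi : R * R -> R * R.
Hypothesis F1C : wC1 D F1 a11 a12.
Hypothesis F2C : wC1 D F2 a21 a22.
Hypothesis FiD : forall q, K q -> D (Fi q).
Hypothesis FiK : forall q, K q -> (F1 (Fi q), F2 (Fi q)) = q.
Hypothesis Fic : forall q, K q -> Fi @ within K (nbhs q) --> Fi q.
Let det p := a11 p * a22 p - a12 p * a21 p.
Hypothesis det0 : forall p, D p -> det p != 0.

Let FiDc q : K q -> Fi @ within K (nbhs q) --> within D (nbhs (Fi q)).
Proof.
move=> Kq S; rewrite /within /= => SD.
have := Fic Kq SD; rewrite /nbhs /= /within /=.
by apply: filterS => q' h Kq'; apply: h => //; exact: FiD.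
Qed.

Lemma cin_inv f : cin D f -> cin K (f \o Fi).
Proof.
by move=> fc q Kq; apply: (cvg_comp _ _ (FiDc Kq)); apply: fc; exact: FiD.
Qed.

(** Cramer's rule, applied to slopes instead of derivatives: increments of [F1] and [F2] determine
    those of the preimage as long as the determinant [de] of the slopes is nonzero, which holds near
    [Fi q]. *)
Lemma wC1_inv f d1 d2 : wC1 D f d1 d2 ->
  wC1 K (f \o Fi) ((fun p => (d1 p * a22 p - d2 p * a21 p) / det p) \o Fi)
    ((fun p => (d2 p * a11 p - d1 p * a12 p) / det p) \o Fi).
Proof.
case: F1C F2C => [dF1 c11 c12] [dF2 c21 c22] [df c1 c2].
have cdet : cin D det by apply: cinD; [|apply: cinN]; exact: cinM.
split; last 2 first.
- apply: cin_inv; apply: cinM; last exact: cinV.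
  by apply: cinD; [|apply: cinN]; exact: cinM.
- apply: cin_inv; apply: cinM; last exact: cinV.
  by apply: cinD; [|apply: cinN]; exact: cinM.
move=> q Kq.
have := df _ (FiD Kq); move=> [A1 [A2 [A1p A2p fE]]].
have := dF1 _ (FiD Kq); move=> [M11 [M12 [M11p M12p F1E]]].
have := dF2 _ (FiD Kq); move=> [M21 [M22 [M21p M22p F2E]]].
pose de p := M11 p * M22 p - M12 p * M21 p.
have dep : de @ within D (nbhs (Fi q)) --> det (Fi q).
  by apply: cvgB; apply: cvgM.
have deV : (de p)^-1 @[p --> within D (nbhs (Fi q))] --> (det (Fi q))^-1.
  by apply: cvgV => //; apply: det0; exact: FiD.
have de0 : \forall p \near within D (nbhs (Fi q)), de p != 0.
  have dq0 := det0 (FiD Kq).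
  move/cvgrPdist_lt : dep => /(_ `|det (Fi q)|); rewrite normr_gt0 => /(_ dq0).
  apply: filterS => p; apply: contraTN => /eqP ->.
  by rewrite subr0 ltxx.
exists ((fun p => (A1 p * M22 p - A2 p * M21 p) / de p) \o Fi),
  ((fun p => (A2 p * M11 p - A1 p * M12 p) / de p) \o Fi); split.
- apply: (cvg_comp _ _ (FiDc Kq)).
  by apply: cvgM => //; apply: cvgB; exact: cvgM.
- apply: (cvg_comp _ _ (FiDc Kq)).
  by apply: cvgM => //; apply: cvgB; exact: cvgM.
have I : \forall x \near within D (nbhs (Fi q)), [/\
    f x = f (Fi q) + (A1 x * (x.1 - (Fi q).1) + A2 x * (x.2 - (Fi q).2)),
    F1 x = F1 (Fi q) + (M11 x * (x.1 - (Fi q).1) + M12 x * (x.2 - (Fi q).2)),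
    F2 x = F2 (Fi q) + (M21 x * (x.1 - (Fi q).1) + M22 x * (x.2 - (Fi q).2)) &
    de x != 0].
  by near=> x; split; near: x.
have KF : \forall q' \near within K (nbhs q), K q' by exact: withinT.
have H : within K (nbhs q) (Fi @^-1` _) := FiDc Kq I.
apply: filterS2 KF H => q' Kq' /= [fE' F1E' F2E' de0'].
have [q1 q2] : q.1 = F1 (Fi q) /\ q.2 = F2 (Fi q) by rewrite -{1 3}(FiK Kq).
have [q1' q2'] : q'.1 = F1 (Fi q') /\ q'.2 = F2 (Fi q').
  by rewrite -{1 3}(FiK Kq').
rewrite /comp q1 q2 q1' q2' /= fE' F1E' F2E' /=.
move: de0'; rewrite /de /= => de0'.
by field.
Unshelve. all: by end_near. Qed.

End Inverse.

End Calculus2.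

(** * Euclidean norm and perturbations of linear maps *)

Section PairCoordinates.
Context {R : realType}.
Implicit Types p q : R * R.
Lemma subp1 p q : (p - q).1 = p.1 - q.1. Proof. by []. Qed.
Lemma subp2 p q : (p - q).2 = p.2 - q.2. Proof. by []. Qed.
Lemma addp1 p q : (p + q).1 = p.1 + q.1. Proof. by []. Qed.
Lemma addp2 p q : (p + q).2 = p.2 + q.2. Proof. by []. Qed.
Lemma oppp1 p : (- p).1 = - p.1. Proof. by []. Qed.
Lemma oppp2 p : (- p).2 = - p.2. Proof. by []. Qed.
Lemma scalep1 (a : R) p : (a *: p).1 = a * p.1. Proof. by []. Qed.
Lemma scalep2 (a : R) p : (a *: p).2 = a * p.2. Proof. by []. Qed.
Lemma perpp1 p : (perp p).1 = - p.2. Proof. by []. Qed.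
Lemma perpp2 p : (perp p).2 = p.1. Proof. by []. Qed.
Lemma pairp1 (a b : R) : (a, b).1 = a. Proof. by []. Qed.
Lemma pairp2 (a b : R) : (a, b).2 = b. Proof. by []. Qed.
End PairCoordinates.

Notation crdE := (subp1, subp2, addp1, addp2, oppp1, oppp2, scalep1, scalep2,
  perpp1, perpp2, pairp1, pairp2).

Section EuclideanPlane.
Context {R : realType}.
Implicit Types (p q : R * R) (M N : 'M[R]_2).

Lemma prod_ext p q : p.1 = q.1 -> p.2 = q.2 -> p = q.
Proof. by case: p q => ? ? [? ?] /= -> ->. Qed.

Lemma dot_ge0 p : 0 <= dot p p.
Proof. by rewrite addr_ge0// -expr2 sqr_ge0. Qed.

Lemma enorm_ge0 p : 0 <= enorm p. Proof. exact: sqrtr_ge0. Qed.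

Lemma enorm_sqr p : enorm p ^+ 2 = dot p p.
Proof. by rewrite sqr_sqrtr// dot_ge0. Qed.

Lemma enorm_eq0 p : enorm p = 0 -> p = 0.
Proof.
move=> p0; have := enorm_sqr p; rewrite p0 expr0n /= => /esym/eqP.
rewrite /dot paddr_eq0 ?sqr_ge0// -?expr2 ?sqr_ge0//.
by rewrite !sqrf_eq0 => /andP[/eqP ? /eqP ?]; exact: prod_ext.
Qed.

Lemma dot_le p q : dot p q <= enorm p * enorm q.
Proof.
have [pq|pq] := ltP (dot p q) 0.
  by rewrite (le_trans (ltW pq))// mulr_ge0// enorm_ge0.
rewrite -(@ler_pXn2r _ 2)// ?nnegrE ?mulr_ge0 ?enorm_ge0//.
rewrite exprMn !enorm_sqr /dot -subr_ge0.
rewrite [X in 0 <= X](_ : _ = (p.1 * q.2 - p.2 * q.1) ^+ 2); last by ring.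
exact: sqr_ge0.
Qed.

Lemma enormD p q : enorm (p + q) <= enorm p + enorm q.
Proof.
rewrite -(@ler_pXn2r _ 2)// ?nnegrE ?addr_ge0 ?enorm_ge0//.
rewrite sqrrD !enorm_sqr.
have := dot_le p q; rewrite /dot !crdE; lra.
Qed.

Lemma enormZ (a : R) p : enorm (a *: p) = `|a| * enorm p.
Proof.
rewrite /enorm -sqrtr_sqr -sqrtrM ?sqr_ge0//; congr Num.sqrt.
rewrite /dot !crdE; ring.
Qed.

Lemma enormN p : enorm (- p) = enorm p.
Proof. by rewrite -scaleN1r enormZ normrN normr1 mul1r. Qed.

Lemma enorm0 : enorm (0 : R * R) = 0.
Proof. by rewrite /enorm /dot /= mul0r addr0 sqrtr0. Qed.

Lemma enormB p q : enorm (p - q) = enorm (q - p).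
Proof. by rewrite -enormN opprB. Qed.

Lemma ler_enormB p q : enorm p - enorm q <= enorm (p - q).
Proof. by rewrite lerBlDr -{1}(subrK q p) enormD. Qed.

Lemma normr1_enorm p : `|p.1| <= enorm p.
Proof. by rewrite -sqrtr_sqr ler_wsqrtr// /dot -expr2 lerDl -expr2 sqr_ge0. Qed.

Lemma normr2_enorm p : `|p.2| <= enorm p.
Proof. by rewrite -sqrtr_sqr ler_wsqrtr// /dot -!expr2 lerDr sqr_ge0. Qed.

Lemma enorm_le p : enorm p <= `|p.1| + `|p.2|.
Proof.
rewrite -(@ler_pXn2r _ 2)// ?nnegrE ?addr_ge0 ?enorm_ge0//.
rewrite enorm_sqr /dot sqrrD -!expr2 !real_normK ?num_real//.
by rewrite addrAC lerDl mulrn_wge0// mulr_ge0.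
Qed.

Lemma mulmx2E M N i j : (M *m N) i j = M i 0 * N 0 j + M i 1 * N 1 j.
Proof.
rewrite mxE big_ord_recl big_ord1.
by rewrite (_ : lift ord0 ord0 = 1)//; exact: val_inj.
Qed.

Lemma mxactM M N p : mxact (M *m N) p = mxact M (mxact N p).
Proof.
by apply: prod_ext; rewrite /mxact /= !mulmx2E; ring.
Qed.

Lemma mxact1 p : mxact 1%:M p = p.
Proof. by apply: prod_ext; rewrite /mxact /= !mxE /=; ring. Qed.

Lemma mxactZ M (a : R) p : mxact M (a *: p) = a *: mxact M p.
Proof. by apply: prod_ext; rewrite /mxact !crdE /=; ring. Qed.

Lemma mxact_bound M : exists2 C : R, 0 < C & forall p,
  enorm (mxact M p) <= C * enorm p.
Proof.
exists (`|M 0 0| + `|M 0 1| + `|M 1 0| + `|M 1 1| + 1).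
  by rewrite ltr_wpDl// !addr_ge0.
move=> p; apply: le_trans (enorm_le _) _; rewrite /mxact /=.
apply: le_trans (lerD (ler_normD _ _) (ler_normD _ _)) _; rewrite !normrM.
have [h1 h2] := (normr1_enorm p, normr2_enorm p).
have := ler_wpM2l (normr_ge0 (M 0 0)) h1.
have := ler_wpM2l (normr_ge0 (M 0 1)) h2.
have := ler_wpM2l (normr_ge0 (M 1 0)) h1.
have := ler_wpM2l (normr_ge0 (M 1 1)) h2.
have := enorm_ge0 p.
lra.
Qed.

Lemma cvg_enormP (T : Type) (F : set_system T) (FF : Filter F) (f : T -> R * R) p :
  (forall e, 0 < e -> \forall x \near F, enorm (f x - p) < e) -> f @ F --> p.
Proof.
move=> H; apply/cvgrPdist_lt => e e0.
apply: filterS (H _ e0) => x; apply: le_lt_trans.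
rewrite -opprB normrN /= ge_max.
by rewrite normr1_enorm normr2_enorm.
Qed.

Lemma near_enorm p (e : R) : 0 < e -> \forall q \near p, enorm (q - p) < e.
Proof.
move=> e0; apply/near_boxP; exists (e / 2); first by rewrite divr_gt0.
move=> q q1 q2; apply: le_lt_trans (enorm_le _) _; rewrite !crdE; lra.
Qed.


(** Projection onto [[a, b]]. Composition with it extends a function from an interval to a
    continuous function on the line, the form in which curves and integrands are handled
    throughout. *)
Definition clamp (a b x : R) := Order.max a (Order.min b x).

Lemma clamp_itv a b x : a <= b -> a <= clamp a b x <= b.
Proof. by move=> ab; rewrite /clamp le_max lexx ge_max ab ge_min lexx. Qed.

Lemma clamp_id a b x : a <= x <= b -> clamp a b x = x.
Proof. by move=> /andP[ax xb]; rewrite /clamp (min_r xb) (max_r ax). Qed.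

Lemma continuous_clamp a b : continuous (clamp a b).
Proof.
move=> x; apply: continuous_max; first exact: cst_continuous.
by apply: continuous_min; [exact: cst_continuous|exact: cvg_id].
Qed.

Lemma clamp_near a b x : a < x < b -> \forall y \near x, clamp a b y = y.
Proof.
move=> /andP[ax xb]; near=> y; apply: clamp_id; apply/andP; split; apply: ltW; near: y.
- exact: lt_nbhsr.
- exact: lt_nbhsl.
Unshelve. all: by end_near. Qed.

Lemma is_derive_near (f g : R -> R) (x d : R) : (\forall y \near x, f y = g y) ->
  is_derive x 1 f d -> is_derive x 1 g d.
Proof. exact: near_eq_is_derive. Qed.

Lemma is_derive_affine (a b x : R) : is_derive x 1 (fun t => a + t * b) b.
Proof.
apply: (near_slope_is_derive (g := cst b)); first exact: cvg_cst.
by near=> z; rewrite /=; ring.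
Unshelve. all: by end_near. Qed.

Definition cvx_set (D : set (R * R)) := forall p q t, D p -> D q ->
  0 <= t <= 1 -> D (p.1 + t * (q.1 - p.1), p.2 + t * (q.2 - p.2)).

Lemma cin_curve (D : set (R * R)) f (c1 c2 : R -> R) : cin D f ->
  continuous c1 -> continuous c2 -> (forall t, D (c1 t, c2 t)) ->
  continuous (fun t => f (c1 t, c2 t)).
Proof.
move=> fc cc1 cc2 cD t.
have h : (c1 s, c2 s) @[s --> t] --> within D (nbhs (c1 t, c2 t)).
  move=> S; rewrite /within /= => SD.
  have h : (c1 s, c2 s) @[s --> t] --> (c1 t, c2 t).
    exact: cvg_pair (cc1 t) (cc2 t).
  have h' : \forall s \near t, D (c1 s, c2 s) -> S (c1 s, c2 s) := h _ SD.
  suff : \forall s \near t, S (c1 s, c2 s) by [].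
  by apply: filterS h' => s; apply.
exact: (cvg_comp _ _ h (fc _ (cD t))).
Qed.

Lemma convex_mvt (D : set (R * R)) f d1 d2 p q : cvx_set D ->
  wC1 D f d1 d2 -> D p -> D q ->
  exists2 z, D z & f q - f p = d1 z * (q.1 - p.1) + d2 z * (q.2 - p.2).
Proof.
move=> Dc fC Dp Dq; have fc := wC1_cin fC; case: fC => df _ _.
(* The segment from [p] to [q], stopped at its ends so that the curve lies in [D] at all times. *)
pose c1 t := p.1 + clamp 0 1 t * (q.1 - p.1).
pose c2 t := p.2 + clamp 0 1 t * (q.2 - p.2).
have cD t : D (c1 t, c2 t) by apply: Dc => //; exact: clamp_itv.
have cc1 : continuous c1.
  move=> t; apply: cvgD; first exact: cvg_cst.
  by apply: cvgM; [exact: continuous_clamp|exact: cvg_cst].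
have cc2 : continuous c2.
  move=> t; apply: cvgD; first exact: cvg_cst.
  by apply: cvgM; [exact: continuous_clamp|exact: cvg_cst].
have [|t t01 E] := MVT (@ltr01 R) _ (continuous_subspaceT (cin_curve fc cc1 cc2 cD))
  (df := fun t => d1 (c1 t, c2 t) * (q.1 - p.1) + d2 (c1 t, c2 t) * (q.2 - p.2)).
  move=> t; rewrite in_itv /= => t01.
  have lin (a b : R) : is_derive t 1 (fun t => a + clamp 0 1 t * (b - a)) (b - a).
    apply: is_derive_near (is_derive_affine a (b - a) t).
    by apply: filterS (clamp_near t01) => s ->.
  apply: (wdiff_curve (D := D) (c1 := c1) (c2 := c2)); first exact: df.
  by near=> s; exact: cD.
exists (c1 t, c2 t) => //; move: E; rewrite subr0 mulr1.
have -> : c1 1 = q.1 by rewrite /c1 clamp_id ?lexx ?ler01// mul1r addrC subrK.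
have -> : c2 1 = q.2 by rewrite /c2 clamp_id ?lexx ?ler01// mul1r addrC subrK.
have -> : c1 0 = p.1 by rewrite /c1 clamp_id ?lexx ?ler01// mul0r addr0.
have -> : c2 0 = p.2 by rewrite /c2 clamp_id ?lexx ?ler01// mul0r addr0.
by rewrite -!surjective_pairing.
Unshelve. all: by end_near. Qed.

(** * Lipschitz perturbations of an invertible linear map *)

Section Perturbation.
Variables (D : set (R * R)) (F : R * R -> R * R) (B : 'M[R]_2) (c : R).
Hypothesis Bu : B \in unitmx.
Hypothesis c0 : 0 <= c.
Hypothesis c1 : c < 1.
Hypothesis FB : forall p q, D p -> D q ->
  enorm (F p - F q - mxact B (p - q)) <= c * enorm (mxact B (p - q)).

Lemma perturbation_lower p q : D p -> D q ->
  (1 - c) * enorm (mxact B (p - q)) <= enorm (F p - F q).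
Proof.
move=> Dp Dq; have := FB Dp Dq; rewrite enormB.
have := ler_enormB (mxact B (p - q)) (F p - F q); lra.
Qed.

Lemma perturbation_dist : exists2 C : R, 0 < C & forall p q, D p -> D q ->
  enorm (p - q) <= C * enorm (F p - F q).
Proof.
have [C C0 CB] := mxact_bound (invmx B).
exists (C / (1 - c)); first by rewrite divr_gt0// subr_gt0.
move=> p q Dp Dq; have := perturbation_lower Dp Dq.
have := CB (mxact B (p - q)); rewrite -mxactM mulVmx// mxact1 => h1 h2.
apply: le_trans h1 _; rewrite -mulrA ler_pM2l// ler_pdivlMl ?subr_gt0//.
Qed.

Lemma perturbation_inj p q : D p -> D q -> F p = F q -> p = q.
Proof.
move=> Dp Dq pq; have [C _ /(_ p q Dp Dq)] := perturbation_dist.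
rewrite pq subrr enorm0 mulr0 => h; apply/eqP; rewrite -subr_eq0; apply/eqP.
by apply: enorm_eq0; apply/eqP; rewrite eq_le h enorm_ge0.
Qed.

Lemma perturbation_inverse (G : R * R -> R * R) (K : set (R * R)) :
  (forall q, K q -> D (G q)) -> (forall q, K q -> F (G q) = q) ->
  forall q, K q -> G @ within K (nbhs q) --> G q.
Proof.
move=> GD GK q Kq; have [C C0 CD] := perturbation_dist.
apply: cvg_enormP => e e0.
have := near_enorm q (divr_gt0 e0 C0).
suff : forall q', enorm (q' - q) < e / C -> K q' -> enorm (G q' - G q) < e.
  by move=> h; apply: filterS => q' ? ?; exact: h.
move=> q' qq' Kq'; apply: le_lt_trans (CD _ _ (GD _ Kq') (GD _ Kq)) _.
by rewrite !GK// mulrC -ltr_pdivlMr.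
Qed.

(** A minimizer [q] of the distance from [F q] to [y] over a small closed box is a preimage of [y]:
    if the minimum [rho] were positive, moving [q] by [s *: d] with [B d = y - F q] would bring the
    distance down to [(1 - s) * rho + c * s * rho] at most. *)
Lemma perturbation_open p : interior D p ->
  \forall y \near F p, exists2 q, D q & F q = y.
Proof.
move=> Dp; have : \forall q \near p, D q by [].
move=> /near_boxP[r0 r00 rD].
pose r := r0 / 2; have rr0 : 0 < r by rewrite divr_gt0.
pose Q := `[p.1 - r, p.1 + r]%classic `*` `[p.2 - r, p.2 + r]%classic.
have QP q : Q q <-> `|q.1 - p.1| <= r /\ `|q.2 - p.2| <= r.
  by rewrite /Q /= !in_itv /= !ler_distl.
have QD q : Q q -> D q by move=> /QP[q1 q2]; apply: rD; rewrite /r in q1 q2; lra.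
have cQ : compact Q by apply: compact_setX; exact: segment_compact.
have [C C0 CD] := perturbation_dist.
have Qp : Q p by apply/QP; rewrite !subrr normr0 ltW.
have Dpp := QD _ Qp.
(* One half of the tolerance [r / C] is for [y - F p], the other for the minimal distance; together
   they keep the minimizer closer than [r] to [p], off the boundary of the box. *)
have e0 : 0 < r / (2 * C) by rewrite divr_gt0// mulr_gt0.
apply: filterS (near_enorm (F p) e0) => y yF.
have [L L0 BL] := mxact_bound B.
have FL q q' : D q -> D q' -> enorm (F q - F q') <= (1 + c) * (L * enorm (q - q')).
  move=> Dq Dq'; have := FB Dq Dq'; have := BL (q - q').
  have := ler_enormB (F q - F q') (mxact B (q - q')) => h1 h2 h3.
  apply: (@le_trans _ _ ((1 + c) * enorm (mxact B (q - q')))); first lra.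
  by rewrite ler_wpM2l// addr_ge0.
have L10 : 0 < (1 + c) * L by rewrite mulr_gt0// ltr_wpDr.
have FcD : {within Q, continuous (fun q => enorm (F q - y))}.
  apply/subspace_continuousP => q Qq; apply/cvgrPdist_lt => e e1.
  have := near_enorm q (divr_gt0 e1 L10).
  suff H q' : enorm (q' - q) < e / ((1 + c) * L) -> Q q' ->
      `|enorm (F q - y) - enorm (F q' - y)| < e.
    by move=> h; apply: filterS h => q' ? ?; exact: H.
  rewrite ltr_pdivlMr// => qq' Qq'.
  apply: le_lt_trans qq'; apply: (@le_trans _ _ (enorm (F q' - F q))); last first.
    by have := FL _ _ (QD _ Qq') (QD _ Qq); lra.
  rewrite ler_norml; apply/andP; split.
    have := enormD (F q' - F q) (F q - y); rewrite addrA subrK; lra.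
  have := enormD (F q - F q') (F q' - y); rewrite addrA subrK.
  rewrite (enormB (F q)); lra.
have [|q /set_mem Qq qmin] := compact_EVT_min _ cQ FcD; first by exists p.
exists q; first exact: QD.
apply/eqP; rewrite -subr_eq0; apply/eqP; apply: enorm_eq0.
apply/eqP; rewrite eq_le enorm_ge0 andbT leNgt; apply/negP => rho0.
set rho := enorm (F q - y) in rho0 qmin.
have rhoe : rho < r / (2 * C).
  by apply: le_lt_trans (qmin p (mem_set Qp)) _; rewrite enormB.
have qp : enorm (q - p) < r.
  apply: le_lt_trans (CD _ _ (QD _ Qq) Dpp) _.
  have := enormD (F q - y) (y - F p); rewrite addrA subrK -/rho => h.
  have : enorm (F q - F p) < r / (2 * C) + r / (2 * C) by lra.
  rewrite -ltr_pdivlMl// => h'.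
  by apply: lt_le_trans h' _; rewrite le_eqVlt; apply/orP; left; apply/eqP; field; lra.
pose d := mxact (invmx B) (y - F q).
have Bd : mxact B d = y - F q by rewrite -mxactM mulmxV// mxact1.
(* A step of length at most 1 that does not leave the box; the added 1 avoids a division by zero. *)
pose s := Order.min 1 ((r - enorm (q - p)) / (enorm d + 1)).
have d1 : 0 < enorm d + 1 by rewrite ltr_wpDl// enorm_ge0.
have s0 : 0 < s by rewrite lt_min ltr01/= divr_gt0// subr_gt0.
have s1 : s <= 1 by rewrite ge_min lexx.
have sd : s * enorm d <= r - enorm (q - p).
  apply: (@le_trans _ _ (s * (enorm d + 1))); first by rewrite ler_pM2l// lerDl.
  by rewrite -ler_pdivlMr// ge_min lexx orbT.
have Qs : Q (q + s *: d).
  have : enorm (q + s *: d - p) <= r.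
    rewrite addrAC; apply: le_trans (enormD _ _) _.
    by rewrite enormZ gtr0_norm//; lra.
  move=> h; apply/QP; split.
    exact: le_trans (normr1_enorm (q + s *: d - p)) h.
  exact: le_trans (normr2_enorm (q + s *: d - p)) h.
have := qmin _ (mem_set Qs); apply/negP; rewrite -ltNge.
have := FB (QD _ Qs) (QD _ Qq).
have -> : q + s *: d - q = s *: d by rewrite addrAC subrr add0r.
rewrite mxactZ Bd enormZ (gtr0_norm s0) (enormB y) -/rho => h.
have -> : F (q + s *: d) - y = (F (q + s *: d) - F q - s *: (y - F q)) +
    (1 - s) *: (F q - y).
  by apply: prod_ext; rewrite !crdE; ring.
apply: le_lt_trans (enormD _ _) _; rewrite enormZ ger0_norm ?subr_ge0// -/rho.
apply: le_lt_trans (lerD h (lexx _)) _.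
have : c * (s * rho) < s * rho by rewrite gtr_pMl// mulr_gt0.
lra.
Qed.

End Perturbation.
End EuclideanPlane.

(** * Element maps *)

Section Ord3.

Lemma ord2P (P : 'I_2 -> Prop) : P 0 -> P 1 -> forall i, P i.
Proof.
by move=> P0 P1 [[|[|//]] h];
  [rewrite (_ : Ordinal h = 0)|rewrite (_ : Ordinal h = 1)] => //; exact: val_inj.
Qed.

Lemma ord3P (P : 'I_3 -> Prop) : P 0 -> P 1 -> P 2%:R -> forall i, P i.
Proof.
by move=> P0 P1 P2 [[|[|[|//]]] h];
  [rewrite (_ : Ordinal h = 0)|rewrite (_ : Ordinal h = 1)
  |rewrite (_ : Ordinal h = 2%:R)] => //; exact: val_inj.
Qed.

Lemma ord3_11 : 1 + 1 = 2%:R :> 'I_3. Proof. exact: val_inj. Qed.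
Lemma ord3_12 : 1 + 2%:R = 0 :> 'I_3. Proof. exact: val_inj. Qed.
Lemma ord3_21 : 2%:R + 1 = 0 :> 'I_3. Proof. exact: val_inj. Qed.
Lemma ord3_22 : 2%:R + 2%:R = 1 :> 'I_3. Proof. exact: val_inj. Qed.
Definition ord3E := (ord3_11, ord3_12, ord3_21, ord3_22, @add0r 'I_3, @addr0 'I_3).

Lemma big_ord3 (V : nmodType) (f : 'I_3 -> V) :
  \sum_i f i = f 0 + f 1 + f 2%:R.
Proof.
rewrite !big_ord_recl big_ord0 addr0 addrA.
by congr (f _ + f _ + f _); exact: val_inj.
Qed.

End Ord3.

Lemma closed_box_compact (R : realType) (A : set (R * R)) : closed A ->
  (exists M : R, forall p, A p -> `|p.1| <= M /\ `|p.2| <= M) -> compact A.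
Proof.
move=> cA [M AM].
apply: (@subclosed_compact _ A (`[- M, M]%classic `*` `[- M, M]%classic)) => //.
  by apply: compact_setX; exact: segment_compact.
by move=> p /AM[p1 p2]; split; rewrite /= in_itv /= -ler_norml.
Qed.

Section ReferenceTriangle.
Context {R : realType}.
Variable Th : triangulation R.
Hypothesis Th_nd : ref_nondegenerate Th.
Notation T := (ref_triangle Th).
Notation w := (tri_vert Th).
Implicit Types (p q : R * R).

Let del := dot (w 1 - w 0) (perp (w 2%:R - w 0)).

(** Barycentric coordinates, by Cramer's rule; up to sign [del] is twice the area of the reference
    triangle. *)
Definition lam (i : 'I_3) p : R :=
  if i == 0 then 1 - dot (p - w 0) (perp (w 2%:R - w 0)) / del
                   - dot (w 1 - w 0) (perp (p - w 0)) / del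
  else if i == 1 then dot (p - w 0) (perp (w 2%:R - w 0)) / del
  else dot (w 1 - w 0) (perp (p - w 0)) / del.

Let del0 : del != 0 := Th_nd.

Lemma lam_sum p : \sum_i lam i p = 1.
Proof. by rewrite big_ord3 /lam /=; ring. Qed.

Lemma lam_bary p : p = \sum_i lam i p *: w i.
Proof.
rewrite big_ord3; move: del0; rewrite /lam /= /del /dot !crdE => d0.
by apply: prod_ext; rewrite !crdE; field.
Qed.

Lemma lam_unique (l : 'I_3 -> R) i : \sum_j l j = 1 ->
  lam i (\sum_j l j *: w j) = l i.
Proof.
move=> l1; have l0E : l 0 = 1 - l 1 - l 2%:R by rewrite -l1 big_ord3; ring.
rewrite big_ord3; move: del0; rewrite /lam /del /dot !crdE => d0.
by elim/ord3P: i => /=; rewrite ?l0E; field.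
Qed.

Lemma ref_triangleP p : T p <-> forall i, 0 <= lam i p.
Proof.
split=> [[l [l0 l1 ->]] i|l0]; first by rewrite lam_unique.
by exists (lam^~ p); split => //; [exact: lam_sum|exact: lam_bary].
Qed.

Lemma ref_edgeP i p : ref_edge Th i p <-> T p /\ lam i p = 0.
Proof.
split.
  move=> [t]; rewrite /= in_itv /= => /andP[t0 t1] <-.
  pose l (j : 'I_3) := if j == i then 0 else if j == i + 1 then 1 - t else t.
  have -> : (1 - t) *: w (i + 1) + t *: w (i + 2%:R) = \sum_j l j *: w j.
    rewrite big_ord3 /l; elim/ord3P: i {l} => /=;
    by rewrite !ord3E /= scale0r ?add0r ?addr0// addrC.
  have l1 : \sum_j l j = 1.
    by rewrite big_ord3 /l; elim/ord3P: i {l} => /=; rewrite ?ord3E /=; ring.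
  split; last by rewrite lam_unique// /l eqxx.
  apply/ref_triangleP => j; rewrite lam_unique// /l.
  by case: ifP => // _; case: ifP => // _; rewrite subr_ge0.
move=> [/ref_triangleP Tp li]; exists (lam (i + 2%:R) p).
  have := lam_sum p; have h1 := Tp (i + 1); have h2 := Tp (i + 2%:R).
  rewrite /= in_itv /= h2 big_ord3 /=; move: li h1 h2.
  by elim/ord3P: i; rewrite ?ord3E; lra.
rewrite {3}[p]lam_bary big_ord3; have := lam_sum p; rewrite big_ord3; move: li.
elim/ord3P: i => li; rewrite ?ord3E li => E.
- rewrite (_ : 1 - lam 2%:R p = lam 1 p) ?scale0r ?add0r//; lra.
- rewrite (_ : 1 - lam 0 p = lam 2%:R p) ?scale0r ?addr0 1?addrC//; lra.
- rewrite (_ : 1 - lam 1 p = lam 0 p) ?scale0r ?addr0//; lra.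
Qed.

Lemma lam_wC2 i D : wC2e D (lam i).
Proof.
have aff (a b c : R) : wC2e D (fun p => a + b * p.1 + c * p.2).
  by apply: wC2eD; [apply: wC2eD; [exact: wC2e_cst|apply: wC2eM;
    [exact: wC2e_cst|exact: wC2e_fst]]|apply: wC2eM;
    [exact: wC2e_cst|exact: wC2e_snd]].
pose u := w 1 - w 0; pose v := w 2%:R - w 0.
have e1 : wC2e D (lam 1).
  have := aff (((w 0).1 * v.2 - (w 0).2 * v.1) / del) (- v.2 / del) (v.1 / del).
  congr (wC2e D); apply/funext => p; rewrite /lam /= /dot -/v !crdE.
  by field.
have e2 : wC2e D (lam 2%:R).
  have := aff ((u.1 * (w 0).2 - u.2 * (w 0).1) / del) (u.2 / del) (- u.1 / del).
  congr (wC2e D); apply/funext => p; rewrite /lam /= /dot -/u !crdE.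
  by field.
have e0 : wC2e D (lam 0).
  have := wC2eD (wC2e_cst D 1) (wC2eM (wC2e_cst D (-1)) (wC2eD e1 e2)).
  congr (wC2e D); apply/funext => p; rewrite /lam /= mulN1r opprD addrA //.
by elim/ord3P: i.
Qed.

Lemma lam_continuous i : continuous (lam i).
Proof.
have [d1 [d2 [c _ _]]] := lam_wC2 i setT.
move=> p; have := wC1_cin c (p := p) I.
by rewrite within_interior// interiorT.
Qed.

Lemma ref_triangle_convex : cvx_set T.
Proof.
move=> p q t Tp Tq /andP[t0 t1]; apply/ref_triangleP => i.
have {}Tp := (ref_triangleP p).1 Tp; have {}Tq := (ref_triangleP q).1 Tq.
have -> : (p.1 + t * (q.1 - p.1), p.2 + t * (q.2 - p.2)) =
  \sum_j ((1 - t) * lam j p + t * lam j q) *: w j.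
  under eq_bigr do rewrite scalerDl -!scalerA.
  rewrite big_split /= -!scaler_sumr -!lam_bary.
  by apply: prod_ext; rewrite !crdE; ring.
rewrite lam_unique; last first.
  by rewrite big_split/= -!mulr_sumr !lam_sum; ring.
by rewrite addr_ge0// mulr_ge0// subr_ge0.
Qed.

Lemma ref_triangle_compact : compact T.
Proof.
apply: closed_box_compact.
  have -> : T = \bigcap_(i : 'I_3) [set p | 0 <= lam i p].
    apply/seteqP; split=> p; first by move=> /(ref_triangleP p).1 Tp i _; exact: Tp.
    by move=> Tp; apply/ref_triangleP => i; exact: Tp.
  apply: closed_bigI => i _; apply: (@closed_comp _ _ (lam i) [set x | 0 <= x]).
    move=> p _; exact: lam_continuous.
  exact: closed_ge.
exists (`|(w 0).1| + `|(w 0).2| + (`|(w 1).1| + `|(w 1).2|)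
        + (`|(w 2%:R).1| + `|(w 2%:R).2|)) => p Tp.
have {}Tp := (ref_triangleP p).1 Tp.
have := lam_sum p; rewrite big_ord3 => l1.
have l01 i : `|lam i p| <= 1.
  rewrite ger0_norm//; move: (Tp 0) (Tp 1) (Tp 2%:R).
  by elim/ord3P: i; lra.
have H i (a : R) : `|lam i p * a| <= `|a| by rewrite normrM ler_piMl.
rewrite {1 2}[p]lam_bary big_ord3 !crdE; split.
- apply: le_trans (ler_normD _ _) _; apply: lerD.
    apply: le_trans (ler_normD _ _) _; apply: lerD.
      by apply: le_trans (H _ _) _; rewrite lerDl.
    by apply: le_trans (H _ _) _; rewrite lerDl.
  by apply: le_trans (H _ _) _; rewrite lerDl.
- apply: le_trans (ler_normD _ _) _; apply: lerD.
    apply: le_trans (ler_normD _ _) _; apply: lerD.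
      by apply: le_trans (H _ _) _; rewrite lerDr.
    by apply: le_trans (H _ _) _; rewrite lerDr.
  by apply: le_trans (H _ _) _; rewrite lerDr.
Qed.

End ReferenceTriangle.

(** The lowest nonzero coefficient dominates near 0. Serves to choose one [d] that avoids several
    degenerate directions at once. *)
Lemma quadratic_near0 (R : realType) (x y z : R) : (x, y, z) != 0 ->
  \forall d \near 0^'+, x + y * d + z * d ^+ 2 != 0.
Proof.
have z1 : 0 < `|z| + 1 by rewrite ltr_wpDl.
have yz1 : 0 < `|y| + `|z| + 1 by rewrite ltr_wpDl// addr_ge0.
(* Thresholds for [d] below which [y], respectively [x], dominates the terms of higher order; 1 is a
   dummy when the coefficient vanishes. *)
pose ty := if y == 0 then 1 else `|y| / (`|z| + 1).
pose tx := if x == 0 then 1 else `|x| / (`|y| + `|z| + 1).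
have ty0 : 0 < ty by rewrite /ty; case: ifPn => // ?; rewrite divr_gt0// normr_gt0.
have tx0 : 0 < tx by rewrite /tx; case: ifPn => // ?; rewrite divr_gt0// normr_gt0.
move=> xyz; near=> d.
have d0 : 0 < d by near: d; exact: nbhs_right_gt.
have d1 : d < 1 by near: d; exact: nbhs_right_lt.
have dd : d ^+ 2 <= d by rewrite expr2 ler_piMl// ltW.
have dty : d < ty by near: d; exact: nbhs_right_lt.
have dtx : d < tx by near: d; exact: nbhs_right_lt.
apply/eqP => E.
have [x0|x0] := eqVneq x 0.
  have [y0|y0] := eqVneq y 0.
    move: E; rewrite x0 y0 mul0r !add0r => /eqP; rewrite mulf_eq0 expf_eq0 /=.
    rewrite (gt_eqF d0) orbF => /eqP z0.
    by move: xyz; rewrite x0 y0 z0 eqxx.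
  have dy : d < `|y| / (`|z| + 1).
    by have := dty; rewrite /ty (negbTE y0).
  have : d * (y + z * d) = 0 by rewrite -[RHS]E x0; ring.
  move=> /eqP; rewrite mulf_eq0 (gt_eqF d0)/= addr_eq0 => /eqP yE.
  move: dy; rewrite yE normrN normrM (gtr0_norm d0) ltr_pdivlMr//.
  lra.
have dx : d < `|x| / (`|y| + `|z| + 1) by have := dtx; rewrite /tx (negbTE x0).
have xE : x = - (y * d + z * d ^+ 2) by apply/eqP; rewrite -addr_eq0 addrA E.
move: dx; rewrite ltr_pdivlMr//.
have : `|x| <= `|y| * d + `|z| * d.
  rewrite xE normrN; apply: le_trans (ler_normD _ _) _.
  rewrite (normrM y) (normrM z) normrX (gtr0_norm d0) lerD2l ler_wpM2l//.
have := mulr_ge0 (normr_ge0 y) (ltW d0); have := mulr_ge0 (normr_ge0 z) (ltW d0).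
lra.
Unshelve. all: by end_near. Qed.

Section ElementMap.
Context {R : realType}.
Variable Th : triangulation R.
Hypothesis Th_nd : ref_nondegenerate Th.
Variable F : R * R -> R * R.
Notation T := (ref_triangle Th).
Hypothesis FC2 : Ck_map 2 T F.
Variables (B : 'M[R]_2) (b : R * R) (c : R).
Hypothesis Bu : B \in unitmx.
Hypothesis c1 : c < 1.
Hypothesis FPhi : forall p, T p -> forall xi : R * R,
  enorm (mxact (jac (fun p => F p - (mxact B p + b)) p *m invmx B) xi)
    <= c * enorm xi.
Implicit Types (p q : R * R).

Let F1 p := (F p).1.
Let F2 p := (F p).2.
Let a (f : R * R -> R) i := 'D_(basis i) f.

Lemma F1_wC2 : [/\ wC1 T F1 (a F1 0) (a F1 1), wC1e T (a F1 0) & wC1e T (a F1 1)].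
Proof.
have [U [oU TU FU]] := FC2.
have [d1 [d2 [-> -> h1 h2 h3]]] := Ck_on_wC2 oU TU (FU 0).
exact: (And3 h1 h2 h3).
Qed.

Lemma F2_wC2 : [/\ wC1 T F2 (a F2 0) (a F2 1), wC1e T (a F2 0) & wC1e T (a F2 1)].
Proof.
have [U [oU TU FU]] := FC2.
have [d1 [d2 [-> -> h1 h2 h3]]] := Ck_on_wC2 oU TU (FU 1).
exact: (And3 h1 h2 h3).
Qed.

Let c0 : 0 <= c.
Proof.
have := FPhi (p := tri_vert Th 0) _ (1, 0).
rewrite {2}/enorm /dot !crdE mul1r mul0r addr0 sqrtr1 mulr1 => h.
apply: le_trans (h _); first exact: enorm_ge0.
exists (fun i => if i == 0 then 1 else 0); split.
- by elim/ord3P => /=.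
- by rewrite big_ord3 /= !addr0.
- by rewrite big_ord3 /= !scale0r !addr0 scale1r.
Qed.

(** The operator bound taken at the vector [mxact B xi], so that [invmx B] cancels:
    [|(DF - B) xi| <= c |B xi|]. *)
Let Phi_dir p : T p -> forall xi : R * R,
  enorm ((a F1 0 p * xi.1 + a F1 1 p * xi.2, a F2 0 p * xi.1 + a F2 1 p * xi.2)
     - mxact B xi) <= c * enorm (mxact B xi).
Proof.
move=> Tp xi; have := FPhi Tp (mxact B xi); rewrite -mxactM mulmxKV//.
congr (enorm _ <= _).
have [U [oU TU FU]] := FC2.
have Up : interior U p by apply: open_nbhs_nbhs; split => //; exact: TU.
have D i j : 'D_(basis j) (coord i \o (fun p => F p - (mxact B p + b))) p =
    'D_(basis j) (coord i \o F) p - B i j.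
  have [d1 [d2 [-> -> [dF _ _] _ _]]] := Ck_on_wC2 oU (@subset_refl _ U) (FU i).
  have dA : wdiff U (fun p => -1 * (B i 0 * p.1 + B i 1 * p.2 + coord i b))
      (- B i 0) (- B i 1) p.
    have := wdiffM (wdiff_cst U (-1) p) (wdiffD (wdiffD
      (wdiffM (wdiff_cst U (B i 0) p) (wdiff_fst U p))
      (wdiffM (wdiff_cst U (B i 1) p) (wdiff_snd U p)))
      (wdiff_cst U (coord i b) p)).
    by move/wdiff_eq; apply; rewrite /=; ring.
  have := wdiffD (dF p (TU _ Tp)) dA.
  have -> : (fun q => (coord i \o F) q + -1 * (B i 0 * q.1 + B i 1 * q.2 + coord i b))
     = coord i \o (fun p => F p - (mxact B p + b)).
    apply/funext => q /=.
    by elim/ord2P: i {dF dA}; rewrite /coord /= mulN1r.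
  move=> /(wdiff_interior Up)[D0 D1].
  by elim/ord2P: j; rewrite derive_val.
have J1 j : jac (fun p => F p - (mxact B p + b)) p 0 j = a F1 j p - B 0 j by rewrite mxE D.
have J2 j : jac (fun p => F p - (mxact B p + b)) p 1 j = a F2 j p - B 1 j by rewrite mxE D.
apply: prod_ext; rewrite /mxact !crdE ?J1 ?J2.
  by move: (a F1 0 p) (a F1 1 p) => u v; ring.
by move: (a F2 0 p) (a F2 1 p) => u v; ring.
Qed.

(** The mean value theorem is applied to the scalar function [W . (F - B)], where [W] is the very
    defect to be bounded. It yields [|W|^2 = W . V] with [V] controlled by [Phi_dir], and
    Cauchy-Schwarz concludes. *)
Let Phi_lip p q : T p -> T q ->
  enorm (F p - F q - mxact B (p - q)) <= c * enorm (mxact B (p - q)).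
Proof.
move=> Tp Tq; set W := F p - F q - mxact B (p - q).
have [W0|W0] := eqVneq (enorm W) 0.
  by rewrite W0 mulr_ge0// enorm_ge0.
have [F1C _ _] := F1_wC2; have [F2C _ _] := F2_wC2.
have idC : wC1 T (fun q => - (W.1 * B 0 0 + W.2 * B 1 0) * q.1)
    (cst (- (W.1 * B 0 0 + W.2 * B 1 0))) (cst 0).
  split; try exact: cin_cst.
  move=> z _; have := wdiffM (wdiff_cst T (- (W.1 * B 0 0 + W.2 * B 1 0)) z) (wdiff_fst T z).
  by move/wdiff_eq; apply; rewrite /=; ring.
have idC2 : wC1 T (fun q => - (W.1 * B 0 1 + W.2 * B 1 1) * q.2)
    (cst 0) (cst (- (W.1 * B 0 1 + W.2 * B 1 1))).
  split; try exact: cin_cst.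
  move=> z _; have := wdiffM (wdiff_cst T (- (W.1 * B 0 1 + W.2 * B 1 1)) z) (wdiff_snd T z).
  by move/wdiff_eq; apply; rewrite /=; ring.
have cstC (k : R) : wC1 T (cst k) (cst 0) (cst 0).
  by split; try exact: cin_cst; move=> z _; exact: wdiff_cst.
have fC := wC1D (wC1D (wC1M (cstC W.1) F1C) (wC1M (cstC W.2) F2C)) (wC1D idC idC2).
have [z Tz E] := convex_mvt (ref_triangle_convex Th_nd) fC Tq Tp.
have := Phi_dir Tz (p - q).
set V := (_ - mxact B (p - q)) => hV.
have WV : enorm W ^+ 2 = dot W V.
  rewrite enorm_sqr.
  move: E; rewrite /= /dot /V {2 4}/W /mxact !crdE /F1 /F2 /= => E.
  rewrite (_ : W.1 * _ + W.2 * _ =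
     W.1 * ((F p).1 - (F q).1) + W.2 * ((F p).2 - (F q).2)
     - (W.1 * B 0 0 + W.2 * B 1 0) * (p.1 - q.1)
     - (W.1 * B 0 1 + W.2 * B 1 1) * (p.2 - q.2)); last by ring.
  transitivity (W.1 * (F p).1 + W.2 * (F p).2 + (- (W.1 * B 0 0 + W.2 * B 1 0) * p.1
     + - (W.1 * B 0 1 + W.2 * B 1 1) * p.2) -
    (W.1 * (F q).1 + W.2 * (F q).2 + (- (W.1 * B 0 0 + W.2 * B 1 0) * q.1
     + - (W.1 * B 0 1 + W.2 * B 1 1) * q.2))); first by ring.
  rewrite E; move: (a F1 0 z) (a F1 1 z) (a F2 0 z) (a F2 1 z) => u1 u2 u3 u4; ring.
apply: le_trans hV; rewrite -(@ler_pM2l _ (enorm W)) ?lt0r ?W0 ?enorm_ge0//.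
by rewrite -expr2 WV dot_le.
Qed.


Notation E := (F @` T).

Lemma elt_inj p q : T p -> T q -> F p = F q -> p = q.
Proof. exact: (perturbation_inj Bu c1 Phi_lip). Qed.

Lemma elt_lip : exists2 C : R, 0 < C & forall p q, T p -> T q ->
  enorm (F p - F q) <= C * enorm (p - q).
Proof.
have [L L0 BL] := mxact_bound B.
exists ((1 + c) * L); first by rewrite mulr_gt0// ltr_wpDr.
move=> p q Tp Tq; have := Phi_lip Tp Tq; have := BL (p - q).
have := ler_enormB (F p - F q) (mxact B (p - q)) => h1 h2 h3.
apply: (@le_trans _ _ ((1 + c) * enorm (mxact B (p - q)))); first lra.
by rewrite -mulrA ler_wpM2l// addr_ge0.
Qed.

Lemma elt_cvg p : T p -> F @ within T (nbhs p) --> F p.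
Proof.
move=> Tp; have [C C0 CF] := elt_lip; apply: cvg_enormP => e e0.
have := near_enorm p (divr_gt0 e0 C0).
suff H q : enorm (q - p) < e / C -> T q -> enorm (F q - F p) < e.
  by move=> h; apply: filterS h => q ? ?; exact: H.
rewrite ltr_pdivlMr// mulrC => qp Tq; exact: le_lt_trans (CF _ _ Tq Tp) qp.
Qed.

Lemma elt_compact : compact E.
Proof.
apply: continuous_compact; last exact: ref_triangle_compact.
by apply/subspace_continuousP => p Tp; exact: elt_cvg.
Qed.

Let det p := a F1 0 p * a F2 1 p - a F1 1 p * a F2 0 p.

(** A kernel vector [xi] of [DF] satisfies [|B xi| <= c |B xi|] with [c < 1], hence vanishes. If the
    determinant were zero, each row turned by a right angle would lie in the kernel; both rows would
    then be zero, and [(1, 0)] would lie in the kernel too. *)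
Lemma elt_det p : T p -> det p != 0.
Proof.
rewrite /det => Tp; have Phi := Phi_dir Tp; move: Phi.
move: (a F1 0 p) (a F1 1 p) (a F2 0 p) (a F2 1 p) => a11 a12 a21 a22 Phi.
apply/eqP => d0.
have H (xi : R * R) : a11 * xi.1 + a12 * xi.2 = 0 -> a21 * xi.1 + a22 * xi.2 = 0 -> xi = 0.
  move=> h1 h2; have := Phi xi; rewrite h1 h2 enormB subr0 => h.
  have B0 : enorm (mxact B xi) = 0.
    have := enorm_ge0 (mxact B xi); rewrite le_eqVlt => /orP[/eqP//|Bp].
    have : c * enorm (mxact B xi) < enorm (mxact B xi) by rewrite gtr_pMl.
    by rewrite ltNge h.
  rewrite -[xi]mxact1 -(mulVmx Bu) mxactM (enorm_eq0 B0).
  by apply: prod_ext; rewrite /mxact !crdE !mulr0 addr0.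
have /(congr1 fst)/= e11 : (a12, - a11) = 0 :> R * R.
  by apply: H; rewrite !crdE; [rewrite mulrN mulrC subrr|rewrite -[RHS]oppr0 -d0; ring].
have /(congr1 snd)/= e12 : (a12, - a11) = 0 :> R * R.
  by apply: H; rewrite !crdE; [rewrite mulrN mulrC subrr|rewrite -[RHS]oppr0 -d0; ring].
have /(congr1 fst)/= e21 : (a22, - a21) = 0 :> R * R.
  by apply: H; rewrite !crdE; [rewrite -[RHS]d0; ring|rewrite mulrN mulrC subrr].
have /(congr1 snd)/= e22 : (a22, - a21) = 0 :> R * R.
  by apply: H; rewrite !crdE; [rewrite -[RHS]d0; ring|rewrite mulrN mulrC subrr].
have /(congr1 fst)/= : (1, 0) = 0 :> R * R.
  move: e12 e22 => /eqP; rewrite oppr_eq0 => /eqP e12 /eqP; rewrite oppr_eq0 => /eqP e22.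
  by apply: H; rewrite !crdE ?e11 ?e12 ?e21 ?e22 !mul0r addr0.
by move/eqP; rewrite oner_eq0.
Qed.

(** The derivatives of [V] composed with the inverse map are again C^1 functions composed with the
    inverse map, so [wC1_inv] serves once for [v] and once more for each of its derivatives. *)
Lemma elt_wC2 (v V : R * R -> R) : wC2e T V ->
  (forall p, T p -> v (F p) = V p) -> wC2e E v.
Proof.
move=> [d1 [d2 [VC d1C d2C]]] vV.
have [F1C a11C a12C] := F1_wC2; have [F2C a21C a22C] := F2_wC2.
pose Fi q := get [set p | T p /\ F p = q].
have FiP q : E q -> T (Fi q) /\ F (Fi q) = q.
  by move=> [p Tp pq]; apply: (@getPex _ [set p | T p /\ F p = q]); exists p.
have FiT q : E q -> T (Fi q) by move=> /FiP[].
have FiE q : E q -> F (Fi q) = q by move=> /FiP[].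
have FiK q : E q -> (F1 (Fi q), F2 (Fi q)) = q.
  by move=> Eq; apply: prod_ext; rewrite !crdE /F1 /F2 FiE.
have Fic := perturbation_inverse Bu c1 Phi_lip FiT FiE.
have detC : wC1e T det by apply: wC1eB; exact: wC1eM.
have g1C : wC1e T (fun p => (d1 p * a F2 1 p - d2 p * a F2 0 p) / det p).
  by apply: wC1eM; [apply: wC1eB; exact: wC1eM|exact: wC1eV elt_det detC].
have g2C : wC1e T (fun p => (d2 p * a F1 0 p - d1 p * a F1 1 p) / det p).
  by apply: wC1eM; [apply: wC1eB; exact: wC1eM|exact: wC1eV elt_det detC].
have invC := wC1_inv F1C F2C FiT FiK Fic elt_det.
do 2 eexists; split.
- apply: (wC1_ext (f := V \o Fi)); last exact: invC VC.
  by move=> q Eq /=; rewrite -vV ?FiE//; exact: FiT.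
- by have [? [? /invC ?]] := g1C; do 2 eexists; eassumption.
- by have [? [? /invC ?]] := g2C; do 2 eexists; eassumption.
Qed.

(** Edge [i] of the reference triangle, from vertex [i + 1] to vertex [i + 2], at rest outside
    [[0, 1]]. *)
Definition ref_param i (t : R) :=
  (1 - clamp 0 1 t) *: tri_vert Th (i + 1) + clamp 0 1 t *: tri_vert Th (i + 2%:R).

Definition elt_param i t := F (ref_param i t).

Lemma ref_param_edge i t : ref_edge Th i (ref_param i t).
Proof. by exists (clamp 0 1 t) => //=; rewrite in_itv; exact: clamp_itv. Qed.

Lemma ref_param_T i t : T (ref_param i t).
Proof. by have /(ref_edgeP Th_nd)[] := ref_param_edge i t. Qed.

Lemma ref_param_continuous i : continuous (ref_param i).
Proof.
move=> t; have ct := @continuous_clamp _ 0 1 t.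
apply: cvgD; apply: cvgZr_tmp; last exact: ct.
by apply: cvgB; [exact: cvg_cst|exact: ct].
Qed.

Lemma elt_param_continuous i : continuous (elt_param i).
Proof.
move=> t; have [C C0 CF] := elt_lip; apply: cvg_enormP => e e0.
have h : \forall x \near t, enorm (ref_param i x - ref_param i t) < e / C :=
  ref_param_continuous (near_enorm (ref_param i t) (divr_gt0 e0 C0)).
apply: filterS h => x; rewrite ltr_pdivlMr// mulrC.
by apply: le_lt_trans; apply: CF; exact: ref_param_T.
Qed.

Lemma ref_paramB i s t : ref_param i s - ref_param i t =
  (clamp 0 1 s - clamp 0 1 t) *: (tri_vert Th (i + 2%:R) - tri_vert Th (i + 1)).
Proof. by apply: prod_ext; rewrite /ref_param !crdE; ring. Qed.

Lemma lam_vertex i j : lam Th i (tri_vert Th j) = (i == j)%:R.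
Proof.
have -> : tri_vert Th j = \sum_l (l == j)%:R *: tri_vert Th l.
  rewrite big_ord3; elim/ord3P: j => /=; by rewrite !scale0r scale1r ?add0r ?addr0.
rewrite lam_unique//.
by rewrite big_ord3; elim/ord3P: j => /=; rewrite ?addr0 ?add0r.
Qed.

Lemma lam_ref_param i j t : lam Th j (ref_param i t) =
  (1 - clamp 0 1 t) * (j == i + 1)%:R + clamp 0 1 t * (j == i + 2%:R)%:R.
Proof.
rewrite [ref_param i t](_ : _ = \sum_l ((1 - clamp 0 1 t) * (l == i + 1)%:R +
  clamp 0 1 t * (l == i + 2%:R)%:R) *: tri_vert Th l).
  rewrite lam_unique// big_ord3; elim/ord3P: i => /=; rewrite ?ord3E /=; ring.
rewrite big_ord3; apply: prod_ext; rewrite /ref_param !crdE;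
  elim/ord3P: i => /=; rewrite ?ord3E /=; ring.
Qed.

Lemma elt_param_inj i s t : 0 <= s <= 1 -> 0 <= t <= 1 ->
  elt_param i s = elt_param i t -> s = t.
Proof.
move=> s01 t01 /(elt_inj (ref_param_T _ _) (ref_param_T _ _)).
move=> /(congr1 (lam Th (i + 2%:R))); rewrite !lam_ref_param !clamp_id//.
by elim/ord3P: i; rewrite ?ord3E /=; lra.
Qed.

Lemma elt_param_meet i j s t : 0 <= s <= 1 -> 0 <= t <= 1 -> i != j ->
  elt_param i s = elt_param j t -> s = 0 \/ s = 1.
Proof.
move=> s01 t01 ij /(elt_inj (ref_param_T _ _) (ref_param_T _ _)).
move=> /(congr1 (lam Th j)); rewrite !lam_ref_param !clamp_id//.
by elim/ord3P: i ij; elim/ord3P: j => //; rewrite ?ord3E /= => _ ?;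
  [right|left|left|right|right|left]; lra.
Qed.

Lemma elt_param_end i : elt_param i 1 = elt_param (i + 1) 0.
Proof.
rewrite /elt_param /ref_param !clamp_id ?lexx ?ler01// subrr subr0.
rewrite !scale0r !scale1r add0r addr0.
by elim/ord3P: i; rewrite ?ord3E.
Qed.

Notation bdry := (\bigcup_i (elt_param i @` `[0, 1]%classic)).

Lemma elt_param_edge i : elt_param i @` `[0, 1]%classic = F @` ref_edge Th i.
Proof.
apply/seteqP; split=> [_ [t _ <-]|_ [_ [t t01 <-] <-]].
  by exists (ref_param i t) => //; exact: ref_param_edge.
by exists t => //; rewrite /elt_param /ref_param clamp_id.
Qed.

Lemma elt_minus_bdry q : (E `\` bdry) q <->
  exists2 p, (forall i, 0 < lam Th i p) & F p = q.
Proof.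
split=> [[[p Tp <-] nb]|[p lp <-]].
  exists p => // i; rewrite lt0r; apply/andP; split; last exact: (ref_triangleP Th_nd p).1.
  apply/eqP => li; apply: nb; exists i => //; rewrite elt_param_edge.
  by exists p => //; apply/(ref_edgeP Th_nd).
have Tp : T p by apply/(ref_triangleP Th_nd) => i; exact: ltW.
split; first by exists p.
move=> [i _]; rewrite elt_param_edge => -[p' /(ref_edgeP Th_nd)[Tp' li] pp'].
by move: (lp i); rewrite -(elt_inj Tp' Tp pp') li ltxx.
Qed.

(** The set is the image of the open reference triangle, and perturbations of an invertible linear
    map are open. *)
Lemma elt_minus_bdry_open : open (E `\` bdry).
Proof.
rewrite openE => q /elt_minus_bdry[p lp <-].
pose D := [set p | forall i, 0 < lam Th i p].
have Dp : interior D p.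
  have H i : \forall q \near p, 0 < lam Th i q.
    have := @lam_continuous _ _ Th_nd i p; move=> /cvgrPdist_lt /(_ _ (lp i)).
    by apply: filterS => q'; rewrite ltr_distlC; lra.
  have : \forall q \near p, [/\ 0 < lam Th 0 q, 0 < lam Th 1 q & 0 < lam Th 2%:R q].
    exact: filterS3 (H 0) (H 1) (H 2%:R).
  by apply: filterS => q' [q0 q1 q2]; elim/ord3P.
have DT p' : D p' -> T p'.
  by move=> Dp'; apply/(ref_triangleP Th_nd) => i; exact: ltW.
have lipD p1 p2 (D1 : D p1) (D2 : D p2) := Phi_lip (DT _ D1) (DT _ D2).
have := perturbation_open Bu c0 c1 lipD Dp.
by apply: filterS => y [p' Dp' p'y]; apply/elt_minus_bdry; exists p'.
Qed.

Lemma elt_minus_bdry_nonempty : (E `\` bdry) !=set0.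
Proof.
exists (F (\sum_i 3^-1 *: tri_vert Th i)); apply/elt_minus_bdry.
exists (\sum_i 3^-1 *: tri_vert Th i) => // i.
by rewrite (lam_unique Th_nd (l := fun=> 3^-1)) ?invr_gt0// big_ord3; field.
Qed.

Variable i0 : 'I_3.
Hypothesis straight : forall i, i != i0 -> forall t, 0 <= t <= 1 ->
  elt_param i t = (1 - t) *: elt_param i 0 + t *: elt_param i 1.

Let W i := tri_vert Th (i + 2%:R) - tri_vert Th (i + 1).

Let W0 i : W i != 0.
Proof.
rewrite subr_eq0; apply/eqP => /(congr1 (lam Th (i + 1))).
rewrite !lam_vertex eqxx; elim/ord3P: i; rewrite ?ord3E /= => /eqP;
by rewrite eq_sym oner_eq0.
Qed.

Let shear (al : R) p := p.1 + al * p.2.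

(** On the edge [i0] a chord differs from a multiple of [Ev], the image of the reference edge by
    [B], by at most a fraction [c] of that multiple, so a direction [nu] close to [Ev] detects it.
    On a straight edge [nu] only has to be non-orthogonal to the edge. The vectors
    [Ev + (d, d ^+ 2)] describe a parabola, which meets every line in finitely many points; a small
    [d] therefore avoids all forbidden lines, including [nu.1 = 0], excluded because [nu] is scaled
    to [(1, al)]. *)
Lemma elt_param_chord : exists al k : R, 0 < k /\ forall i s t,
  k * enorm (elt_param i s - elt_param i t) <=
    `|shear al (elt_param i s) - shear al (elt_param i t)|.
Proof.
pose Ev := mxact B (W i0).
have Ev0 : 0 < enorm Ev.
  rewrite lt0r enorm_ge0 andbT; apply/eqP => /enorm_eq0 h.
  move: (W0 i0); rewrite -[W i0]mxact1 -(mulVmx Bu) mxactM -/Ev h.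
  have -> : mxact (invmx B) 0 = 0 by apply: prod_ext; rewrite /mxact !crdE /=; ring.
  by rewrite eqxx.
pose D i := elt_param i 1 - elt_param i 0.
have D0 i : D i != 0.
  rewrite subr_eq0; apply/eqP => /elt_param_inj; rewrite !lexx ler01 => /(_ isT isT).
  by move/eqP; rewrite oner_eq0.
have nz p : p != 0 -> forall z : R, (z, p.1, p.2) != 0.
  move=> p0 z; apply: contraNneq p0 => /pair_equal_spec[/pair_equal_spec[_ p1] p2].
  by apply/eqP; apply: prod_ext; rewrite ?p1 ?p2.
have [d [d0 dsmall nu1 nuD]] : exists d : R, [/\ 0 < d,
    4 * d * (1 + c) <= (1 - c) * enorm Ev /\ d <= 1, Ev.1 + d != 0 &
    forall i, dot Ev (D i) + (D i).1 * d + (D i).2 * d ^+ 2 != 0].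
  near (0 : R)^'+ => d; exists d.
  have d0 : 0 < d by near: d; exact: nbhs_right_gt.
  split => //.
  - split; last by near: d; exact: nbhs_right_le.
    rewrite mulrAC -ler_pdivlMl; last by rewrite mulr_gt0// ltr_wpDr.
    near: d; apply: nbhs_right_le.
    by rewrite mulr_gt0 ?invr_gt0// ?mulr_gt0 ?subr_gt0// ltr_wpDr.
  - have -> : Ev.1 + d = Ev.1 + 1 * d + 0 * d ^+ 2 by ring.
    near: d; apply: quadratic_near0.
    by apply/eqP => /pair_equal_spec[/pair_equal_spec[_ /eqP]]; rewrite oner_eq0.
  - by apply: ord3P; near: d; apply: quadratic_near0; exact: nz.
have [dsmall1 d1] := dsmall.
pose nu : R * R := (Ev.1 + d, Ev.2 + d ^+ 2).
have nuE p q : `|shear (nu.2 / nu.1) p - shear (nu.2 / nu.1) q| = `|dot nu (p - q)| / `|nu.1|.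
  rewrite -normf_div; congr `|_|; rewrite /shear /dot !crdE; field.
  by move: nu1; rewrite /nu.
have [C C0 CF] := elt_lip.
have ki i : exists2 k : R, 0 < k & forall s t,
    k * enorm (elt_param i s - elt_param i t) <= `|dot nu (elt_param i s - elt_param i t)|.
  have [m m0 mP] : exists2 m : R, 0 < m & forall s t,
      m * `|clamp 0 1 s - clamp 0 1 t| <= `|dot nu (elt_param i s - elt_param i t)|.
    have [->|ii0] := eqVneq i i0.
      (* With [nu = Ev] the margin would be [(1 - c) * enorm Ev]; the perturbation of [nu] costs
         [2 * d * (1 + c)], at most half of it by the choice of [d]. *)
      exists (enorm Ev * ((1 - c) * enorm Ev / 2)).
        by rewrite !mulr_gt0// subr_gt0.
      move=> s t; have := Phi_lip (ref_param_T i0 s) (ref_param_T i0 t).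
      rewrite ref_paramB mxactZ -/(W i0) -/Ev enormZ.
      set cc := clamp 0 1 s - clamp 0 1 t; set r := (_ - _ *: Ev) => rle.
      have -> : elt_param i0 s - elt_param i0 t = cc *: Ev + r by rewrite /r [RHS]addrC subrK.
      pose dd : R * R := (d, d ^+ 2).
      have ddn : enorm dd <= 2 * d.
        apply: le_trans (enorm_le _) _; rewrite !crdE (gtr0_norm d0).
        rewrite (ger0_norm (ltW (exprn_gt0 2 d0))).
        have : d ^+ 2 <= d by rewrite expr2 ler_piMl// ltW.
        lra.
      have nuEd : nu = Ev + dd by [].
      have nun : enorm nu <= enorm Ev + 2 * d.
        by rewrite nuEd; apply: le_trans (enormD _ _) _; rewrite lerD2l.
      have nuEv : enorm Ev ^+ 2 - 2 * d * enorm Ev <= dot nu Ev.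
        have -> : dot nu Ev = enorm Ev ^+ 2 - dot (- dd) Ev.
          by rewrite enorm_sqr /dot /nu !crdE; ring.
        rewrite lerD2l lerN2; apply: le_trans (dot_le _ _) _.
        by rewrite enormN ler_wpM2r// enorm_ge0.
      have nur : `|dot nu r| <= (enorm Ev + 2 * d) * (c * (`|cc| * enorm Ev)).
        apply: le_trans (_ : enorm nu * enorm r <= _).
          rewrite ler_norml dot_le andbT lerNl.
          have -> : - dot nu r = dot nu (- r) by rewrite /dot !crdE; ring.
          by rewrite -(enormN r) dot_le.
        by apply: ler_pM => //; exact: enorm_ge0.
      have -> : dot nu (cc *: Ev + r) = cc * dot nu Ev + dot nu r.
        by rewrite /dot !crdE; ring.
      have := lerB_dist (cc * dot nu Ev) (- dot nu r).
      rewrite opprK normrN normrM.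
      have nuEv0 : 0 <= dot nu Ev.
        apply: le_trans nuEv; rewrite expr2 -mulrBl mulr_ge0 ?enorm_ge0//.
        have : 0 <= c * d by rewrite mulr_ge0// ltW.
        have : 0 <= c * enorm Ev by rewrite mulr_ge0// enorm_ge0.
        lra.
      rewrite (ger0_norm nuEv0).
      have h1 := ler_wpM2l (normr_ge0 cc) nuEv.
      have h2 : `|cc| * (enorm Ev * (4 * d * (1 + c))) <= `|cc| * (enorm Ev * ((1 - c) * enorm Ev)).
        by rewrite !ler_wpM2l// enorm_ge0.
      lra.
    exists `|dot nu (D i)|.
      rewrite normr_gt0; apply: contra (nuD i) => /eqP <-; apply/eqP.
      by rewrite /nu /dot !crdE; ring.
    move=> s t.
    have str u : elt_param i u = (1 - clamp 0 1 u) *: elt_param i 0 + clamp 0 1 u *: elt_param i 1.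
      by rewrite -straight// ?clamp_itv// /elt_param /ref_param (clamp_id (x := clamp 0 1 u)) ?clamp_itv.
    have -> : dot nu (elt_param i s - elt_param i t) =
        (clamp 0 1 s - clamp 0 1 t) * dot nu (D i).
      by rewrite (str s) (str t) /D /dot !crdE; ring.
    by rewrite normrM mulrC.
  exists (m / (C * enorm (W i) + 1)).
    by rewrite divr_gt0// ltr_wpDl// mulr_ge0 ?enorm_ge0// ltW.
  move=> s t; apply: le_trans (mP s t).
  rewrite mulrAC ler_pdivrMr; last by rewrite ltr_wpDl// mulr_ge0 ?enorm_ge0// ltW.
  rewrite -mulrA ler_pM2l//; apply: le_trans (CF _ _ (ref_param_T _ _) (ref_param_T _ _)) _.
  rewrite ref_paramB enormZ -/(W i) mulrCA ler_wpM2l// lerDl ler01//.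
have [k0 k00 k0P] := ki 0; have [k1 k10 k1P] := ki 1; have [k2 k20 k2P] := ki 2%:R.
have n0 : 0 < `|nu.1| by rewrite normr_gt0.
exists (nu.2 / nu.1), (Order.min k0 (Order.min k1 k2) / `|nu.1|); split.
  by rewrite divr_gt0// !lt_min k00 k10.
move=> i s t; rewrite nuE mulrAC ler_pM2r ?invr_gt0//.
elim/ord3P: i.
- by apply: le_trans (k0P s t); rewrite ler_wpM2r ?enorm_ge0// ge_min lexx.
- by apply: le_trans (k1P s t); rewrite ler_wpM2r ?enorm_ge0// !ge_min lexx !orbT.
- by apply: le_trans (k2P s t); rewrite ler_wpM2r ?enorm_ge0// !ge_min lexx !orbT.
Unshelve. all: by end_near. Qed.

End ElementMap.

(** * Curved triangles as regions between two graphs *)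

Section RealLine.
Context {R : realType}.

Lemma continuous_inj_between (f : R -> R) (t : R) : continuous f ->
  (forall s t, 0 <= s <= 1 -> 0 <= t <= 1 -> f s = f t -> s = t) ->
  f 0 < f 1 -> 0 <= t <= 1 -> f 0 <= f t <= f 1.
Proof.
move=> cf finj f01 /andP[t0 t1].
have wcf (A : set R) : {within A, continuous f} by exact: continuous_subspaceT.
apply/andP; split; rewrite leNgt; apply/negP => ft.
- have [|s] := @IVT _ f t 1 (f 0) t1 (wcf _).
    by rewrite (min_l (ltW (lt_trans ft f01))) (max_r (ltW (lt_trans ft f01))) !ltW.
  rewrite in_itv /= => /andP[ts s1] /finj; rewrite lexx ler01 (le_trans t0 ts) s1.
  move=> /(_ isT isT) s0; move: ft; have -> : t = 0 by lra.
  by rewrite ltxx.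
- have [|s] := @IVT _ f 0 t (f 1) t0 (wcf _).
    by rewrite (min_l (ltW (lt_trans f01 ft))) (max_r (ltW (lt_trans f01 ft))) !ltW.
  rewrite in_itv /= => /andP[s0 st] /finj; rewrite lexx ler01 (le_trans st t1) s0.
  move=> /(_ isT isT) s1; move: ft; have -> : t = 1 by lra.
  by rewrite ltxx.
Qed.

Lemma continuous_inj_onto (f : R -> R) (x : R) : continuous f ->
  Order.min (f 0) (f 1) <= x <= Order.max (f 0) (f 1) ->
  exists2 t, 0 <= t <= 1 & f t = x.
Proof.
move=> cf fx; have [t] := @IVT _ f 0 1 x ler01 (continuous_subspaceT cf) fx.
by rewrite in_itv /= => t01 <-; exists t.
Qed.

(** The times spent in [E] form a closed set since [E] is closed, and an open one since they are the
    times spent in [O]; [[0, 1]] is connected. *)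
Lemma path_stays (E O : set (R * R)) (c : R -> R * R) : closed E -> open O ->
  O `<=` E -> continuous c -> (forall t, 0 <= t <= 1 -> E (c t) -> O (c t)) ->
  E (c 0) -> E (c 1).
Proof.
move=> cE oO OE cc EO E0.
have := @segment_connected R 0 1 (`[0, 1]%classic `&` c @^-1` E).
have h : `[0, 1]%classic `&` c @^-1` E = `[0, 1]%classic `&` c @^-1` O.
  apply/seteqP; split=> t [t01 Et]; split => //.
    by apply: EO => //; move: t01; rewrite /= in_itv.
  exact: OE.
move=> H; have : (`[0, 1]%classic `&` c @^-1` E) 1.
  rewrite H; first by rewrite /= in_itv /= lexx ler01.
  - by exists 0; split => //; rewrite /= in_itv /= lexx ler01.
  - by exists (c @^-1` O) => //; apply: open_comp => // ? _; exact: cc.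
  - by exists (c @^-1` E) => //; apply: closed_comp => // ? _; exact: cc.
by case.
Qed.

End RealLine.

(** Together with the ordinate, an area-preserving change of coordinates, inverted by [unshear]. *)
Definition shear {R : realType} (al : R) (p : R * R) := p.1 + al * p.2.
Definition unshear {R : realType} (al x y : R) : R * R := (x - al * y, y).

(* The edge [e i] runs from vertex i + 1 to vertex i + 2 of [E], and [ct_chord]
   makes it a graph over the coordinate [shear al]. *)
Record curved_tri {R : realType} (E : set (R * R)) (e : 'I_3 -> R -> R * R)
    (al k : R) : Prop := {
  ct_compact : compact E;
  ct_cont : forall i, continuous (e i);
  ct_mem : forall i t, E (e i t);
  ct_inj : forall i s t, 0 <= s <= 1 -> 0 <= t <= 1 -> e i s = e i t -> s = t;
  ct_meet : forall i j s t, 0 <= s <= 1 -> 0 <= t <= 1 -> i != j ->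
    e i s = e j t -> s = 0 \/ s = 1;
  ct_end : forall i, e i 1 = e (i + 1) 0;
  ct_open : open (E `\` \bigcup_i (e i @` `[0, 1]%classic));
  ct_nonempty : (E `\` \bigcup_i (e i @` `[0, 1]%classic)) !=set0;
  ct_k : 0 < k;
  ct_chord : forall i s t,
    k * enorm (e i s - e i t) <= `|shear al (e i s) - shear al (e i t)| }.

Section CurvedTriangle.
Context {R : realType}.
Variables (E : set (R * R)) (e : 'I_3 -> R -> R * R) (al k : R).
Hypothesis H : curved_tri E e al k.
Notation bdry := (\bigcup_i (e i @` `[0, 1]%classic)).
Notation X := (shear al).
Notation P := (unshear al).
Implicit Types (p q : R * R) (i j : 'I_3).

Lemma shearK p : P (X p) p.2 = p.
Proof. by case: p => x y; rewrite /unshear /shear /= addrK. Qed.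

Lemma unshearK x y : X (P x y) = x.
Proof. by rewrite /unshear /shear /= subrK. Qed.

Lemma continuous_shear : continuous X.
Proof.
move=> p; apply: cvgD; first exact: cvg_fst.
by apply: cvgM; [exact: cvg_cst|exact: cvg_snd].
Qed.

Let phi i t := X (e i t).

Let phic i : continuous (phi i).
Proof.
by move=> t; apply: (continuous_comp (f := e i)); [exact: (ct_cont H)|exact: continuous_shear].
Qed.

Let phi_eq i s t : phi i s = phi i t -> e i s = e i t.
Proof.
move=> st; have := ct_chord H i s t; rewrite -/(phi i s) -/(phi i t) st subrr normr0.
rewrite pmulr_rle0 ?(ct_k H)// => h; apply/eqP; rewrite -subr_eq0; apply/eqP.
by apply: enorm_eq0; apply/eqP; rewrite eq_le h enorm_ge0.
Qed.

Let phi_inj i s t : 0 <= s <= 1 -> 0 <= t <= 1 -> phi i s = phi i t -> s = t.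
Proof. by move=> s01 t01 /phi_eq; exact: (ct_inj H). Qed.

(* The edge [e i] is the graph of [gy i] over its xspan in the coordinate [X]. *)
Definition xspan i (a b : R) := a < b /\
  ((X (e i 0) = a /\ X (e i 1) = b) \/ (X (e i 0) = b /\ X (e i 1) = a)).

Definition gy i x := (e i (get [set t | 0 <= t <= 1 /\ X (e i t) = x])).2.

Let gyE i t : 0 <= t <= 1 -> gy i (phi i t) = (e i t).2.
Proof.
move=> t01; rewrite /gy.
have [|g01 gE] := @getPex _ [set s | 0 <= s <= 1 /\ phi i s = phi i t]; first by exists t.
by congr snd; exact: phi_eq.
Qed.

Lemma edge_gy i t : 0 <= t <= 1 -> e i t = P (X (e i t)) (gy i (X (e i t))).
Proof. by move=> t01; rewrite -/(phi i t) gyE// shearK. Qed.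

Lemma span_onto i a b x : xspan i a b -> a <= x <= b ->
  exists2 t, 0 <= t <= 1 & X (e i t) = x.
Proof.
move=> [ab ends] xab; apply: (continuous_inj_onto (f := phi i)) => //.
case: ends => -[]; rewrite -/(phi i 0) -/(phi i 1) => -> ->.
  by rewrite (min_l (ltW ab)) (max_r (ltW ab)).
by rewrite (min_r (ltW ab)) (max_l (ltW ab)).
Qed.

Lemma span_range i a b t : xspan i a b -> 0 <= t <= 1 -> a <= X (e i t) <= b.
Proof.
move=> [ab [[ea eb]|[eb ea]]] t01.
  rewrite -ea -eb; apply: (continuous_inj_between (f := phi i)) => //.
  - exact: phi_inj.
  - by rewrite /phi ea eb.
have := @continuous_inj_between _ (fun t => - phi i t) t _ _ _ t01.
rewrite !lerN2 /phi ea eb => /(_ _ _ _)/andP[] //.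
- by move=> u; apply: cvgN; exact: phic.
- by move=> s u s01 u01 /oppr_inj; exact: phi_inj.
- by rewrite ltrN2.
- by move=> -> ->.
Qed.

Lemma span_end i a b t : xspan i a b -> t = 0 \/ t = 1 -> X (e i t) = a \/ X (e i t) = b.
Proof. by move=> [ab [[ea eb]|[ea eb]]] [->|->]; auto. Qed.

(** The chord bound read backwards: the ordinate varies by at most the length of the chord, hence by
    at most [k^-1] times the variation of the abscissa. *)
Lemma gy_lipschitz i a b x y : xspan i a b -> a <= x <= b -> a <= y <= b ->
  `|gy i x - gy i y| <= k^-1 * `|x - y|.
Proof.
move=> sp /(span_onto sp)[s s01 <-] /(span_onto sp)[t t01 <-].
rewrite -/(phi i s) -/(phi i t) !gyE// ler_pdivlMl ?(ct_k H)//.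
apply: le_trans (ct_chord H i s t); rewrite ler_pM2l ?(ct_k H)//.
exact: (normr2_enorm (e i s - e i t)).
Qed.

Lemma gy_continuous i a b : xspan i a b -> continuous (gy i \o clamp a b).
Proof.
move=> sp x; have ab := ltW sp.1; apply/cvgrPdist_lt => d d0.
have k0 : 0 < k * d by rewrite mulr_gt0// (ct_k H).
have := @continuous_clamp _ a b x; move=> /cvgrPdist_lt /(_ _ k0).
apply: filterS => y xy; apply: le_lt_trans (gy_lipschitz sp _ _) _.
- exact: clamp_itv.
- exact: clamp_itv.
- by rewrite ltr_pdivrMl// (ct_k H).
Qed.

(* The edge [iL] lies over [[l, r]], the other two over [[l, m]] and [[m, r]]. *)
Record sorted (iL i1 i2 : 'I_3) (l m r : R) : Prop := {
  so_L : xspan iL l r;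
  so_1 : xspan i1 l m;
  so_2 : xspan i2 m r;
  so_L1 : iL != i1;
  so_L2 : iL != i2;
  so_all : forall i, i = iL \/ i = i1 \/ i = i2;
  so_l : gy iL l = gy i1 l;
  so_r : gy iL r = gy i2 r;
  so_m : gy i1 m = gy i2 m }.

(** No edge has both ends at the same abscissa, so the three vertices are strictly ordered and the
    long edge joins the extreme ones. Of the eight combinations of comparisons the two cyclic ones
    are contradictory. *)
Lemma sorted_edges : exists iL i1 i2 l m r, sorted iL i1 i2 l m r.
Proof.
pose x i := X (e i 0).
have xS i : X (e i 1) = x (i + 1) by rewrite (ct_end H).
have xn i : x i != x (i + 1).
  rewrite -xS; apply/eqP => /(@phi_inj i); rewrite lexx ler01 lexx => /(_ isT isT).
  by move/eqP; rewrite eq_sym oner_eq0.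
have g0 i : gy i (x i) = (e i 0).2 by rewrite -[x i]/(phi i 0) gyE// lexx ler01.
have g1 i : gy i (x (i + 1)) = gy (i + 1) (x (i + 1)).
  by rewrite g0 -(ct_end H) -xS -[X _]/(phi i 1) gyE// lexx ler01.
have sp i a b : a < b -> (x i = a /\ x (i + 1) = b) \/ (x i = b /\ x (i + 1) = a) ->
    xspan i a b.
  by move=> ab; rewrite /xspan !xS.
have all3 i : i = 0 \/ i = 1 \/ i = 2%:R by elim/ord3P: i; auto.
move: (xn 0) (xn 1) (xn 2%:R) (sp 0) (sp 1) (sp 2%:R) (g1 0) (g1 1) (g1 2%:R).
rewrite !ord3E => n0 n1 n2 s0 s1 s2 h0 h1 h2.
case: (ltgtP (x 0) (x 1)) n0 => // x01 _; case: (ltgtP (x 1) (x 2%:R)) n1 => // x12 _;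
  case: (ltgtP (x 2%:R) (x 0)) n2 => // x20 _; try by exfalso; lra.
- exists 2%:R, 0, 1, (x 0), (x 1), (x 2%:R).
  by split; [apply: s2; auto; lra|apply: s0; auto|apply: s1; auto| | | |..] => //
   => i; case: (all3 i) => [->|[->|->]]; auto.
- exists 1, 2%:R, 0, (x 2%:R), (x 0), (x 1).
  by split; [apply: s1; auto; lra|apply: s2; auto|apply: s0; auto| | | |..] => //
   => i; case: (all3 i) => [->|[->|->]]; auto.
- exists 0, 2%:R, 1, (x 0), (x 2%:R), (x 1).
  by split; [apply: s0; auto; lra|apply: s2; auto|apply: s1; auto| | | |..] => //
   => i; case: (all3 i) => [->|[->|->]]; auto.
- exists 0, 1, 2%:R, (x 1), (x 2%:R), (x 0).
  by split; [apply: s0; auto; lra|apply: s1; auto|apply: s2; auto| | | |..] => //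
   => i; case: (all3 i) => [->|[->|->]]; auto.
- exists 1, 0, 2%:R, (x 1), (x 0), (x 2%:R).
  by split; [apply: s1; auto; lra|apply: s0; auto|apply: s2; auto| | | |..] => //
   => i; case: (all3 i) => [->|[->|->]]; auto.
- exists 2%:R, 1, 0, (x 2%:R), (x 1), (x 0).
  by split; [apply: s2; auto; lra|apply: s1; auto|apply: s0; auto| | | |..] => //
   => i; case: (all3 i) => [->|[->|->]]; auto.
Qed.

Lemma bdryP q : bdry q <-> exists2 i, exists a b, xspan i a b /\ a <= X q <= b &
  q.2 = gy i (X q).
Proof.
split.
  move=> [i _ [t]]; rewrite /= in_itv /= => t01 <-.
  exists i; last by rewrite -[X _]/(phi i t) gyE.
  have e01 : X (e i 0) != X (e i 1).
    apply/eqP => /(@phi_inj i); rewrite lexx ler01 lexx => /(_ isT isT).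
    by move/eqP; rewrite eq_sym oner_eq0.
  have [lt01|lt10|E01] := ltgtP (X (e i 0)) (X (e i 1)).
  - have sp : xspan i (X (e i 0)) (X (e i 1)) by split; auto.
    by do 2 eexists; split; [exact: sp|exact: span_range sp t01].
  - have sp : xspan i (X (e i 1)) (X (e i 0)) by split; auto.
    by do 2 eexists; split; [exact: sp|exact: span_range sp t01].
  - by move: e01; rewrite E01 eqxx.
move=> [i [a [b [sp /(span_onto sp)[t t01 Xt]]]] q2].
exists i => //; exists t => //.
by rewrite (edge_gy i t01) Xt -q2 shearK.
Qed.

Lemma span_unique i a b a' b' : xspan i a b -> xspan i a' b' -> a = a' /\ b = b'.
Proof.
by move=> [ab [[ea eb]|[ea eb]]] [ab' [[ea' eb']|[ea' eb']]]; split; lra.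
Qed.

Section Sorted.
Variables (iL i1 i2 : 'I_3) (l m r : R).
Hypothesis so : sorted iL i1 i2 l m r.

Let lm : l < m. Proof. exact: (so_1 so).1. Qed.
Let mr : m < r. Proof. exact: (so_2 so).1. Qed.

(** The long edge, above or below the broken path [bpath] of the other two; which of them is the
    upper one is left to the sign in [paths_sign]. *)
Definition upath x := gy iL (clamp l r x).
Definition bpath x := if x <= m then gy i1 (clamp l m x) else gy i2 (clamp m r x).

Lemma upathE x : l <= x <= r -> upath x = gy iL x.
Proof. by move=> xlr; rewrite /upath clamp_id. Qed.

Lemma bpathE1 x : l <= x <= m -> bpath x = gy i1 x.
Proof. by move=> /andP[lx xm]; rewrite /bpath xm clamp_id// lx. Qed.

Lemma bpathE2 x : m <= x <= r -> bpath x = gy i2 x.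
Proof.
move=> /andP[mx xr]; rewrite /bpath; case: ifPn => xm; last by rewrite clamp_id// mx.
have -> : x = m by apply/eqP; rewrite eq_le xm mx.
by rewrite clamp_id ?lexx ?(ltW lm)// (so_m so).
Qed.

Lemma upath_continuous : continuous upath.
Proof. exact: (gy_continuous (so_L so)). Qed.

Lemma bpath_continuous : continuous bpath.
Proof.
(* The clamped graphs are glued by addition: on either side of [m] one of them is constant, equal to
   the common value at [m]. *)
have -> : bpath = (fun x => (gy i1 \o clamp l m) x + (gy i2 \o clamp m r) x - gy i1 m).
  apply/funext => x; rewrite /bpath /=; case: ifPn => xm.
    have -> : clamp m r x = m.
      by rewrite /clamp (min_r (le_trans xm (ltW mr))) (max_l xm).
    by rewrite -(so_m so) addrK.
  have xm' : m <= x by rewrite ltW// ltNge.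
  have -> : clamp l m x = m by rewrite /clamp (min_l xm') (max_r (ltW lm)).
  by rewrite addrAC subrr add0r.
move=> x; apply: cvgB; last exact: cvg_cst.
by apply: cvgD; [exact: (gy_continuous (so_1 so))|exact: (gy_continuous (so_2 so))].
Qed.

Lemma bdry_sorted q : bdry q <->
  l <= X q <= r /\ (q.2 = upath (X q) \/ q.2 = bpath (X q)).
Proof.
have lm' := lm; have mr' := mr.
split=> [/bdryP[i [a [b [sp Xq]]] q2]|].
  case: (so_all so i) => [iE|[iE|iE]]; move: sp q2; rewrite iE => sp q2.
  - have [al' br] := span_unique sp (so_L so); rewrite al' br in Xq.
    by split => //; left; rewrite upathE.
  - have [al' br] := span_unique sp (so_1 so); rewrite al' br in Xq.
    by split; [lra|right; rewrite bpathE1].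
  - have [al' br] := span_unique sp (so_2 so); rewrite al' br in Xq.
    by split; [lra|right; rewrite bpathE2].
move=> [Xq [q2|q2]]; apply/bdryP.
- exists iL; last by rewrite q2 upathE.
  by exists l, r; split => //; exact: (so_L so).
- have [Xm|Xm] := leP (X q) m.
  + exists i1; last by rewrite q2 bpathE1//; lra.
    by exists l, m; split; [exact: (so_1 so)|lra].
  + exists i2; last by rewrite q2 bpathE2//; lra.
    by exists m, r; split; [exact: (so_2 so)|lra].
Qed.

(** A common point lies on two edges, hence at an end of the long one, whose abscissa is [l] or
    [r]. *)
Lemma paths_meet x : l < x < r -> upath x != bpath x.
Proof.
move=> xlr; apply/eqP => ub.
have [t t01 Xt] := span_onto (so_L so) (x := x) ltac:(lra).
have et : e iL t = P x (upath x) by rewrite (edge_gy iL t01) Xt upathE//; lra.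
suff : t = 0 \/ t = 1.
  by move=> /(span_end (so_L so)); rewrite Xt; lra.
have [xm|xm] := leP x m.
- have [s s01 Xs] := span_onto (so_1 so) (x := x) ltac:(lra).
  apply: (ct_meet H (j := i1) t01 s01); first exact: (so_L1 so).
  have es := edge_gy i1 s01; rewrite Xs in es.
  by rewrite es et ub bpathE1//; apply/andP; split; lra.
- have [s s01 Xs] := span_onto (so_2 so) (x := x) ltac:(lra).
  apply: (ct_meet H (j := i2) t01 s01); first exact: (so_L2 so).
  have es := edge_gy i2 s01; rewrite Xs in es.
  by rewrite es et ub bpathE2//; apply/andP; split; lra.
Qed.

Lemma paths_ends : upath l = bpath l /\ upath r = bpath r.
Proof.
rewrite !upathE ?lexx ?(ltW (lt_trans lm mr))// (so_l so) (so_r so).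
by rewrite bpathE1 ?bpathE2 ?lexx ?ltW.
Qed.

Lemma paths_sign : exists2 sg : R, sg = 1 \/ sg = -1 &
  forall x, l < x < r -> 0 < sg * (upath x - bpath x).
Proof.
have lm' := lm; have mr' := mr.
have cd : continuous (fun x => upath x - bpath x).
  by move=> x; apply: cvgB; [exact: upath_continuous|exact: bpath_continuous].
suff key (g : R -> R) : continuous g -> (forall x, l < x < r -> g x != 0) ->
    0 < g m -> forall x, l < x < r -> 0 < g x.
  have n0 x : l < x < r -> upath x - bpath x != 0.
    by move=> /paths_meet; rewrite subr_eq0.
  have mlr : l < m < r by lra.
  have [h|h|h] := ltgtP 0 (upath m - bpath m).
  - by exists 1; [left|move=> x xlr; rewrite mul1r; exact: (key _ cd n0 h x xlr)].
  - exists (-1); [by right|move=> x xlr; rewrite mulN1r].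
    apply: (key (fun x => - (upath x - bpath x))) => //.
    + by move=> y; apply: cvgN; exact: cd.
    + by move=> y ylr; rewrite oppr_eq0 n0.
    + by rewrite oppr_gt0.
  - by have := n0 m mlr; rewrite -h eqxx.
move=> cg g0 gm x xlr; rewrite ltNge; apply/negP => gx.
have wcg (A : set R) : {within A, continuous g} by exact: continuous_subspaceT.
have [xm|mx] := leP x m.
- have [|y] := @IVT _ g x m 0 xm (wcg _).
    by rewrite (min_l (le_trans gx (ltW gm))) (max_r (le_trans gx (ltW gm))) gx ltW.
  rewrite in_itv /= => xym gy0; have := g0 y ltac:(lra); by rewrite gy0 eqxx.
- have [|y] := @IVT _ g m x 0 (ltW mx) (wcg _).
    by rewrite (min_r (le_trans gx (ltW gm))) (max_l (le_trans gx (ltW gm))) gx ltW.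
  rewrite in_itv /= => xym gy0; have := g0 y ltac:(lra); by rewrite gy0 eqxx.
Qed.


Let uc := upath_continuous.
Let bc := bpath_continuous.

Let unsh_c (f g : R -> R) : continuous f -> continuous g ->
  continuous (fun t => P (f t) (g t)).
Proof.
move=> cf cg t; have h1 : (f s - al * g s) @[s --> t] --> f t - al * g t.
  by apply: cvgB; [exact: cf|apply: cvgM; [exact: cvg_cst|exact: cg]].
exact: cvg_pair h1 (cg t).
Qed.

Let stay (c : R -> R * R) : continuous c -> (forall t, 0 <= t <= 1 -> ~ bdry (c t)) ->
  E (c 0) -> E (c 1).
Proof.
move=> cc nb; apply: (path_stays _ (ct_open H) _ cc).
- by apply: compact_closed; [exact: norm_hausdorff|exact: (ct_compact H)].
- by move=> q [].
- by move=> t t01 Et; split => //; exact: nb.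
Qed.

(** A vertical ray that starts in [E] and misses the three edges would stay in [E], which is
    bounded. *)
Let ray q (u : R) : E q -> ~ (forall t, 0 <= t -> ~ bdry (P (X q) (q.2 + t * u))) \/ u = 0.
Proof.
move=> Eq; have [->|u0] := eqVneq u 0; [by right|left] => nb.
have [M [_ EM]] := compact_bounded (ct_compact H).
(* Long enough for the ordinate to exceed the bound [|M| + 1] valid on [E]. *)
pose T := (`|M| + 1 + `|q.2| + 1) / `|u|.
have T0 : 0 <= T by rewrite divr_ge0// !addr_ge0.
have := @stay (fun t => P (X q) (q.2 + (t * T) * u)) _ _.
rewrite !mul0r addr0 mul1r shearK => /(_ _ _ Eq) ET.
have /EM : E (P (X q) (q.2 + T * u)).
  apply: ET.
    apply: unsh_c; first exact: cst_continuous.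
    move=> t; apply: cvgD; first exact: cvg_cst.
    by do 2 (apply: cvgM; last exact: cvg_cst); exact: cvg_id.
  by move=> t /andP[t0 _]; apply: nb; rewrite mulr_ge0.
move=> /(_ (`|M| + 1)); rewrite (le_lt_trans (ler_norm M)) ?ltrDl// => /(_ isT).
rewrite /Num.norm /= ge_max => /andP[_].
have Tu : `|T * u| = `|M| + 1 + `|q.2| + 1.
  by rewrite normrM ger0_norm// /T divfK// normr_eq0.
have h : `|T * u| - `|q.2| <= `|q.2 + T * u|.
  by have := lerB_dist (T * u) (- q.2); rewrite opprK normrN [T * u + _]addrC.
rewrite Tu in h; rewrite /unshear /= => h2; have h3 : `|q.2 + T * u| <= `|M| + 1 := h2; lra.
Qed.

(** Positive when the ordinate lies strictly between the two graphs, in whichever order these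
    are. *)
Definition inside q := (q.2 - bpath (X q)) * (upath (X q) - q.2).

(** Both vertical rays from the point hit the edges, one above and one below, and each graph has a
    single point over a given abscissa: the point lies between them. *)
Let O_inside q : (E `\` bdry) q -> l < X q < r /\ 0 < inside q.
Proof.
move=> [Eq nb].
have up : ~ (forall t, 0 <= t -> ~ bdry (P (X q) (q.2 + t * 1))).
  by have [//|/eqP] := ray 1 Eq; rewrite oner_eq0.
have dn : ~ (forall t, 0 <= t -> ~ bdry (P (X q) (q.2 + t * -1))).
  by have [//|/eqP] := ray (-1) Eq; rewrite oppr_eq0 oner_eq0.
have bP t : bdry (P (X q) t) <-> l <= X q <= r /\ (t = upath (X q) \/ t = bpath (X q)).
  by rewrite bdry_sorted unshearK.
have [Xq|Xq] := boolP (l <= X q <= r); last first.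
  by exfalso; apply: up => t _ /bP[Xq']; rewrite Xq' in Xq.
have nq : q.2 <> upath (X q) /\ q.2 <> bpath (X q).
  by split=> q2; apply: nb; rewrite -[q]shearK; apply/bP; auto.
have [n1 n2] := nq.
have U : exists2 t : R, 0 <= t & q.2 + t = upath (X q) \/ q.2 + t = bpath (X q).
  apply: contrapT => h; apply: up => t t0 /bP[_ tt]; apply: h; exists t => //.
  by rewrite mulr1 in tt.
have D : exists2 t : R, 0 <= t & q.2 - t = upath (X q) \/ q.2 - t = bpath (X q).
  apply: contrapT => h; apply: dn => t t0 /bP[_ tt]; apply: h; exists t => //.
  by rewrite mulrN1 in tt.
have ins : 0 < inside q.
  rewrite /inside; case: U D => t t0 tE [s s0 sE].
  have [h|h] : (bpath (X q) < q.2 /\ q.2 < upath (X q)) \/ (upath (X q) < q.2 /\ q.2 < bpath (X q)).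
    have [h1|h1|] := ltgtP q.2 (upath (X q)); last by [].
    - left; split => //; have [h2|//|E2] := ltgtP q.2 (bpath (X q)); exfalso.
        by case: sE; lra.
      exact: n2.
    - right; split => //; have [//|h2|E2] := ltgtP q.2 (bpath (X q)); exfalso.
        by case: tE; lra.
      exact: n2.
  - by rewrite mulr_gt0// subr_gt0; case: h.
  - by rewrite nmulr_rgt0 subr_lt0; case: h.
split=> //; have [pl pr] := paths_ends.
have Z x : upath x = bpath x -> X q <> x.
  move=> ux Xx; move: ins; rewrite /inside Xx ux.
  have := sqr_ge0 (q.2 - bpath x); rewrite expr2; lra.
have := Z _ pl; have := Z _ pr; move: Xq => /andP[lX Xr] /eqP Xr' /eqP Xl'.
by rewrite !lt_neqAle lX Xr Xr' eq_sym Xl'.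
Qed.


(** The region between the graphs is path connected, and a path that avoids the edges stays in [E].
    From a known point of the open part, the abscissa is moved at constant relative height [ht],
    then the height at constant abscissa. *)
Let inside_O q : l < X q < r -> 0 < inside q -> (E `\` bdry) q.
Proof.
move=> Xq iq; have [q0 Oq0] := ct_nonempty H.
have [X0 i0] := O_inside Oq0.
pose ht p := (p.2 - bpath (X p)) / (upath (X p) - bpath (X p)).
have htP p : l < X p < r -> 0 < inside p -> 0 < ht p < 1 /\
    p.2 = bpath (X p) + ht p * (upath (X p) - bpath (X p)).
  move=> Xp ip; have ub : upath (X p) - bpath (X p) != 0 by rewrite subr_eq0 paths_meet.
  split; last by rewrite /ht divfK// addrC subrK.
  have ub2 : 0 < (upath (X p) - bpath (X p)) ^+ 2 by rewrite exprn_even_gt0.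
  have e1 : ht p = (p.2 - bpath (X p)) * (upath (X p) - bpath (X p)) / (upath (X p) - bpath (X p)) ^+ 2.
    by rewrite /ht; field.
  have e2 : 1 - ht p = (upath (X p) - p.2) * (upath (X p) - bpath (X p)) / (upath (X p) - bpath (X p)) ^+ 2.
    by rewrite /ht; field.
  apply/andP; split; last rewrite -subr_gt0 e2; rewrite ?e1 divr_gt0//;
  move: ip; rewrite /inside; set A := p.2 - _; set B := _ - p.2 => AB;
  rewrite (_ : upath (X p) - bpath (X p) = A + B); try by rewrite /A /B; ring.
  - by rewrite mulrDr ltr_wpDl// -expr2 sqr_ge0.
  - by rewrite mulrDr ltr_pwDl 1?mulrC// -expr2 sqr_ge0.
have nb x y : l < x < r -> 0 < y < 1 ->
    ~ bdry (P x (bpath x + y * (upath x - bpath x))).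
  move=> xlr y01 /bdry_sorted; rewrite unshearK /unshear /= => -[_].
  have := paths_meet xlr; rewrite -subr_eq0 => ub [E1|E1].
    have : (1 - y) * (upath x - bpath x) = 0 by move: E1; set u := upath x; lra.
    by move/eqP; rewrite mulf_eq0 (negbTE ub) orbF subr_eq0 gt_eqF//; lra.
  have : y * (upath x - bpath x) = 0 by lra.
  by move/eqP; rewrite mulf_eq0 (negbTE ub) orbF gt_eqF//; lra.
have [h0 q02] := htP _ X0 i0; have [h1 q2] := htP _ Xq iq.
split; last by rewrite -[q]shearK q2; exact: nb.
pose x (t : R) := X q0 + t * (X q - X q0).
have cx : continuous x.
  by move=> t; apply: cvgD; [exact: cvg_cst|apply: cvgM; [exact: cvg_id|exact: cvg_cst]].
have cux : continuous (upath \o x) by move=> t; apply: continuous_comp; [exact: cx|exact: uc].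
have cbx : continuous (bpath \o x) by move=> t; apply: continuous_comp; [exact: cx|exact: bc].
have xlr t : 0 <= t <= 1 -> l < x t < r.
  move=> /andP[t0 t1]; rewrite /x.
  have -> : X q0 + t * (X q - X q0) = (1 - t) * X q0 + t * X q by ring.
  have [h01 h02] := andP X0; have [h11 h12] := andP Xq.
  have [t0'|t0'] := eqVneq t 0; first by rewrite t0' subr0 mul1r mul0r addr0.
  have tp : 0 < t by rewrite lt0r t0'.
  apply/andP; split.
    have -> : l = (1 - t) * l + t * l by ring.
    by rewrite ler_ltD ?ltr_pM2l// ler_wpM2l ?subr_ge0// ltW.
  have -> : r = (1 - t) * r + t * r by ring.
  by rewrite ler_ltD ?ltr_pM2l// ler_wpM2l ?subr_ge0// ltW.
have := @stay (fun t => P (x t) (bpath (x t) + ht q0 * (upath (x t) - bpath (x t)))) _ _.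
have -> : x 0 = X q0 by rewrite /x mul0r addr0.
have -> : x 1 = X q by rewrite /x mul1r addrC subrK.
rewrite -q02 shearK => /(_ _ _ Oq0.1) E1.
have {}E1 : E (P (X q) (bpath (X q) + ht q0 * (upath (X q) - bpath (X q)))).
  apply: E1; last by move=> t t01; apply: nb; [exact: xlr|].
  apply: unsh_c => // t; apply: cvgD; first exact: cbx.
  by apply: cvgM; [exact: cvg_cst|apply: cvgB; [exact: cux|exact: cbx]].
pose y (t : R) := ht q0 + t * (ht q - ht q0).
have := @stay (fun t => P (X q) (bpath (X q) + y t * (upath (X q) - bpath (X q)))) _ _.
have -> : y 0 = ht q0 by rewrite /y mul0r addr0.
have -> : y 1 = ht q by rewrite /y mul1r addrC subrK.
rewrite -q2 shearK; apply=> //.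
- apply: unsh_c; first exact: cst_continuous.
  move=> t; apply: cvgD; first exact: cvg_cst.
  apply: cvgM; last exact: cvg_cst.
  by apply: cvgD; [exact: cvg_cst|apply: cvgM; [exact: cvg_id|exact: cvg_cst]].
- move=> t /andP[t0 t1]; apply: nb => //; rewrite /y; have := andP h0; have := andP h1.
  have -> : ht q0 + t * (ht q - ht q0) = (1 - t) * ht q0 + t * ht q by ring.
  move=> [h11 h12] [h01 h02].
  have [t0'|t0'] := eqVneq t 0; first by rewrite t0' subr0 mul1r mul0r addr0 h01 h02.
  have tp : 0 < t by rewrite lt0r t0'.
  apply/andP; split.
    by apply: ltr_wpDl; [apply: mulr_ge0; [rewrite subr_ge0|exact: ltW]|exact: mulr_gt0].
  rewrite [ltRHS](_ : 1 = (1 - t) * 1 + t * 1); last by ring.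
  by rewrite ler_ltD ?ltr_pM2l// ler_wpM2l ?subr_ge0// ltW.
Qed.

Lemma openE_sorted q : (E `\` bdry) q <-> l < X q < r /\ 0 < inside q.
Proof. by split=> [/O_inside//|[Xq]]; exact: inside_O. Qed.

Lemma E_sorted q : E q <-> l <= X q <= r /\ 0 <= inside q.
Proof.
have lm' := lm; have mr' := mr.
split=> [Eq|[Xq iq]].
  have [/bdry_sorted[Xq q2]|nb] := pselect (bdry q).
    split=> //; rewrite /inside; case: q2 => ->; first by rewrite subrr mulr0.
    by rewrite subrr mul0r.
  have [Xq iq] : l < X q < r /\ 0 < inside q by apply: O_inside; split.
  by rewrite (ltW iq) !ltW//; case/andP: Xq.
have bE : bdry `<=` E by move=> _ [i _ [t _ <-]]; exact: (ct_mem H).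
have [Xe|Xe] := boolP (l < X q < r); last first.
  apply: bE; apply/bdry_sorted; split=> //; right.
  have [pl pr] := paths_ends.
  have [Xq'|Xq'] : X q = l \/ X q = r.
    move: Xe; rewrite negb_and -!leNgt => /orP[h|h]; [left|right]; apply/eqP;
      rewrite eq_le; lra.
  - move: iq; rewrite /inside Xq' pl => iq; nra.
  - move: iq; rewrite /inside Xq' pr => iq; nra.
move: iq; rewrite le_eqVlt => /orP[/eqP i0|i0]; last by have [] := inside_O Xe i0.
apply: bE; apply/bdry_sorted; split=> //.
by move/esym/eqP: i0; rewrite mulf_eq0 !subr_eq0 => /orP[/eqP ->|/eqP ->]; auto.
Qed.

(** At a point of an edge, small moves up and down at fixed sheared abscissa cannot both stay
    between the graphs. *)
Lemma interior_sorted : interior E = E `\` bdry.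
Proof.
apply/seteqP; split=> q; last first.
  move=> Oq; have : nbhs q (E `\` bdry) by apply: open_nbhs_nbhs; split => //; exact: (ct_open H).
  by apply: filterS => p [].
move=> Eq; split; first exact: interior_subset Eq.
move=> /bdry_sorted[Xq q2].
have /near_boxP[d d0 dE] : \forall p \near q, E p by [].
have out (u : R) : 0 < `|u| -> 0 < `|u| < d -> `|u| * `|al| < d -> E (P (X q) (q.2 + u)).
  move=> u0 ud uad; apply: dE; rewrite /unshear /shear /=.
    by rewrite (_ : _ - q.1 = - (u * al)); [rewrite normrN normrM|ring].
  by rewrite addrC addKr; lra.
(* A vertical move of [u] at fixed sheared abscissa shifts the first coordinate by [al * u] in size;
   both must stay below [d]. *)
pose u := d / 2 / (1 + `|al|).
have a1 : 0 < 1 + `|al| by rewrite ltr_wpDr.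
have u0 : 0 < u by rewrite !divr_gt0.
have ud : u * (1 + `|al|) = d / 2 by rewrite /u divfK// gt_eqF.
have ud1 : u < d by have := mulr_ge0 (ltW u0) (normr_ge0 al); lra.
have ud2 : u * `|al| < d by lra.
have /E_sorted[_ i1'] : E (P (X q) (q.2 + u)).
  by apply: out; rewrite (gtr0_norm u0)// u0.
have /E_sorted[_ i2'] : E (P (X q) (q.2 - u)).
  by apply: out; rewrite normrN (gtr0_norm u0)// u0.
move: i1' i2'; rewrite /inside !unshearK /unshear /=.
case: q2 => ->; set A := upath _; set B := bpath _.
- rewrite (_ : A - (A + u) = - u); last by ring.
  rewrite (_ : A - (A - u) = u); last by ring.
  rewrite mulrN oppr_ge0 (pmulr_lle0 _ u0) (pmulr_lge0 _ u0); lra.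
- rewrite (_ : B + u - B = u); last by ring.
  rewrite (_ : B - u - B = - u); last by ring.
  rewrite mulNr oppr_ge0 (pmulr_rle0 _ u0) (pmulr_rge0 _ u0); lra.
Qed.

End Sorted.

End CurvedTriangle.

(** * Edges parametrized by arc length *)

Lemma cont_comp (R : realType) (f g : R -> R) : continuous f -> continuous g ->
  continuous (fun x => g (f x)).
Proof. by move=> cf cg x; exact: (continuous_comp (cf x) (cg (f x))). Qed.

Lemma cvg_sqr (R : realType) (T : Type) (F : set_system T) (FF : Filter F)
  (f : T -> R) (a : R) : f @ F --> a -> (f x ^+ 2) @[x --> F] --> a ^+ 2.
Proof. by move=> fa; rewrite expr2; exact: cvgM. Qed.

(* A curve on the whole line, of which the part over [[alo, ahi]] matters. *)
Record arc (R : realType) := Arc {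
  apt : R -> R * R;
  adir : R -> R * R;
  alo : R;
  ahi : R }.

Section Arcs.
Context {R : realType}.
Implicit Types (c : arc R) (S : set (R * R)).

Record arc_ok c : Prop := {
  arc_lohi : alo c < ahi c;
  arc_der1 : forall s : R, is_derive s 1 (fun s => (apt c s).1) (adir c s).1;
  arc_der2 : forall s : R, is_derive s 1 (fun s => (apt c s).2) (adir c s).2;
  arc_dirc1 : continuous (fun s => (adir c s).1);
  arc_dirc2 : continuous (fun s => (adir c s).2);
  arc_unit : forall s, (adir c s).1 ^+ 2 + (adir c s).2 ^+ 2 = 1 }.

Definition arc_img c : set (R * R) := apt c @` `[alo c, ahi c]%classic.

Definition arc_rev c : arc R :=
  Arc (fun s => apt c (- s)) (fun s => - adir c (- s)) (- ahi c) (- alo c).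

Definition arc_normal c s : R * R := ((adir c s).2, - (adir c s).1).

Lemma arc_rev_ok c : arc_ok c -> arc_ok (arc_rev c).
Proof.
case=> lh d1 d2 c1 c2 u.
have dN (s : R) : is_derive s 1 (fun s : R => - s) (-1).
  by apply: is_derive_eq; rewrite /GRing.scale.
have oc : continuous (fun s : R => - s) by move=> s; exact: opp_continuous.
have c1' : continuous (fun s => (adir c (- s)).1) := cont_comp oc c1.
have c2' : continuous (fun s => (adir c (- s)).2) := cont_comp oc c2.
split => /=.
- by rewrite ltrN2.
- move=> s; have := is_derive1_comp (f := fun s => (apt c s).1) (g := fun s => - s) (d1 (- s)) (dN s).
  by rewrite mulrN1.
- move=> s; have := is_derive1_comp (f := fun s => (apt c s).2) (g := fun s => - s) (d2 (- s)) (dN s).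
  by rewrite mulrN1.
- move=> s; exact: (cvgN (c1' s)).
- move=> s; exact: (cvgN (c2' s)).
- by move=> s; rewrite !sqrrN.
Qed.

Lemma arc_rev_img c : arc_img (arc_rev c) = arc_img c.
Proof.
apply/seteqP; split=> p [s]; rewrite /= in_itv /= => /andP[s1 s2] <-;
  exists (- s); rewrite /= ?in_itv /= ?opprK//; lra.
Qed.

Lemma arc_revK c : arc_rev (arc_rev c) = c.
Proof.
case: c => p d a b; rewrite /arc_rev /= !opprK; congr Arc; apply/funext => s.
  by rewrite opprK.
by rewrite !opprK.
Qed.

Lemma arc_continuous c : arc_ok c -> continuous (apt c).
Proof.
move=> [_ d1 d2 _ _ _] s.
have E : (fun t => ((apt c t).1, (apt c t).2)) = apt c.
  by apply/funext => t; rewrite -surjective_pairing.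
rewrite -E; exact: cvg_pair (is_derive_continuous (d1 s)) (is_derive_continuous (d2 s)).
Qed.

End Arcs.

Section EdgeArcs.
Context {R : realType}.
Variables (E : set (R * R)) (e : 'I_3 -> R -> R * R) (al k : R).
Hypothesis H : curved_tri E e al k.
Notation X := (shear al).
Notation P := (unshear al).
Implicit Types (c : arc R) (i : 'I_3).

Definition edge_arc i c := arc_ok c /\ arc_img c = e i @` `[0, 1]%classic.

Lemma edge_arc_rev i c : edge_arc i c -> edge_arc i (arc_rev c).
Proof. by move=> [ok im]; split; [exact: arc_rev_ok|rewrite arc_rev_img]. Qed.

Definition aslope c s := (adir c s).1 + al * (adir c s).2.

Section OneArc.
Variables (i : 'I_3) (c : arc R).
Hypothesis ic : edge_arc i c.
Notation a := (alo c).
Notation b := (ahi c).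

Lemma arc_X_derive (s : R) : is_derive s 1 (fun s => X (apt c s)) (aslope c s).
Proof.
have [ok _] := ic; have d1 := arc_der1 ok s; have d2 := arc_der2 ok s.
have d3 : is_derive s 1 (fun s => al * (apt c s).2) (al * (adir c s).2).
  by have := is_deriveZ al d2.
exact: is_deriveD d1 d3.
Qed.

Lemma aslope_continuous : continuous (aslope c).
Proof.
have [ok _] := ic => s; apply: cvgD; first exact: (arc_dirc1 ok).
by apply: cvgM; [exact: cvg_cst|exact: (arc_dirc2 ok)].
Qed.

Lemma edge_arc_chord s t : a <= s <= b -> a <= t <= b ->
  k * enorm (apt c s - apt c t) <= `|X (apt c s) - X (apt c t)|.
Proof.
move=> sab tab; have [_ im] := ic.
have pt u : a <= u <= b -> exists v, e i v = apt c u.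
  move=> uab; have : (e i @` `[0, 1]%classic) (apt c u).
    by rewrite -im; exists u => //; rewrite /= in_itv.
  by move=> [v _ <-]; exists v.
have [u <-] := pt _ sab; have [v <-] := pt _ tab.
exact: (ct_chord H).
Qed.

Let k0 : 0 < k := ct_k H.
Let ok : arc_ok c := ic.1.
Let ab : a < b := arc_lohi ok.

Let itv_near s : a < s < b -> \forall t \near s, a <= t <= b.
Proof.
move=> sab; have := near_in_itvoo (a := a) (b := b) (x := s).
rewrite in_itv /= sab => /(_ isT); apply: filterS => t.
by rewrite in_itv /= => /andP[? ?]; rewrite !ltW.
Qed.

(** The squared chord bound divided by [(t - s) ^+ 2], in the limit [t -> s]: the slopes of the
    coordinates tend to a unit vector, so the left side tends to [k ^+ 2]. *)
Let aslope_oo s : a < s < b -> k ^+ 2 <= aslope c s ^+ 2.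
Proof.
move=> sab; rewrite leNgt; apply/negP => h.
have /is_derive1_caratheodory[g [gE gc gs]] := arc_X_derive s.
have /is_derive1_caratheodory[g1 [g1E g1c g1s]] := arc_der1 ok s.
have /is_derive1_caratheodory[g2 [g2E g2c g2s]] := arc_der2 ok s.
have hc : (g t ^+ 2 - k ^+ 2 * (g1 t ^+ 2 + g2 t ^+ 2)) @[t --> s] -->
    g s ^+ 2 - k ^+ 2 * (g1 s ^+ 2 + g2 s ^+ 2).
  apply: cvgB; first exact: cvg_sqr.
  by apply: cvgM; [exact: cvg_cst|apply: cvgD; exact: cvg_sqr].
rewrite gs g1s g2s (arc_unit ok) mulr1 in hc.
have h0 : 0 < k ^+ 2 - aslope c s ^+ 2 by rewrite subr_gt0.
move/cvgrPdist_lt : hc => /(_ _ h0) hc.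
near s^' => t.
have ts : t != s by near: t; exact: nbhs_dnbhs_neq.
have hct : `|aslope c s ^+ 2 - k ^+ 2 - (g t ^+ 2 - k ^+ 2 * (g1 t ^+ 2 + g2 t ^+ 2))|
    < k ^+ 2 - aslope c s ^+ 2 by near: t; exact: nbhs_dnbhs.
have tab : a <= t <= b by near: t; apply: nbhs_dnbhs; exact: itv_near.
have sab' : a <= s <= b by have [? ?] := andP sab; rewrite !ltW.
have := edge_arc_chord tab sab'; rewrite gE => ch0.
have ke : 0 <= k * enorm (apt c t - apt c s) by rewrite mulr_ge0 ?enorm_ge0 ?(ltW k0).
have := lerXn2r 2 ke (le_trans ke ch0) ch0; rewrite exprMn enorm_sqr.
rewrite real_normK ?num_real// /dot !crdE g1E g2E => ch.
have tt : 0 < (t - s) ^+ 2 by rewrite exprn_even_gt0//= subr_eq0.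
have h1 : k ^+ 2 * (g1 t ^+ 2 + g2 t ^+ 2) <= g t ^+ 2.
  by rewrite -(ler_pM2r tt); move: ch; lra.
by move: hct; rewrite ltr_norml => /andP[hct _]; lra.
Unshelve. all: by end_near. Qed.

Lemma aslope_ge s : a <= s <= b -> k ^+ 2 <= aslope c s ^+ 2.
Proof.
move=> sab; have [soo|] := boolP (a < s < b); first exact: aslope_oo.
have cD : (aslope c t ^+ 2) @[t --> s] --> aslope c s ^+ 2.
  by apply: cvg_sqr; exact: aslope_continuous.
move=> noo; rewrite leNgt; apply/negP => h.
have h0 : 0 < k ^+ 2 - aslope c s ^+ 2 by rewrite subr_gt0.
move/cvgrPdist_lt : cD => /(_ _ h0) cD.
suff [t too tD] : exists2 t, a < t < b &
    `|aslope c s ^+ 2 - aslope c t ^+ 2| < k ^+ 2 - aslope c s ^+ 2.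
  by have := aslope_oo too; move: tD; rewrite ltr_norml => /andP[]; lra.
have [sa|sa] := eqVneq s a.
  have cR : \forall t \near a^'+, `|aslope c s ^+ 2 - aslope c t ^+ 2| < k ^+ 2 - aslope c s ^+ 2.
    by rewrite sa in cD *; apply: filterS cD => t ? _.
  near a^'+ => t; exists t; last by near: t.
  by apply/andP; split; near: t; [exact: nbhs_right_gt|exact: nbhs_right_lt].
have sb : s = b.
  apply/eqP; move: noo; rewrite negb_and -!leNgt => /orP[|]; have [as' sb'] := andP sab.
    by move=> sa'; move: sa; rewrite eq_le as' sa'.
  by move=> bs; rewrite eq_le sb' bs.
have cL : \forall t \near b^'-, `|aslope c s ^+ 2 - aslope c t ^+ 2| < k ^+ 2 - aslope c s ^+ 2.
  by rewrite sb in cD *; apply: filterS cD => t ? _.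
near b^'- => t; exists t; last by near: t.
by apply/andP; split; near: t; [exact: nbhs_left_gt|exact: nbhs_left_lt].
Unshelve. all: by end_near. Qed.

End OneArc.

Definition inc c := forall s, alo c <= s <= ahi c -> 0 < aslope c s.

Lemma aslope_rev c s : aslope (arc_rev c) s = - aslope c (- s).
Proof. by rewrite /aslope !crdE; ring. Qed.

(** The velocity [aslope] of the abscissa is continuous and, by [aslope_ge], never zero, so it has
    constant sign along the arc. *)
Lemma arc_dichotomy i c : edge_arc i c -> inc c \/ inc (arc_rev c).
Proof.
move=> ic; have k0 := ct_k H; have ab := arc_lohi ic.1.
have n0 s : alo c <= s <= ahi c -> aslope c s != 0.
  move=> /(aslope_ge ic); apply: contraTneq => ->.
  by rewrite expr0n /= -ltNge exprn_gt0.
have wc (A : set R) : {within A, continuous (aslope c)}.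
  by apply: continuous_subspaceT; exact: aslope_continuous ic.
have key s t : alo c <= s <= ahi c -> alo c <= t <= ahi c ->
    aslope c s < 0 -> 0 < aslope c t -> False.
  move=> sab tab s0 t0.
  have st0 : aslope c s < aslope c t by lra.
  have [st|ts] := leP s t.
    have [|u] := @IVT _ (aslope c) s t 0 st (wc _).
      by rewrite (min_l (ltW st0)) (max_r (ltW st0)) !ltW.
    rewrite in_itv /= => ust u0; have := n0 u ltac:(lra); rewrite u0 eqxx.
    by [].
  have [|u] := @IVT _ (aslope c) t s 0 (ltW ts) (wc _).
    by rewrite (min_r (ltW st0)) (max_l (ltW st0)) !ltW.
  by rewrite in_itv /= => ust u0; have := n0 u ltac:(lra); rewrite u0 eqxx.
have aab : alo c <= alo c <= ahi c by rewrite lexx ltW.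
have [a0|a0|a0] := ltgtP (aslope c (alo c)) 0.
- right=> s /= sab; rewrite aslope_rev oppr_gt0.
  have sab' : alo c <= - s <= ahi c by lra.
  have [//|s0|s0] := ltgtP (aslope c (- s)) 0; first by case: (key _ _ aab sab').
  by have := n0 _ sab'; rewrite s0 eqxx.
- left=> s sab; have [s0|//|s0] := ltgtP (aslope c s) 0; first by case: (key _ _ sab aab).
  by have := n0 _ sab; rewrite s0 eqxx.
- by have := n0 _ aab; rewrite a0 eqxx.
Qed.

Section IncArc.
Variables (i : 'I_3) (c : arc R).
Hypothesis ic : edge_arc i c.
Hypothesis cinc : inc c.
Notation a := (alo c).
Notation b := (ahi c).
Notation xa := (X (apt c a)).
Notation xb := (X (apt c b)).

Let k0 : 0 < k. Proof. exact: ct_k H. Qed.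
Let ok : arc_ok c. Proof. exact: ic.1. Qed.
Let ab : a < b. Proof. exact: arc_lohi ok. Qed.

Lemma inc_ge s : a <= s <= b -> k <= aslope c s.
Proof.
move=> sab; rewrite -(@ler_pXn2r _ 2)// ?nnegrE ?(ltW k0) ?(ltW (cinc sab))//.
exact: aslope_ge ic _ sab.
Qed.

Let Xc : continuous (fun s => X (apt c s)).
Proof. by move=> s; exact: is_derive_continuous (arc_X_derive ic s). Qed.

Lemma inc_mono s t : a <= s <= b -> a <= t <= b -> s <= t ->
  k * (t - s) <= X (apt c t) - X (apt c s).
Proof.
move=> sab tab st.
have [u|u ust ->] := @mvt_between _ (fun s => X (apt c s)) (aslope c) s t.
  by move=> _; exact: arc_X_derive ic u.
rewrite ler_wpM2r ?subr_ge0// inc_ge//.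
by move: ust; rewrite (min_l st) (max_r st); lra.
Qed.

Lemma inc_lt : xa < xb.
Proof.
have ab' := ab; rewrite -subr_gt0; apply: lt_le_trans (inc_mono _ _ (ltW ab)); try lra.
by rewrite mulr_gt0// subr_gt0.
Qed.

Lemma inc_range s : a <= s <= b -> xa <= X (apt c s) <= xb.
Proof.
move=> sab; have ab' := ab.
have h1 := inc_mono (s := a) (t := s) ltac:(lra) sab ltac:(lra).
have h2 := inc_mono (s := s) (t := b) sab ltac:(lra) ltac:(lra).
have h3 : 0 <= k * (s - a) by rewrite mulr_ge0 ?(ltW k0)//; lra.
have h4 : 0 <= k * (b - s) by rewrite mulr_ge0 ?(ltW k0)//; lra.
lra.
Qed.

Definition ainv x := get [set s | a <= s <= b /\ X (apt c s) = x].

Lemma ainvP x : xa <= x <= xb -> a <= ainv x <= b /\ X (apt c (ainv x)) = x.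
Proof.
move=> xab; apply: (@getPex _ [set s | a <= s <= b /\ X (apt c s) = x]).
have [|s] := @IVT _ (fun s => X (apt c s)) a b x (ltW ab) (continuous_subspaceT Xc).
  by rewrite (min_l (ltW inc_lt)) (max_r (ltW inc_lt)).
by rewrite in_itv /= => sab <-; exists s.
Qed.

Lemma ainv_lipschitz x y : xa <= x <= xb -> xa <= y <= xb ->
  `|ainv x - ainv y| <= k^-1 * `|x - y|.
Proof.
wlog xy : x y / ainv x <= ainv y.
  move=> h hx hy; case/orP: (le_total (ainv x) (ainv y)) => xy; first exact: h.
  by rewrite distrC [X in _ * X]distrC; exact: h.
move=> /ainvP[sx ex] /ainvP[sy ey].
have := inc_mono sx sy xy; rewrite ex ey => h.
rewrite ler_pdivlMl// distrC ger0_norm ?subr_ge0// distrC.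
by apply: le_trans h _; exact: ler_norm.
Qed.

Lemma ainvK s : a <= s <= b -> ainv (X (apt c s)) = s.
Proof.
move=> sab; have [h1 h2] := ainvP (inc_range sab).
set t := ainv _ in h1 h2 *.
case/orP: (le_total t s) => ts.
  have := inc_mono h1 sab ts; rewrite h2 subrr pmulr_rle0// => h; lra.
have := inc_mono sab h1 ts; rewrite h2 subrr pmulr_rle0// => h; lra.
Qed.

Lemma ainv_oo x : xa < x < xb -> a < ainv x < b.
Proof.
move=> xab; have [|/andP[h1 h2] h3] := ainvP (x := x); first lra.
rewrite !lt_neqAle h1 h2 !andbT; apply/andP; split; apply/eqP => Ex.
  by move: xab; rewrite -h3 -Ex ltxx.
by move: xab; rewrite -h3 Ex ltxx andbF.
Qed.

Lemma ainv_continuous : continuous (ainv \o clamp xa xb).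
Proof.
move=> x; have xab := ltW inc_lt; apply/cvgrPdist_lt => d d0.
have kd : 0 < k * d by rewrite mulr_gt0.
have := @continuous_clamp _ xa xb x; move=> /cvgrPdist_lt /(_ _ kd).
apply: filterS => y xy; apply: le_lt_trans (ainv_lipschitz _ _) _.
- exact: clamp_itv.
- exact: clamp_itv.
- by rewrite ltr_pdivrMl.
Qed.

Lemma ainv_derive (x : R) : xa < x < xb -> is_derive x 1 ainv (aslope c (ainv x))^-1.
Proof.
move=> xab; have soo := ainv_oo xab.
have D0 : aslope c (ainv x) != 0 by rewrite gt_eqF// cinc//; lra.
have /is_derive1_caratheodory[g [gE gc gs]] := arc_X_derive ic (ainv x).
have nx := clamp_near xab.
have ainvc : ainv y @[y --> x] --> ainv x.
  have := ainv_continuous (x := x); rewrite /continuous_at /= clamp_id; last lra.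
  by apply: cvg_trans; apply: near_eq_cvg; apply: filterS nx => y yE; rewrite /= yE.
have gyc : g (ainv y) @[y --> x] --> aslope c (ainv x).
  by rewrite -gs; exact: (cvg_comp _ _ ainvc gc).
apply: (near_slope_is_derive (g := fun y => (g (ainv y))^-1)); first exact: cvgV.
have g0 : \forall y \near x, g (ainv y) != 0.
  move/cvgrPdist_lt : gyc => /(_ `|aslope c (ainv x)|); rewrite normr_gt0 => /(_ D0).
  by apply: filterS => y; apply: contraTneq => ->; rewrite subr0 ltxx.
apply: filterS2 g0 nx => y gy0 yE.
have [_ ey] : a <= ainv y <= b /\ X (apt c (ainv y)) = y.
  by apply: ainvP; rewrite -yE; exact: clamp_itv (ltW inc_lt).
have [_ ex] : a <= ainv x <= b /\ X (apt c (ainv x)) = x by apply: ainvP; lra.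
have := gE (ainv y); rewrite ey ex => ->.
by rewrite mulrA mulVf// mul1r.
Qed.

(** The arc and the parametrization [e i] have the same image, and the extreme abscissas of that
    image are taken at the ends of both. *)
Lemma inc_span : xspan e al i xa xb.
Proof.
have [_ im] := ic; have lt := inc_lt; have ab' := ab.
have inA t : 0 <= t <= 1 -> xa <= X (e i t) <= xb.
  move=> t01; have : (e i @` `[0, 1]%classic) (e i t) by exists t.
  by rewrite -im => -[s]; rewrite /= in_itv /= => sab <-; exact: inc_range.
have inE s : a <= s <= b -> exists2 t, 0 <= t <= 1 & e i t = apt c s.
  move=> sab; have : arc_img c (apt c s) by exists s.
  by rewrite im => -[t]; rewrite /= in_itv /=; exists t.
have h0 := inA 0 ltac:(lra); have h1 := inA 1 ltac:(lra).
have [ta ta01 tae] := inE a ltac:(lra); have [tb tb01 tbe] := inE b ltac:(lra).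
have fin a' b' : xspan e al i a' b' -> xspan e al i xa xb.
  move=> sp; have := span_range H sp ta01; have := span_range H sp tb01.
  rewrite tae tbe => hb ha.
  suff [<- <-] : a' = xa /\ b' = xb by [].
  by case: sp => a'b' [[ea eb]|[ea eb]]; split; lra.
have [l01|l10|E01] := ltgtP (X (e i 0)) (X (e i 1)).
- by apply: (fin (X (e i 0)) (X (e i 1))); split; auto.
- by apply: (fin (X (e i 1)) (X (e i 0))); split; auto.
- have := ct_chord H i 0 1; rewrite E01 subrr normr0 pmulr_rle0// => h.
  have /enorm_eq0/eqP : enorm (e i 0 - e i 1) = 0 by apply/eqP; rewrite eq_le h enorm_ge0.
  rewrite subr_eq0 => /eqP /(ct_inj H); rewrite lexx ler01 lexx => /(_ isT isT)/eqP.
  by rewrite eq_sym oner_eq0.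
Qed.

Lemma gy_arc x : xa <= x <= xb -> gy e al i x = (apt c (ainv x)).2.
Proof.
move=> xab; have [sab sE] := ainvP xab; have [_ im] := ic.
have : arc_img c (apt c (ainv x)) by exists (ainv x).
rewrite im => -[t]; rewrite /= in_itv /= => t01 et.
have := edge_gy H i t01; rewrite et sE => /(congr1 snd) /= ->.
by [].
Qed.

(** Slope of the graph [gy]: velocity of the ordinate over velocity of the abscissa. *)
Definition gslope x := (adir c (ainv x)).2 / aslope c (ainv x).

Lemma gy_derive (x : R) : xa < x < xb -> is_derive x 1 (gy e al i) (gslope x).
Proof.
move=> xab; have d1 := ainv_derive xab.
have := is_derive1_comp (f := fun s => (apt c s).2) (g := ainv) (arc_der2 ok _) d1.
apply: is_derive_near; apply: filterS (clamp_near xab) => y yE.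
by rewrite /= gy_arc// -yE; exact: clamp_itv (ltW inc_lt).
Qed.

Lemma gslope_continuous : continuous (gslope \o clamp xa xb).
Proof.
move=> x; rewrite /gslope /=.
have c1 : (adir c (ainv (clamp xa xb y))).2 @[y --> x] --> (adir c (ainv (clamp xa xb x))).2.
  exact: (continuous_comp (@ainv_continuous x) (@arc_dirc2 _ _ ok _)).
have c2 : aslope c (ainv (clamp xa xb y)) @[y --> x] --> aslope c (ainv (clamp xa xb x)).
  exact: (continuous_comp (@ainv_continuous x) (@aslope_continuous _ _ ic _)).
apply: cvgM => //; apply: cvgV => //; rewrite gt_eqF// cinc//.
by have [] := ainvP (clamp_itv x (ltW inc_lt)).
Qed.

End IncArc.
End EdgeArcs.

(** * The outward side of an edge *)

Section Sides.
Context {R : realType}.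
Variables (E : set (R * R)) (e : 'I_3 -> R -> R * R) (al k : R).
Hypothesis H : curved_tri E e al k.
Notation X := (shear al).
Notation P := (unshear al).
Implicit Types (c : arc R) (i : 'I_3).

(* [arc_normal] points to the right of the direction of travel. *)
Definition outward c := forall s d, alo c < s < ahi c -> dot d (arc_normal c s) < 0 ->
  \forall t \near 0^'+, interior E (apt c s + t *: d) /\ ~ E (apt c s - t *: d).

Lemma arc_normal_rev c s : arc_normal (arc_rev c) s = - arc_normal c (- s).
Proof. by []. Qed.

Lemma dotNr (p q : R * R) : dot p (- q) = - dot p q.
Proof. by rewrite /dot !crdE; ring. Qed.

Lemma dotNl (p q : R * R) : dot (- p) q = - dot p q.
Proof. by rewrite /dot !crdE; ring. Qed.

Lemma outward_rev c : outward (arc_rev c) ->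
  forall s d, alo c < s < ahi c -> dot d (arc_normal c s) < 0 ->
  \forall t \near 0^'+, interior E (apt c s - t *: d) /\ ~ E (apt c s + t *: d).
Proof.
move=> oc s d sab dn; have := oc (- s) (- d).
rewrite arc_normal_rev dotNl dotNr !opprK /= opprK => /(_ ltac:(lra) dn).
by apply: filterS => t; rewrite scalerN opprK.
Qed.

Section Sorted.
Variables (iL i1 i2 : 'I_3) (l m r sg : R).
Hypothesis so : sorted e al iL i1 i2 l m r.
Hypothesis sg1 : sg = 1 \/ sg = -1.
Notation upath := (upath e al iL l r).
Notation bpath := (bpath e al i1 i2 l m r).
Hypothesis sgP : forall x, l < x < r -> 0 < sg * (upath x - bpath x).

(* [sg] is 1 if the long edge is the upper one and -1 if it is the lower one;
   [kap i] is 1 when [X] increases along the outward orientation of edge [i]. *)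
Definition kap i := if i == iL then - sg else sg.

Let lm : l < m. Proof. exact: (so_1 so).1. Qed.
Let mr : m < r. Proof. exact: (so_2 so).1. Qed.

Let near_X q a b : a < X q < b -> \forall p \near q, a < X p < b.
Proof.
move=> /andP[aq qb]; have cX := @continuous_shear _ al q.
have h1 : \forall p \near q, a < X p by exact: (cvgr_gt (X q) cX).
have h2 : \forall p \near q, X p < b by exact: (cvgr_lt (X q) cX).
by apply: filterS2 h1 h2 => p -> ->.
Qed.

Let near_pos q (f g : R -> R) : continuous f -> continuous g ->
  (0 < sg * (f (X q) - q.2) -> \forall p \near q, 0 < sg * (f (X p) - p.2)) /\
  (0 < sg * (q.2 - g (X q)) -> \forall p \near q, 0 < sg * (p.2 - g (X p))).
Proof.
move=> cf cg.
have fX : f (X p) @[p --> q] --> f (X q).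
  by apply: (cvg_comp X f (@continuous_shear _ al q)); exact: cf.
have gX : g (X p) @[p --> q] --> g (X q).
  by apply: (cvg_comp X g (@continuous_shear _ al q)); exact: cg.
have c2 : p.2 @[p --> q] --> q.2 by exact: cvg_snd.
split=> h.
  exact: (cvgr_gt _ (cvgM (@cvg_cst _ sg _ (nbhs q) _) (cvgB fX c2))).
exact: (cvgr_gt _ (cvgM (@cvg_cst _ sg _ (nbhs q) _) (cvgB c2 gX))).
Qed.

(** Near an inner point of an edge one of the two factors of [inside] keeps its sign, so the other
    one, the vertical offset from this edge, decides. *)
Lemma edge_sides i a b q : xspan e al i a b -> a < X q < b -> q.2 = gy e al i (X q) ->
  \forall p \near q, (0 < kap i * (p.2 - gy e al i (X p)) -> interior E p) /\
    (kap i * (p.2 - gy e al i (X p)) < 0 -> ~ E p).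
Proof.
move=> sp Xq q2; have lm' := lm; have mr' := mr.
have nX := near_X Xq; have uc := upath_continuous H so; have bc := bpath_continuous H so.
have sg2 : sg * sg = 1 by case: sg1 => ->; ring.
have insE p : inside e al iL i1 i2 l m r p =
    (sg * (p.2 - bpath (X p))) * (sg * (upath (X p) - p.2)).
  by rewrite /inside mulrACA sg2 mul1r.
have fin p (u v : R) : l < X p < r -> inside e al iL i1 i2 l m r p = u * v -> 0 < u ->
    (0 < v -> interior E p) /\ (v < 0 -> ~ E p).
  move=> Xp iE u0; split=> [v0|v0].
    by rewrite (interior_sorted H so); apply/(openE_sorted H so); rewrite iE mulr_gt0.
  by move=> /(E_sorted H so)[_]; rewrite iE pmulr_rge0//; lra.
case: (so_all so i) => [iE|[iE|iE]]; rewrite /kap iE in sp q2 *.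
- rewrite eqxx; have [? ?] := span_unique sp (so_L so); subst a b.
  have [_ h] := near_pos q uc bc.
  have {}h : \forall p \near q, 0 < sg * (p.2 - bpath (X p)).
    by apply: h; rewrite q2 -(@upathE _ e al iL l r)// ?sgP//; lra.
  apply: filterS2 nX h => p Xp hp.
  rewrite -(@upathE _ e al iL l r (X p)); last lra.
  have -> : - sg * (p.2 - upath (X p)) = sg * (upath (X p) - p.2) by ring.
  exact: (fin p _ _ Xp (insE p) hp).
- rewrite eq_sym (negbTE (so_L1 so)).
  have [? ?] := span_unique sp (so_1 so); subst a b.
  have [/(_ _) h _] := near_pos q uc bc.
  have {}h : \forall p \near q, 0 < sg * (upath (X p) - p.2).
    by apply: h; rewrite q2 -(@bpathE1 _ e al i1 i2 l m r)// ?sgP//; lra.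
  apply: filterS2 nX h => p Xp hp.
  rewrite -(@bpathE1 _ e al i1 i2 l m r (X p)); last lra.
  by apply: (fin p _ _ _ _ hp); [lra|rewrite insE mulrC].
- rewrite eq_sym (negbTE (so_L2 so)).
  have [? ?] := span_unique sp (so_2 so); subst a b.
  have [/(_ _) h _] := near_pos q uc bc.
  have {}h : \forall p \near q, 0 < sg * (upath (X p) - p.2).
    by apply: h; rewrite q2 -(@bpathE2 _ e al iL i1 i2 l m r so)// ?sgP//; lra.
  apply: filterS2 nX h => p Xp hp.
  rewrite -(@bpathE2 _ e al iL i1 i2 l m r so (X p)); last lra.
  by apply: (fin p _ _ _ _ hp); [lra|rewrite insE mulrC].
Qed.

Section Arc.
Variables (i : 'I_3) (c : arc R).
Hypothesis ic : edge_arc e i c.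
Hypothesis cinc : inc al c.

Let height d s t := let q := apt c s + t *: d in q.2 - gy e al i (X q).

(** The offset from the graph along the ray of direction [d] has slope [d.2 - gslope * X d], which
    is [- d . n] over the positive velocity of the abscissa. A direction with [d . n < 0] therefore
    rises above the graph. *)
Let height_derive d s : alo c < s < ahi c ->
  is_derive (0 : R) 1 (height d s) (- dot d (arc_normal c s) / aslope al c s).
Proof.
move=> sab; have ab := arc_lohi ic.1; have k0 := ct_k H.
have a0 : 0 < aslope al c s by apply: cinc; lra.
have h1 := inc_mono H ic cinc (s := alo c) (t := s) ltac:(lra) ltac:(lra) ltac:(lra).
have h2 := inc_mono H ic cinc (s := s) (t := ahi c) ltac:(lra) ltac:(lra) ltac:(lra).
have h3 : 0 < k * (s - alo c) by apply: mulr_gt0 => //; lra.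
have h4 : 0 < k * (ahi c - s) by apply: mulr_gt0 => //; lra.
have Xs : X (apt c (alo c)) < X (apt c s) < X (apt c (ahi c)) by lra.
have dg := gy_derive H ic cinc Xs.
rewrite /gslope (ainvK H ic cinc) in dg; last lra.
have d1 : is_derive (0 : R) 1 (fun t => X (apt c s) + t * X d) (X d).
  exact: is_derive_affine.
have E0 : X (apt c s) = X (apt c s) + 0 * X d by rewrite mul0r addr0.
rewrite {1}E0 in dg.
have d2 := @is_derive1_comp _ (gy e al i) (fun t => X (apt c s) + t * X d) 0 _ _ dg d1.
have d3 := @is_derive_affine _ (apt c s).2 d.2 0.
have := is_deriveB d3 d2.
have -> : (fun t : R => (apt c s).2 + t * d.2) - (gy e al i \o (fun t => X (apt c s) + t * X d))
    = height d s.
  apply/funext => t; rewrite /height.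
  change ((apt c s).2 + t * d.2 - gy e al i (X (apt c s) + t * X d) =
    (apt c s + t *: d).2 - gy e al i (X (apt c s + t *: d))).
  by congr (_ - gy e al i _); rewrite /shear !crdE; ring.
move=> h; apply: is_derive_eq h _.
rewrite /dot /arc_normal /shear !crdE.
set D := aslope al c s in a0 *; have D0 : D != 0 by rewrite gt_eqF.
have -> : (adir c s).1 = D - al * (adir c s).2 by rewrite /D /aslope addrK.
by rewrite /GRing.scale /=; field.
Qed.

Lemma inc_sides s d : alo c < s < ahi c -> dot d (arc_normal c s) < 0 ->
  \forall t \near 0^'+,
    (0 < kap i -> interior E (apt c s + t *: d) /\ ~ E (apt c s - t *: d)) /\
    (kap i < 0 -> interior E (apt c s - t *: d) /\ ~ E (apt c s + t *: d)).
Proof.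
move=> sab dn.
have ab := arc_lohi ic.1; have k0 := ct_k H.
have a0 : 0 < aslope al c s by apply: cinc; lra.
have h1 := inc_mono H ic cinc (s := alo c) (t := s) ltac:(lra) ltac:(lra) ltac:(lra).
have h2 := inc_mono H ic cinc (s := s) (t := ahi c) ltac:(lra) ltac:(lra) ltac:(lra).
have h3 : 0 < k * (s - alo c) by apply: mulr_gt0 => //; lra.
have h4 : 0 < k * (ahi c - s) by apply: mulr_gt0 => //; lra.
have Xs : X (apt c (alo c)) < X (apt c s) < X (apt c (ahi c)) by lra.
have gs : (apt c s).2 = gy e al i (X (apt c s)).
  by rewrite (gy_arc H ic cinc) ?(ainvK H ic cinc)//; lra.
have es := edge_sides (inc_span H ic cinc) Xs gs.
have line (u : R) : apt c s + (u * t) *: d @[t --> (0 : R)] --> apt c s.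
  rewrite -{2}[apt c s]addr0 -(scale0r d).
  apply: cvgD; first exact: cvg_cst.
  apply: cvgZr_tmp; rewrite -[X in _ --> X](mulr0 u).
  by apply: cvgM; [exact: cvg_cst|exact: cvg_id].
pose Q p := (0 < kap i * (p.2 - gy e al i (X p)) -> interior E p) /\
    (kap i * (p.2 - gy e al i (X p)) < 0 -> ~ E p).
have lines (u : R) : \forall t \near 0^'+, Q (apt c s + (u * t) *: d).
  have h : \forall t \near 0, Q (apt c s + (u * t) *: d) := line u _ es.
  by apply: filterS h => t h _.
have hD : \forall t \near 0, t != 0 -> 0 < height d s t * t.
  have /is_derive1_caratheodory[g [gE gc gs0]] := height_derive d sab.
  have H0 : height d s 0 = 0 by rewrite /height scale0r addr0 gs subrr.
  have : \forall t \near 0, 0 < g t.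
    by apply: (cvgr_gt _ gc); rewrite gs0 divr_gt0// oppr_gt0.
  apply: filterS => t gt t0; have := gE t; rewrite H0 !subr0 => ->.
  by rewrite -mulrA mulr_gt0// -expr2 exprn_even_gt0.
have hDp : \forall t \near 0^'+, 0 < height d s (1 * t).
  have : \forall t \near 0^'+, 0 < t -> 0 < height d s t * t.
    by apply: filterS hD => t h /= t0 _; apply: h; rewrite gt_eqF.
  move=> h; near=> t; have t0 : 0 < t by near: t; exact: nbhs_right_gt.
  rewrite mul1r -(pmulr_lgt0 _ t0); move: t0; by near: t.
have hDm : \forall t \near 0^'+, height d s (-1 * t) < 0.
  have hN : \forall t \near (0 : R), - t != 0 -> 0 < height d s (- t) * - t.
    have ocv : - t @[t --> (0 : R)] --> (0 : R).
      by rewrite -{2}oppr0; apply: cvgN; exact: cvg_id.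
    exact: (ocv _ hD).
  have h : \forall t \near 0^'+, 0 < t -> 0 < height d s (- t) * - t.
    by apply: filterS hN => t h /= t0 _; apply: h; rewrite oppr_eq0 gt_eqF.
  near=> t; have t0 : 0 < t by near: t; exact: nbhs_right_gt.
  have : 0 < height d s (- t) * - t by move: t0; near: t.
  by rewrite mulrN oppr_gt0 mulN1r pmulr_llt0.
have lp := lines 1; have lm' := lines (-1).
near=> t.
have [p1 p2] : Q (apt c s + (1 * t) *: d) by near: t.
have [m1 m2] : Q (apt c s + (-1 * t) *: d) by near: t.
have hp : 0 < height d s (1 * t) by near: t.
have hm : height d s (-1 * t) < 0 by near: t.
have -> : apt c s + t *: d = apt c s + (1 * t) *: d by rewrite mul1r.
have -> : apt c s - t *: d = apt c s + (-1 * t) *: d by rewrite mulN1r scaleNr.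
split=> k1; split.
- by apply: p1; exact: mulr_gt0.
- by apply: m2; rewrite pmulr_rlt0.
- by apply: m1; rewrite nmulr_rgt0.
- by apply: p2; rewrite nmulr_rlt0.
Unshelve. all: by end_near. Qed.

End Arc.

Lemma inc_outward i c : edge_arc e i c -> inc al c ->
  (kap i = 1 /\ outward c) \/ (kap i = -1 /\ outward (arc_rev c)).
Proof.
move=> ic cinc.
have [k1|k1] : kap i = 1 \/ kap i = -1.
  by rewrite /kap; case: ifP => _; case: sg1 => ->; rewrite ?opprK; auto.
- left; split=> // s d sab dn; apply: filterS (inc_sides ic cinc sab dn) => t [h _].
  by apply: h; rewrite k1.
- right; split=> // s d /= sab; rewrite arc_normal_rev dotNr oppr_lt0 => dn.
  have := inc_sides ic cinc (s := - s) (d := - d) ltac:(lra); rewrite dotNl oppr_lt0 => /(_ dn).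
  apply: filterS => t [_ h]; move: h; rewrite scalerN opprK; apply; rewrite k1; lra.
Qed.

(** An arc and its reverse cannot both be outward, since the same ray would start inside and outside
    [E]. This selects the orientation found by [inc_outward]. *)
Lemma outward_inc i c : edge_arc e i c -> outward c ->
  (kap i = 1 /\ inc al c) \/ (kap i = -1 /\ inc al (arc_rev c)).
Proof.
move=> ic oc.
have contra c' : edge_arc e i c' -> outward c' -> outward (arc_rev c') -> False.
  move=> ic' o1 o2; have ab := arc_lohi ic'.1.
  pose s := (alo c' + ahi c') / 2; pose d := - arc_normal c' s.
  have sab : alo c' < s < ahi c' by rewrite /s; lra.
  have dn : dot d (arc_normal c' s) < 0.
    have := arc_unit ic'.1 s; rewrite /dot /d /arc_normal !crdE; nra.
  have [t [[/interior_subset ? _] [_ ?]]] :=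
    filter_ex (filterI (o1 s d sab dn) (outward_rev o2 sab dn)).
  by [].
have [ci|ci] := arc_dichotomy H ic; [left|right].
  by case: (inc_outward ic ci) => -[k1 o]; split=> //; case: (contra c).
have := inc_outward (edge_arc_rev ic) ci; rewrite arc_revK => -[[k1 o]|[k1 o]]; split=> //.
by case: (contra c).
Qed.

End Sorted.
End Sides.

(** * Green's formula *)

Section Integral1.
Context {R : realType}.
Notation mu := (@lebesgue_measure R).
Implicit Types (f g F G : R -> R) (a b : R).

Definition itg a b f := Rintegral mu `[a, b]%classic f.

Lemma itg_integrable f a b : {within `[a, b], continuous f} ->
  mu.-integrable `[a, b]%classic (EFin \o f).
Proof. by move=> cf; apply: continuous_compact_integrable => //; exact: segment_compact. Qed.

Lemma eq_itg f g a b : (forall x, a <= x <= b -> f x = g x) -> itg a b f = itg a b g.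
Proof. by move=> fg; apply: eq_Rintegral => x; rewrite inE /= in_itv /=; exact: fg. Qed.

Lemma itg_pt f a : itg a a f = 0.
Proof. by rewrite /itg set_itv1 Rintegral_set1. Qed.

Lemma itgD f g a b : {within `[a, b], continuous f} -> {within `[a, b], continuous g} ->
  itg a b (fun x => f x + g x) = itg a b f + itg a b g.
Proof. by move=> cf cg; apply: RintegralD => //; exact: itg_integrable. Qed.

Lemma itgB f g a b : {within `[a, b], continuous f} -> {within `[a, b], continuous g} ->
  itg a b (fun x => f x - g x) = itg a b f - itg a b g.
Proof. by move=> cf cg; apply: RintegralB => //; exact: itg_integrable. Qed.

Lemma itgZ f c a b : {within `[a, b], continuous f} ->
  itg a b (fun x => c * f x) = c * itg a b f.
Proof. by move=> cf; apply: RintegralZl => //; exact: itg_integrable. Qed.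

Lemma derivable_oo_LR F f a b : a < b -> {within `[a, b], continuous F} ->
  (forall x : R, a < x < b -> is_derive x 1 F (f x)) ->
  derivable_oo_LRcontinuous F a b /\ {in `]a, b[, derive1 F =1 f}.
Proof.
move=> ab cF dF; have [_ ca cb] := (continuous_within_itvP F ab).1 cF.
split; first split => //.
  by move=> x; rewrite in_itv /= => /dF[].
by move=> x; rewrite in_itv /= => /dF h; rewrite derive1E; exact: derive_val.
Qed.

Lemma itg_FTC f F a b : a <= b -> {within `[a, b], continuous f} ->
  {within `[a, b], continuous F} -> (forall x : R, a < x < b -> is_derive x 1 F (f x)) ->
  itg a b f = F b - F a.
Proof.
rewrite le_eqVlt => /orP[/eqP-> _ _ _|ab cf cF dF]; first by rewrite itg_pt subrr.
have [d1 d2] := derivable_oo_LR ab cF dF.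
by rewrite /itg /Rintegral (continuous_FTC2 ab cf d1 d2).
Qed.

Lemma itg_parts F G f g a b : a < b ->
  {within `[a, b], continuous f} -> {within `[a, b], continuous F} ->
  (forall x : R, a < x < b -> is_derive x 1 F (f x)) ->
  {within `[a, b], continuous g} -> {within `[a, b], continuous G} ->
  (forall x : R, a < x < b -> is_derive x 1 G (g x)) ->
  itg a b (fun x => F x * g x) = F b * G b - F a * G a - itg a b (fun x => f x * G x).
Proof.
move=> ab cf cF dF cg cG dG.
have [d1 d2] := derivable_oo_LR ab cF dF; have [d3 d4] := derivable_oo_LR ab cG dG.
exact: Rintegration_by_parts.
Qed.

Lemma itg_primitive f (M : R) : continuous f ->
  exists F, forall x : R, M < x -> is_derive x 1 F (f x).
Proof.
move=> cf; exists (fun x => \int[mu]_(t in `[M, x]) f t)%R => x Mx.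
have xx : x < x + 1 by rewrite ltrDl.
have [|d <-] := @continuous_FTC1_closed R f M x (x + 1) xx _ Mx (cf x).
  by apply: itg_integrable; exact: continuous_subspaceT.
by rewrite derive1E; exact: DeriveDef.
Qed.

Lemma itg_bound f M a b : a <= b -> {within `[a, b], continuous f} ->
  (forall x, a <= x <= b -> `|f x| <= M) -> `|itg a b f| <= M * (b - a).
Proof.
move=> ab cf fM; have mI : measurable (`[a, b]%classic : set (measurableTypeR R)) by [].
apply: le_trans (le_normr_Rintegral _ (itg_integrable cf)) _ => //.
have -> : M * (b - a) = itg a b (cst M).
  have dc (x : R) : a < x < b -> is_derive x 1 (fun x => 0 + x * M) (cst M x).
    by move=> _; exact: is_derive_affine.
  rewrite (itg_FTC ab _ _ dc); first by ring.
  - by apply: continuous_subspaceT; exact: cst_continuous.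
  - by apply: continuous_subspaceT => x; exact: is_derive_continuous (is_derive_affine 0 M x).
apply: le_Rintegral => //.
- apply: itg_integrable => x; apply: continuous_comp; first exact: cf.
  exact: norm_continuous.
- by apply: itg_integrable; apply: continuous_subspaceT; exact: cst_continuous.
Qed.

Lemma itg01_bound f M : {within `[0, 1], continuous f} ->
  (forall x, 0 <= x <= 1 -> `|f x| <= M) -> `|itg 0 1 f| <= M.
Proof. by move=> cf fM; have := itg_bound ler01 cf fM; rewrite subr0 mulr1. Qed.

End Integral1.

(** * Green's formula on a rectangle *)

Section GreenRectangle.
Context {R : realType}.
Implicit Types (f : R * R -> R).

(** Compactness of [[0, 1]] makes the continuity in the parameter uniform in [t]. *)
Lemma near_slab (T : topologicalType) (f : T * R -> R) (p : T) (d : R) :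
  continuous f -> 0 < d ->
  \forall q \near p, forall t, 0 <= t <= 1 -> `|f (q, t) - f (p, t)| < d.
Proof.
move=> cf d0.
have h (t : R) : `[0, 1]%classic t -> \forall t' \near t & q \near p, `|f (q, t') - f (p, t')| < d.
  move=> _; have d2 : 0 < d / 2 by rewrite divr_gt0.
  have /cvgrPdist_lt /(_ _ d2) [[U V] /= [Up Vt] UV] := cf (p, t).
  exists (V, U) => //= -[t' q] [/= Vt' Uq].
  have h1 := UV (q, t') (conj Uq Vt'); have h2 := UV (p, t') (conj (nbhs_singleton Up) Vt').
  move: h1 h2; rewrite !ltr_norml /= => /andP[? ?] /andP[? ?]; lra.
have /compact_near_coveringP /(_ _ _ (fun q t => `|f (q, t) - f (p, t)| < d) _ h) := @segment_compact R 0 1.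
apply: filterS => q hq t t01; apply: hq; by rewrite /= in_itv.
Qed.

Let pairc (x : R) : continuous (fun t : R => (x, t)).
Proof. move=> t; have h1 : x @[_ --> t] --> x by exact: cvg_cst.
exact: cvg_pair h1 cvg_id. Qed.

Let sect f x : continuous f -> continuous (fun t => f (x, t)).
Proof. move=> cf t; apply: (@continuous_comp _ _ _ (fun t => (x, t)) f); last exact: cf.
exact: pairc. Qed.

Let sect1 f t : continuous f -> continuous (fun x => f (x, t)).
Proof.
move=> cf x; apply: (@continuous_comp _ _ _ (fun x => (x, t)) f); last exact: cf.
have h1 : t @[_ --> x] --> t by exact: cvg_cst.
exact: cvg_pair cvg_id h1.
Qed.

Let wi (g : R -> R) (A : set R) : continuous g -> {within A, continuous g}.
Proof. exact: continuous_subspaceT. Qed.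

Let mulc (f g : R -> R) : continuous f -> continuous g -> continuous (fun t => f t * g t).
Proof. by move=> cf cg t; apply: cvgM; [exact: cf|exact: cg]. Qed.

Let subc (f g : R -> R) : continuous f -> continuous g -> continuous (fun t => f t - g t).
Proof. by move=> cf cg t; apply: cvgB; [exact: cf|exact: cg]. Qed.

Lemma itg_param_continuous f : continuous f -> continuous (fun x => itg 0 1 (fun t => f (x, t))).
Proof.
move=> cf x; apply/cvgrPdist_le => d d0; have := near_slab x cf d0.
apply: filterS => z fz; rewrite -itgB; try by apply: wi; exact: sect.
apply: itg01_bound.
  by apply: wi; apply: subc; exact: sect.
by move=> t t01; rewrite distrC ltW// fz.
Qed.

Section Rectangle.
Variables (a b : R) (u w ux ut wx wt : R * R -> R).
Hypothesis ab : a < b.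
Hypotheses (uc : continuous u) (wc : continuous w) (uxc : continuous ux)
  (utc : continuous ut) (wxc : continuous wx) (wtc : continuous wt).
Hypothesis dux : forall x t : R, a < x < b -> 0 <= t <= 1 ->
  is_derive x 1 (fun x => u (x, t)) (ux (x, t)).
Hypothesis dwx : forall x t : R, a < x < b -> 0 <= t <= 1 ->
  is_derive x 1 (fun x => w (x, t)) (wx (x, t)).
Hypothesis dut : forall x t : R, a < x < b -> 0 < t < 1 ->
  is_derive t 1 (fun t => u (x, t)) (ut (x, t)).
Hypothesis dwt : forall x t : R, a < x < b -> 0 < t < 1 ->
  is_derive t 1 (fun t => w (x, t)) (wt (x, t)).

Let slope f fx x z t := if z == x then fx (x, t) else (f (z, t) - f (x, t)) / (z - x).

Let slopeE f fx x z t : f (z, t) - f (x, t) = slope f fx x z t * (z - x).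
Proof.
rewrite /slope; case: eqVneq => [->|zx]; first by rewrite !subrr mulr0.
by rewrite divfK// subr_eq0.
Qed.

Let slope_cont f fx x z : continuous f -> continuous fx -> continuous (slope f fx x z).
Proof.
move=> cf cfx; rewrite /slope; case: eqVneq => zx; first exact: sect.
by apply: mulc; [apply: subc; exact: sect|exact: cst_continuous].
Qed.

Let slope_mvt f fx x z t :
  (forall y : R, a < y < b -> is_derive y 1 (fun y => f (y, t)) (fx (y, t))) ->
  a < x < b -> a < z < b ->
  exists2 y, Order.min x z <= y <= Order.max x z & slope f fx x z t = fx (y, t).
Proof.
move=> df xab zab; rewrite /slope; case: eqVneq => [->|zx].
  by exists x => //; rewrite minxx maxxx lexx.
have [|y yxz yE] := @mvt_between _ (fun y => f (y, t)) (fun y => fx (y, t)) x z.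
  move=> y yxz; apply: df; move: yxz; rewrite minEle maxEle; case: ifPn; lra.
by exists y => //; rewrite yE mulfK// subr_eq0.
Qed.

Let I x := itg 0 1 (fun t => u (x, t) * wt (x, t)).
Let J x := itg 0 1 (fun t => ux (x, t) * wt (x, t) - ut (x, t) * wx (x, t)).

(** Only first derivatives of [w] are available, so [wt] cannot be differentiated in [x]. In the
    difference quotient of [I] the increment of [wt] is integrated by parts in [t]: the derivative
    in [t] passes to [u], the increment of [w] remains, and the boundary term consists of the values
    at [t = 1] and [t = 0]. *)
Let dI (x : R) : a < x < b ->
  is_derive x 1 I (J x + (u (x, 1) * wx (x, 1) - u (x, 0) * wx (x, 0))).
Proof.
move=> xab.
pose U := slope u ux x; pose W := slope w wx x.
pose K z t := U z t * wt (z, t) - ut (x, t) * W z t.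
have Kc z : continuous (K z).
  by apply: subc; apply: mulc; try exact: sect; exact: slope_cont.
pose g z := itg 0 1 (K z) + (u (x, 1) * W z 1 - u (x, 0) * W z 0).
have nab : \forall z \near x, a < z < b.
  by have := near_in_itvoo (a := a) (b := b) (x := x); rewrite in_itv /= => /(_ xab).
have -> : J x + (u (x, 1) * wx (x, 1) - u (x, 0) * wx (x, 0)) = g x.
  rewrite /g /W /slope eqxx; congr (_ + _).
  by apply: eq_itg => t _; rewrite /K /U /W /slope eqxx.
apply: (near_slope_is_derive (g := g)).
  (* A slope is the derivative at an intermediate point [y], while [wt] is taken at [z]; convergence
     uniform in [t] is obtained for functions of [((y, z), t)]. *)
  pose H1 (q : (R * R) * R) := ux (q.1.1, q.2) * wt (q.1.2, q.2).
  pose H2 (q : (R * R) * R) := ut (x, q.2) * wx (q.1.1, q.2).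
  pose H3 (q : (R * R) * R) := wx (q.1.1, q.2).
  have c1 (h : R * R -> R) (pr : R * R -> R) : continuous h -> continuous pr ->
      continuous (fun q : (R * R) * R => h (pr q.1, q.2)).
    move=> ch cpr q; apply: (@continuous_comp _ _ _ (fun q : (R * R) * R => (pr q.1, q.2)) h);
      last exact: ch.
    have h1 : pr q'.1 @[q' --> q] --> pr q.1.
      by apply: (@continuous_comp _ _ _ fst pr); [exact: cvg_fst|exact: cpr].
    have h2 : q'.2 @[q' --> q] --> q.2 by exact: cvg_snd.
    exact: cvg_pair h1 h2.
  have f1 : continuous (fst : R * R -> R) by move=> q; exact: cvg_fst.
  have f2 : continuous (snd : R * R -> R) by move=> q; exact: cvg_snd.
  have H1c : continuous H1 by move=> q; apply: cvgM; apply: c1.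
  have H3c : continuous H3 by apply: c1.
  have H2c : continuous H2.
    move=> q; apply: cvgM; last exact: H3c.
    by apply: (c1 ut (fun=> x)) => //; exact: cst_continuous.
  have near1 (H : (R * R) * R -> R) (d : R) : continuous H -> 0 < d ->
      exists2 r : R, 0 < r & forall y z : R, `|y - x| < r ->
      `|z - x| < r -> forall t : R, 0 <= t <= 1 -> `|H ((y, z), t) - H ((x, x), t)| < d.
    move=> Hc d0; have /near_boxP[r r0 rP] := near_slab (x, x) Hc d0.
    by exists r => // y z yr zr; exact: (rP (y, z)).
  have Wlim t : 0 <= t <= 1 -> W z t @[z --> x] --> W x t.
    move=> t01; apply/cvgrPdist_lt => d d0.
    have [r r0 rP] := near1 H3 d H3c d0.
    have nr : \forall z \near x, `|z - x| < r.
      by apply/nbhs_ballP; exists r => //= z; rewrite /ball /= distrC.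
    apply: filterS2 nab nr => z zab zr.
    have [y yxz yE] := slope_mvt (fun y yab => dwx yab t01) xab zab.
    rewrite [W z t]yE distrC /W /slope eqxx; apply: (rP y x) => //; last by rewrite subrr normr0.
    exact: between_dist yxz zr.
  apply: cvgD; last by apply: cvgB; apply: cvgM; [exact: cvg_cst|apply: Wlim; rewrite ?ler01 ?lexx|
    exact: cvg_cst|apply: Wlim; rewrite ?ler01 ?lexx].
  apply/cvgrPdist_le => d d0; have d2 : 0 < d / 2 by rewrite divr_gt0.
  have [r1 r10 rP1] := near1 H1 _ H1c d2; have [r2 r20 rP2] := near1 H2 _ H2c d2.
  have nr (r : R) : 0 < r -> \forall z \near x, `|z - x| < r.
    by move=> r0; apply/nbhs_ballP; exists r => //= z; rewrite /ball /= distrC.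
  apply: filterS3 nab (nr _ r10) (nr _ r20) => z zab zr1 zr2.
  rewrite -itgB; try by apply: wi; exact: Kc.
  apply: itg01_bound.
    by apply: wi; apply: subc; exact: Kc.
  move=> t t01; rewrite distrC.
  have [y yxz yE] := slope_mvt (fun y yab => dux yab t01) xab zab.
  have [y' yxz' yE'] := slope_mvt (fun y yab => dwx yab t01) xab zab.
  have h1 := rP1 y z (between_dist yxz zr1) zr1 t t01.
  have h2 := rP2 y' z (between_dist yxz' zr2) zr2 t t01.
  rewrite /K {1}/U {1}/W yE yE' /U /W /slope eqxx.
  move: h1 h2; rewrite /H1 /H2 /= ltr_norml ltr_norml => /andP[? ?] /andP[? ?].
  rewrite ler_norml; lra.
apply: filterS nab => z zab.
rewrite /I -itgB; try by apply: wi; apply: mulc; exact: sect.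
(* The second summand is the one to be integrated by parts. *)
have E1 t : u (z, t) * wt (z, t) - u (x, t) * wt (x, t) =
    (U z t * wt (z, t)) * (z - x) + u (x, t) * (wt (z, t) - wt (x, t)).
  have := slopeE u ux x z t; rewrite -/(U z t) => h.
  have -> : u (z, t) = u (x, t) + U z t * (z - x) by rewrite -h addrC subrK.
  ring.
under eq_itg do rewrite E1.
rewrite itgD; try by apply: wi; repeat (apply: mulc || apply: subc); try exact: sect;
  try exact: slope_cont; exact: cst_continuous.
have dG (t : R) : 0 < t < 1 -> is_derive t 1 (fun t => w (z, t) - w (x, t)) (wt (z, t) - wt (x, t)).
  by move=> t01; exact: (is_deriveB (dwt zab t01) (dwt xab t01)).
rewrite (itg_parts (ltr01) _ _ (fun t t01 => dut xab t01) _ _ dG);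
  try by apply: wi; try apply: subc; exact: sect.
rewrite /g !mulrDl !(slopeE w wx x z).
have -> : itg 0 1 (fun t => U z t * wt (z, t) * (z - x)) = itg 0 1 (fun t => U z t * wt (z, t)) * (z - x).
  rewrite [RHS]mulrC -itgZ; last by apply: wi; apply: mulc; [exact: slope_cont|exact: sect].
  by apply: eq_itg => t _; rewrite mulrC.
have -> : itg 0 1 (fun t => ut (x, t) * (w (z, t) - w (x, t))) = itg 0 1 (fun t => ut (x, t) * W z t) * (z - x).
  rewrite [RHS]mulrC -itgZ; last by apply: wi; apply: mulc; [exact: sect|exact: slope_cont].
  by apply: eq_itg => t _; rewrite (slopeE w wx) -/(W z t); ring.
rewrite /K itgB; try by apply: wi; apply: mulc; try exact: sect; exact: slope_cont.
rewrite -!/(W z _); ring.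
Qed.

(** The fundamental theorem of calculus for [I], whose derivative is [J] plus the terms of the two
    horizontal sides. *)
Lemma green_rectangle : itg a b J =
  I b - I a - (itg a b (fun x => u (x, 1) * wx (x, 1)) - itg a b (fun x => u (x, 0) * wx (x, 0))).
Proof.
have Jc : continuous J.
  apply: (itg_param_continuous (f := fun p => ux p * wt p - ut p * wx p)) => p.
  by apply: cvgB; apply: cvgM; [exact: uxc|exact: wtc|exact: utc|exact: wxc].
have Ic : continuous I.
  apply: (itg_param_continuous (f := fun p => u p * wt p)) => p.
  by apply: cvgM; [exact: uc|exact: wtc].
have bc t : continuous (fun x => u (x, t) * wx (x, t)) by apply: mulc; exact: sect1.
have bbc : continuous (fun x => u (x, 1) * wx (x, 1) - u (x, 0) * wx (x, 0)) by exact: subc.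
have Sc : {within `[a, b], continuous (fun x => J x + (u (x, 1) * wx (x, 1) - u (x, 0) * wx (x, 0)))}.
  by apply: wi => x; apply: cvgD; [exact: Jc|exact: bbc].
have Iw : {within `[a, b], continuous I} by exact: wi.
by rewrite -(itg_FTC (ltW ab) Sc Iw dI) itgD ?itgB ?addrK //; apply: wi.
Qed.

End Rectangle.
End GreenRectangle.

(** * Planar measure and Fubini's theorem in sheared coordinates *)

Section Measure2.
Context {R : realType}.
Notation mu := (@lebesgue_measure R).
Notation mR := (measurableTypeR R).
Notation mu2 := (mu \x mu)%E.
Implicit Types (U : set (R * R)) (f : R * R -> R).

Lemma open_measurable2 U : open U -> measurable (U : set (mR * mR)).
Proof.
(* Boxes with rational corners are countably many, and those contained in [U] cover it. *)
move=> oU; pose B (q : rat * rat * (rat * rat)) : set (mR * mR) :=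
  `]ratr q.1.1, ratr q.1.2[%classic `*` `]ratr q.2.1, ratr q.2.2[%classic.
pose F q := if `[< B q `<=` U >] then B q else set0.
have -> : U = \bigcup_q F q.
  apply/seteqP; split=> [p Up|p [q _]]; last first.
    by rewrite /F; case: asboolP => // + Bp; apply.
  have /near_boxP[r r0 rU] := open_nbhs_nbhs (conj oU Up).
  have rat_between (x y : R) : x < y -> exists q : rat, x < ratr q < y.
    by move=> xy; have [q] := rat_in_itvoo xy; rewrite in_itv /=; exists q.
  have [a /andP[a1 a2]] := rat_between (p.1 - r) p.1 ltac:(lra).
  have [b /andP[b1 b2]] := rat_between p.1 (p.1 + r) ltac:(lra).
  have [c /andP[c1 c2]] := rat_between (p.2 - r) p.2 ltac:(lra).
  have [d /andP[d1 d2]] := rat_between p.2 (p.2 + r) ltac:(lra).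
  exists (a, b, (c, d)) => //; rewrite /F asboolT.
    by split; rewrite /= in_itv /= ?a2 ?c2.
  move=> x [] /=; rewrite !in_itv /= => /andP[x1 x2] /andP[y1 y2].
  by apply: rU; rewrite ltr_norml; apply/andP; split; lra.
apply: countable_bigcupT_measurable => [|q]; first exact: countableP.
rewrite /F; by case: ifP => // _; apply: measurableX.
Qed.

Lemma cin_measurable U f : open U -> cin U f ->
  measurable_fun (U : set (mR * mR)) (f : mR * mR -> mR).
Proof.
move=> oU fc; apply: (measurability _ (RGenOpens.measurableE R)).
move=> _ [_ [a [b ->] <-]]; apply: open_measurable2.
rewrite openE => p [Up fp].
have oab : nbhs (f p) `]a, b[%classic.
  by apply: open_nbhs_nbhs; split => //; exact: interval_open.
have := fc p Up _ oab; rewrite /nbhs /= /within /= => h.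
have nU : nbhs p U by apply: open_nbhs_nbhs.
by apply: filterS2 h nU => q fq Uq; split => //; exact: fq.
Qed.


Let shiftc (c : R) : measurable_fun setT ((fun x => x - c) : mR -> mR).
Proof.
apply: continuous_measurable_fun => x; apply: cvgB; [exact: cvg_id|exact: cvg_cst].
Qed.

(** By uniqueness of Lebesgue measure it suffices to compare the two measures on half-open
    intervals. *)
Lemma lebesgue_shift (c : R) (A : set mR) : measurable A ->
  pushforward mu ((fun x => x - c) : mR -> mR) A = mu A.
Proof.
move=> mA; apply/esym.
apply: (@lebesgue_measure_unique R (pushforward mu ((fun x => x - c) : mR -> mR))) => //.
move=> _ [[a b]] _ <-.
have E : (fun x : R => x - c) @^-1` `]a, b] = `](a + c), (b + c)]%classic.
  apply/seteqP; split => x; rewrite /= !in_itv /= => /andP[? ?]; apply/andP; split; lra.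
change (mu `]a, b]%classic = mu ((fun x : R => x - c) @^-1` `]a, b]%classic)).
rewrite E !lebesgue_measure_itv/= !lte_fin ltrD2r; case: ifP => // _.
by rewrite -!EFinB; congr EFin; ring.
Qed.

Lemma integral_shift (g : mR -> \bar R) (c : R) : measurable_fun setT g ->
  (\int[mu]_x g (x - c)%R = \int[mu]_x g x)%E.
Proof.
move=> mg.
have ge0 (h : mR -> \bar R) : measurable_fun setT h -> (forall x, (0 <= h x)%E) ->
    (\int[mu]_x h (x - c)%R = \int[mu]_x h x)%E.
  move=> mh h0.
  have := @ge0_integral_pushforward _ _ mR mR R ((fun x => x - c) : mR -> mR) (shiftc c) mu setT h
    measurableT mh (fun x _ => h0 x).
  rewrite preimage_setT => <-.
  by apply: eq_measure_integral => A mA _; exact: lebesgue_shift.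
rewrite integralE [RHS]integralE; congr (_ - _)%E.
- rewrite -(ge0 g^\+%E (measurable_funepos mg) (funepos_ge0 g)).
  by apply: eq_integral => x _; rewrite !funeposE.
- rewrite -(ge0 g^\-%E (measurable_funeneg mg) (funeneg_ge0 g)).
  by apply: eq_integral => x _; rewrite !funenegE.
Qed.

Lemma bounded_lty U (M : R) : open U -> (forall p, U p -> `|p.1| <= M /\ `|p.2| <= M) ->
  (mu2 (U : set (mR * mR)) < +oo)%E.
Proof.
move=> oU UM.
pose B : set mR := `[(- M), M]%classic.
have mB : measurable B by exact: measurable_itv.
have UB : U `<=` B `*` B.
  by move=> p /UM[h1 h2]; split; rewrite /B /= in_itv /= -ler_norml.
apply: (@le_lt_trans _ _ (mu2 (B `*` B))).
  by apply: le_measure => //; rewrite inE; [exact: open_measurable2|exact: measurableX].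
have -> : mu2 (B `*` B) = (mu B * mu B)%E by exact: product_measure1E.
rewrite /B lebesgue_measure_itv /=.
by case: ifP => _; rewrite ?mule0 // -EFinB -EFinM ltry.
Qed.

Lemma cin_integrable U f (M : R) : open U -> (forall p, U p -> `|p.1| <= M /\ `|p.2| <= M) ->
  cin U f -> (forall p, U p -> `|f p| <= M) ->
  mu2.-integrable (U : set (mR * mR)) (EFin \o f).
Proof.
move=> oU UM fc fM; apply: measurable_bounded_integrable.
- exact: open_measurable2.
- exact: bounded_lty oU UM.
- exact: cin_measurable.
- exists M; split; first by rewrite num_real.
  by move=> y My p Up; apply: le_trans (fM p Up) _; exact: ltW.
Qed.

(** For a fixed ordinate the shear is a translation of the abscissa, under which the inner integral
    is invariant; the order of integration is then exchanged. *)
Lemma shear_fubini U f (al M : R) : open U -> (forall p, U p -> `|p.1| <= M /\ `|p.2| <= M) ->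
  cin U f -> (forall p, U p -> `|f p| <= M) ->
  (\int[mu2]_(p in (U : set (mR * mR))) (f p)%:E =
   \int[mu]_x \int[mu]_y (((f \_ U) (unshear al x y))%:E))%E.
Proof.
move=> oU UM fc fM; have iF := cin_integrable oU UM fc fM.
pose F := f \_ U; pose P (q : R * R) := unshear al q.1 q.2.
have Pc : continuous P.
  move=> q; have h1 : q'.1 - al * q'.2 @[q' --> q] --> q.1 - al * q.2.
    by apply: cvgB; [exact: cvg_fst|apply: cvgM; [exact: cvg_cst|exact: cvg_snd]].
  have h2 : q'.2 @[q' --> q] --> q.2 by exact: cvg_snd.
  exact: cvg_pair h1 h2.
pose V := P @^-1` U.
have oV : open V by apply: open_comp => // q _; exact: Pc.
(* Bound for the sheared region, whose abscissas grow by at most [|al| * |M|]. *)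
pose N := `|M| + `|al| * `|M|.
have MN : M <= N by rewrite /N (le_trans (ler_norm M))// lerDl mulr_ge0.
have VN p : V p -> `|p.1| <= N /\ `|p.2| <= N.
  move=> /UM[]; rewrite /P /unshear /= => h1 h2; split; last exact: le_trans h2 MN.
  have -> : p.1 = (p.1 - al * p.2) + al * p.2 by rewrite subrK.
  apply: le_trans (ler_normD _ _) _; apply: lerD.
    by apply: le_trans h1 _; exact: ler_norm.
  by rewrite normrM ler_wpM2l// (le_trans h2)// ler_norm.
have fPc : cin V (f \o P).
  move=> q Vq; apply: (cvg_comp P f (G := within U (nbhs (P q)))); last exact: fc.
  move=> S; rewrite /within /= => h; have h2 := Pc q _ h.
  have h3 : \forall q' \near q, U (P q') -> S (P q') := h2.
  have : \forall q' \near within V (nbhs q), S (P q') by rewrite /within; near_simpl; apply: filterS h3 => q' SP Vq'; exact: SP.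
  by [].
have iFP := cin_integrable oV VN fPc (fun q Vq => le_trans (fM _ Vq) MN).
have FPE : (f \o P) \_ V = F \o P.
  by apply/funext => q; rewrite /F /= !patchE /V; congr (if _ then _ else _); rewrite !mem_setE.
have mU := open_measurable2 oU; have mV := open_measurable2 oV.
have iFT : mu2.-integrable setT (EFin \o F).
  by move: iF => /(integrable_mkcond _ mU); rewrite restrict_EFin.
have iFPT : mu2.-integrable setT (EFin \o (F \o P)).
  by move: iFP => /(integrable_mkcond _ mV); rewrite restrict_EFin FPE.
rewrite integral_mkcond restrict_EFin.
transitivity (\int[mu2]_z (EFin \o (F \o P)) z)%E; last first.
  by rewrite -(integral12_prod_meas1 iFPT).
rewrite -(integral21_prod_meas1 iFT) -(integral21_prod_meas1 iFPT).
apply: eq_integral => y _; rewrite /fubini_G.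
have mFT : measurable_fun setT (EFin \o F) by have /integrableP[] := iFT.
rewrite -(@integral_shift (fun x => (EFin \o F) (x, y)) (al * y)) //.
by apply: measurableT_comp => //.
Qed.

End Measure2.

Section LineIntegrals.
Context {R : realType}.
Notation mu := (@lebesgue_measure R).
Notation mR := (measurableTypeR R).
Notation mu2 := (mu \x mu)%E.
Implicit Types (f g : R -> R) (a b : R).

Lemma itg_FTCc f F a b : a <= b -> continuous f ->
  (forall x : R, a <= x <= b -> is_derive x 1 F (f x)) -> itg a b f = F b - F a.
Proof.
move=> ab cf dF; apply: itg_FTC => //.
- exact: continuous_subspaceT.
- apply/subspace_continuousP => x; rewrite /= in_itv /= => xab.
  apply: cvg_trans (is_derive_continuous (dF x xab)); apply: cvg_app; exact: cvg_within.
- by move=> x xab; apply: dF; have [? ?] := andP xab; rewrite !ltW.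
Qed.

(** A primitive on a whole half-line turns additivity, substitution and reflection into identities
    between its values. *)
Lemma itg_antiderivative f (M : R) : continuous f ->
  exists F, (forall x : R, M < x -> is_derive x 1 F (f x)) /\
    forall a b, M < a -> a <= b -> itg a b f = F b - F a.
Proof.
move=> cf; have [F dF] := itg_primitive M cf; exists F; split=> // a b Ma ab.
by apply: itg_FTCc => // x /andP[ax _]; apply: dF; exact: lt_le_trans ax.
Qed.

Lemma itg_split f a m b : continuous f -> a <= m <= b ->
  itg a b f = itg a m f + itg m b f.
Proof.
move=> cf /andP[am mb]; have [F [_ FE]] := itg_antiderivative (a - 1) cf.
by rewrite !FE; first ring; lra.
Qed.

Lemma itg_comp f (g dg : R -> R) a b (F : R -> R) : a <= b -> continuous f -> continuous dg ->
  continuous g -> (forall x : R, a <= x <= b -> is_derive x 1 g (dg x)) ->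
  (forall x : R, a <= x <= b -> is_derive (g x) 1 F (f (g x))) ->
  itg a b (fun x => f (g x) * dg x) = F (g b) - F (g a).
Proof.
move=> ab cf cdg cg dg' dF.
apply: (@itg_FTCc (fun x => f (g x) * dg x) (F \o g)) => //.
  by move=> x; apply: cvgM; [exact: (cont_comp cg cf)|exact: cdg].
by move=> x xab; have := is_derive1_comp (dF x xab) (dg' x xab).
Qed.

Lemma itg_affine f h k : continuous f ->
  (h <= k -> itg h k f = itg 0 1 (fun t => f (h + t * (k - h)) * (k - h))) /\
  (k <= h -> itg k h f = - itg 0 1 (fun t => f (h + t * (k - h)) * (k - h))).
Proof.
move=> cf; pose M := Order.min h k - 1.
have [F [dF FE]] := itg_antiderivative M cf.
have Mh : M < h by rewrite /M minEle; case: ifPn; lra.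
have Mk : M < k by rewrite /M minEle; case: ifPn; lra.
have -> : itg 0 1 (fun t => f (h + t * (k - h)) * (k - h)) = F k - F h.
  have dFx (x : R) : 0 <= x <= 1 -> is_derive (h + x * (k - h)) 1 F (f (h + x * (k - h))).
    move=> /andP[x0 x1]; apply: dF.
    have -> : h + x * (k - h) = (1 - x) * h + x * k by ring.
    have -> : M = (1 - x) * M + x * M by ring.
    have [->|x0'] := eqVneq x 0; first by rewrite subr0 !mul0r !mul1r !addr0.
    by rewrite ler_ltD// ?ltr_pM2l ?lt0r ?x0'// ler_wpM2l ?subr_ge0// ltW.
  have dA (x : R) : 0 <= x <= 1 -> is_derive x 1 (fun t => h + t * (k - h)) (cst (k - h) x).
    by move=> _; exact: is_derive_affine.
  have := itg_comp (ler01) cf (@cst_continuous _ _ (k - h)) _ dA dFx.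
  rewrite mul1r mul0r addr0 [h + (k - h)]addrC subrK; apply.
  by move=> x; exact: is_derive_continuous (is_derive_affine _ _ x).
by split=> hk; rewrite FE// opprB.
Qed.

Lemma itg_opp f a b : continuous f -> a <= b ->
  itg (- b) (- a) (fun x => f (- x)) = itg a b f.
Proof.
move=> cf ab; have [F [dF FE]] := itg_antiderivative (a - 1) cf.
have dN (s : R) : is_derive s 1 (fun s : R => - s) (-1).
  by apply: is_derive_eq; rewrite /GRing.scale.
have oc : continuous (fun s : R => - s) by move=> s; exact: opp_continuous.
rewrite FE//; last lra.
have dG (x : R) : - b <= x <= - a -> is_derive x 1 (fun x => - F (- x)) (f (- x)).
  move=> xab; have h : is_derive (- x) 1 F (f (- x)) by apply: dF; lra.
  have h1 := is_derive1_comp h (dN x).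
  by have := is_deriveN h1; rewrite mulrN1 opprK.
have ba : - b <= - a by rewrite lerN2.
by rewrite (itg_FTCc ba (cont_comp oc cf) dG) !opprK; ring.
Qed.

Lemma cin_comp (T : topologicalType) (E : set (R * R)) (g : R * R -> R) (phi : T -> R * R) :
  cin E g -> continuous phi -> (forall x, E (phi x)) -> continuous (g \o phi).
Proof.
move=> gc pc pE x; apply: (cvg_comp phi g (G := within E (nbhs (phi x)))); last exact: gc.
move=> S h; have h2 : \forall y \near x, E (phi y) -> S (phi y) := pc x _ h.
have h3 : \forall y \near x, S (phi y) by apply: filterS h2 => y; apply.
by [].
Qed.

Lemma cin_bounded (E : set (R * R)) (g : R * R -> R) : compact E -> cin E g ->
  exists M, forall p, E p -> `|g p| <= M.
Proof.
move=> cE gc; have : compact (g @` E).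
  by apply: continuous_compact => //; apply/subspace_continuousP => p Ep; exact: gc.
move=> /compact_bounded[M [_ h]]; exists (`|M| + 1) => p Ep.
by apply: (h (`|M| + 1)); [rewrite (le_lt_trans (ler_norm M))// ltrDl|exists p].
Qed.

(* the integral of [g1 dg2] along [c], with [(d1, d2)] the gradient of [g2] *)
Definition lint (c : arc R) (g1 d1 d2 : R * R -> R) : R := itg (alo c) (ahi c)
  (fun s => g1 (apt c s) * (d1 (apt c s) * (adir c s).1 + d2 (apt c s) * (adir c s).2)).

Lemma lint_rev (E : set (R * R)) c (g1 d1 d2 : R * R -> R) : arc_ok c -> arc_img c `<=` E ->
  cin E g1 -> cin E d1 -> cin E d2 -> lint (arc_rev c) g1 d1 d2 = - lint c g1 d1 d2.
Proof.
move=> ok cE g1c d1c d2c; have ab := ltW (arc_lohi ok).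
pose q s := apt c (clamp (alo c) (ahi c) s).
have qE s : E (q s) by apply: cE; exists (clamp (alo c) (ahi c) s); rewrite //= in_itv /= clamp_itv.
have qc : continuous q.
  move=> s; apply: (@continuous_comp _ _ _ (clamp (alo c) (ahi c)) (apt c)).
    exact: continuous_clamp.
  exact: arc_continuous ok _.
have cc (g : R * R -> R) : cin E g -> continuous (fun s => g (q s)) by move=> gc; exact: cin_comp gc qc qE.
pose w s := g1 (q s) * (d1 (q s) * (adir c s).1 + d2 (q s) * (adir c s).2).
have wc : continuous w.
  move=> s; apply: cvgM; [exact: cc|apply: cvgD; apply: cvgM; try exact: cc].
    exact: (arc_dirc1 ok).
  exact: (arc_dirc2 ok).
have -> : lint c g1 d1 d2 = itg (alo c) (ahi c) w.
  by apply: eq_itg => s sab; rewrite /w /q clamp_id.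
rewrite -itg_opp// /lint /=.
have -> : - itg (- ahi c) (- alo c) (fun x => w (- x)) =
    itg (- ahi c) (- alo c) (fun x => (-1) * w (- x)).
  rewrite itgZ ?mulN1r//; apply: continuous_subspaceT.
  by apply: (cont_comp _ wc) => s; exact: opp_continuous.
apply: eq_itg => s sab; rewrite /w /q clamp_id; last lra.
by rewrite /=; ring.
Qed.

End LineIntegrals.

(** * Green's formula between two graphs *)

Section Slab.
Context {R : realType}.
Variables (E : set (R * R)) (al a b : R) (f h df dh : R -> R).
Variables (g1 a11 a12 g2 a21 a22 : R * R -> R).
Hypothesis ab : a < b.
Hypotheses (fc : continuous f) (hc : continuous h) (dfc : continuous df) (dhc : continuous dh).
Hypothesis fd : forall x : R, a < x < b -> is_derive x 1 f (df x).
Hypothesis hd : forall x : R, a < x < b -> is_derive x 1 h (dh x).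
Hypothesis slabE : forall x t, a <= x <= b -> 0 <= t <= 1 ->
  E (unshear al x (h x + t * (f x - h x))).
Hypothesis g1C : wC1 E g1 a11 a12.
Hypothesis g2C : wC1 E g2 a21 a22.

Definition slab_det := fun p => a11 p * a22 p - a12 p * a21 p.

Definition slab_pt x t := unshear al x (h x + t * (f x - h x)).

(** The integral of [g1 dg2] along the segment at sheared abscissa [x], travelled from the graph of
    [h] to that of [f]. *)
Definition slab_side x := itg 0 1 (fun t =>
  g1 (slab_pt x t) * ((a22 (slab_pt x t) - al * a21 (slab_pt x t)) * (f x - h x))).

(** The integral of [g1 dg2] along the graph of [F]: the velocity of [unshear al x (F x)] is
    [(1 - al * dF x, dF x)]. *)
Definition slab_graph (F dF : R -> R) := itg a b (fun x =>
  g1 (unshear al x (F x)) * (a21 (unshear al x (F x)) * (1 - al * dF x) +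
    a22 (unshear al x (F x)) * dF x)).

Let cx (p : R * R) := clamp a b p.1.
Let ct (p : R * R) := clamp 0 1 p.2.
Let phi p := slab_pt (cx p) (ct p).

Let cxc : continuous cx.
Proof.
move=> p; apply: (@continuous_comp _ _ _ fst (clamp a b)); first exact: cvg_fst.
exact: continuous_clamp.
Qed.

Let ctc : continuous ct.
Proof.
move=> p; apply: (@continuous_comp _ _ _ snd (clamp 0 1)); first exact: cvg_snd.
exact: continuous_clamp.
Qed.

Let ccx (F : R -> R) : continuous F -> continuous (fun p => F (cx p)).
Proof. by move=> cF p; apply: (@continuous_comp _ _ _ cx F); [exact: cxc|exact: cF]. Qed.

Let cD (u v : R * R -> R) : continuous u -> continuous v -> continuous (fun p => u p + v p).
Proof. by move=> uc vc p; apply: cvgD; [exact: uc|exact: vc]. Qed.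
Let cB (u v : R * R -> R) : continuous u -> continuous v -> continuous (fun p => u p - v p).
Proof. by move=> uc vc p; apply: cvgB; [exact: uc|exact: vc]. Qed.
Let cM (u v : R * R -> R) : continuous u -> continuous v -> continuous (fun p => u p * v p).
Proof. by move=> uc vc p; apply: cvgM; [exact: uc|exact: vc]. Qed.
Let cC (x : R) : continuous (fun p : R * R => x).
Proof. exact: cst_continuous. Qed.

Let yy p := h (cx p) + ct p * (f (cx p) - h (cx p)).

Let yyc : continuous yy.
Proof. by apply: cD; [exact: ccx|apply: cM => //; apply: cB; exact: ccx]. Qed.

Let phic : continuous phi.
Proof.
have h0 : continuous (fun p => cx p - al * yy p) by apply: cB => //; exact: cM.
move=> p; have h1 : cx q - al * yy q @[q --> p] --> cx p - al * yy p by exact: h0.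
have h2 : yy q @[q --> p] --> yy p by exact: yyc.
exact: cvg_pair h1 h2.
Qed.

Let phiE p : E (phi p).
Proof. by apply: slabE; apply: clamp_itv; rewrite ?ler01 ?ltW. Qed.

Let gphi g : cin E g -> continuous (fun p => g (phi p)).
Proof. by move=> gc; exact: cin_comp gc phic phiE. Qed.

Let yx p := dh (cx p) + ct p * (df (cx p) - dh (cx p)).

Let yxc : continuous yx.
Proof. by apply: cD; [exact: ccx|apply: cM => //; apply: cB; exact: ccx]. Qed.

Let phi_id x t : a <= x <= b -> 0 <= t <= 1 -> phi (x, t) = slab_pt x t.
Proof. by move=> xab t01; rewrite /phi /cx /ct /= !clamp_id. Qed.

Let dpx g d1 d2 (x t : R) : wC1 E g d1 d2 -> a < x < b -> 0 <= t <= 1 ->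
  is_derive x 1 (fun x => g (phi (x, t)))
    (d1 (phi (x, t)) * (1 - al * yx (x, t)) + d2 (phi (x, t)) * yx (x, t)).
Proof.
move=> [gd _ _] xab t01.
have n := clamp_near xab.
have dy : is_derive x 1 (fun x => yy (x, t)) (yx (x, t)).
  have d0 : is_derive x 1 (fun x => h x + clamp 0 1 t * (f x - h x))
      (dh x + clamp 0 1 t * (df x - dh x)).
    have d1' := is_deriveB (fd xab) (hd xab).
    have d2' : is_derive x 1 (fun x => clamp 0 1 t * (f x - h x)) (clamp 0 1 t * (df x - dh x)).
      by have := is_deriveZ (clamp 0 1 t) d1'.
    exact: is_deriveD (hd xab) d2'.
  have e1 : yx (x, t) = dh x + clamp 0 1 t * (df x - dh x).
    by rewrite /yx /cx /ct /= clamp_id//; have [? ?] := andP xab; rewrite !ltW.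
  rewrite e1; apply: is_derive_near d0.
  by apply: filterS n => y yE; rewrite /yy /cx /= yE.
have dx : is_derive x 1 (fun x => cx (x, t) - al * yy (x, t)) (1 - al * yx (x, t)).
  have d3 : is_derive x 1 (fun x => cx (x, t)) 1.
    apply: is_derive_near (is_derive_id x 1).
    by apply: filterS n => y yE; rewrite /cx /= yE.
  have d4 : is_derive x 1 (fun x => al * yy (x, t)) (al * yx (x, t)).
    by have := is_deriveZ al dy.
  exact: is_deriveB d3 d4.
apply: (wdiff_curve (D := E) (c1 := fun x => cx (x, t) - al * yy (x, t)) (c2 := fun x => yy (x, t))) => //.
- exact: (gd (phi (x, t)) (phiE _)).
- by near=> z; exact: (phiE (z, t)).
Unshelve. all: by end_near. Qed.

Let dpt g d1 d2 (x t : R) : wC1 E g d1 d2 -> a < x < b -> 0 < t < 1 ->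
  is_derive t 1 (fun t => g (phi (x, t)))
    ((d2 (phi (x, t)) - al * d1 (phi (x, t))) * (f (cx (x, t)) - h (cx (x, t)))).
Proof.
move=> [gd _ _] xab t01.
have n := clamp_near t01; set q := f _ - h _.
have dy : is_derive t 1 (fun t => yy (x, t)) q.
  apply: is_derive_near (is_derive_affine (h (clamp a b x)) q t).
  by apply: filterS n => y yE; rewrite /yy /cx /ct /= yE.
have dx : is_derive t 1 (fun t => cx (x, t) - al * yy (x, t)) (- (al * q)).
  have d4 : is_derive t 1 (fun t => al * yy (x, t)) (al * q) by have := is_deriveZ al dy.
  have d3 : is_derive t 1 (fun t => cx (x, t)) 0.
    by have := is_derive_cst (clamp a b x) t 1.
  by have := is_deriveB d3 d4; rewrite sub0r.
have := wdiff_curve (D := E) (c1 := fun t => cx (x, t) - al * yy (x, t)) (c2 := fun t => yy (x, t))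
  (gd (phi (x, t)) (phiE _)) dx dy.
have nE : \forall z \near t, E (cx (x, z) - al * yy (x, z), yy (x, z)).
  by near=> z; exact: (phiE (x, z)).
move=> /(_ nE) hh; apply: is_derive_eq hh _; ring.
Unshelve. all: by end_near. Qed.

(** Green's formula on the rectangle for the pullbacks of [g1] and [g2] by [slab_pt], whose Jacobian
    determinant is [f x - h x], of either sign. *)
Lemma green_slab :
  itg a b (fun x => itg 0 1 (fun t => slab_det (slab_pt x t) * (f x - h x))) =
  slab_side b - slab_side a - (slab_graph f df - slab_graph h dh).
Proof.
have [_ a11c a12c] := g1C; have [_ a21c a22c] := g2C.
have g1c := wC1_cin g1C; have g2c := wC1_cin g2C.
have oc : continuous (fun p => 1 - al * yx p) by apply: cB => //; exact: cM.
have qc : continuous (fun p => f (cx p) - h (cx p)) by apply: cB; exact: ccx.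
have xc d1 d2 : cin E d1 -> cin E d2 ->
    continuous (fun p => d1 (phi p) * (1 - al * yx p) + d2 (phi p) * yx p).
  by move=> c1 c2; apply: cD; apply: cM => //; exact: gphi.
have tc d1 d2 : cin E d1 -> cin E d2 ->
    continuous (fun p => (d2 (phi p) - al * d1 (phi p)) * (f (cx p) - h (cx p))).
  move=> c1 c2; apply: cM => //; apply: cB; first exact: gphi.
  by apply: cM => //; exact: gphi.
have := green_rectangle ab (gphi g1c) (gphi g2c) (xc _ _ a11c a12c) (tc _ _ a11c a12c)
  (xc _ _ a21c a22c) (tc _ _ a21c a22c)
  (fun x t xab t01 => dpx g1C xab t01) (fun x t xab t01 => dpx g2C xab t01)
  (fun x t xab t01 => dpt g1C xab t01) (fun x t xab t01 => dpt g2C xab t01).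
move=> GR.
have aab : a <= a <= b by rewrite lexx ltW.
have bab : a <= b <= b by rewrite lexx ltW.
have i0 : 0 <= (0 : R) <= 1 by rewrite lexx ler01.
have i1 : 0 <= (1 : R) <= 1 by rewrite lexx ler01.
have side x : a <= x <= b -> slab_side x = itg 0 1 (fun t => g1 (phi (x, t)) *
    ((a22 (phi (x, t)) - al * a21 (phi (x, t))) * (f (cx (x, t)) - h (cx (x, t))))).
  by move=> xab; apply: eq_itg => t t01; rewrite phi_id// /cx /= clamp_id.
rewrite (side b bab) (side a aab).
have p1 x : slab_pt x 1 = unshear al x (f x) by rewrite /slab_pt mul1r [h x + _]addrC subrK.
have p0 x : slab_pt x 0 = unshear al x (h x) by rewrite /slab_pt mul0r addr0.
have -> : slab_graph f df = itg a b (fun x => g1 (phi (x, 1)) *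
    (a21 (phi (x, 1)) * (1 - al * yx (x, 1)) + a22 (phi (x, 1)) * yx (x, 1))).
  apply: eq_itg => x xab; rewrite phi_id// p1 /yx /cx /ct /= !clamp_id//.
  by rewrite mul1r [dh x + _]addrC subrK.
have -> : slab_graph h dh = itg a b (fun x => g1 (phi (x, 0)) *
    (a21 (phi (x, 0)) * (1 - al * yx (x, 0)) + a22 (phi (x, 0)) * yx (x, 0))).
  apply: eq_itg => x xab; rewrite phi_id// p0 /yx /cx /ct /= !clamp_id//.
  by rewrite mul0r addr0.
rewrite -GR; apply: eq_itg => x xab; apply: eq_itg => t t01.
rewrite phi_id// /slab_det; have -> : cx (x, t) = x by rewrite /cx /= clamp_id.
ring.
Qed.

End Slab.

(** * Green's formula on a curved triangle *)

Section GreenTriangle.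
Context {R : realType}.
Notation mu := (@lebesgue_measure R).
Notation mR := (measurableTypeR R).
Notation mu2 := (mu \x mu)%E.
Variables (E : set (R * R)) (e : 'I_3 -> R -> R * R) (al k : R).
Hypothesis H : curved_tri E e al k.
Notation X := (shear al).
Notation P := (unshear al).
Variables (g1 a11 a12 g2 a21 a22 : R * R -> R).
Hypothesis g1C : wC1 E g1 a11 a12.
Hypothesis g2C : wC1 E g2 a21 a22.

Lemma integral_oo (f : R -> R) a b : continuous f -> a <= b ->
  (\int[mu]_x (((f \_ `]a, b[%classic) x)%:E) = (itg a b f)%:E)%E.
Proof.
move=> cf ab.
have E1 : (\int[mu]_x (((f \_ `]a, b[%classic) x)%:E) = \int[mu]_(x in `]a, b[%classic) (f x)%:E)%E.
  by rewrite [RHS]integral_mkcond restrict_EFin.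
have mf (A : set R) : measurable_fun A f.
  by apply: measurable_funS (continuous_measurable_fun cf).
rewrite E1 -(@integral_itv_bndoo _ a b _ true false); last exact/measurable_EFinP.
rewrite /itg /Rintegral fineK// integrable_fin_num//.
by apply: itg_integrable; exact: continuous_subspaceT.
Qed.

Section OneArc.
Variables (i : 'I_3) (c : arc R).
Hypothesis ic : edge_arc e i c.
Hypothesis cinc : inc al c.
Notation a := (alo c).
Notation b := (ahi c).
Notation xa := (X (apt c a)).
Notation xb := (X (apt c b)).
Notation inv x := (ainv al c (clamp xa xb x)).

Let omega x := let q := apt c (inv x) in let s := gslope al c (clamp xa xb x) in
  g1 q * (a21 q * (1 - al * s) + a22 q * s).

Lemma edge_arc_sub : arc_img c `<=` E.
Proof. by have [_ ->] := ic; move=> _ [t _ <-]; exact: (ct_mem H). Qed.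

Let xab : xa < xb. Proof. exact (inc_lt H ic cinc). Qed.

Let inv_itv x : a <= inv x <= b.
Proof. by have [] := ainvP H ic cinc (clamp_itv x (ltW xab)). Qed.

Let omega_continuous : continuous omega.
Proof.
have [_ a21c a22c] := g2C; have g1c := wC1_cin g1C.
have qc : continuous (fun x => apt c (inv x)).
  move=> x; apply: (@continuous_comp _ _ _ (ainv al c \o clamp xa xb) (apt c)).
    exact (@ainv_continuous _ _ _ _ _ H _ _ ic cinc x).
  by apply: arc_continuous; exact: ic.1.
have qE x : E (apt c (inv x)).
  by apply: edge_arc_sub; exists (inv x) => //; rewrite /= in_itv /=; exact: inv_itv.
have cc (g : R * R -> R) : cin E g -> continuous (fun x => g (apt c (inv x))).
  by move=> gc; exact: cin_comp gc qc qE.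
have sc := gslope_continuous H ic cinc.
move=> x; apply: cvgM; first exact: cc.
apply: cvgD; apply: cvgM; try exact: cc; last exact: sc.
by apply: cvgB; [exact: cvg_cst|apply: cvgM; [exact: cvg_cst|exact: sc]].
Qed.

Lemma slab_graph_arc (F dF : R -> R) x0 x1 : xa <= x0 -> x1 <= xb ->
  (forall x, x0 <= x <= x1 -> F x = gy e al i x) ->
  (forall x, x0 <= x <= x1 -> dF x = gslope al c x) ->
  slab_graph al x0 x1 g1 a21 a22 F dF = itg x0 x1 omega.
Proof.
move=> xa0 xb1 FE dFE; apply: eq_itg => x x01.
have xab' : xa <= x <= xb by lra.
rewrite /omega clamp_id// FE// dFE// (gy_arc H ic cinc xab').
have [_ Xs] := ainvP H ic cinc xab'.
by rewrite -{1 3 6}Xs shearK.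
Qed.

(** Change of variable from the abscissa to arc length; the factor [aslope] cancels the denominator
    of [gslope]. *)
Lemma omega_lint : itg xa xb omega = lint c g1 a21 a22.
Proof.
have [F [dF FE]] := itg_antiderivative (xa - 1) omega_continuous.
have ab := ltW (arc_lohi ic.1); have xab' := xab.
rewrite FE; [|lra|lra].
have dX (s : R) : a <= s <= b -> is_derive s 1 (fun s => X (apt c s)) (aslope al c s).
  by move=> _; exact (arc_X_derive al ic s).
have dFX (s : R) : a <= s <= b -> is_derive (X (apt c s)) 1 F (omega (X (apt c s))).
  by move=> sab; apply: dF; have := inc_range H ic cinc sab; lra.
have Xc : continuous (fun s => X (apt c s)).
  by move=> s; exact: is_derive_continuous (arc_X_derive al ic s).
have Sc : continuous (aslope al c) by move=> s; exact: (aslope_continuous ic).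
rewrite -(itg_comp ab omega_continuous Sc Xc dX dFX).
apply: eq_itg => s sab; have Xs := inc_range H ic cinc sab.
rewrite /omega clamp_id// (ainvK H ic cinc sab) /gslope (ainvK H ic cinc sab).
have S0 : aslope al c s != 0 by rewrite gt_eqF// cinc.
have -> : (adir c s).1 = aslope al c s - al * (adir c s).2 by rewrite /aslope addrK.
by field.
Qed.

Lemma slab_graph_split (F dF : R -> R) x : xa <= x <= xb ->
  (forall x, xa <= x <= xb -> F x = gy e al i x) ->
  (forall x, xa <= x <= xb -> dF x = gslope al c x) ->
  lint c g1 a21 a22 = slab_graph al xa x g1 a21 a22 F dF + slab_graph al x xb g1 a21 a22 F dF.
Proof.
move=> xx FE dFE.
rewrite -omega_lint (itg_split omega_continuous xx).
by congr (_ + _); symmetry; apply: slab_graph_arc => //; try lra; move=> y yx;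
  [apply: FE|apply: dFE|apply: FE|apply: dFE]; lra.
Qed.

Lemma slab_graph_lint (F dF : R -> R) :
  (forall x, xa <= x <= xb -> F x = gy e al i x) ->
  (forall x, xa <= x <= xb -> dF x = gslope al c x) ->
  lint c g1 a21 a22 = slab_graph al xa xb g1 a21 a22 F dF.
Proof.
by move=> FE dFE; rewrite -omega_lint; symmetry; apply: slab_graph_arc.
Qed.

End OneArc.

Section Sorted.
Variables (iL i1 i2 : 'I_3) (l m r sg : R).
Hypothesis so : sorted e al iL i1 i2 l m r.
Hypothesis sg1 : sg = 1 \/ sg = -1.
Notation upath := (upath e al iL l r).
Notation bpath := (bpath e al i1 i2 l m r).
Hypothesis sgP : forall x, l < x < r -> 0 < sg * (upath x - bpath x).

Let lm : l < m. Proof. exact: (so_1 so).1. Qed.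
Let mr : m < r. Proof. exact: (so_2 so).1. Qed.
Let uc := upath_continuous H so.
Let bc := bpath_continuous H so.

Lemma slab_mem x t : l <= x <= r -> 0 <= t <= 1 ->
  E (P x (bpath x + t * (upath x - bpath x))).
Proof.
move=> xlr t01; apply/(E_sorted H so); rewrite unshearK; split=> //.
rewrite /inside unshearK /unshear /=; set u := upath x; set b := bpath x.
have -> : (b + t * (u - b) - b) * (u - (b + t * (u - b))) = (t * (1 - t)) * (u - b) ^+ 2 by ring.
by have /andP[t0 t1] := t01; apply: mulr_ge0; [apply: mulr_ge0 => //; rewrite subr_ge0|exact: sqr_ge0].
Qed.

Let D := slab_det a11 a12 a21 a22.
Notation pt := (slab_pt al upath bpath).

Let Dc : cin E D.
Proof.
have [_ c1 c2] := g1C; have [_ c3 c4] := g2C.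
by apply: cinD; [|apply: cinN]; apply: cinM.
Qed.

Let fibre x := itg 0 1 (fun t => D (pt x t) * (upath x - bpath x)).

(** The fibre of the interior over [x] is the open interval between the two graphs. Its
    parametrization from [bpath] to [upath] gives an oriented integral, whose orientation is
    corrected by [sg]. *)
Let integral_fibre x : l < x < r ->
  (\int[mu]_y (((D \_ (interior E)) (P x y))%:E) = (sg * fibre x)%:E)%E.
Proof.
move=> xlr; have ub := sgP xlr.
have xlr' : l <= x <= r by have [? ?] := andP xlr; rewrite !ltW.
pose lo := Order.min (bpath x) (upath x); pose hi := Order.max (bpath x) (upath x).
have lohi : lo <= hi by rewrite /lo /hi ge_min le_max lexx.
pose psi y := D (P x (clamp lo hi y)).
have mem y : lo <= y <= hi -> E (P x y).
  move=> ylh; have n0 := paths_meet H so xlr; rewrite -subr_eq0 in n0.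
  have -> : y = bpath x + ((y - bpath x) / (upath x - bpath x)) * (upath x - bpath x).
    by rewrite divfK// addrC subrK.
  apply: slab_mem => //; move: ylh n0; rewrite /lo /hi minEle maxEle.
  case: ifPn => [bu yb n0|]; last rewrite -ltNge => bu yb n0.
    have u0 : 0 < upath x - bpath x by rewrite lt0r n0 subr_ge0.
    by rewrite divr_ge0 ?ler_pdivrMr ?mul1r//; lra.
  rewrite -[_ / _]mulrNN -invrN divr_ge0 ?ler_pdivrMr ?mul1r//; lra.
have psic : continuous psi.
  apply: (cin_comp (phi := fun y => P x (clamp lo hi y)) Dc) => [y|y]; last first.
    by apply: mem; exact: clamp_itv.
  have cc := @continuous_clamp _ lo hi y.
  have h1 : x - al * clamp lo hi z @[z --> y] --> x - al * clamp lo hi y.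
    by apply: cvgB; [exact: cvg_cst|apply: cvgM; [exact: cvg_cst|exact: cc]].
  have h2 : clamp lo hi z @[z --> y] --> clamp lo hi y by exact: cc.
  exact: cvg_pair h1 h2.
have E1 y : (D \_ (interior E)) (P x y) = (psi \_ `]lo, hi[%classic) y.
  rewrite !patchE; have -> : (P x y \in (interior E : set (R * R))) = (y \in `]lo, hi[%classic).
    apply/idP/idP; rewrite !inE (interior_sorted H so).
      move=> /(openE_sorted H so)[_]; rewrite /inside unshearK /unshear /= in_itv /= /lo /hi.
      rewrite minEle maxEle; case: ifPn; nra.
    rewrite /= in_itv /= => ylh; apply/(openE_sorted H so); rewrite unshearK; split=> //.
    rewrite /inside unshearK /unshear /=; move: ylh; rewrite /lo /hi.
    rewrite minEle maxEle; case: ifPn => bu ylh; first by rewrite mulr_gt0//; lra.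
    by rewrite nmulr_rgt0; lra.
  case: ifPn => //; rewrite inE /= in_itv /= => /andP[y1 y2].
  by rewrite /psi clamp_id// !ltW.
under eq_integral do rewrite E1.
rewrite integral_oo//; congr EFin.
have [h1 h2] := itg_affine (bpath x) (upath x) psic.
have fE : fibre x = itg 0 1 (fun t => psi (bpath x + t * (upath x - bpath x)) * (upath x - bpath x)).
  apply: eq_itg => t t01; rewrite /psi clamp_id//.
  rewrite /lo /hi minEle maxEle; case: ifPn => bu; nra.
rewrite fE; case: sg1 => sgE; move: ub; rewrite sgE ?mul1r ?mulN1r => ub; rewrite /lo /hi.
  by rewrite min_l ?max_r ?h1//; lra.
by rewrite min_r ?max_l ?h2//; lra.
Qed.

Let fibre_continuous : exists2 F, continuous F & forall x, l <= x <= r -> F x = fibre x.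
Proof.
pose q (p : R * R) := pt (clamp l r p.1) (clamp 0 1 p.2).
have lr : l <= r by have := lm; have := mr; lra.
exists (fun x => itg 0 1 (fun t => D (q (x, t)) * (upath (clamp l r x) - bpath (clamp l r x)))).
  have cl : continuous (fun p : R * R => clamp l r p.1).
    by move=> p; apply: (@continuous_comp _ _ _ fst (clamp l r)); [exact: cvg_fst|exact: continuous_clamp].
  have ct : continuous (fun p : R * R => clamp 0 1 p.2 : R).
    by move=> p; apply: (@continuous_comp _ _ _ snd (clamp 0 1)); [exact: cvg_snd|exact: continuous_clamp].
  have cu : continuous (fun p : R * R => upath (clamp l r p.1)).
    by move=> p; apply: (@continuous_comp _ _ _ (fun p : R * R => clamp l r p.1) upath); [exact: cl|exact: uc].
  have cb : continuous (fun p : R * R => bpath (clamp l r p.1)).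
    by move=> p; apply: (@continuous_comp _ _ _ (fun p : R * R => clamp l r p.1) bpath); [exact: cl|exact: bc].
  pose y (p : R * R) := bpath (clamp l r p.1) + clamp 0 1 p.2 * (upath (clamp l r p.1) - bpath (clamp l r p.1)).
  have cy : continuous y.
    by move=> p; apply: cvgD; [exact: cb|apply: cvgM; [exact: ct|apply: cvgB; [exact: cu|exact: cb]]].
  have cq : continuous q.
    move=> p; have h1 : clamp l r p'.1 - al * y p' @[p' --> p] --> clamp l r p.1 - al * y p.
      by apply: cvgB; [exact: cl|apply: cvgM; [exact: cvg_cst|exact: cy]].
    have h2 : y p' @[p' --> p] --> y p by exact: cy.
    exact: cvg_pair h1 h2.
  apply: (itg_param_continuous (f := fun p => D (q p) * (upath (clamp l r p.1) - bpath (clamp l r p.1)))).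
  move=> p; apply: cvgM; last by apply: cvgB; [exact: cu|exact: cb].
  apply: (cin_comp Dc cq) => p'; apply: slab_mem; apply: clamp_itv => //; exact: ler01.
move=> x xlr; apply: eq_itg => t t01; rewrite /q /= !clamp_id//.
Qed.

Let integral_region :
  (\int[mu2]_(p in (interior E : set (mR * mR))) (D p)%:E = (sg * itg l r fibre)%:E)%E.
Proof.
have lr : l <= r by have := lm; have := mr; lra.
have [M1 M1P] := cin_bounded (ct_compact H) Dc.
have [M2 [_ M2P]] := compact_bounded (ct_compact H).
pose M := Order.max M1 (`|M2| + 1).
have DU : cin (interior E) D.
  move=> p Up; have := Dc (interior_subset Up); apply: cvg_trans.
  apply: cvg_app => S h.
  have h2 : \forall q \near p, E q -> S q := h.
  have h3 : \forall q \near p, interior E q -> S q.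
    by apply: filterS h2 => q qS /interior_subset; exact: qS.
  exact: h3.
have UM p : interior E p -> `|p.1| <= M /\ `|p.2| <= M.
  move=> /interior_subset Ep; have := M2P (`|M2| + 1).
  rewrite (le_lt_trans (ler_norm M2)) ?ltrDl// => /(_ isT _ Ep).
  rewrite /Num.norm /= ge_max => /andP[h1 h2].
  by split; rewrite le_max; apply/orP; right.
have DM p : interior E p -> `|D p| <= M.
  by move=> /interior_subset /M1P h; rewrite le_max h.
rewrite (shear_fubini al (@open_interior _ E) UM DU DM).
have [F Fc FE] := fibre_continuous.
have sFc : continuous (fun x => sg * F x) by move=> x; apply: cvgM; [exact: cvg_cst|exact: Fc].
rewrite -(eq_itg (f := F) (g := fibre)); last exact: FE.
rewrite -itgZ; last exact: continuous_subspaceT.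
rewrite -integral_oo//; apply: eq_integral => x _; rewrite patchE.
case: ifPn; rewrite ?inE /= ?in_itv /=.
  move=> xlr; rewrite integral_fibre// FE//; have [? ?] := andP xlr; rewrite !ltW//.
move=> xlr; rewrite -[RHS]/(0%E); apply: integral0_eq => y _; rewrite patchE ifF//.
apply/negbTE/negP; rewrite inE (interior_sorted H so) => /(openE_sorted H so)[].
rewrite unshearK => h _; move/negP: xlr; apply.
by rewrite ?inE /= ?in_itv.
Qed.

Section Arcs.
Variable c : 'I_3 -> arc R.
Hypothesis ic : forall i, edge_arc e i (c i).
Hypothesis cinc : forall i, inc al (c i).

Let i12 : i1 != i2.
Proof.
apply/eqP => ii; have := so_2 so; rewrite -ii => sp.
by have [h _] := span_unique sp (so_1 so); have := lm; rewrite h ltxx.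
Qed.

Let ends i u v : xspan e al i u v -> X (apt (c i) (alo (c i))) = u /\ X (apt (c i) (ahi (c i))) = v.
Proof. by move=> sp; have := span_unique (inc_span H (ic i) (@cinc i)) sp. Qed.

(** Green's formula on the slabs over [[l, m]] and [[m, r]]: the side at [m] occurs with opposite
    signs, and those at [l] and [r] have length zero. *)
Let green_inc :
  sg * itg l r fibre = \sum_i kap iL sg i * lint (c i) g1 a21 a22.
Proof.
have lm' := lm; have mr' := mr; have lr : l < r by lra.
pose dF i x := gslope al (c i) (clamp (X (apt (c i) (alo (c i)))) (X (apt (c i) (ahi (c i)))) x).
have dFc i : continuous (dF i).
  by move=> x; exact: (gslope_continuous H (ic i) (@cinc i)).
have [el er] := ends (so_L so); have [e1l e1r] := ends (so_1 so); have [e2l e2r] := ends (so_2 so).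
have [F Fc FE] := fibre_continuous.
have -> : itg l r fibre = itg l m fibre + itg m r fibre.
  rewrite -!(eq_itg (f := F) (g := fibre)); [|move=> x xx; apply: FE; lra..].
  by apply: itg_split => //; lra.
have ud a b (x : R) : l <= a -> b <= r -> a < x < b -> is_derive x 1 upath (dF iL x).
  move=> la br xab; rewrite /dF el er clamp_id; last lra.
  have xlr : l < x < r by lra.
  have := gy_derive H (ic iL) (@cinc iL) (x := x); rewrite el er => /(_ xlr).
  by apply: is_derive_near; apply: filterS (clamp_near xlr) => y yE; rewrite /upath /= yE.
have b1d (x : R) : l < x < m -> is_derive x 1 bpath (dF i1 x).
  move=> xlm; rewrite /dF e1l e1r clamp_id; last lra.
  have := gy_derive H (ic i1) (@cinc i1) (x := x); rewrite e1l e1r => /(_ xlm).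
  apply: is_derive_near; apply: filterS (clamp_near xlm) => y yE.
  by rewrite bpathE1// -yE clamp_itv// ltW.
have b2d (x : R) : m < x < r -> is_derive x 1 bpath (dF i2 x).
  move=> xmr; rewrite /dF e2l e2r clamp_id; last lra.
  have := gy_derive H (ic i2) (@cinc i2) (x := x); rewrite e2l e2r => /(_ xmr).
  apply: is_derive_near; apply: filterS (clamp_near xmr) => y yE.
  by rewrite (bpathE2 so)// -yE clamp_itv// ltW.
have mem a b : l <= a -> b <= r -> forall x t, a <= x <= b -> 0 <= t <= 1 ->
    E (P x (bpath x + t * (upath x - bpath x))).
  by move=> la br x t xab; apply: slab_mem; lra.
have S1 := green_slab lm uc bc (dFc iL) (dFc i1) (fun x => ud l m x (lexx l) (ltW mr')) b1d
  (mem l m (lexx l) (ltW mr')) g1C g2C.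
have S2 := green_slab mr uc bc (dFc iL) (dFc i2) (fun x => ud m r x (ltW lm') (lexx r)) b2d
  (mem m r (ltW lm') (lexx r)) g1C g2C.
rewrite /fibre /D S1 S2.
have [pl pr] := paths_ends so.
have side0 x : upath x = bpath x -> slab_side al upath bpath g1 a21 a22 x = 0.
  move=> ux; rewrite /slab_side.
  have -> : (fun t => g1 (pt x t) * ((a22 (pt x t) - al * a21 (pt x t)) * (upath x - bpath x)))
      = cst 0 by apply/funext => t; rewrite ux subrr !mulr0.
  by rewrite /itg /Rintegral integral0.
rewrite (side0 l pl) (side0 r pr).
have LL : lint (c iL) g1 a21 a22 = slab_graph al l m g1 a21 a22 upath (dF iL) +
    slab_graph al m r g1 a21 a22 upath (dF iL).
  have hx : X (apt (c iL) (alo (c iL))) <= m <= X (apt (c iL) (ahi (c iL))) by rewrite el er; lra.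
  have := slab_graph_split (ic iL) (@cinc iL) (F := upath) (dF := dF iL) hx.
  rewrite el er; apply; first by move=> x; exact: upathE.
  by move=> x xlr; rewrite /dF el er clamp_id.
have L1 : lint (c i1) g1 a21 a22 = slab_graph al l m g1 a21 a22 bpath (dF i1).
  have := slab_graph_lint (ic i1) (@cinc i1) (F := bpath) (dF := dF i1).
  rewrite e1l e1r; apply; first by move=> x; exact: bpathE1.
  by move=> x xlr; rewrite /dF e1l e1r clamp_id.
have L2 : lint (c i2) g1 a21 a22 = slab_graph al m r g1 a21 a22 bpath (dF i2).
  have := slab_graph_lint (ic i2) (@cinc i2) (F := bpath) (dF := dF i2).
  rewrite e2l e2r; apply; first by move=> x; exact: bpathE2 so x.
  by move=> x xlr; rewrite /dF e2l e2r clamp_id.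
rewrite (bigD1 iL)//= (bigD1 i1)/=; last by rewrite eq_sym (so_L1 so).
rewrite (bigD1 i2)/=; last by rewrite eq_sym (so_L2 so) eq_sym i12.
rewrite big1 ?addr0; last first.
  move=> i /andP[/andP[n0 n1] n2].
  by case: (so_all so i) => [iE|[iE|iE]]; move: n0 n1 n2; rewrite iE eqxx.
rewrite /kap eqxx ![_ == iL]eq_sym (negbTE (so_L1 so)) (negbTE (so_L2 so)) LL L1 L2.
ring.
Qed.

Lemma green_sorted :
  Rintegral mu2 (interior E : set (mR * mR)) D = \sum_i kap iL sg i * lint (c i) g1 a21 a22.
Proof. by rewrite /Rintegral integral_region /= green_inc. Qed.

End Arcs.

End Sorted.

(** Each outward arc is travelled in the direction of increasing abscissa, reversed if necessary;
    reversal changes the sign of its integral, which is the sign [kap] in [green_sorted]. *)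
Theorem green_triangle (c : 'I_3 -> arc R) : (forall i, edge_arc e i (c i)) ->
  (forall i, outward E (c i)) ->
  Rintegral mu2 (interior E : set (mR * mR)) (fun p => a11 p * a22 p - a12 p * a21 p) =
  \sum_i lint (c i) g1 a21 a22.
Proof.
move=> ic oc; have [iL [i1 [i2 [l [m [r so]]]]]] := sorted_edges H.
have [sg sg1 sgP] := paths_sign H so.
pose c' i := if kap iL sg i == 1 then c i else arc_rev (c i).
have [_ a21c a22c] := g2C; have g1c := wC1_cin g1C.
have key i := outward_inc H so sg1 sgP (ic i) (oc i).
have n1 : (-1 == 1 :> R) = false by apply/eqP; lra.
have ic' i : edge_arc e i (c' i).
  by rewrite /c'; case: ifP => _ //; exact: edge_arc_rev.
have cinc' i : inc al (c' i).
  by rewrite /c'; case: (key i) => -[-> ?]; rewrite ?eqxx ?n1.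
have := green_sorted so sg1 sgP ic' cinc'; rewrite /slab_det => ->.
apply: eq_bigr => i _; rewrite /c'; case: (key i) => -[-> _]; rewrite ?eqxx ?n1 ?mul1r//.
by rewrite (lint_rev (ic i).1 (edge_arc_sub (ic i)))// mulN1r opprK.
Qed.

End GreenTriangle.

(** * Elements and edges of the mesh *)

Section Polynomials.
Context {R : realType}.
Implicit Types (D : set (R * R)) (f : R * R -> R).

Lemma wC2e_sum (I : Type) D (s : seq I) (P : pred I) (f : I -> R * R -> R) :
  (forall i, wC2e D (f i)) -> wC2e D (fun p => \sum_(i <- s | P i) f i p).
Proof.
move=> fC; elim: s => [|i s IH].
  by rewrite (_ : (fun p => _) = cst 0); [exact: wC2e_cst|apply/funext => p; rewrite big_nil].
have -> : (fun p => \sum_(j <- i :: s | P j) f j p) =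
    if P i then (fun p => f i p + \sum_(j <- s | P j) f j p)
    else (fun p => \sum_(j <- s | P j) f j p).
  by apply/funext => p; rewrite big_cons; case: ifP.
by case: ifP => _ //; exact: wC2eD.
Qed.

Lemma wC2eX D f n : wC2e D f -> wC2e D (fun p => f p ^+ n).
Proof.
move=> fC; elim: n => [|n IH]; first exact: wC2e_cst.
have -> : (fun p => f p ^+ n.+1) = (fun p => f p * f p ^+ n).
  by apply/funext => p; rewrite exprS.
exact: wC2eM.
Qed.

End Polynomials.

Section ArcEnds.
Context {R : realType}.
Variables (E : set (R * R)) (e : 'I_3 -> R -> R * R) (al k : R).
Hypothesis H : curved_tri E e al k.

Lemma ct_shear_inj i (p q : R * R) : (e i @` `[0, 1]%classic) p -> (e i @` `[0, 1]%classic) q ->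
  shear al p = shear al q -> p = q.
Proof.
move=> [s _ <-] [t _ <-] st; have := ct_chord H i s t; rewrite st subrr normr0.
rewrite pmulr_rle0 ?(ct_k H)// => h; apply/eqP; rewrite -subr_eq0; apply/eqP.
by apply: enorm_eq0; apply/eqP; rewrite eq_le h enorm_ge0.
Qed.

(** Along an increasing arc the ends have the extreme abscissas, as do the ends of [e i], and a
    point of the edge is determined by its abscissa. *)
Lemma edge_arc_ends i c : edge_arc e i c ->
  (apt c (alo c) = e i 0 /\ apt c (ahi c) = e i 1) \/
  (apt c (alo c) = e i 1 /\ apt c (ahi c) = e i 0).
Proof.
move=> ic.
have key c' : edge_arc e i c' -> inc al c' ->
    (apt c' (alo c') = e i 0 /\ apt c' (ahi c') = e i 1) \/
    (apt c' (alo c') = e i 1 /\ apt c' (ahi c') = e i 0).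
  move=> ic' ci; have ab := ltW (arc_lohi ic'.1); have [_ im] := ic'.
  have ma : (e i @` `[0, 1]%classic) (apt c' (alo c')).
    by rewrite -im; exists (alo c') => //; rewrite /= in_itv /= lexx.
  have mb : (e i @` `[0, 1]%classic) (apt c' (ahi c')).
    by rewrite -im; exists (ahi c') => //; rewrite /= in_itv /= lexx ab.
  have m0 : (e i @` `[0, 1]%classic) (e i 0) by exists 0 => //; rewrite /= in_itv /= lexx ler01.
  have m1 : (e i @` `[0, 1]%classic) (e i 1) by exists 1 => //; rewrite /= in_itv /= lexx ler01.
  have [_ [[h0 h1]|[h1 h0]]] := inc_span H ic' ci.
    by left; split; apply: (ct_shear_inj (i := i)).
  by right; split; apply: (ct_shear_inj (i := i)).
have [ci|ci] := arc_dichotomy H ic; first exact: key.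
have := key _ (edge_arc_rev ic) ci; rewrite /= !opprK.
by case=> -[-> ->]; auto.
Qed.

End ArcEnds.

Section Elements.
Context {R : realType}.
Variables (Omega : set (R * R)) (Th : triangulation R).
Hypothesis hTh : exact_conforming Omega Th.
Implicit Types (K : Th) (i j : 'I_3).

Definition epar K i := elt_param Th (tri_map K) i.

Lemma epar_edge K i : epar K i @` `[0, 1]%classic = edge K i.
Proof. exact: elt_param_edge. Qed.

Lemma epar0 K i : epar K i 0 = vertex K (i + 1).
Proof.
by rewrite /epar /elt_param /ref_param clamp_id ?lexx ?ler01// subr0 scale1r scale0r addr0.
Qed.

Lemma epar1 K i : epar K i 1 = vertex K (i + 2%:R).
Proof.
by rewrite /epar /elt_param /ref_param clamp_id ?lexx ?ler01// subrr scale1r scale0r add0r.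
Qed.

Lemma elt_curved_tri K : exists al k, curved_tri (elt K) (epar K) al k.
Proof.
have nd := mesh_ref hTh; have C2 := mesh_C2 hTh K.
have [_ [B [b [Bu [c c1 FPhi]]]]] := mesh_curved hTh K.
(* The curved edge if there is one; otherwise all edges are straight and 0 is an arbitrary
   choice. *)
have [i0 i0P] : exists i0, forall i, i != i0 -> is_segment (edge K i).
  have [[i0 h0]|h] := pselect (exists i, ~ is_segment (edge K i)).
    exists i0 => i ii; apply: contrapT => hi; move/eqP: ii; apply.
    exact: (mesh_one_curved hTh hi h0).
  by exists 0 => i _; apply: contrapT => hi; apply: h; exists i.
have straight i : i != i0 -> forall t, 0 <= t <= 1 ->
    epar K i t = (1 - t) *: epar K i 0 + t *: epar K i 1.
  move=> ii t t01; rewrite epar0 epar1 -(mesh_straight_affine hTh (i0P i ii)) ?in_itv//.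
  by rewrite /epar /elt_param /ref_param clamp_id.
have [al [k [k0 chord]]] := elt_param_chord nd C2 Bu c1 FPhi straight.
exists al, k; split => //.
- by have := elt_compact nd C2 Bu FPhi.
- by move=> i; have := elt_param_continuous nd C2 Bu FPhi (i := i).
- by move=> i t; exists (ref_param Th i t) => //; exact: ref_param_T.
- by move=> i s t; have := elt_param_inj nd C2 Bu c1 FPhi (i := i) (s := s) (t := t).
- by move=> i j s t; have := elt_param_meet nd C2 Bu c1 FPhi (i := i) (j := j) (s := s) (t := t).
- by move=> i; exact: elt_param_end.
- by have := elt_minus_bdry_open nd C2 Bu c1 FPhi.
- by have := elt_minus_bdry_nonempty nd C2 Bu c1 FPhi.
Qed.

Lemma elt_closed K : closed (elt K).
Proof.
have [al [k H]] := elt_curved_tri K.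
by apply: compact_closed; [exact: norm_hausdorff|exact: ct_compact H].
Qed.

Lemma elt_interior K : interior (elt K) = elt K `\` \bigcup_i edge K i.
Proof.
have [al [k H]] := elt_curved_tri K.
have [iL [i1 [i2 [l [m [r so]]]]]] := sorted_edges H.
by rewrite (interior_sorted H so); under eq_bigcupr do rewrite epar_edge.
Qed.

Lemma edge_sub K i : edge K i `<=` elt K.
Proof.
rewrite -epar_edge => _ [t _ <-]; exists (ref_param Th i t) => //.
by apply: ref_param_T; exact: mesh_ref hTh.
Qed.

(** A point of the reference triangle moved slightly towards the barycentre [z] has positive
    barycentric coordinates, and the element map is Lipschitz. This gives sense to limits from the
    interior at every point of the element. *)
Lemma elt_closure_interior K : elt K `<=` closure (interior (elt K)).
Proof.
have nd := mesh_ref hTh; have C2 := mesh_C2 hTh K.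
have [_ [B [b [Bu [c c1 FPhi]]]]] := mesh_curved hTh K.
have [al [k H]] := elt_curved_tri K.
have [iL [i1 [i2 [l [m [r so]]]]]] := sorted_edges H.
move=> _ [p Tp <-]; rewrite (interior_sorted H so).
pose z := \sum_(i < 3) 3^-1 *: tri_vert Th i.
have lz i : lam Th i z = 3^-1.
  by rewrite (lam_unique nd (l := fun=> 3^-1)) // big_ord3; field.
pose q (t : R) : R * R := (1 - t) *: p + t *: z.
have qlam t i : lam Th i (q t) = (1 - t) * lam Th i p + t * 3^-1.
  have -> : q t = \sum_j ((1 - t) * lam Th j p + t * 3^-1) *: tri_vert Th j.
    rewrite /q /z {1}(lam_bary nd p) !big_ord3.
    by apply: prod_ext; rewrite !crdE; ring.
  rewrite (lam_unique nd (l := fun j => (1 - t) * lam Th j p + t * 3^-1))//.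
  rewrite big_split /= -mulr_sumr lam_sum big_ord3; by field.
have Tp' := (ref_triangleP nd p).1 Tp.
have qT t : 0 <= t <= 1 -> ref_triangle Th (q t).
  move=> /andP[t0 t1]; apply/(ref_triangleP nd) => i; rewrite qlam addr_ge0 ?mulr_ge0 ?subr_ge0//.
have qin t : 0 < t <= 1 -> (elt K `\` \bigcup_i (epar K i @` `[0, 1]%classic)) (tri_map K (q t)).
  move=> /andP[t0 t1]; apply/(elt_minus_bdry nd C2 Bu c1 FPhi); exists (q t) => // i.
  by rewrite qlam ltr_wpDl// ?mulr_ge0 ?subr_ge0// mulr_gt0.
have [C C0 CF] := elt_lip nd C2 Bu FPhi.
move=> U /nbhs_ballP[d /= d0 dU].
(* At most 1, and small enough for the Lipschitz bound to give a distance below [d]; the added 1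
   covers [z = p]. *)
pose t := Order.min 1 (d / (2 * C * (enorm (z - p) + 1))).
have e1 : 0 < enorm (z - p) + 1 by rewrite ltr_wpDl// enorm_ge0.
have den : 0 < 2 * C * (enorm (z - p) + 1) by rewrite !mulr_gt0.
have t0 : 0 < t by rewrite lt_min ltr01 divr_gt0.
have t1 : t <= 1 by rewrite ge_min lexx.
exists (tri_map K (q t)); split; first by apply: qin; rewrite t0.
apply: dU; rewrite -ball_normE /= distrC.
have h : enorm (tri_map K (q t) - tri_map K p) < d.
  apply: le_lt_trans (CF _ _ (qT t _) Tp) _; first by rewrite (ltW t0).
  have -> : q t - p = t *: (z - p) by apply: prod_ext; rewrite /q !crdE; ring.
  rewrite enormZ (gtr0_norm t0).
  have td : t * (2 * C * (enorm (z - p) + 1)) <= d by rewrite -ler_pdivlMr// ge_min lexx orbT.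
  have := enorm_ge0 (z - p); nra.
by rewrite /Num.norm /= gt_max !(le_lt_trans _ h)// ?normr1_enorm ?normr2_enorm.
Qed.

Lemma in_PK_wC2e k K v : in_PK k K v -> wC2e (elt K) v.
Proof.
move=> [a aP]; have nd := mesh_ref hTh; have C2 := mesh_C2 hTh K.
have [_ [B [b [Bu [c c1 FPhi]]]]] := mesh_curved hTh K.
apply: (elt_wC2 nd C2 Bu c1 FPhi _ aP).
apply: wC2e_sum => i; apply: wC2e_sum => j.
apply: wC2eM; [apply: wC2eM; [exact: wC2e_cst|]|]; apply: wC2eX.
  exact: wC2e_fst.
exact: wC2e_snd.
Qed.

End Elements.

(** * The boundary curve *)

Section BoundaryCurve.
Context {R : realType}.
Variables (Omega : set (R * R)) (xb : R -> R * R) (L : R).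
Hypothesis hOmega : C2_domain Omega xb L.

Definition xarc (a b : R) : arc R := Arc xb (tangent xb) a b.

Lemma xarc_ok a b : a < b -> arc_ok (xarc a b).
Proof.
move=> ab; have C := dom_C2 hOmega; have [d0 [_ c0]] := C 0; have [d1 [_ c1]] := C 1.
have dd (f : R -> R) (s : R) : (forall s, derivable f s 1) -> is_derive s 1 f (derive1 f s).
  by move=> df; rewrite derive1E; exact: DeriveDef.
have E0 : coord 0 \o xb = (fun s => (xb s).1) by [].
have E1 : coord 1 \o xb = (fun s => (xb s).2) by [].
have cd (f : R -> R) : (forall s, derivable f s 1) -> continuous f.
  by move=> df s; apply: differentiable_continuous; apply/derivable1_diffP; exact: df.
have [[_ [h0 _]] [_ [h1 _]]] := (C 0, C 1).
have cd0 := cd _ h0; have cd1 := cd _ h1.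
split; first exact: ab.
- by move=> s; rewrite -E0; exact: dd d0.
- by move=> s; rewrite -E1; exact: dd d1.
- exact: cd0.
- exact: cd1.
- move=> s; have := dom_arclength hOmega s => h.
  by have := enorm_sqr (tangent xb s); rewrite h expr1n /dot !expr2 => <-.
Qed.

Lemma xb_continuous : continuous xb.
Proof.
have := arc_continuous (xarc_ok (ltr01 : 0 < 1 :> R)); exact.
Qed.

(** The parameter is brought into [[0, L]] by subtracting [floor (s / L)] periods. *)
Lemma frontier_xb s : frontier Omega (xb s).
Proof.
have L0 := dom_length hOmega.
have per (n : int) : xb (s + n%:~R * L) = xb s.
  elim/int_ind: n => [|n IH|n IH]; first by rewrite mul0r addr0.
    by rewrite -[RHS]IH -[RHS](dom_periodic hOmega); congr xb; rewrite -addn1 PoszD intrD mulrDl mul1r addrA.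
  rewrite -[LHS](dom_periodic hOmega) -[RHS]IH; congr xb.
  have -> : (- (n.+1%:Z))%:~R = (- n%:Z)%:~R - 1 :> R by rewrite -addn1 PoszD opprD intrD intrN.
  by rewrite mulrBl mul1r addrA subrK.
rewrite -(dom_boundary hOmega) -(per (- Num.floor (s / L))).
exists (s + (- Num.floor (s / L))%:~R * L) => //.
rewrite /= in_itv /= intrN.
have := floor_itv (s / L) => /andP[f1 f2].
rewrite ler_pdivlMr// in f1; rewrite ltr_pdivrMr// intrD in f2.
by apply/andP; split; lra.
Qed.

Lemma frontier_param p : frontier Omega p -> exists2 s, 0 <= s <= L & xb s = p.
Proof. by rewrite -(dom_boundary hOmega) => -[s]; rewrite /= in_itv /=; exists s. Qed.

Lemma frontier_closed : closed (frontier Omega).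
Proof.
rewrite -(dom_boundary hOmega); apply: compact_closed; first exact: norm_hausdorff.
apply: continuous_compact; last exact: segment_compact.
exact: continuous_subspaceT xb_continuous.
Qed.

Lemma near_line (S : set (R * R)) (p d : R * R) : nbhs p S -> \forall t \near 0^'+, S (p + t *: d).
Proof.
move=> Sp; have line : p + t *: d @[t --> (0 : R)] --> p.
  rewrite -{2}[p]addr0 -(scale0r d); apply: cvgD; first exact: cvg_cst.
  by apply: cvgZr_tmp; exact: cvg_id.
have h : \forall t \near (0 : R), S (p + t *: d) := line _ Sp.
by apply: filterS h => t h _.
Qed.

Lemma frontier_not_interior p : frontier Omega p -> ~ interior (closure Omega) p.
Proof.
move=> /frontier_param[s _ <-] ci; have h1 := near_line (normal xb s) ci.
by have [t [? [_]]] := filter_ex (filterI h1 (dom_outward hOmega s)).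
Qed.

Lemma interior_closure_Omega p : interior (closure Omega) p -> Omega p.
Proof.
move=> ci; apply: contrapT => nO; apply: (frontier_not_interior (p := p)) => //.
split; first exact: interior_subset ci.
by move=> /interior_subset.
Qed.

Lemma closure_Omega p : closure Omega p -> ~ frontier Omega p -> Omega p.
Proof.
move=> cp nf; apply: contrapT => nO; apply: nf; split => //; by move=> /interior_subset.
Qed.

Lemma xb_shift_inj s0 s t : s0 < s < s0 + L -> s0 < t < s0 + L -> 0 <= s0 < L ->
  xb s = xb t -> s = t.
Proof.
move=> hs ht h0; have inj := dom_simple hOmega.
have red u : s0 < u < s0 + L -> exists2 v, v \in `[0, L[ & xb v = xb u /\ (v = u \/ v = u - L).
  move=> hu; have [uL|uL] := ltP u L.
    by exists u; [rewrite in_itv /=; lra|auto].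
  exists (u - L); first by rewrite in_itv /=; lra.
  by split; [rewrite -(dom_periodic hOmega) subrK|right].
have [s' s'I [es' s'E]] := red s hs; have [t' t'I [et' t'E]] := red t ht.
rewrite -es' -et' => /(inj _ _ s'I t'I).
by case: s'E => ->; case: t'E => ->; lra.
Qed.

Section BoundaryArc.
Variables (E : set (R * R)) (e : 'I_3 -> R -> R * R) (al k : R) (i : 'I_3).
Hypothesis H : curved_tri E e al k.
Notation F := (e i @` `[0, 1]%classic).
Hypothesis Fbd : F `<=` frontier Omega.

(** Otherwise the sheared abscissa along [xb] would be continuous, periodic and injective over one
    period, although it takes the value [v] halfway between [f 0] and [f m] both before and after
    [m]. *)
Let off_point : exists2 s0, 0 <= s0 < L & ~ F (xb s0).
Proof.
have L0 := dom_length hOmega.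
apply: contrapT => h.
have hF s : 0 <= s < L -> F (xb s) by move=> sL; apply: contrapT => nF; apply: h; exists s.
pose f s := shear al (xb s).
have fc : continuous f.
  by move=> s; apply: (@continuous_comp _ _ _ xb (shear al)); [exact: xb_continuous|exact: continuous_shear].
have fi s t : 0 <= s < L -> 0 <= t < L -> f s = f t -> s = t.
  move=> hs ht st; apply: (dom_simple hOmega); rewrite ?in_itv//.
  by apply: (ct_shear_inj H (i := i)) => //; exact: hF.
have fL : f L = f 0 by rewrite /f -[L in LHS]add0r (dom_periodic hOmega).
pose m := L / 2; pose v := (f 0 + f m) / 2.
have m0 : 0 < m < L by rewrite /m; lra.
have f0m : f 0 <> f m by move=> /fi; rewrite lexx L0 => /(_ isT ltac:(lra)); lra.
have vb : Order.min (f 0) (f m) <= v <= Order.max (f 0) (f m).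
  by rewrite /v minEle maxEle; case: ifPn; rewrite -?ltNge; lra.
have wfc (A : set R) : {within A, continuous f} by exact: continuous_subspaceT.
have [s1 s1I s1v] := @IVT _ f 0 m v ltac:(lra) (wfc _) vb.
have [|s2 s2I s2v] := @IVT _ f m L v ltac:(lra) (wfc _).
  by rewrite fL minC maxC.
rewrite in_itv /= in s1I; rewrite in_itv /= in s2I.
have n1 : s1 <> m by move=> s1m; move: s1v f0m; rewrite s1m /v; lra.
have n2 : s2 <> L by move=> s2L; move: s2v f0m; rewrite s2L fL /v; lra.
have [h1 h2] := andP s1I; have [h3 h4] := andP s2I.
have : s1 = s2.
  apply: fi; [lra| |by rewrite s1v s2v].
  by apply/andP; split; [lra|rewrite lt_neqAle h4 andbT; exact/eqP].
lra.
Qed.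

(** Parameters are counted from a point [xb s0] off the edge, so that the edge does not straddle the
    start of the period. Its set of parameters is compact, and it is an interval because the edge is
    connected: a missing value in between would split the edge into two disjoint closed parts. *)
Lemma boundary_arc : exists s0 a b, [/\ 0 <= s0 < L, s0 < a, a < b, b < s0 + L &
  forall s, s0 <= s <= s0 + L -> F (xb s) <-> a <= s <= b].
Proof.
have [s0 s0L nF] := off_point; have L0 := dom_length hOmega.
pose S := [set s | s0 <= s <= s0 + L /\ F (xb s)].
have strict s : S s -> s0 < s < s0 + L.
  move=> [/andP[h1 h2] Fs]; rewrite !lt_neqAle h1 h2 !andbT; apply/andP; split; apply/eqP => E0.
    by apply: nF; rewrite E0.
  by apply: nF; rewrite -(dom_periodic hOmega) -E0.
have surj p : F p -> exists2 s, S s & xb s = p.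
  move=> Fp; have [s sL sp] := frontier_param (Fbd Fp).
  have [h|h] := leP s0 s; first by exists s => //; split; [lra|rewrite sp].
  exists (s + L); last by rewrite (dom_periodic hOmega).
  by split; [lra|rewrite (dom_periodic hOmega) sp].
have inj s t : S s -> S t -> xb s = xb t -> s = t.
  by move=> /strict hs /strict ht; exact: xb_shift_inj hs ht s0L.
have cF : closed F.
  apply: compact_closed; first exact: norm_hausdorff.
  apply: continuous_compact; last exact: segment_compact.
  by apply: continuous_subspaceT; exact: (ct_cont H).
have cS u v : s0 <= u -> v <= s0 + L -> compact [set s | u <= s <= v /\ F (xb s)].
  move=> hu hv.
  have -> : [set s | u <= s <= v /\ F (xb s)] = `[u, v]%classic `&` xb @^-1` F.
    by apply/seteqP; split=> s []; rewrite /= ?in_itv.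
  apply: compact_closedI; first exact: segment_compact.
  by apply: closed_comp => // s _; exact: xb_continuous.
have cSS : compact S by exact: cS.
have S0 : S !=set0.
  have F0 : F (e i 0) by exists 0 => //; rewrite /= in_itv /= lexx ler01.
  by have [s Ss _] := surj _ F0; exists s.
have wid (A : set R) : {within A, continuous (fun x : R => x)}.
  by apply: continuous_subspaceT => x; exact: cvg_id.
have [b] := compact_EVT_max S0 cSS (wid S); rewrite inE => Sb bmax.
have [a] := compact_EVT_min S0 cSS (wid S); rewrite inE => Sa amin.
have {}bmax s : S s -> s <= b by move=> Ss; apply: bmax; rewrite inE.
have {}amin s : S s -> a <= s by move=> Ss; apply: amin; rewrite inE.
have conv m : a <= m <= b -> F (xb m).
  move=> mab; apply: contrapT => nFm.
  have ha := strict _ Sa; have hb := strict _ Sb.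
  pose C1 := xb @` [set s | s0 <= s <= m /\ F (xb s)].
  pose C2 := xb @` [set s | m <= s <= s0 + L /\ F (xb s)].
  have clos u v : s0 <= u -> v <= s0 + L -> closed (xb @` [set s | u <= s <= v /\ F (xb s)]).
    move=> hu hv; apply: compact_closed; first exact: norm_hausdorff.
    apply: continuous_compact; last exact: cS.
    exact: continuous_subspaceT xb_continuous.
  have c1 : closed C1 by apply: clos; lra.
  have c2 : closed C2 by apply: clos; lra.
  have ec : continuous (e i) by exact: (ct_cont H).
  have SI u v s : s0 <= u -> v <= s0 + L -> u <= s <= v /\ F (xb s) -> S s.
    by move=> hu hv [suv Fs]; split => //; lra.
  have disj p : C1 p -> C2 p -> False.
    move=> [s hs <-] [t ht] ts; have st : t = s.
      by apply: inj ts; [apply: (SI m (s0 + L)) ht; lra|apply: (SI s0 m) hs; lra].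
    by case: hs ht => hs Fs [ht _]; apply: nFm; have <- : s = m by move: ht; rewrite st; lra.
  have cover p : F p -> C1 p \/ C2 p.
    move=> /surj[s [sI Fs] sp]; have [h|h] := leP s m.
      by left; exists s => //; split; [lra|].
    by right; exists s => //; split; [lra|].
  have hcon := @segment_connected R 0 1 (`[0, 1]%classic `&` e i @^-1` C1).
  have Feq : `[0, 1]%classic `&` e i @^-1` C1 = `[0, 1]%classic `&` e i @^-1` (~` C2).
    apply/seteqP; split=> t [tI Ct]; split => //=.
      by move=> C2t; exact: disj Ct C2t.
    by have [//|] := cover (e i t) (ex_intro2 _ _ t tI erefl).
  have [t tI te] := Sb.2.
  have : (`[0, 1]%classic `&` e i @^-1` C1) t.
    rewrite hcon //.
    - have [u uI ue] := Sa.2; exists u; split => //; exists a => //.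
      by split; [lra|exact: Sa.2].
    - exists (e i @^-1` (~` C2)) => //; apply: open_comp; first by move=> ? _; exact: ec.
      exact: closed_openC.
    - exists (e i @^-1` C1) => //; apply: closed_comp => // ? _; exact: ec.
  move=> [_]; rewrite /= te => -[s hs sb].
  have sE : s = b by apply: inj sb => //; apply: (SI s0 m) hs; lra.
  apply: nFm; have <- : b = m by move: hs; rewrite sE => -[]; lra.
  exact: Sb.2.
have ha := strict _ Sa; have hb := strict _ Sb.
(* A single parameter would reduce the edge to one point. *)
have ab : a < b.
  rewrite lt_neqAle amin// andbT; apply/eqP => ab.
  have one p : F p -> p = xb a.
    by move=> /surj[s Ss <-]; congr xb; have := amin s Ss; have := bmax s Ss; lra.
  have e0 : e i 0 = e i 1.
    have F0 : F (e i 0) by exists 0 => //; rewrite /= in_itv /= lexx ler01.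
    have F1 : F (e i 1) by exists 1 => //; rewrite /= in_itv /= lexx ler01.
    exact: etrans (one _ F0) (esym (one _ F1)).
  by have := ct_inj H (i := i) (s := 0) (t := 1); rewrite lexx ler01 lexx => /(_ isT isT e0); lra.
exists s0, a, b; split => //; try lra.
move=> s hs; split => [Fs|]; last exact: conv.
by rewrite amin ?bmax.
Qed.

Lemma boundary_arc_edge s0 a b : 0 <= s0 < L -> s0 < a -> a < b -> b < s0 + L ->
  (forall s, s0 <= s <= s0 + L -> F (xb s) <-> a <= s <= b) -> edge_arc e i (xarc a b).
Proof.
move=> s0L ha ab hb FE; split; first exact: xarc_ok.
apply/seteqP; split=> p.
  by move=> [s]; rewrite /= in_itv /= => sab <-; apply/FE => //; lra.
move=> Fp; have [s sL sp] := frontier_param (Fbd Fp).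
have [s' [s'I s'p]] : exists s', s0 <= s' <= s0 + L /\ xb s' = p.
  have [h|h] := leP s0 s; first by exists s; split => //; lra.
  by exists (s + L); split; [lra|rewrite (dom_periodic hOmega)].
by exists s' => //; rewrite /= in_itv /=; apply/FE => //; rewrite s'p.
Qed.

End BoundaryArc.

End BoundaryCurve.

Section ArcSides.
Context {R : realType}.
Variables (E : set (R * R)) (e : 'I_3 -> R -> R * R) (al k : R).
Hypothesis H : curved_tri E e al k.

Lemma edge_arc_outward i c : edge_arc e i c -> outward E c \/ outward E (arc_rev c).
Proof.
move=> ic; have [iL [i1 [i2 [l [m [r so]]]]]] := sorted_edges H.
have [sg sg1 sgP] := paths_sign H so.
have [ci|ci] := arc_dichotomy H ic.
  by case: (inc_outward H so sg1 sgP ic ci) => -[_ o]; auto.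
by case: (inc_outward H so sg1 sgP (edge_arc_rev ic) ci) => -[_ o]; rewrite ?arc_revK in o; auto.
Qed.

Lemma edge_arc_strict i c s : edge_arc e i c -> alo c < s < ahi c ->
  apt c s <> e i 0 /\ apt c s <> e i 1.
Proof.
have key c' s' : edge_arc e i c' -> inc al c' -> alo c' < s' < ahi c' ->
    apt c' s' <> apt c' (alo c') /\ apt c' s' <> apt c' (ahi c').
  move=> ic ci sab; have k0 := ct_k H; have [h1 h2] := andP sab.
  have m1 := inc_mono H ic ci (s := alo c') (t := s') ltac:(lra) ltac:(lra) ltac:(lra).
  have m2 := inc_mono H ic ci (s := s') (t := ahi c') ltac:(lra) ltac:(lra) ltac:(lra).
  have p1 : 0 < k * (s' - alo c') by rewrite mulr_gt0// subr_gt0.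
  have p2 : 0 < k * (ahi c' - s') by rewrite mulr_gt0// subr_gt0.
  by split=> E0; [rewrite E0 in m1|rewrite E0 in m2]; lra.
move=> ic sab.
suff [n1 n2] : apt c s <> apt c (alo c) /\ apt c s <> apt c (ahi c).
  by have [[<- <-]|[<- <-]] := edge_arc_ends H ic.
have [ci|ci] := arc_dichotomy H ic; first exact: key.
have := key _ (- s) (edge_arc_rev ic) ci; rewrite /= !opprK => /(_ ltac:(lra))[? ?]; split => //.
Qed.

End ArcSides.

(** * Adjacency of elements *)

Section Adjacency.
Context {R : realType}.
Variables (Omega : set (R * R)) (xb : R -> R * R) (L : R) (Th : triangulation R).
Hypothesis hOmega : C2_domain Omega xb L.
Hypothesis hTh : exact_conforming Omega Th.
Implicit Types (K : Th) (i j l : 'I_3) (p : R * R).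
Notation fr := (frontier Omega).

Lemma elt_sub K : elt K `<=` closure Omega.
Proof. by rewrite -(mesh_cover hTh) => p Kp; exists K. Qed.

Lemma interior_elt_Omega K : interior (elt K) `<=` Omega.
Proof.
move=> p Kp; apply: (interior_closure_Omega hOmega).
by move: Kp; apply: filterS; exact: elt_sub.
Qed.

(** Both elements contain in their interiors the points just behind the middle of the arc, opposite
    to its normal. *)
Lemma outward_unique K K' c : arc_ok c -> outward (elt K) c -> outward (elt K') c -> K = K'.
Proof.
move=> ok o1 o2; apply: contrapT => KK'; have ab := arc_lohi ok.
pose s := (alo c + ahi c) / 2; pose d := - arc_normal c s.
have sab : alo c < s < ahi c by rewrite /s; lra.
have dn : dot d (arc_normal c s) < 0.
  have := arc_unit ok s; rewrite /dot /d /arc_normal !crdE; nra.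
have [t [[h1 _] [h2 _]]] := filter_ex (filterI (o1 s d sab dn) (o2 s d sab dn)).
have : (interior (elt K) `&` interior (elt K')) (apt c s + t *: d) by [].
by rewrite (mesh_disjoint hTh)//; exact/eqP.
Qed.

(** Vertex [l] is the last point of edge [l + 1] and the first point of edge [l + 2]. One of these
    edges differs from [i], and distinct edges meet only at ends. *)
Lemma vertex_edge K l i (s : R) : 0 <= s <= 1 -> epar K i s = vertex K l -> s = 0 \/ s = 1.
Proof.
have [al [k H]] := elt_curved_tri hTh K.
have o1 : (l + 1) + 2%:R = l by elim/ord3P: l; rewrite ?ord3E; exact: val_inj.
have o2 : (l + 2%:R) + 1 = l by clear o1; elim/ord3P: l; rewrite ?ord3E; exact: val_inj.
move=> s01; have [E1|n1] := eqVneq i (l + 1).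
  have n2 : i != l + 2%:R by rewrite E1; elim/ord3P: l {o1 o2 E1}.
  rewrite -{1}o2 -epar0 => /(ct_meet H s01 _ n2); apply; by rewrite lexx ler01.
rewrite -{1}o1 -epar1 => /(ct_meet H s01 _ n1); apply; by rewrite lexx ler01.
Qed.

Lemma arc_not_vertex K i c s l : edge_arc (epar K) i c -> alo c < s < ahi c ->
  apt c s <> vertex K l.
Proof.
move=> ic sab; have [al [k H]] := elt_curved_tri hTh K.
have [n0 n1] := edge_arc_strict H ic sab; have [_ im] := ic.
have : arc_img c (apt c s) by exists s => //; rewrite /= in_itv /=; have [? ?] := andP sab; rewrite !ltW.
rewrite im => -[t]; rewrite /= in_itv /= => t01 te sv.
have := vertex_edge (K := K) (l := l) (i := i) t01; rewrite te => /(_ sv).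
by case=> t0; move: te; rewrite t0 => te; [apply: n0|apply: n1].
Qed.

Lemma edge_meet K i j p : i != j -> edge K i p -> edge K j p -> exists l, p = vertex K l.
Proof.
have [al [k H]] := elt_curved_tri hTh K; rewrite -!epar_edge.
move=> ij [s sI <-] [t tI ts]; rewrite /= in_itv /= in sI; rewrite /= in_itv /= in tI.
case: (ct_meet H sI tI ij (esym ts)) => ->; [exists (i + 1)|exists (i + 2%:R)].
  exact: epar0.
exact: epar1.
Qed.

Lemma edge_mid_not_vertex K i : exists2 p, edge K i p & forall l, p <> vertex K l.
Proof.
exists (epar K i 2^-1).
  by rewrite -epar_edge; exists 2^-1 => //; rewrite /= in_itv /= invr_ge0 ler0n invf_le1 ?ler1n.
have h : 0 <= (2^-1 : R) <= 1 by rewrite invr_ge0 ler0n invf_le1 ?ler1n.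
by move=> l /(vertex_edge h)[]; lra.
Qed.

Lemma edge_inj K i j : edge K i = edge K j -> i = j.
Proof.
move=> ij; apply/eqP; apply: contrapT => /negP n.
have [p pi pv] := edge_mid_not_vertex K i.
have [|l pl] := edge_meet (p := p) n pi; first by rewrite -ij.
exact: pv pl.
Qed.

Lemma elt_meet K K' p : K <> K' -> elt K p -> elt K' p ->
  (exists l, p = vertex K l) \/ (exists i j, edge K i p /\ edge K i = edge K' j).
Proof.
move=> /eqP KK' Kp K'p; have pI : (elt K `&` elt K') p by [].
case: (mesh_conforming hTh KK') => [E0|[i [j [E0 _]]]|[i [j [E0 E1]]]]; rewrite E0 in pI.
- by [].
- by left; exists i.
- by right; exists i, j.
Qed.

Lemma bd_arc K i : edge K i `<=` fr -> exists s0 a b,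
  [/\ 0 <= s0 < L, s0 < a, a < b, b < s0 + L &
    forall s, s0 <= s <= s0 + L -> edge K i (xb s) <-> a <= s <= b].
Proof.
move=> bd; have [al [k H]] := elt_curved_tri hTh K.
have := boundary_arc hOmega (i := i) H; rewrite epar_edge; exact.
Qed.

Lemma bd_edge_arc K i s0 a b : edge K i `<=` fr ->
  0 <= s0 < L -> s0 < a -> a < b -> b < s0 + L ->
  (forall s, s0 <= s <= s0 + L -> edge K i (xb s) <-> a <= s <= b) ->
  edge_arc (epar K) i (xarc xb a b).
Proof.
move=> bd h1 h2 h3 h4 h5; apply: (boundary_arc_edge hOmega _ h1) => //; by rewrite epar_edge.
Qed.

(** The opposite orientation would put the element on the side to which [normal] points, where
    points are off [closure Omega]. *)
Lemma bd_outward K i a b : edge_arc (epar K) i (xarc xb a b) -> outward (elt K) (xarc xb a b).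
Proof.
move=> ic; have [al [k H]] := elt_curved_tri hTh K.
have [//|o] := edge_arc_outward H ic; exfalso.
have ab := arc_lohi ic.1; rewrite /= in ab.
pose s := (a + b) / 2; have sab : a < s < b by rewrite /s; lra.
have dn : dot (- normal xb s) (arc_normal (xarc xb a b) s) < 0.
  have := arc_unit ic.1 s; rewrite /dot /arc_normal /normal /=; nra.
have h := outward_rev o sab dn.
have [t [[/interior_subset/elt_sub h1 _] [_ h2]]] := filter_ex (filterI h (dom_outward hOmega s)).
by apply: h2; move: h1; rewrite scalerN opprK.
Qed.

Lemma edge_arc_eq K K' i j c : edge K i = edge K' j -> edge_arc (epar K) i c ->
  edge_arc (epar K') j c.
Proof. by move=> EE [ok im]; split=> //; rewrite im !epar_edge. Qed.

Lemma bd_unique K K' i j : edge K i `<=` fr -> edge K i = edge K' j -> K = K'.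
Proof.
move=> bd EE; have [s0 [a [b [h1 h2 h3 h4 h5]]]] := bd_arc bd.
have ic := bd_edge_arc bd h1 h2 h3 h4 h5.
exact: outward_unique ic.1 (bd_outward ic) (bd_outward (edge_arc_eq EE ic)).
Qed.

Lemma bd_elt K K' i p : edge K i `<=` fr -> edge K i p -> elt K' p -> K <> K' ->
  exists l, p = vertex K l.
Proof.
move=> bd pe K'p KK'; have Kp := edge_sub hTh pe.
have [//|[i' [j [pe' EE]]]] := elt_meet KK' Kp K'p.
have [ii|ii] := eqVneq i i'; last exact: edge_meet ii pe pe'.
by case: KK'; apply: (bd_unique (i := i) (j := j)) => //; rewrite ii.
Qed.

Lemma bd_meet K K' i j p : edge K i `<=` fr -> edge K i <> edge K' j ->
  edge K i p -> edge K' j p -> exists l, p = vertex K l.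
Proof.
move=> bd nE pe pe'; have [KK|KK] := pselect (K = K').
  subst K'; apply: edge_meet pe pe'; by apply/eqP => ij; apply: nE; rewrite ij.
exact: bd_elt bd pe (edge_sub hTh pe') KK.
Qed.

Definition larc (q t : R * R) (a b : R) : arc R := Arc (fun s => q + s *: t) (fun=> t) a b.

Lemma nbd_segment K i : ~ edge K i `<=` fr -> is_segment (edge K i).
Proof. by move=> nb; apply: contrapT => /(mesh_curved_boundary hTh). Qed.

Lemma segment_edgeP K i p : is_segment (edge K i) -> edge K i p <->
  exists2 t : R, 0 <= t <= 1 & p = vertex K (i + 1) + t *: (vertex K (i + 2%:R) - vertex K (i + 1)).
Proof.
move=> sK; have aff := mesh_straight_affine hTh sK.
have E0 t : (1 - t) *: vertex K (i + 1) + t *: vertex K (i + 2%:R) =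
    vertex K (i + 1) + t *: (vertex K (i + 2%:R) - vertex K (i + 1)).
  by apply: prod_ext; rewrite !crdE; ring.
split=> [[_ [t t01 <-] <-]|[t t01 ->]].
  exists t; first by move: t01; rewrite /= in_itv.
  by rewrite aff// E0.
exists ((1 - t) *: tri_vert Th (i + 1) + t *: tri_vert Th (i + 2%:R)).
  by exists t => //; rewrite /= in_itv.
by rewrite aff ?in_itv// E0.
Qed.

Lemma vertex_neq K i : vertex K (i + 2%:R) - vertex K (i + 1) <> 0.
Proof.
move/eqP; rewrite subr_eq0 -epar0 -epar1 => /eqP.
have h : 0 <= (1 : R) <= 1 by rewrite lexx ler01.
have [al [k H]] := elt_curved_tri hTh K.
by move=> /(ct_inj H h); rewrite lexx ler01 => /(_ isT); lra.
Qed.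

Lemma segment_tangent K i : is_segment (edge K i) -> exists t, unit_tangent (edge K i) t.
Proof.
move=> sK; pose w := vertex K (i + 2%:R) - vertex K (i + 1).
have w0 : 0 < enorm w.
  by rewrite lt0r enorm_ge0 andbT; apply/eqP => /enorm_eq0; exact: vertex_neq.
exists ((enorm w)^-1 *: w); split.
  by rewrite enormZ ger0_norm ?invr_ge0 ?enorm_ge0// mulVf// gt_eqF.
move=> _ _ /(segment_edgeP _ sK)[s _ ->] /(segment_edgeP _ sK)[t _ ->].
by rewrite -/w /dot !crdE; ring.
Qed.

Lemma line_arc K i q t : is_segment (edge K i) -> edge K i q -> unit_tangent (edge K i) t ->
  exists a b, edge_arc (epar K) i (larc q t a b) /\
    forall s, edge K i (q + s *: t) <-> a <= s <= b.
Proof.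
move=> sK qe [t1 tperp]; pose u := vertex K (i + 1); pose w := vertex K (i + 2%:R) - u.
have seg p : edge K i p <-> exists2 r : R, 0 <= r <= 1 & p = u + r *: w.
  exact: segment_edgeP.
have tt : t.1 ^+ 2 + t.2 ^+ 2 = 1.
  by have := enorm_sqr t; rewrite t1 expr1n /dot !expr2 => <-.
(* The length of the edge, signed by the direction of [t]. *)
pose la := dot t w.
have wla : w = la *: t.
  have ue : edge K i u by apply/seg; exists 0; rewrite ?lexx ?ler01// scale0r addr0.
  have we : edge K i (u + w) by apply/seg; exists 1; rewrite ?lexx ?ler01// scale1r.
  have := tperp _ _ we ue; rewrite [u + w]addrC addrK => h.
  have hx : - t.2 * w.1 + t.1 * w.2 = 0 by exact: h.
  apply: prod_ext; rewrite scalep1 || rewrite scalep2.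
    rewrite -[LHS]mulr1 -tt (_ : w.1 * _ = la * t.1 - t.2 * (- t.2 * w.1 + t.1 * w.2)).
      by rewrite hx mulr0 subr0.
    by rewrite /la /dot; ring.
  rewrite -[LHS]mulr1 -tt (_ : w.2 * _ = la * t.2 + t.1 * (- t.2 * w.1 + t.1 * w.2)).
    by rewrite hx mulr0 addr0.
  by rewrite /la /dot; ring.
have la0 : la != 0.
  by apply/eqP => l0; apply: (@vertex_neq K i); rewrite -/w wla l0 scale0r.
have [r r01 qE] := (seg q).1 qe.
have tinj (x y : R) : x *: t = y *: t -> x = y.
  move=> xy; have := congr1 (dot t) xy; rewrite /dot !crdE => h.
  rewrite -[x]mulr1 -[y]mulr1 -tt; lra.
have key s : edge K i (q + s *: t) <-> exists2 v : R, 0 <= v <= 1 & s = (v - r) * la.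
  split=> [/seg[v v01 vE]|[v v01 ->]]; last first.
    by apply/seg; exists v => //; rewrite qE wla; apply: prod_ext; rewrite !crdE; ring.
  exists v => //; apply: tinj; apply: (@addrI _ q); rewrite vE qE wla.
  by apply: prod_ext; rewrite !crdE; ring.
pose a := Order.min (- r * la) ((1 - r) * la); pose b := Order.max (- r * la) ((1 - r) * la).
have itv s : (exists2 v : R, 0 <= v <= 1 & s = (v - r) * la) <-> a <= s <= b.
  split=> [[v v01 ->]|sab].
    by rewrite /a /b minEle maxEle; case: ifPn; rewrite -?ltNge => h; apply/andP; split; nra.
  exists (s / la + r); last by rewrite addrK divfK.
  have [lp|ln|l0] := ltgtP 0 la; last by move: la0; rewrite -l0 eqxx.
    have h : - r * la <= (1 - r) * la by nra.
    move: sab; rewrite /a /b (min_l h) (max_r h) => /andP[s1 s2].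
    have : - r <= s / la <= 1 - r by rewrite ler_pdivlMr// ler_pdivrMr// s1 s2.
    lra.
  have h : (1 - r) * la <= - r * la by nra.
  move: sab; rewrite /a /b (min_r h) (max_l h) => /andP[s1 s2].
  have : - r <= s / la <= 1 - r by rewrite ler_ndivrMr// ler_ndivlMr// s1 s2.
  lra.
have ab : a < b.
  rewrite /a /b lt_neqAle ge_min le_max lexx /= andbT.
  rewrite minEle maxEle; case: ifPn => h; apply/eqP => e0; move/eqP: la0; apply; lra.
exists a, b; split; last by move=> s; rewrite key itv.
split.
  split => //=.
  - by move=> s; have := is_derive_affine q.1 t.1 s.
  - by move=> s; have := is_derive_affine q.2 t.2 s.
  - by move=> s; exact: cvg_cst.
  - by move=> s; exact: cvg_cst.
rewrite epar_edge; apply/seteqP; split=> p.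
  by move=> [s]; rewrite /= in_itv /= => sab <-; apply/key/itv.
move=> /[dup] pe /seg[v v01 pE]; exists ((v - r) * la).
  by rewrite /= in_itv /=; apply/itv; exists v.
by rewrite /= pE qE wla; apply: prod_ext; rewrite !crdE; ring.
Qed.

Lemma elt_near_other K p : (forall K', K' <> K -> ~ elt K' p) ->
  \forall q \near p, forall K', K' <> K -> ~ elt K' q.
Proof.
move=> np.
suff h K' : \forall q \near p, K' <> K -> ~ elt K' q.
  exact: (@filter_forall _ _ (fun K' q => K' <> K -> ~ elt K' q) _ _ h).
have [->|KK'] := pselect (K' = K); first by near=> q.
have : \forall q \near p, ~ elt K' q.
  apply: open_nbhs_nbhs; split; last exact: np.
  by apply: closed_openC; exact: (elt_closed hTh).
by apply: filterS => q.
Unshelve. all: by end_near. Qed.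

(** Some point of the edge lies in [Omega] and is not a vertex. Just beyond it, off [K], there are
    still points of [Omega], covered by other elements; as these are finitely many closed sets, one
    of them contains the point itself, and conformity makes the edge common. *)
Lemma shared_or_bd K i : edge K i `<=` fr \/ exists K' j, K <> K' /\ edge K i = edge K' j.
Proof.
have [bd|nb] := pselect (edge K i `<=` fr); [by left|right].
have sK := nbd_segment nb; have [al [k H]] := elt_curved_tri hTh K.
have [t tt] := segment_tangent sK.
have [p pe pf] : exists2 p, edge K i p & ~ fr p.
  by apply: contrapT => h; apply: nb => p pe; apply: contrapT => pf; apply: h; exists p.
have [a [b [ic cE]]] := line_arc sK pe tt; have ab := arc_lohi ic.1; rewrite /= in ab.
have s1 : a <= 0 <= b by apply/cE; rewrite scale0r addr0.
pose m := (a + b) / 2.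
have nf : \forall q \near p, ~ fr q.
  apply: open_nbhs_nbhs; split => //; exact: closed_openC (frontier_closed hOmega).
(* The point [p] may be an end of the edge. It is moved slightly towards the midpoint, at parameter
   [m], which keeps it off the closed frontier. *)
have [s [sab nfs]] : exists s, a < s < b /\ ~ fr (p + s *: t).
  have h1 := near_line (m *: t) nf.
  have h2 : \forall x \near (0 : R)^'+, 0 < x by exact: nbhs_right_gt.
  have h3 : \forall x \near (0 : R)^'+, x < 1 by exact: nbhs_right_lt.
  have [x [nx [x0 x1]]] := filter_ex (filterI h1 (filterI h2 h3)).
  exists (x * m); split; last by rewrite -scalerA.
  by rewrite /m; have [? ?] := andP s1; apply/andP; split; nra.
pose q := p + s *: t.
have qe : edge K i q by apply/cE; lra.
have Oq : Omega q.
  by apply: closure_Omega => //; exact: elt_sub (edge_sub hTh qe).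
have [nu out] : exists nu, \forall x \near 0^'+, ~ elt K (q + x *: nu).
  have dn c : arc_ok c -> dot (- arc_normal c s) (arc_normal c s) < 0.
    by move=> ok; have := arc_unit ok s; rewrite /dot /arc_normal !crdE; nra.
  have [ou|ou] := edge_arc_outward H ic.
    exists (arc_normal (larc p t a b) s); have := ou s _ sab (dn _ ic.1).
    by apply: filterS => x [_]; rewrite scalerN opprK.
  exists (- arc_normal (larc p t a b) s); have := outward_rev ou sab (dn _ ic.1).
  by apply: filterS => x [_].
have [K' [KK' K'q]] : exists K', K <> K' /\ elt K' q.
  apply: contrapT => h.
  have nr : forall K', K' <> K -> ~ elt K' q by move=> K' n K'q; apply: h; exists K'; split=> // /esym.
  have h1 := near_line nu (elt_near_other nr).
  have oO : nbhs q Omega by apply: open_nbhs_nbhs; split=> //; exact: dom_open hOmega.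
  have h2 := near_line nu oO.
  have [x [n1 [n2 n3]]] := filter_ex (filterI h1 (filterI h2 out)).
  have : closure Omega (q + x *: nu) by exact: subset_closure.
  rewrite -(mesh_cover hTh) => -[K' _ K'x].
  by have [E0|n] := pselect (K' = K); [apply: n3; rewrite -E0|exact: n1 n K'x].
have nv l : q <> vertex K l by exact: (arc_not_vertex (c := larc p t a b) ic sab).
have [[l /nv//]|[i' [j [pe' EE]]]] := elt_meet KK' (edge_sub hTh qe) K'q.
have [ii|ii] := eqVneq i i'; first by subst i'; exists K', j.
by have [l /nv] := edge_meet ii qe pe'.
Qed.

Lemma shared_nbd K K' i j : K <> K' -> edge K i = edge K' j -> ~ edge K i `<=` fr.
Proof. by move=> KK' EE bd; apply: KK'; exact: bd_unique bd EE. Qed.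

Lemma shared_outward K K' i j c : K <> K' -> edge K i = edge K' j -> edge_arc (epar K) i c ->
  (outward (elt K) c /\ outward (elt K') (arc_rev c)) \/
  (outward (elt K) (arc_rev c) /\ outward (elt K') c).
Proof.
move=> KK' EE ic; have ic' := edge_arc_eq EE ic; have okr := (edge_arc_rev ic).1.
have [al [k H]] := elt_curved_tri hTh K; have [al' [k' H']] := elt_curved_tri hTh K'.
have [ou|ou] := edge_arc_outward H ic; have [ou'|ou'] := edge_arc_outward H' ic'; auto.
  by case: KK'; exact: outward_unique ic.1 ou ou'.
by case: KK'; exact: outward_unique okr ou ou'.
Qed.

(** Each of the two orientations of an arc along the edge is outward for one element only. *)
Lemma shared_two K K' K2 i j i2 : K <> K' -> edge K i = edge K' j -> edge K i = edge K2 i2 ->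
  K2 = K \/ K2 = K'.
Proof.
move=> KK' EE E2; have sK := nbd_segment (shared_nbd KK' EE).
have [t tt] := segment_tangent sK; have [p pe _] := edge_mid_not_vertex K i.
have [a [b [ic _]]] := line_arc sK pe tt; have okr := (edge_arc_rev ic).1.
have [al [k H]] := elt_curved_tri hTh K2.
have [ou|ou] := edge_arc_outward H (edge_arc_eq E2 ic);
  have [[ou1 ou2]|[ou1 ou2]] := shared_outward KK' EE ic.
- by left; exact: outward_unique ic.1 ou ou1.
- by right; exact: outward_unique ic.1 ou ou2.
- by right; exact: outward_unique okr ou ou2.
- by left; exact: outward_unique okr ou ou1.
Qed.

(** An inner point of a shared edge has elements on both sides, and a tangent direction stays on the
    edge, so that no direction leaves [closure Omega] there; the outward normal at [xb s] does.
    Hence on a shared edge [xb s] can only be an end. *)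
Lemma frontier_cover s :
  (exists K l, xb s = vertex K l) \/ (exists K i, edge K i `<=` fr /\ edge K i (xb s)).
Proof.
have fs := frontier_xb hOmega s; have : closure Omega (xb s) by case: fs.
rewrite -(mesh_cover hTh) => -[K _ Ks].
have [i ie] : exists i, edge K i (xb s).
  apply: contrapT => h; apply: (frontier_not_interior hOmega fs).
  have : interior (elt K) (xb s).
    by rewrite (elt_interior hTh); split=> // -[i _ ie]; apply: h; exists i.
  by apply: filterS; exact: elt_sub.
have [bd|[K' [j [KK' EE]]]] := shared_or_bd K i; first by right; exists K, i.
left; have sK := nbd_segment (shared_nbd KK' EE).
have [t tt] := segment_tangent sK; have [a [b [ic cE]]] := line_arc sK ie tt.
have ab := arc_lohi ic.1; rewrite /= in ab.
have sab : a <= 0 <= b by apply/cE; rewrite scale0r addr0.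
have [al [k H]] := elt_curved_tri hTh K.
have ends : forall x, x = a \/ x = b -> exists l, xb s + x *: t = vertex K l.
  move=> x xab; have [[e0 e1]|[e0 e1]] := edge_arc_ends H ic; rewrite /= in e0 e1; case: xab => ->.
  - by exists (i + 1); rewrite e0 epar0.
  - by exists (i + 2%:R); rewrite e1 epar1.
  - by exists (i + 2%:R); rewrite e0 epar1.
  - by exists (i + 1); rewrite e1 epar0.
exists K; have [E0|na] := eqVneq a 0.
  by have [l] := ends 0 (or_introl (esym E0)); rewrite scale0r addr0; exists l.
have [E0|nb] := eqVneq b 0.
  by have [l] := ends 0 (or_intror (esym E0)); rewrite scale0r addr0; exists l.
have s0 : a < 0 < b.
  by have [h1 h2] := andP sab; rewrite !lt_neqAle h1 h2 na eq_sym nb.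
exfalso; pose nu := normal xb s; have out := dom_outward hOmega s; rewrite -/nu in out.
pose c := larc (xb s) t a b.
have q0 : apt c 0 = xb s by rewrite /= scale0r addr0.
have contra (P : R -> Prop) : (forall x, P x -> closure Omega (xb s + x *: nu)) ->
    (\forall x \near (0 : R)^'+, P x) -> False.
  move=> PO Pn; have h : \forall x \near (0 : R)^'+, P x /\ ~ closure Omega (xb s + x *: nu).
    by apply: filterS2 Pn out => x Px [_ Nx].
  case: (@filter_ex _ _ (at_right_proper_filter (0 : R)) _ h) => x Hx; exact: Hx.2 (PO x Hx.1).
have side K1 : outward (elt K1) c -> dot nu (arc_normal c 0) < 0 -> False.
  move=> o d0; apply: contra (o 0 nu s0 d0) => x; rewrite q0 => -[/interior_subset/elt_sub].
  by [].
have side' K1 : outward (elt K1) (arc_rev c) -> 0 < dot nu (arc_normal c 0) -> False.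
  move=> o d0; have dn : dot (- nu) (arc_normal c 0) < 0 by rewrite dotNl oppr_lt0.
  apply: contra (outward_rev o s0 dn) => x; rewrite q0 scalerN opprK => -[/interior_subset/elt_sub].
  by [].
have [d0|d0|d0] := ltgtP (dot nu (arc_normal c 0)) 0.
- by have [[ou _]|[_ ou]] := shared_outward KK' EE ic; exact: side ou d0.
- by have [[_ ou]|[ou _]] := shared_outward KK' EE ic; exact: side' ou d0.
(* The remaining case, in which the normal is tangent to the edge. *)
have u1 := arc_unit ic.1 0; rewrite /= in u1.
have nuE : nu = dot nu t *: t.
  have hx : nu.1 * t.2 + nu.2 * - t.1 = 0 by exact: d0.
  apply: prod_ext.
    rewrite -[LHS]mulr1 -u1 scalep1 (_ : nu.1 * _ = dot nu t * t.1 + t.2 * (nu.1 * t.2 + nu.2 * - t.1)).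
      by rewrite hx mulr0 addr0.
    by rewrite /dot; ring.
  rewrite -[LHS]mulr1 -u1 scalep2 (_ : nu.2 * _ = dot nu t * t.2 - t.1 * (nu.1 * t.2 + nu.2 * - t.1)).
    by rewrite hx mulr0 subr0.
  by rewrite /dot; ring.
have lin : \forall x \near (0 : R)^'+, a <= x * dot nu t <= b.
  have nI : nbhs (0 : R) [set x | a <= x <= b].
    have := near_in_itvoo (a := a) (b := b) (x := 0); rewrite in_itv /= => /(_ s0).
    by apply: filterS => x; rewrite in_itv /= => /andP[? ?]; rewrite /= !ltW.
  have lc : x * dot nu t @[x --> (0 : R)] --> (0 : R).
    by rewrite -[X in _ --> X](mul0r (dot nu t)); apply: cvgM; [exact: cvg_id|exact: cvg_cst].
  have h : \forall x \near (0 : R), a <= x * dot nu t <= b := lc _ nI.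
  by apply: filterS h => x h _.
apply: contra lin => x xab; apply: (elt_sub (K := K)); apply: (edge_sub hTh (i := i)).
by rewrite nuE scalerA; apply/cE.
Qed.

End Adjacency.

(** * Integrals up to finitely many parameters *)

Section NullPoints.
Context {R : realType}.
Notation mu := (@lebesgue_measure R).
Notation mR := (measurableTypeR R).
Implicit Types (f g : R -> R) (D : set R) (Z : seq R).

Lemma measurable_setD_seq D Z : measurable (D : set mR) -> measurable (D `\` [set` Z] : set mR).
Proof.
move=> mD; apply: measurableD => //; elim: Z => [|z Z IH].
  by rewrite (_ : [set` [::]] = set0)//; apply/seteqP; split.
rewrite (_ : [set` z :: Z] = [set z] `|` [set` Z]).
  by apply: measurableU => //; exact: measurable_set1.
apply/seteqP; split=> x; rewrite /= inE.
  by move=> /orP[/eqP ->|]; auto.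
by move=> [->|->]; rewrite ?eqxx ?orbT.
Qed.

Lemma measurable_fun_setD_seq D Z (f : mR -> \bar R) : measurable (D : set mR) ->
  measurable_fun (D `\` [set` Z] : set mR) f -> measurable_fun (D : set mR) f.
Proof.
move=> mD mf _ Y mY; have mDZ := measurable_setD_seq Z mD.
have -> : D `&` f @^-1` Y = ((D `\` [set` Z]) `&` f @^-1` Y) `|` (D `&` [set` Z] `&` f @^-1` Y).
  apply/seteqP; split=> x.
    by move=> [Dx Yx]; have [xZ|xZ] := pselect ([set` Z] x); [right|left].
  by move=> [[[Dx _] Yx]|[[Dx _] Yx]].
apply: measurableU; first exact: mf.
apply: countable_measurable; first by move=> t; exact: measurable_set1.
apply: finite_set_countable; apply: (sub_finite_set (B := [set` Z])); last exact: finite_seq.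
by move=> x [[_ ?] _].
Qed.

Lemma integral_setD_seq D Z (f : mR -> \bar R) : measurable (D : set mR) ->
  measurable_fun (D `\` [set` Z] : set mR) f ->
  (\int[mu]_(x in D `\` [set` Z]) f x = \int[mu]_(x in D) f x)%E.
Proof.
elim: Z D => [|z Z IH] D mD mf.
  by rewrite (_ : D `\` _ = D)//; apply/seteqP; split=> x //= [].
have E1 : D `\` [set` z :: Z] = (D `\ z) `\` [set` Z].
  apply/seteqP; split=> x /=.
    by move=> [Dx /negP]; rewrite inE negb_or => /andP[/eqP xz /negP xZ].
  by move=> [[Dx xz] xZ]; split => //; rewrite inE => /orP[/eqP|].
rewrite E1 in mf *.
have mDz : measurable (D `\ z : set mR) by apply: measurableD => //; exact: measurable_set1.
rewrite IH// integral_setD1//.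
exact: measurable_fun_setD_seq mf.
Qed.

Lemma Rintegral_setD_seq D Z f g : measurable (D : set mR) -> measurable_fun (D : set mR) g ->
  (forall x, D x -> ~ [set` Z] x -> f x = g x) -> Rintegral mu D f = Rintegral mu D g.
Proof.
move=> mD mg fg; rewrite /Rintegral; congr fine.
have mg' : measurable_fun (D : set mR) (EFin \o g) by exact/measurable_EFinP.
have mDZ := measurable_setD_seq Z mD.
have mg2 : measurable_fun (D `\` [set` Z] : set mR) (EFin \o g).
  by apply: measurable_funS mg' => // x [].
have fg' : {in D `\` [set` Z], (EFin \o f) =1 (EFin \o g)}.
  by move=> x; rewrite inE => -[Dx xZ]; rewrite /= fg.
have mf2 : measurable_fun (D `\` [set` Z] : set mR) (EFin \o f).
  by apply: eq_measurable_fun mg2 => x xD; rewrite fg'.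
rewrite -(integral_setD_seq mD mf2) -(integral_setD_seq mD mg2).
exact: eq_integral.
Qed.

Lemma itg_oo f g a b : continuous g -> (forall x, a < x < b -> f x = g x) ->
  Rintegral mu `[a, b]%classic f = itg a b g.
Proof.
move=> cg fg; apply: (@Rintegral_setD_seq _ [:: a; b]) => //.
  by apply: measurable_funS (continuous_measurable_fun cg).
move=> x; rewrite /= in_itv /= !inE => /andP[ax xb] /negP; rewrite negb_or => /andP[xa xb'].
by apply: fg; rewrite !lt_neqAle ax xb eq_sym xa xb'.
Qed.

Lemma patch_integrable g a b D : continuous g -> measurable (D : set mR) -> D `<=` `[a, b]%classic ->
  mu.-integrable setT (EFin \o (g \_ D)).
Proof.
move=> cg mD Dab; rewrite -restrict_EFin.
have i1 : mu.-integrable (D : set mR) (EFin \o g).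
  have i0 : mu.-integrable `[a, b]%classic (EFin \o g).
    by apply: itg_integrable; exact: continuous_subspaceT.
  by apply: (integrableS _ mD Dab i0).
by move: i1 => /(integrable_mkcond _ mD).
Qed.

(** The interval [[a, b]], counted from [s0], may pass beyond [L], while integrals over an edge run
    over parameters in [[0, L]]. The part beyond [L] is moved back by a period; the end points, [s0]
    and their translates form a finite exceptional set. *)
Lemma Rintegral_periodic f g a b s0 L (S : set R) : continuous g ->
  (forall s, f (s + L) = f s) -> (forall s, a < s < b -> f s = g s) ->
  0 <= s0 < L -> s0 < a -> a < b -> b < s0 + L ->
  measurable (S : set mR) -> S `<=` `[0, L]%classic ->
  (forall s, s0 < s < L -> S s <-> a <= s <= b) ->
  (forall s, 0 < s < s0 -> S s <-> a <= s + L <= b) ->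
  Rintegral mu S f = itg a b g.
Proof.
move=> cg fL fg hs0 ha ab hb mS SL S1 S2.
have gc : continuous (fun s => g (s + L)).
  apply: (cont_comp (f := fun s => s + L) _ cg) => s.
  by apply: cvgD; [exact: cvg_id|exact: cvg_cst].
(* [A] is the part of the arc before [L], [C] the part beyond it, and [B] is [C] moved back by a
   period. *)
pose A : set R := `]a, b[%classic `&` `[0, L[%classic.
pose B : set R := `](a - L), (b - L)[%classic `&` `[0, L[%classic.
pose C : set R := `]a, b[%classic `&` `[L, (L + L)[%classic.
have mI (i : interval R) : measurable ([set` i] : set mR) by exact: measurable_itv.
have mA : measurable (A : set mR) by exact: measurableI.
have mB : measurable (B : set mR) by exact: measurableI.
have mC : measurable (C : set mR) by exact: measurableI.
pose hA := g \_ A; pose hB := (fun s => g (s + L)) \_ B; pose hC := g \_ C.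
have iA : mu.-integrable setT (EFin \o hA).
  by apply: (patch_integrable (a := a) (b := b)) => // s [] /=; rewrite !in_itv /=; lra.
have iC : mu.-integrable setT (EFin \o hC).
  by apply: (patch_integrable (a := a) (b := b)) => // s [] /=; rewrite !in_itv /=; lra.
have iB : mu.-integrable setT (EFin \o hB).
  by apply: (patch_integrable (a := a - L) (b := b - L)) => // s [] /=; rewrite !in_itv /=; lra.
have mfun h : mu.-integrable setT (EFin \o h) -> measurable_fun (setT : set mR) h.
  by move=> /integrableP[/measurable_EFinP].
have -> : Rintegral mu S f = Rintegral mu setT (f \_ S).
  exact: Rintegral_mkcond.
have -> : Rintegral mu setT (f \_ S) = Rintegral mu setT (fun s => hA s + hB s).
  apply: (@Rintegral_setD_seq _ [:: 0; L; s0; a; b; a - L; b - L]) => //.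
    by apply: measurable_funD; exact: mfun.
  move=> s _ /negP; rewrite /= !inE !negb_or => /and5P[n0 nL ns0 na /and3P[nb naL nbL]].
  have {}n0 : s <> 0 by exact/eqP.
  have {}nL : s <> L by exact/eqP.
  have {}ns0 : s <> s0 by exact/eqP.
  have {}na : s <> a by exact/eqP.
  have {}nb : s <> b by exact/eqP.
  have {}naL : s <> a - L by exact/eqP.
  have {}nbL : s <> b - L by exact/eqP.
  have inP (D : set R) (h : R -> R) : D s -> (h \_ D) s = h s by move=> Ds; rewrite patchE mem_set.
  have outP (D : set R) (h : R -> R) : ~ D s -> (h \_ D) s = 0 by move=> Ds; rewrite patchE memNset.
  have [sL|sL] := pselect (0 < s < L); last first.
    rewrite outP /hA ?outP /hB ?outP ?addr0//.
    - by move=> [_]; rewrite /= in_itv /=; lra.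
    - by move=> [_]; rewrite /= in_itv /=; lra.
    - by move=> /SL; rewrite /= in_itv /=; lra.
  have [s0s|s0s|s0s] := ltgtP s s0; last by case: ns0.
  - have SE := S2 s ltac:(lra).
    have nA : ~ A s by move=> []; rewrite /= !in_itv /=; lra.
    rewrite [hA s]outP// add0r; have [Ss|Ss] := pselect (S s).
      have Bs : B s by have := SE.1 Ss; rewrite /B /= !in_itv /=; lra.
      rewrite inP// /hB inP//= -fL fg//; move: Bs; rewrite /B /= !in_itv /=; lra.
    rewrite outP// /hB outP// => Bs; apply: Ss; apply/SE; move: Bs; rewrite /B /= !in_itv /=; lra.
  - have SE := S1 s ltac:(lra).
    have nB : ~ B s by move=> []; rewrite /= !in_itv /=; lra.
    rewrite [hB s]outP// addr0; have [Ss|Ss] := pselect (S s).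
      have As : A s by have := SE.1 Ss; rewrite /A /= !in_itv /=; lra.
      rewrite inP// /hA inP//= fg//; move: As; rewrite /A /= !in_itv /=; lra.
    rewrite outP// /hA outP// => As; apply: Ss; apply/SE; move: As; rewrite /A /= !in_itv /=; lra.
rewrite RintegralD//.
have -> : Rintegral mu setT hB = Rintegral mu setT hC.
  rewrite /Rintegral; congr fine.
  have mC' : measurable_fun (setT : set mR) (EFin \o hC) by have /integrableP[] := iC.
  rewrite -(integral_shift (- L) mC'); apply: eq_integral => s _.
  rewrite /= opprK /hB /hC !patchE; congr (if _ then _ else _)%:E.
  by apply/idP/idP; rewrite !inE => -[]; rewrite /= !in_itv /= => h1 h2; split; rewrite /= in_itv /=; lra.
rewrite -RintegralD//.
have -> : itg a b g = Rintegral mu setT (g \_ `]a, b[%classic).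
  by rewrite /Rintegral (integral_oo cg (ltW ab)).
congr (Rintegral _ _ _); apply/funext => s; rewrite /hA /hC !patchE.
have [sab|sab] := boolP (s \in `]a, b[%classic).
  rewrite inE /= in_itv /= in sab; have [sL|sL] := ltP s L.
    rewrite mem_set; last by split; rewrite /= in_itv /=; lra.
    by rewrite memNset ?addr0// => -[_]; rewrite /= in_itv /=; lra.
  rewrite memNset ?add0r; last by move=> [_]; rewrite /= in_itv /=; lra.
  by rewrite mem_set//; split; rewrite /= in_itv /=; lra.
by rewrite !memNset ?addr0// => -[sab' _]; move/negP: sab; apply; rewrite inE.
Qed.

End NullPoints.

(** * Traces on an element *)

Section Traces.
Context {R : realType}.
Variables (Omega : set (R * R)) (Th : triangulation R).
Hypothesis hTh : exact_conforming Omega Th.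
Variable vh : R * R -> R.
Variables (g1 g2 g11 g12 g21 g22 : Th -> R * R -> R).
Hypothesis vC : forall K, wC1 (elt K) vh (g1 K) (g2 K).
Hypothesis g1C : forall K, wC1 (elt K) (g1 K) (g11 K) (g12 K).
Hypothesis g2C : forall K, wC1 (elt K) (g2 K) (g21 K) (g22 K).
Implicit Types (K : Th) (i j l : 'I_3) (p q : R * R).

Lemma D_interior K p : interior (elt K) p ->
  'D_(basis 0) vh p = g1 K p /\ 'D_(basis 1) vh p = g2 K p.
Proof.
move=> Kp; have [vd _ _] := vC K.
have [d0 d1] := wdiff_interior Kp (vd p (interior_subset Kp)).
by split; apply: derive_val.
Qed.

Lemma is_derive_near2 (f g : R * R -> R) p v d : (\forall q \near p, f q = g q) ->
  is_derive p v f d -> is_derive p v g d.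
Proof.
move=> fg /is_deriveP df; apply/is_deriveP; apply: is_derive_near df.
have c : h *: v + p @[h --> (0 : R)] --> p.
  rewrite -{2}[p]add0r -(scale0r v); apply: cvgD; last exact: cvg_cst.
  by apply: cvgZr_tmp; exact: cvg_id.
exact: (c _ fg).
Qed.

Lemma D2_interior K p : interior (elt K) p ->
  [/\ 'D_(basis 0) ('D_(basis 0) vh) p = g11 K p, 'D_(basis 1) ('D_(basis 0) vh) p = g12 K p,
      'D_(basis 0) ('D_(basis 1) vh) p = g21 K p & 'D_(basis 1) ('D_(basis 1) vh) p = g22 K p].
Proof.
move=> Kp; have Ep := interior_subset Kp.
have nK : \forall q \near p, interior (elt K) q.
  by apply: open_nbhs_nbhs; split=> //; exact: open_interior.
have n1 : \forall q \near p, g1 K q = 'D_(basis 0) vh q.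
  by apply: filterS nK => q /D_interior[].
have n2 : \forall q \near p, g2 K q = 'D_(basis 1) vh q.
  by apply: filterS nK => q /D_interior[].
have [d1 _ _] := g1C K; have [d2 _ _] := g2C K.
have [d11 d12] := wdiff_interior Kp (d1 p Ep); have [d21 d22] := wdiff_interior Kp (d2 p Ep).
by split; apply: derive_val; [exact: is_derive_near2 n1 d11|exact: is_derive_near2 n1 d12|
  exact: is_derive_near2 n2 d21|exact: is_derive_near2 n2 d22].
Qed.

Lemma hess_interior K p : interior (elt K) p -> [/\ hess vh p 0 0 = g11 K p,
  hess vh p 0 1 = g12 K p, hess vh p 1 0 = g12 K p & hess vh p 1 1 = g22 K p].
Proof.
move=> Kp; have [h1 h2 h3 h4] := D2_interior Kp.
by rewrite !mxE h1 h2 h3 h4 (wC1_schwarz Kp (vC K) (g1C K) (g2C K)).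
Qed.

Lemma mxfrobE (M N : 'M[R]_2) : mxfrob M N =
  M 0 0 * N 0 0 + M 0 1 * N 0 1 + (M 1 0 * N 1 0 + M 1 1 * N 1 1).
Proof.
rewrite /mxfrob !big_ord_recl !big_ord0 !addr0.
by rewrite (_ : lift ord0 ord0 = 1); last exact: val_inj.
Qed.

Lemma trE (M : 'M[R]_2) : \tr M = M 0 0 + M 1 1.
Proof.
rewrite /mxtrace !big_ord_recl !big_ord0 !addr0.
by rewrite (_ : lift ord0 ord0 = 1); last exact: val_inj.
Qed.

(** Near [p] the set [D] reduces to the interior of [K], which accumulates at [p]; so the limit is
    unique and is the value of the continuous extension [g]. *)
Lemma trace_elt K (D : set (R * R)) f g p : interior (elt K) `<=` D ->
  (\forall q \near p, D q -> interior (elt K) q) ->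
  (forall q, interior (elt K) q -> f q = g q) -> cin (elt K) g -> elt K p ->
  trace D f p = g p.
Proof.
move=> KD DK fg gc Kp.
have clD : closure D p by apply: closure_subset KD _ (elt_closure_interior hTh Kp).
have PF := within_nbhs_proper clD.
apply: cvg_lim => //; have h := gc p Kp.
move=> S Sp; have h2 : \forall q \near p, elt K q -> S (g q) := h S Sp.
have h3 : \forall q \near p, D q -> S (f q).
  apply: filterS2 DK h2 => q Dq Sq /Dq Kq.
  by rewrite fg//; apply: Sq; exact: interior_subset.
exact: h3.
Qed.

Lemma grad_trace_elt K p : elt K p -> grad_trace (interior (elt K)) vh p = (g1 K p, g2 K p).
Proof.
move=> Kp; have n : \forall q \near p, interior (elt K) q -> interior (elt K) q by near=> q.
have [_ c1 c2] := vC K.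
rewrite /grad_trace (trace_elt (subset_refl _) n (fun q Kq => (D_interior Kq).1) c1 Kp).
by rewrite (trace_elt (subset_refl _) n (fun q Kq => (D_interior Kq).2) c2 Kp).
Unshelve. all: by end_near. Qed.

Lemma grad_vertex K K' i j : C1_at_vertices Th vh -> vertex K i = vertex K' j ->
  g1 K (vertex K i) = g1 K' (vertex K i) /\ g2 K (vertex K i) = g2 K' (vertex K i).
Proof.
move=> C1 vv; have [_] := C1 K K' i j vv.
have vE K0 i0 : elt K0 (vertex K0 i0).
  exists (tri_vert Th i0) => //; exists (fun j => (j == i0)%:R); split.
  - by move=> j0; rewrite ler0n.
  - by rewrite (bigD1 i0)//= eqxx big1 ?addr0// => j0 /negbTE ->.
  - rewrite (bigD1 i0)//= eqxx scale1r big1 ?addr0// => j0 /negbTE ->; exact: scale0r.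
rewrite grad_trace_elt// grad_trace_elt; last by rewrite vv.
by move=> [-> ->].
Qed.

(** At a point of a boundary edge other than a vertex no second element is near, so the broken
    gradient is that of [K]. *)
Lemma bgrad_elt xb L K i p : C2_domain Omega xb L -> edge K i `<=` frontier Omega -> edge K i p ->
  (forall l, p <> vertex K l) -> bgrad Th vh p = (g1 K p, g2 K p).
Proof.
move=> hOmega bd pe pv; have Kp := edge_sub hTh pe.
have nr : forall K', K' <> K -> ~ elt K' p.
  by move=> K' KK' K'p; have [|l /pv//] := bd_elt hOmega hTh bd pe K'p; exact: nesym.
have n : \forall q \near p, (\bigcup_(K' : Th) interior (elt K')) q -> interior (elt K) q.
  apply: filterS (elt_near_other hTh nr) => q nq [K' _ K'q].
  by have [<-//|KK'] := pselect (K' = K); case: (nq K' KK'); exact: interior_subset.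
have s : interior (elt K) `<=` \bigcup_(K' : Th) interior (elt K') by move=> q Kq; exists K.
have [_ c1 c2] := vC K.
rewrite /bgrad /grad_trace (trace_elt s n (fun q Kq => (D_interior Kq).1) c1 Kp).
by rewrite (trace_elt s n (fun q Kq => (D_interior Kq).2) c2 Kp).
Qed.

(* [int_c (g1 dg2 - g2 dg1)] *)
Definition wint K (c : arc R) := lint c (g1 K) (g21 K) (g22 K) - lint c (g2 K) (g11 K) (g12 K).

Notation mR := (measurableTypeR R).
Notation mu2 := ((@lebesgue_measure R) \x (@lebesgue_measure R))%E.

Definition detg K := fun p => g11 K p * g22 K p - g12 K p * g21 K p.

Lemma elt_bounded K : exists M : R, forall p, elt K p -> `|p.1| <= M /\ `|p.2| <= M.
Proof.
have [al [k H]] := elt_curved_tri hTh K; have [M [_ MP]] := compact_bounded (ct_compact H).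
exists (`|M| + 1) => p Kp; have := MP (`|M| + 1).
rewrite (le_lt_trans (ler_norm M)) ?ltrDl// => /(_ isT _ Kp).
by rewrite /Num.norm /= ge_max => /andP[].
Qed.

Lemma elt_cin_integrable K f : cin (elt K) f ->
  mu2.-integrable (interior (elt K) : set (mR * mR)) (EFin \o f).
Proof.
move=> fc; have [al [k H]] := elt_curved_tri hTh K.
have [M1 M1P] := elt_bounded K; have [M2 M2P] := cin_bounded (ct_compact H) fc.
apply: (cin_integrable (M := Order.max M1 M2)).
- exact: open_interior.
- move=> p /interior_subset /M1P[h1 h2]; rewrite !le_max h1 h2 //.
- move=> p Kp; have := fc p (interior_subset Kp); apply: cvg_trans.
  apply: cvg_app => S h.
  have h2 : \forall q \near p, elt K q -> S q := h.
  have h3 : \forall q \near p, interior (elt K) q -> S q.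
    by apply: filterS h2 => q qS /interior_subset; exact: qS.
  exact: h3.
- by move=> p /interior_subset /M2P h; rewrite le_max h orbT.
Qed.

(** Green's formula for [g1 dg2] and for [g2 dg1]: the two determinants are opposite, whence the
    factor 2. *)
Lemma det_green K (c : 'I_3 -> arc R) : (forall i, edge_arc (epar K) i (c i)) ->
  (forall i, outward (elt K) (c i)) ->
  2 * Rintegral mu2 (interior (elt K) : set (mR * mR)) (detg K) = \sum_i wint K (c i).
Proof.
move=> ic oc; have [al [k H]] := elt_curved_tri hTh K.
have G1 := green_triangle H (g1C K) (g2C K) ic oc.
have G2 := green_triangle H (g2C K) (g1C K) ic oc.
rewrite /wint sumrB -G1 -G2.
have [_ c11 c12] := g1C K; have [_ c21 c22] := g2C K.
have dc : cin (elt K) (detg K) by apply: cinD; [|apply: cinN]; apply: cinM.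
have -> : Rintegral mu2 (interior (elt K) : set (mR * mR)) (fun p => g21 K p * g12 K p - g22 K p * g11 K p) =
    Rintegral mu2 (interior (elt K) : set (mR * mR)) (fun p => (-1) * detg K p).
  by apply: eq_Rintegral => p _; rewrite /detg; ring.
rewrite RintegralZl; [|by apply: open_measurable2; exact: open_interior|exact: elt_cin_integrable].
rewrite -/(detg K); ring.
Qed.

Lemma wint_rev K i c : edge_arc (epar K) i c -> wint K (arc_rev c) = - wint K c.
Proof.
move=> ic; have [al [k H]] := elt_curved_tri hTh K.
have cE := edge_arc_sub H ic.
have [_ c11 c12] := g1C K; have [_ c21 c22] := g2C K.
have c1 := wC1_cin (g1C K); have c2 := wC1_cin (g2C K).
by rewrite /wint !(lint_rev ic.1 cE)//; ring.
Qed.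

End Traces.

(** * Interior edges *)

Section InteriorEdges.
Context {R : realType}.
Notation mu := (@lebesgue_measure R).
Notation mR := (measurableTypeR R).
Variables (Omega : set (R * R)) (Th : triangulation R).
Hypothesis hTh : exact_conforming Omega Th.
Variable vh : R * R -> R.
Variables (g1 g2 g11 g12 g21 g22 : Th -> R * R -> R).
Hypothesis vC : forall K, wC1 (elt K) vh (g1 K) (g2 K).
Hypothesis g1C : forall K, wC1 (elt K) (g1 K) (g11 K) (g12 K).
Hypothesis g2C : forall K, wC1 (elt K) (g2 K) (g21 K) (g22 K).
Implicit Types (K : Th) (i j l : 'I_3) (p q : R * R) (c : arc R).

(* [f] along [c], frozen at the end points so as to be continuous on the line *)
Definition on_arc c (f : R * R -> R) (s : R) : R := f (apt c (clamp (alo c) (ahi c) s)).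

Lemma on_arcE c f s : alo c <= s <= ahi c -> on_arc c f s = f (apt c s).
Proof. by move=> sab; rewrite /on_arc clamp_id. Qed.

Lemma on_arc_continuous K i c f : edge_arc (epar K) i c -> cin (elt K) f -> continuous (on_arc c f).
Proof.
move=> ic fc; have [al [k H]] := elt_curved_tri hTh K.
have ab := ltW (arc_lohi ic.1).
apply: (cin_comp (phi := fun s => apt c (clamp (alo c) (ahi c) s)) fc).
  move=> s; apply: continuous_comp; first exact: continuous_clamp.
  exact: (arc_continuous ic.1).
move=> s; apply: (edge_arc_sub H ic); exists (clamp (alo c) (ahi c) s) => //.
by rewrite /= in_itv /=; exact: clamp_itv.
Qed.

Lemma apt_derive K i c f d1 d2 (s : R) : edge_arc (epar K) i c -> wC1 (elt K) f d1 d2 ->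
  alo c < s < ahi c -> is_derive s 1 (fun t => f (apt c t))
    (d1 (apt c s) * (adir c s).1 + d2 (apt c s) * (adir c s).2).
Proof.
move=> ic [fd _ _] sab; have [al [k H]] := elt_curved_tri hTh K.
have sub t : alo c <= t <= ahi c -> elt K (apt c t).
  by move=> tab; apply: (edge_arc_sub H ic); exists t => //; rewrite /= in_itv.
have Ks : elt K (apt c s) by apply: sub; have [? ?] := andP sab; rewrite !ltW.
have ic1 := ic.1.
have E0 t : apt c t = ((apt c t).1, (apt c t).2) by case: (apt c t).
have fw : wdiff (elt K) f (d1 (apt c s)) (d2 (apt c s)) ((apt c s).1, (apt c s).2).
  by rewrite -E0; exact: fd.
have near_s : \forall t \near s, elt K ((apt c t).1, (apt c t).2).
  have o : \forall t \near s, `]alo c, ahi c[%classic t.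
    by apply: open_nbhs_nbhs; split; [exact: interval_open|rewrite /= in_itv].
  apply: filterS o => t; rewrite /= in_itv /= => /andP[h1 h2].
  by rewrite -E0; apply: sub; rewrite !ltW.
have := wdiff_curve fw (arc_der1 ic1 s) (arc_der2 ic1 s) near_s.
by rewrite (_ : (fun t => f ((apt c t).1, (apt c t).2)) = (fun t => f (apt c t)))//;
  apply/funext => t; rewrite -E0.
Qed.

Lemma on_arc_derive K i c f d1 d2 (s : R) : edge_arc (epar K) i c -> wC1 (elt K) f d1 d2 ->
  alo c < s < ahi c -> is_derive s 1 (on_arc c f)
    (on_arc c d1 s * (adir c s).1 + on_arc c d2 s * (adir c s).2).
Proof.
move=> ic fC sab; have := apt_derive ic fC sab.
have sab' : alo c <= s <= ahi c by have [? ?] := andP sab; rewrite !ltW.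
rewrite !on_arcE//; apply: is_derive_near.
by apply: filterS (clamp_near sab) => t; rewrite /on_arc => ->.
Qed.

Section Line.
Variables (q ta : R * R) (a b : R).
Notation c := (larc q ta a b).
Hypothesis ta1 : ta.1 ^+ 2 + ta.2 ^+ 2 = 1.

(** Components, seen from [K], of the gradient along the normal [(ta.2, - ta.1)] and along [ta];
    [dntr] and [dttr] are their derivatives along the line. *)
Definition ntr K s := on_arc c (g1 K) s * ta.2 - on_arc c (g2 K) s * ta.1.
Definition ttr K s := on_arc c (g1 K) s * ta.1 + on_arc c (g2 K) s * ta.2.
Definition dttr K s :=
  (on_arc c (g11 K) s * ta.1 + on_arc c (g12 K) s * ta.2) * ta.1 +
  (on_arc c (g21 K) s * ta.1 + on_arc c (g22 K) s * ta.2) * ta.2.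
Definition dntr K s :=
  (on_arc c (g11 K) s * ta.1 + on_arc c (g12 K) s * ta.2) * ta.2 -
  (on_arc c (g21 K) s * ta.1 + on_arc c (g22 K) s * ta.2) * ta.1.

Lemma trs_continuous K i : edge_arc (epar K) i c ->
  [/\ continuous (ntr K), continuous (ttr K), continuous (dttr K) & continuous (dntr K)].
Proof.
move=> ic; have [_ c11 c12] := g1C K; have [_ c21 c22] := g2C K.
have c1 := wC1_cin (g1C K); have c2 := wC1_cin (g2C K).
have k1 := on_arc_continuous ic c1; have k2 := on_arc_continuous ic c2.
have k11 := on_arc_continuous ic c11; have k12 := on_arc_continuous ic c12.
have k21 := on_arc_continuous ic c21; have k22 := on_arc_continuous ic c22.
have M (f : R -> R) (u : R) : continuous f -> continuous (fun s => f s * u).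
  by move=> fc s; apply: cvgM; [exact: fc|exact: cvg_cst].
have D (f g : R -> R) : continuous f -> continuous g -> continuous (fun s => f s + g s).
  by move=> fc gc s; apply: cvgD; [exact: fc|exact: gc].
have B (f g : R -> R) : continuous f -> continuous g -> continuous (fun s => f s - g s).
  by move=> fc gc s; apply: cvgB; [exact: fc|exact: gc].
have k1' := D _ _ (M _ ta.1 k11) (M _ ta.2 k12); have k2' := D _ _ (M _ ta.1 k21) (M _ ta.2 k22).
split; [exact: (B _ _ (M _ _ k1) (M _ _ k2))|exact: (D _ _ (M _ _ k1) (M _ _ k2))|
  exact: (D _ _ (M _ _ k1') (M _ _ k2'))|exact: (B _ _ (M _ _ k1') (M _ _ k2'))].
Qed.

Lemma trs_derive K i (s : R) : edge_arc (epar K) i c -> a < s < b ->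
  is_derive s 1 (ntr K) (dntr K s) /\ is_derive s 1 (ttr K) (dttr K s).
Proof.
move=> ic sab; have d1 := on_arc_derive ic (g1C K) sab; have d2 := on_arc_derive ic (g2C K) sab.
have M (f : R -> R) (d u : R) : is_derive s 1 f d -> is_derive s 1 (fun s => f s * u) (d * u).
  move=> df; have h := is_deriveM df (is_derive_cst u s 1).
  by apply: is_derive_eq; rewrite scaler0 add0r /cst /GRing.scale /= mulrC.
split; first by apply: is_deriveB; exact: M.
by apply: is_deriveD; exact: M.
Qed.

Lemma wint_line K i : edge_arc (epar K) i c ->
  wint g1 g2 g11 g12 g21 g22 K c = 2 * itg a b (fun s => ntr K s * dttr K s) -
    (ntr K b * ttr K b - ntr K a * ttr K a).
Proof.
move=> ic; have ab := arc_lohi ic.1; rewrite /= in ab.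
have [nc tc dtc dnc] := trs_continuous ic.
have der s : a < s < b -> is_derive s 1 (ntr K) (dntr K s) /\ is_derive s 1 (ttr K) (dttr K s).
  exact: trs_derive ic.
have W (f : R -> R) : continuous f -> {within `[a, b], continuous f} by move=> fc; exact: continuous_subspaceT fc.
have P := itg_parts ab (W _ dnc) (W _ nc) (fun s h => (der s h).1) (W _ dtc) (W _ tc)
  (fun s h => (der s h).2).
have Mc (f g : R -> R) : continuous f -> continuous g -> continuous (fun s => f s * g s).
  by move=> fc gc s; apply: cvgM; [exact: fc|exact: gc].
have E0 : wint g1 g2 g11 g12 g21 g22 K c =
    itg a b (fun s => ntr K s * dttr K s) - itg a b (fun s => dntr K s * ttr K s).
  rewrite -itgB; [|exact/W/Mc|exact/W/Mc].
  have [_ c11 c12] := g1C K; have [_ c21 c22] := g2C K.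
  have c1 := on_arc_continuous ic (wC1_cin (g1C K)).
  have c2 := on_arc_continuous ic (wC1_cin (g2C K)).
  have k11 := on_arc_continuous ic c11; have k12 := on_arc_continuous ic c12.
  have k21 := on_arc_continuous ic c21; have k22 := on_arc_continuous ic c22.
  have L (f d1 d2 : R * R -> R) : lint c f d1 d2 =
      itg a b (fun s => on_arc c f s * (on_arc c d1 s * ta.1 + on_arc c d2 s * ta.2)).
    by apply: eq_itg => s sab; rewrite !on_arcE.
  rewrite /wint !L -itgB.
  - apply: eq_itg => s _; rewrite /ntr /ttr /dntr /dttr.
    set G1 := on_arc _ _ s; set G2 := on_arc _ (g2 K) s.
    set d2 := on_arc _ (g21 K) s * _ + _ * _; set d1 := on_arc _ (g11 K) s * _ + _ * _.
    (* The left side is multiplied by [|ta|^2 = 1], which makes the identity polynomial. *)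
    rewrite -[LHS]mul1r -ta1; ring.
  - apply: W; apply: (Mc) => //; move=> s; apply: cvgD; apply: cvgM;
      [exact: k21|exact: cvg_cst|exact: k22|exact: cvg_cst].
  - apply: W; apply: (Mc) => //; move=> s; apply: cvgD; apply: cvgM;
      [exact: k11|exact: cvg_cst|exact: k12|exact: cvg_cst].
rewrite E0; lra.
Qed.

(** Difference quotients along [ta] use only values of [vh] on the edge, so this derivative can be
    computed from either adjacent element. *)
Lemma ttr_derivative K i (s : R) : edge_arc (epar K) i c -> a < s < b ->
  'D_ta vh (q + s *: ta) = ttr K s.
Proof.
move=> ic sab; apply: derive_val; apply/is_deriveP.
have := apt_derive ic (vC K) sab => /is_derive1P.
have sab' : a <= s <= b by have [? ?] := andP sab; rewrite !ltW.
rewrite /ttr !on_arcE//=; congr is_derive; apply/funext => h; congr vh.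
by rewrite scalerDl addrCA.
Qed.

Lemma dttr_derivative K i (s : R) : edge_arc (epar K) i c -> a < s < b ->
  'D_ta ('D_ta vh) (q + s *: ta) = dttr K s.
Proof.
move=> ic sab; have [_ /is_derive1P dt] := trs_derive ic sab.
apply: derive_val; apply/is_deriveP; apply: is_derive_near dt.
have cs : h + s @[h --> (0 : R)] --> s.
  by rewrite -{2}[s]add0r; apply: cvgD; [exact: cvg_id|exact: cvg_cst].
have o : \forall t \near s, `]a, b[%classic t.
  by apply: open_nbhs_nbhs; split; [exact: interval_open|rewrite /= in_itv].
have o' : \forall h \near (0 : R), `]a, b[%classic (h + s) := cs _ o.
apply: filterS o' => h; rewrite /= in_itv /= => hab.
by rewrite -(ttr_derivative ic hab) scalerDl addrCA.
Qed.

Lemma continuous_eq_itv (f g : R -> R) (x y s : R) : continuous f -> continuous g -> x < y ->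
  (forall t, x < t < y -> f t = g t) -> x <= s <= y -> f s = g s.
Proof.
move=> fc gc xy fg sxy; apply: contrapT => nfg.
pose h t := f t - g t.
have hc : continuous h by move=> t; apply: cvgB; [exact: fc|exact: gc].
have h0 : h s != 0 by rewrite subr_eq0; apply/eqP.
have n : \forall t \near s, h t != 0.
  have := hc s; move=> /cvgrPdist_lt /(_ `|h s|); rewrite normr_gt0 => /(_ h0).
  by apply: filterS => t; apply: contraTN => /eqP ->; rewrite subr0 ltxx.
move: n => /nbhs_ballP[e /= e0 eP].
have [t [txy ts]] : exists t, x < t < y /\ `|s - t| < e.
  pose d := Order.min e (y - x) / 4.
  have d0 : 0 < d by rewrite divr_gt0// lt_min e0 subr_gt0.
  have de : d < e.
    have := d0; rewrite /d; have : Order.min e (y - x) <= e by rewrite ge_min lexx.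
    lra.
  have dxy : d < (y - x) / 2.
    have := d0; rewrite /d; have : Order.min e (y - x) <= y - x by rewrite ge_min lexx orbT.
    lra.
  have [h1|h1] := leP s ((x + y) / 2).
    by exists (s + d); rewrite opprD addNKr normrN gtr0_norm//; split=> //; lra.
  by exists (s - d); rewrite opprB addrCA subrr addr0 gtr0_norm//; split=> //; lra.
have := eP t ts; by rewrite /h fg// subrr eqxx.
Qed.

(** At inner points both are the second derivative of [vh] along the edge; the end points follow by
    continuity. *)
Lemma shared_ttr K K' i j s : edge_arc (epar K) i c -> edge_arc (epar K') j c -> a <= s <= b ->
  dttr K s = dttr K' s.
Proof.
move=> ic ic' sab; have ab := arc_lohi ic.1; rewrite /= in ab.
have [_ _ tc _] := trs_continuous ic; have [_ _ tc' _] := trs_continuous ic'.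
apply: (continuous_eq_itv tc tc' ab) => // t tab.
by rewrite -(dttr_derivative ic tab) (dttr_derivative ic' tab).
Qed.

Lemma shared_ends K K' i j : C1_at_vertices Th vh -> edge K i = edge K' j ->
  edge_arc (epar K) i c -> edge_arc (epar K') j c ->
  [/\ ntr K a = ntr K' a, ttr K a = ttr K' a, ntr K b = ntr K' b & ttr K b = ttr K' b].
Proof.
move=> C1v EE ic ic'; have ab := ltW (arc_lohi ic.1); rewrite /= in ab.
have [al [k H]] := elt_curved_tri hTh K; have [al' [k' H']] := elt_curved_tri hTh K'.
have vx s : s = a \/ s = b -> (exists l, apt c s = vertex K l) /\ (exists l, apt c s = vertex K' l).
  have := edge_arc_ends H ic; have := edge_arc_ends H' ic'; rewrite !epar0 !epar1 /=.
  by move=> [[A1 A2]|[A1 A2]] [[B1 B2]|[B1 B2]] [->|->]; split; eexists; eassumption.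
have gE s : s = a \/ s = b -> on_arc c (g1 K) s = on_arc c (g1 K') s /\
    on_arc c (g2 K) s = on_arc c (g2 K') s.
  move=> sE; have sab : a <= s <= b by case: sE => ->; rewrite ?lexx ?ab.
  have [[l lE] [l' lE']] := vx s sE; rewrite !on_arcE//.
  have vv : vertex K l = vertex K' l' by rewrite -lE -lE'.
  by have [h1 h2] := grad_vertex hTh vC C1v vv; rewrite lE.
have [a1 a2] := gE a (or_introl erefl); have [b1 b2] := gE b (or_intror erefl).
by rewrite /ntr /ttr a1 a2 b1 b2.
Qed.

Lemma shared_wint K K' i j : C1_at_vertices Th vh -> edge K i = edge K' j ->
  edge_arc (epar K) i c -> edge_arc (epar K') j c ->
  wint g1 g2 g11 g12 g21 g22 K c + wint g1 g2 g11 g12 g21 g22 K' (arc_rev c) =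
  2 * itg a b (fun s => (ntr K s - ntr K' s) * dttr K s).
Proof.
move=> C1v EE ic ic'; rewrite (wint_rev hTh g1C g2C ic') (wint_line ic) (wint_line ic').
have [-> -> -> ->] := shared_ends C1v EE ic ic'.
have [nc _ dtc _] := trs_continuous ic; have [nc' _ dtc' _] := trs_continuous ic'.
have W (f : R -> R) : continuous f -> {within `[a, b], continuous f} by move=> fc; exact: continuous_subspaceT fc.
have Mc (f g : R -> R) : continuous f -> continuous g -> continuous (fun s => f s * g s).
  by move=> fc gc s; apply: cvgM; [exact: fc|exact: gc].
have -> : itg a b (fun s => ntr K' s * dttr K' s) = itg a b (fun s => ntr K' s * dttr K s).
  by apply: eq_itg => s sab; rewrite (shared_ttr ic ic').
have -> : itg a b (fun s => (ntr K s - ntr K' s) * dttr K s) =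
    itg a b (fun s => ntr K s * dttr K s) - itg a b (fun s => ntr K' s * dttr K s).
  rewrite -itgB; [|exact/W/Mc|exact/W/Mc].
  by apply: eq_itg => s _; rewrite mulrBl.
lra.
Qed.

(** A unit vector orthogonal to the edge is [(ta.2, - ta.1)] or its opposite, and the opposite
    points into the element because the arc is outward. *)
Lemma outward_normal K i n : edge_arc (epar K) i c -> outward (elt K) c ->
  outward_unit_normal (elt K) (edge K i) n -> n = (ta.2, - ta.1).
Proof.
move=> ic oc [n1 nperp nout]; have ab := arc_lohi ic.1; rewrite /= in ab.
pose s := (a + b) / 2; have sab : a < s < b by rewrite /s; lra.
have im := ic.2; rewrite epar_edge in im.
have on t : a <= t <= b -> edge K i (q + t *: ta).
  by move=> tab; rewrite -im; exists t => //; rewrite /= in_itv.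
have pa : edge K i (q + a *: ta) by apply: on; rewrite lexx ltW.
have pb : edge K i (q + b *: ta) by apply: on; rewrite lexx ltW.
have ps : edge K i (q + s *: ta) by apply: on; have [? ?] := andP sab; rewrite !ltW.
have nt : n.1 * ta.1 + n.2 * ta.2 = 0.
  have := nperp _ _ pb pa; rewrite /dot !crdE => h.
  have /eqP : (b - a) * (n.1 * ta.1 + n.2 * ta.2) = 0 by rewrite -[RHS]h; ring.
  by rewrite mulf_eq0 subr_eq0 (gt_eqF ab)/= => /eqP.
have nn : n.1 ^+ 2 + n.2 ^+ 2 = 1.
  by have := enorm_sqr n; rewrite n1 /dot expr1n -!expr2 => <-.
pose la := n.1 * ta.2 - n.2 * ta.1.
have la2 : la ^+ 2 = 1 by rewrite /la; have := ta1; nra.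
have e1 : n.1 = la * ta.2.
  rewrite -[LHS]mulr1 -ta1 /la; have -> : n.1 * (ta.1 ^+ 2 + ta.2 ^+ 2) =
    (n.1 * ta.2 - n.2 * ta.1) * ta.2 + ta.1 * (n.1 * ta.1 + n.2 * ta.2) by ring.
  by rewrite nt mulr0 addr0.
have e2 : n.2 = - (la * ta.1).
  rewrite -[LHS]mulr1 -ta1 /la; have -> : n.2 * (ta.1 ^+ 2 + ta.2 ^+ 2) =
    - ((n.1 * ta.2 - n.2 * ta.1) * ta.1) + ta.2 * (n.1 * ta.1 + n.2 * ta.2) by ring.
  by rewrite nt mulr0 addr0.
have : (la == 1) || (la == -1) by rewrite -eqf_sqr la2 expr1n.
move=> /orP[/eqP l1|/eqP l1]; first by apply: prod_ext; rewrite ?e1 ?e2 l1 !mul1r.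
have nE : n = (- ta.2, ta.1) by apply: prod_ext; rewrite ?e1 ?e2 l1 !mulN1r ?opprK.
have dn : dot n (arc_normal c s) < 0.
  rewrite nE /arc_normal /dot /=; have := ta1; nra.
have h := oc s n sab dn.
by have [t [[h1 _] h2]] := filter_ex (filterI h (nout _ ps)); case: h2; exact: interior_subset h1.
Qed.

End Line.

Lemma larc_rev q ta (a b : R) : arc_rev (larc q ta a b) = larc q (- ta) (- b) (- a).
Proof.
by rewrite /arc_rev /larc /=; congr Arc; apply/funext => s; rewrite scalerN scaleNr.
Qed.

Variables (xb : R -> R * R) (L : R).
Hypothesis hOmega : C2_domain Omega xb L.
Hypothesis C1v : C1_at_vertices Th vh.
Variables (nK : Th -> set (R * R) -> R * R) (tF : set (R * R) -> R * R).

Lemma shared_edge_int K K' i j (q := get (edge K i)) (ta := tF (edge K i)) (a b : R) :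
  K <> K' -> edge K i = edge K' j -> unit_tangent (edge K i) ta ->
  outward_unit_normal (elt K) (edge K i) (nK K (edge K i)) ->
  outward_unit_normal (elt K') (edge K i) (nK K' (edge K i)) ->
  edge_arc (epar K) i (larc q ta a b) -> (forall s, edge K i (q + s *: ta) <-> a <= s <= b) ->
  outward (elt K) (larc q ta a b) -> outward (elt K') (arc_rev (larc q ta a b)) ->
  wint g1 g2 g11 g12 g21 g22 K (larc q ta a b) +
    wint g1 g2 g11 g12 g21 g22 K' (arc_rev (larc q ta a b)) =
  2 * straight_edge_int tF (edge K i) (fun x => normal_jump nK vh (edge K i) x *
     'D_ta ('D_ta vh) x).
Proof.
move=> KK' EE [ta1 tperp] nk nk' ic Fab o o'.
have tt : ta.1 ^+ 2 + ta.2 ^+ 2 = 1.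
  by have := enorm_sqr ta; rewrite ta1 /dot expr1n -!expr2 => <-.
have ic' := edge_arc_eq EE ic.
rewrite (shared_wint tt C1v EE ic ic'); congr (2 * _).
rewrite /straight_edge_int /arc_int -/ta -/q.
have -> : [set s : R | [set: R] s /\ edge K i (q + s *: ta)] = `[a, b]%classic.
  apply/seteqP; split=> s; rewrite /= in_itv /=; first by move=> [_ /Fab].
  by move=> /Fab.
have nKE := outward_normal tt ic o nk.
have nKE' : nK K' (edge K i) = (- ta.2, ta.1).
  rewrite EE in nk'; rewrite larc_rev in o'.
  have icr := edge_arc_rev ic'; rewrite larc_rev in icr.
  have tt' : (- ta).1 ^+ 2 + (- ta).2 ^+ 2 = 1 by rewrite !crdE !sqrrN.
  by have := outward_normal tt' icr o' nk'; rewrite -EE !crdE opprK.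
have [nc _ dtc _] := trs_continuous ic; have [nc' _ _ _] := trs_continuous ic'.
apply: esym; apply: itg_oo.
  by move=> s; apply: cvgM; [apply: cvgB; [exact: nc|exact: nc']|exact: dtc].
move=> s sab /=; rewrite (dttr_derivative ic sab); congr (_ * _).
have sab' : a <= s <= b by have [? ?] := andP sab; rewrite !ltW.
have Fs : edge K i (q + s *: ta) by apply/Fab.
have Ks := edge_sub hTh Fs; have Ks' : elt K' (q + s *: ta) by apply: (edge_sub hTh (i := j)); rewrite -EE.
(* The jump is a sum over all elements with this edge, which are [K] and [K'] only. *)
have PE (K2 : Th) : `[< is_edge K2 (edge K i) >] = (K2 == K) || (K2 == K').
  apply/asboolP/orP => [[i2 E2]|].
    by case: (shared_two hOmega hTh KK' EE E2) => ->; rewrite eqxx; auto.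
  by move=> [/eqP ->|/eqP ->]; [exists i|exists j].
rewrite /normal_jump (bigD1 K) /=; last by rewrite PE eqxx.
rewrite (bigD1 K') /=; last by rewrite PE eqxx orbT andTb; apply/eqP => E; apply: KK'.
rewrite big1 ?addr0; last by move=> K2; rewrite PE => /andP[/andP[/orP[/eqP ->|/eqP ->]]]; rewrite ?eqxx.
rewrite (grad_trace_elt hTh vC Ks) (grad_trace_elt hTh vC Ks') nKE nKE' /dot /ntr /= !on_arcE//=.
ring.
Qed.

End InteriorEdges.

(** * Boundary edges *)

Section BoundaryEdges.
Context {R : realType}.
Notation mu := (@lebesgue_measure R).
Notation mR := (measurableTypeR R).
Variables (Omega : set (R * R)) (xb : R -> R * R) (L : R).
Hypothesis hOmega : C2_domain Omega xb L.
Variables (ell : R * R -> R * R) (theta : R -> R).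
Hypothesis hl : oblique_field Omega xb L ell theta.
Variable chi0 : R.
Hypothesis hchi0 : is_chi0 xb L theta chi0.

Lemma ccM (f g : R -> R) : continuous f -> continuous g -> continuous (fun s => f s * g s).
Proof. by move=> fc gc s; apply: cvgM; [exact: fc|exact: gc]. Qed.

Lemma ccD (f g : R -> R) : continuous f -> continuous g -> continuous (fun s => f s + g s).
Proof. by move=> fc gc s; apply: cvgD; [exact: fc|exact: gc]. Qed.

Lemma ccN (f : R -> R) : continuous f -> continuous (fun s => - f s).
Proof. by move=> fc s; apply: cvgN; exact: fc. Qed.

Lemma is_derive_derive1 (f : R -> R) (s : R) : (forall s, derivable f s 1) ->
  is_derive s 1 f (derive1 f s).
Proof. by move=> df; rewrite derive1E; exact: DeriveDef. Qed.

Lemma derive1_periodic (f : R -> R) (s : R) : (forall t, f (t + L) = f t) ->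
  derive1 f (s + L) = derive1 f s.
Proof.
move=> fp; rewrite /derive1.
have -> : (fun h => h^-1 *: (f (h + (s + L)) - f (s + L))) = (fun h => h^-1 *: (f (h + s) - f s)).
  by apply/funext => h; rewrite addrA !fp.
by [].
Qed.

Notation l1 := (fun s : R => (ell (xb s)).1).
Notation l2 := (fun s : R => (ell (xb s)).2).
Notation dl1 := (derive1 l1).
Notation dl2 := (derive1 l2).
Notation t1 := (fun s : R => (tangent xb s).1).
Notation t2 := (fun s : R => (tangent xb s).2).

Lemma ell_C1 : [/\ forall s : R, is_derive s 1 l1 (dl1 s), forall s : R, is_derive s 1 l2 (dl2 s),
  continuous dl1 & continuous dl2].
Proof.
have C := obl_C1 hl; have [d0 c0] := C 0; have [d1 c1] := C 1.
split; [| |exact: c0|exact: c1] => s.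
- exact: (is_derive_derive1 (f := coord 0 \o (ell \o xb)) s d0).
- exact: (is_derive_derive1 (f := coord 1 \o (ell \o xb)) s d1).
Qed.

Lemma ell_continuous : continuous l1 /\ continuous l2.
Proof.
have [d1 d2 _ _] := ell_C1.
by split=> s; [exact: is_derive_continuous (d1 s)|exact: is_derive_continuous (d2 s)].
Qed.

Lemma ell_unit s : (ell (xb s)).1 ^+ 2 + (ell (xb s)).2 ^+ 2 = 1.
Proof.
have := enorm_sqr (ell (xb s)); rewrite (obl_unit hl (frontier_xb hOmega s)) /dot expr1n -!expr2.
by move=> <-.
Qed.

(** Angular velocity of the unit vector [ell] along the boundary. *)
Definition turn s := l1 s * dl2 s - l2 s * dl1 s.

Lemma turn_continuous : continuous turn.
Proof.
have [_ _ c1 c2] := ell_C1; have [k1 k2] := ell_continuous.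
exact: (ccD (ccM k1 c2) (ccN (ccM k2 c1))).
Qed.

(** [ell] is the normal turned by [theta], and the normal itself turns at the rate [- chi]. The
    angle is given on [[0, L]], whence the open interval for its derivative. *)
Lemma turn_oo (s : R) : 0 < s < L -> turn s = derive1 theta s - chi xb s.
Proof.
move=> sL; have [h0 _] := obl_angle_C1 hl.
have dth : is_derive s 1 theta (derive1 theta s) by rewrite derive1E; exact: DeriveDef.
have C := dom_C2 hOmega; have [_ [e0 _]] := C 0; have [_ [e1 _]] := C 1.
have dt1 : is_derive s 1 t1 (derive1n 2 (coord 0 \o xb) s).
  exact: (is_derive_derive1 (f := derive1 (coord 0 \o xb)) s e0).
have dt2 : is_derive s 1 t2 (derive1n 2 (coord 1 \o xb) s).
  exact: (is_derive_derive1 (f := derive1 (coord 1 \o xb)) s e1).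
have dc : is_derive s 1 (fun s => cos (theta s)) (- sin (theta s) * derive1 theta s).
  exact: (is_derive1_comp (is_derive_cos (theta s)) dth).
have ds : is_derive s 1 (fun s => sin (theta s)) (cos (theta s) * derive1 theta s).
  exact: (is_derive1_comp (is_derive_sin (theta s)) dth).
have oL : \forall t \near s, t \in `[0, L].
  have o : \forall t \near s, `]0, L[%classic t.
    by apply: open_nbhs_nbhs; split; [exact: interval_open|rewrite /= in_itv].
  by apply: filterS o => t; rewrite /= !in_itv /= => /andP[? ?]; rewrite !ltW.
have E0 t : t \in `[0, L] -> l1 t = cos (theta t) * t2 t + sin (theta t) * t1 t /\
    l2 t = - (cos (theta t) * t1 t) + sin (theta t) * t2 t.
  by move=> tL; rewrite (obl_angle hl tL) /normal !crdE /= opprK mulrN.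
have [v1 v2] := E0 s (nbhs_singleton oL).
have D1 : is_derive s 1 l1 (cos (theta s) * derive1n 2 (coord 1 \o xb) s +
    t2 s * (- sin (theta s) * derive1 theta s) +
    (sin (theta s) * derive1n 2 (coord 0 \o xb) s + t1 s * (cos (theta s) * derive1 theta s))).
  have h := is_deriveD (is_deriveM dc dt2) (is_deriveM ds dt1).
  have n : \forall t \near s, cos (theta t) * t2 t + sin (theta t) * t1 t = l1 t.
    by apply: filterS oL => t /E0[].
  exact: (is_derive_near n h).
have D2 : is_derive s 1 l2 (- (cos (theta s) * derive1n 2 (coord 0 \o xb) s +
    t1 s * (- sin (theta s) * derive1 theta s)) +
    (sin (theta s) * derive1n 2 (coord 1 \o xb) s + t2 s * (cos (theta s) * derive1 theta s))).
  have h := is_deriveD (is_deriveN (is_deriveM dc dt1)) (is_deriveM ds dt2).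
  have n : \forall t \near s, - (cos (theta t) * t1 t) + sin (theta t) * t2 t = l2 t.
    by apply: filterS oL => t /E0[].
  exact: (is_derive_near n h).
have W1 := @derive_val _ _ _ _ _ _ _ D1; rewrite -derive1E in W1.
have W2 := @derive_val _ _ _ _ _ _ _ D2; rewrite -derive1E in W2.
rewrite /turn W1 W2 v1 v2 /chi.
have tu : t1 s ^+ 2 + t2 s ^+ 2 = 1.
  by have := enorm_sqr (tangent xb s); rewrite (dom_arclength hOmega) /dot expr1n -!expr2 => <-.
have cs := cos2Dsin2 (theta s).
move: tu cs; move: (t1 s) (t2 s) (cos (theta s)) (sin (theta s)) (derive1 theta s).
move: (derive1n 2 (coord 0 \o xb) s) (derive1n 2 (coord 1 \o xb) s) => d0 d1 a b c z h tu cs.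
(* The unit lengths of the tangent and of [(cos, sin)] enter as factors, which leaves a polynomial
   identity. *)
transitivity ((c ^+ 2 + z ^+ 2) * (h * (a ^+ 2 + b ^+ 2) - (d0 * b - d1 * a))); first ring.
by rewrite tu cs !mul1r mulr1.
Qed.

(** Beyond [L] by periodicity of [ell] along the curve, at [L] by continuity. The range reaches
    [2 L] because the interval of an edge is counted from some [s0] in [[0, L[]. *)
Lemma turn_ge (s : R) : 0 < s < L + L -> chi0 <= turn s.
Proof.
have [_ cle] := hchi0; have L0 := dom_length hOmega.
have lt (u : R) : 0 < u < L -> chi0 <= turn u.
  by move=> uL; rewrite turn_oo//; apply: cle; rewrite in_itv /=; have [? ?] := andP uL; rewrite !ltW.
move=> sL; have [h|h|h] := ltgtP s L.
- by apply: lt; lra.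
- have -> : turn s = turn (s - L).
    have p (f : R * R -> R) u : derive1 (fun s => f (ell (xb s))) (u + L) =
        derive1 (fun s => f (ell (xb s))) u.
      by apply: derive1_periodic => t; rewrite (dom_periodic hOmega).
    have := p fst (s - L); have := p snd (s - L); rewrite /turn subrK => -> ->.
    by have := dom_periodic hOmega (s - L); rewrite subrK => ->.
  by apply: lt; lra.
- rewrite leNgt; apply/negP => tl; have tc : {for s, continuous turn} by exact: turn_continuous.
  move: tc.
  move=> /cvgrPdist_lt /(_ (chi0 - turn s)); rewrite subr_gt0 => /(_ tl) n.
  have n' : \forall u \near s^'-, `|turn s - turn u| < chi0 - turn s.
    by apply: filterS n => u hu _.
  have n0 : \forall u \near s^'-, 0 < u by apply: nbhs_left_gt; rewrite h.
  have nL : \forall u \near s^'-, u < s by exact: nbhs_left_lt.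
  have [u [[hu u0] us]] := @filter_ex _ _ (at_left_proper_filter s) _ (filterI (filterI n' n0) nL).
  have := lt u; rewrite u0 -h us => /(_ isT).
  by move: hu; rewrite ltr_norml; lra.
Qed.


Variables (Th : triangulation R).
Hypothesis hTh : exact_conforming Omega Th.
Variable vh : R * R -> R.
Variables (g1 g2 g11 g12 g21 g22 : Th -> R * R -> R).
Hypothesis vC : forall K, wC1 (elt K) vh (g1 K) (g2 K).
Hypothesis g1C : forall K, wC1 (elt K) (g1 K) (g11 K) (g12 K).
Hypothesis g2C : forall K, wC1 (elt K) (g2 K) (g21 K) (g22 K).
Variables (Q q1 q2 : R * R -> R).
Hypothesis QC : wC1 setT Q q1 q2.
(* The integral of [dQ], the derivative of [Q] along [xb], over a boundary edge is
   the increment of the product of the two oblique derivatives. *)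
Hypothesis Qv : forall (K : Th) (l : 'I_3),
  Q (vertex K l) = dot (ell (vertex K l)) (g1 K (vertex K l), g2 K (vertex K l)) *
    dot (perp (ell (vertex K l))) (g1 K (vertex K l), g2 K (vertex K l)).
Notation fr := (frontier Omega).
Notation W := (wint g1 g2 g11 g12 g21 g22).

Implicit Types (K : Th) (i : 'I_3) (s : R).

Definition dQ (s : R) := q1 (xb s) * t1 s + q2 (xb s) * t2 s.

Lemma tangent_continuous : continuous t1 /\ continuous t2.
Proof.
by have ok := xarc_ok hOmega (ltr01 : 0 < 1 :> R); split; [exact: (arc_dirc1 ok)|exact: (arc_dirc2 ok)].
Qed.

Lemma dQ_continuous : continuous dQ.
Proof.
have [_ c1 c2] := QC; have [k1 k2] := tangent_continuous.
have cc f : cin setT f -> continuous (fun s => f (xb s)).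
  by move=> fc; exact: (cin_comp fc (xb_continuous hOmega)).
exact: (ccD (ccM (cc _ c1) k1) (ccM (cc _ c2) k2)).
Qed.

Lemma Q_derive (s : R) : is_derive s 1 (fun s => Q (xb s)) (dQ s).
Proof.
have ok := xarc_ok hOmega (ltr01 : 0 < 1 :> R); have [Qd _ _] := QC.
have E0 t : xb t = ((xb t).1, (xb t).2) by case: (xb t).
have w : wdiff setT Q (q1 (xb s)) (q2 (xb s)) ((xb s).1, (xb s).2) by rewrite -E0; exact: Qd.
have n : \forall t \near s, [set: R * R] ((xb t).1, (xb t).2) by near=> t.
have := wdiff_curve w (arc_der1 ok s) (arc_der2 ok s) n.
by rewrite (_ : (fun t => Q ((xb t).1, (xb t).2)) = (fun t => Q (xb t)))//;
  apply/funext => t; rewrite -E0.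
Unshelve. all: by end_near. Qed.

Lemma dQ_periodic s : dQ (s + L) = dQ s.
Proof.
rewrite /dQ (dom_periodic hOmega); congr (_ * _ + _ * _);
  by apply: derive1_periodic => t; rewrite /= (dom_periodic hOmega).
Qed.

Lemma edge_params_measurable K i :
  measurable ([set s | `[0, L]%classic s /\ edge K i (xb s)] : set mR).
Proof.
have [al [k H]] := elt_curved_tri hTh K.
have Fc : closed (edge K i).
  rewrite -epar_edge; apply: compact_closed; first exact: norm_hausdorff.
  apply: continuous_compact; last exact: segment_compact.
  by apply: continuous_subspaceT; exact: (ct_cont H).
have c : closed (xb @^-1` edge K i).
  by apply: closed_comp => // s _; exact: (xb_continuous hOmega).
apply: measurableI; first exact: measurable_itv.
exact: closed_measurable.
Qed.

Lemma boundary_int K i s0 a b (f g : R -> R) : 0 <= s0 < L -> s0 < a -> a < b -> b < s0 + L ->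
  (forall s, s0 <= s <= s0 + L -> edge K i (xb s) <-> a <= s <= b) ->
  continuous g -> (forall s, f (s + L) = f s) -> (forall s, a < s < b -> f s = g s) ->
  boundary_edge_int xb L (edge K i) f = itg a b g.
Proof.
move=> h1 h2 h3 h4 FE gc fp fg.
apply: (Rintegral_periodic gc fp fg h1 h2 h3 h4); first exact: edge_params_measurable.
- by move=> s [].
- move=> s sL; rewrite -FE; last by lra.
  by split=> [[]//|es]; split=> //; rewrite /= in_itv /=; lra.
- move=> s sL; rewrite -FE; last by lra.
  rewrite (dom_periodic hOmega).
  by split=> [[]//|es]; split=> //; rewrite /= in_itv /=; lra.
Qed.

Lemma bd_wint K i : edge K i `<=` fr -> exists c : arc R,
  [/\ edge_arc (epar K) i c, outward (elt K) c &
   chi0 * boundary_edge_int xb L (edge K i) (fun s => enorm (bgrad Th vh (xb s)) ^+ 2) +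
     boundary_edge_int xb L (edge K i) dQ <=
   W K c + 2 * boundary_edge_int xb L (edge K i)
     (fun s => derive1 (d_ell Th xb ell vh) s * d_ellperp Th xb ell vh s)].
Proof.
move=> bd; have [s0 [a [b [h1 h2 h3 h4 FE]]]] := bd_arc hOmega hTh bd.
have ic := bd_edge_arc hOmega bd h1 h2 h3 h4 FE; set c := xarc xb a b in ic.
have oc := bd_outward hOmega hTh ic; exists c; split=> //.
have [al [k H]] := elt_curved_tri hTh K.
have [_ c11 c12] := g1C K; have [_ c21 c22] := g2C K.
have k1 := on_arc_continuous hTh ic (wC1_cin (g1C K)).
have k2 := on_arc_continuous hTh ic (wC1_cin (g2C K)).
have k11 := on_arc_continuous hTh ic c11; have k12 := on_arc_continuous hTh ic c12.
have k21 := on_arc_continuous hTh ic c21; have k22 := on_arc_continuous hTh ic c22.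
pose y1 := on_arc c (g1 K); pose y2 := on_arc c (g2 K).
pose d1 s := on_arc c (g11 K) s * t1 s + on_arc c (g12 K) s * t2 s.
pose d2 s := on_arc c (g21 K) s * t1 s + on_arc c (g22 K) s * t2 s.
have [tc1 tc2] := tangent_continuous; have [lc1 lc2] := ell_continuous.
have [ld1 ld2 dlc1 dlc2] := ell_C1.
have dc1 : continuous d1 := ccD (ccM k11 tc1) (ccM k12 tc2).
have dc2 : continuous d2 := ccD (ccM k21 tc1) (ccM k22 tc2).
have yd s : a < s < b -> is_derive s 1 y1 (d1 s) /\ is_derive s 1 y2 (d2 s).
  by move=> sab; split; [exact: (on_arc_derive hTh ic (g1C K) sab)|
    exact: (on_arc_derive hTh ic (g2C K) sab)].
(* The oblique derivatives along the edge as continuous functions on the line; strictly between the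
   end points they coincide with [d_ell] and [d_ellperp]. *)
pose al_ s := l1 s * y1 s + l2 s * y2 s; pose be s := - l2 s * y1 s + l1 s * y2 s.
pose dal s := (l1 s * d1 s + y1 s * dl1 s) + (l2 s * d2 s + y2 s * dl2 s).
pose dbe s := (- l2 s * d1 s + y1 s * - dl2 s) + (l1 s * d2 s + y2 s * dl1 s).
have alc : continuous al_ := ccD (ccM lc1 k1) (ccM lc2 k2).
have bec : continuous be := ccD (ccM (ccN lc2) k1) (ccM lc1 k2).
have dalc : continuous dal := ccD (ccD (ccM lc1 dc1) (ccM k1 dlc1)) (ccD (ccM lc2 dc2) (ccM k2 dlc2)).
have dbec : continuous dbe.
  exact: (ccD (ccD (ccM (ccN lc2) dc1) (ccM k1 (ccN dlc2))) (ccD (ccM lc1 dc2) (ccM k2 dlc1))).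
have der s : a < s < b -> is_derive s 1 al_ (dal s) /\ is_derive s 1 be (dbe s).
  move=> /yd[e1 e2]; split.
    exact: (is_deriveD (is_deriveM (ld1 s) e1) (is_deriveM (ld2 s) e2)).
  exact: (is_deriveD (is_deriveM (is_deriveN (ld2 s)) e1) (is_deriveM (ld1 s) e2)).
have bg s : a < s < b -> bgrad Th vh (xb s) = (y1 s, y2 s).
  move=> sab; have sab' : a <= s <= b by have [? ?] := andP sab; rewrite !ltW.
  have es : edge K i (xb s) by apply/FE => //; lra.
  rewrite (bgrad_elt hTh vC hOmega bd es); last by move=> l; exact: (arc_not_vertex hTh ic sab).
  by rewrite /y1 /y2 !on_arcE.
have bgp s : bgrad Th vh (xb (s + L)) = bgrad Th vh (xb s) by rewrite (dom_periodic hOmega).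
have de s : a < s < b -> d_ell Th xb ell vh s = al_ s.
  by move=> sab; rewrite /d_ell bg.
have dp s : a < s < b -> d_ellperp Th xb ell vh s = be s.
  by move=> sab; rewrite /d_ellperp bg.
have dde s : a < s < b -> derive1 (d_ell Th xb ell vh) s = dal s.
  move=> sab; have [d _] := der s sab.
  have n : \forall t \near s, al_ t = d_ell Th xb ell vh t.
    have o : \forall t \near s, `]a, b[%classic t.
      by apply: open_nbhs_nbhs; split; [exact: interval_open|rewrite /= in_itv].
    by apply: filterS o => t; rewrite /= in_itv /= => /de.
  have d' := is_derive_near n d.
  by rewrite derive1E; exact: (@derive_val _ _ _ _ _ _ _ d').
rewrite (boundary_int h1 h2 h3 h4 FE (g := fun s => y1 s ^+ 2 + y2 s ^+ 2)); first last.
- by move=> s sab; rewrite bg// enorm_sqr /dot -!expr2.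
- by move=> s; rewrite bgp.
- exact: (ccD (ccM k1 k1) (ccM k2 k2)).
rewrite (boundary_int h1 h2 h3 h4 FE (g := dQ)) //; last exact: dQ_periodic; last exact: dQ_continuous.
rewrite (boundary_int h1 h2 h3 h4 FE (g := fun s => dal s * be s)); first last.
- by move=> s sab; rewrite dde// dp.
- move=> s; rewrite (derive1_periodic (f := d_ell Th xb ell vh)).
    by rewrite /d_ellperp (dom_periodic hOmega).
  by move=> t; rewrite /d_ell (dom_periodic hOmega).
- exact: ccM dalc bec.
have Wi (f : R -> R) : continuous f -> {within `[a, b], continuous f}.
  by move=> fc; exact: continuous_subspaceT fc.
have WE : W K c = itg a b (fun s => y1 s * d2 s) - itg a b (fun s => y2 s * d1 s).
  by rewrite /wint /lint; congr (_ - _); apply: eq_itg => s sab /=; rewrite /y1 /y2 /d1 /d2 !on_arcE.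
pose tn s := turn s * (y1 s ^+ 2 + y2 s ^+ 2).
have tnc : continuous tn := ccM turn_continuous (ccD (ccM k1 k1) (ccM k2 k2)).
have ab' := ltW h3.
(* The ends of the edge are vertices, where [Q] takes the value of the product. *)
have QE : itg a b dQ = al_ b * be b - al_ a * be a.
  have ve s : s = a \/ s = b -> Q (xb s) = al_ s * be s.
    move=> sE; have sab : a <= s <= b by case: sE => ->; rewrite ?lexx ?ab'.
    have [l lE] : exists l, xb s = vertex K l.
      have := edge_arc_ends H ic; rewrite !epar0 !epar1 /= => -[[A1 A2]|[A1 A2]];
      by case: sE => ->; eexists; eassumption.
    rewrite lE Qv.
    by rewrite -lE /al_ /be /y1 /y2 !on_arcE// /dot /= .
  rewrite -(ve b (or_intror erefl)) -(ve a (or_introl erefl)).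
  exact: (itg_FTCc (F := fun s => Q (xb s)) ab' dQ_continuous (fun x _ => Q_derive x)).
have PE : itg a b (fun s => al_ s * dbe s + be s * dal s) = al_ b * be b - al_ a * be a.
  apply: (itg_FTC (F := fun s => al_ s * be s)) => //.
  - exact/Wi/(ccD (ccM alc dbec) (ccM bec dalc)).
  - exact/Wi/(ccM alc bec).
  - by move=> x /der[e1 e2]; exact: (is_deriveM e1 e2).
have TE : W K c + 2 * itg a b (fun s => dal s * be s) = itg a b tn + itg a b dQ.
  rewrite QE -PE WE -itgZ; last exact/Wi/(ccM dalc bec).
  rewrite -itgB; [|exact/Wi/(ccM k1 dc2)|exact/Wi/(ccM k2 dc1)].
  have e1 : continuous (fun s => y1 s * d2 s - y2 s * d1 s).
    exact: (ccD (ccM k1 dc2) (ccN (ccM k2 dc1))).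
  have e2 : continuous (fun s => 2 * (dal s * be s)).
    by apply: ccM; [move=> s; exact: cvg_cst|exact: (ccM dalc bec)].
  have e3 : continuous (fun s => al_ s * dbe s + be s * dal s).
    exact: (ccD (ccM alc dbec) (ccM bec dalc)).
  rewrite -(itgD (Wi _ e1) (Wi _ e2)) -(itgD (Wi _ tnc) (Wi _ e3)).
  apply: eq_itg => s _; rewrite /tn /turn /al_ /be /dal /dbe.
  have lu := ell_unit s; move: lu.
  move: (ell (xb s)).1 (ell (xb s)).2 (dl1 s) (dl2 s) (y1 s) (y2 s) (d1 s) (d2 s).
  move=> u1 u2 v1 v2 z1 z2 w1 w2 lu.
  (* The factor [|ell|^2 = 1] before the first term makes both sides homogeneous in [ell] and its
     derivative, and the identity polynomial. *)
  transitivity ((u1 ^+ 2 + u2 ^+ 2) * (z1 * w2 - z2 * w1) +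
    2 * ((u1 * w1 + z1 * v1 + (u2 * w2 + z2 * v2)) * (- u2 * z1 + u1 * z2))).
    by rewrite lu mul1r.
  ring.
rewrite TE lerD2r -itgZ; last exact/Wi/(ccD (ccM k1 k1) (ccM k2 k2)).
have n2c : continuous (fun s => chi0 * (y1 s ^+ 2 + y2 s ^+ 2)).
  by apply: ccM; [move=> s; exact: cvg_cst|exact: (ccD (ccM k1 k1) (ccM k2 k2))].
apply: le_Rintegral => //=.
- exact: itg_integrable (Wi _ n2c).
- exact: itg_integrable (Wi _ tnc).
- move=> s; rewrite in_itv /= => sab.
  by rewrite /tn ler_wpM2r ?addr_ge0 ?sqr_ge0// turn_ge//; lra.
Qed.

End BoundaryEdges.

(** * Summation over the edges *)

Section Interpolation.
Context {R : realType}.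
Implicit Types (p q w : R * R).

Lemma wC1e_dist2 w : wC1e setT (fun p => dot (p - w) (p - w)).
Proof.
have kst a : wC1e [set: R * R] (cst a) by exact: wC1e_cst.
have f1 : wC1e [set: R * R] fst.
  by exists (cst 1), (cst 0); split=> [p _||]; [exact: wdiff_fst|exact: cin_cst|exact: cin_cst].
have f2 : wC1e [set: R * R] snd.
  by exists (cst 0), (cst 1); split=> [p _||]; [exact: wdiff_snd|exact: cin_cst|exact: cin_cst].
have d1 := wC1eB f1 (kst w.1); have d2 := wC1eB f2 (kst w.2).
exact: (wC1eD (wC1eM d1 d1) (wC1eM d2 d2)).
Qed.

Lemma dist2_eq0 p w : dot (p - w) (p - w) = 0 -> p = w.
Proof.
rewrite -enorm_sqr => /eqP; rewrite expf_eq0 /= => /eqP /enorm_eq0 /eqP.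
by rewrite subr_eq0 => /eqP.
Qed.

(** Newton's scheme: for a new node, a multiple of the product of squared distances to the earlier
    nodes is added, which leaves their values unchanged. Repeated nodes are allowed by the
    compatibility of the values. *)
Lemma interpolation (I : eqType) (s : seq I) (z : I -> R * R) (v : I -> R) :
  (forall i j, z i = z j -> v i = v j) ->
  exists Q d1 d2, wC1 setT Q d1 d2 /\ forall i, i \in s -> Q (z i) = v i.
Proof.
move=> vz; suff [Q [q1 [q2 QC]] Qs] : exists2 Q, wC1e setT Q & forall i, i \in s -> Q (z i) = v i.
  by exists Q, q1, q2.
elim: s => [|i s [Q QC Qs]]; first by exists (cst 0); [exact: wC1e_cst|].
have [[j js ji]|n] := pselect (exists2 j, j \in s & z j = z i).
  exists Q => // l; rewrite inE => /orP[/eqP ->|/Qs//].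
  by rewrite -ji Qs//; exact: vz.
pose Z p := \prod_(j <- s) dot (p - z j) (p - z j).
have ZC : wC1e setT Z.
  rewrite /Z; elim: (s) => [|j s' IH].
    by rewrite (_ : (fun p => _) = cst 1); [exact: wC1e_cst|apply/funext => p; rewrite big_nil].
  rewrite (_ : (fun p => _) = (fun p => dot (p - z j) (p - z j) *
     \prod_(j <- s') dot (p - z j) (p - z j))).
    exact: (wC1eM (wC1e_dist2 _) IH).
  by apply/funext => p; rewrite big_cons.
have Zi : Z (z i) != 0.
  rewrite prodf_seq_neq0; apply/allP => j js; apply/implyP => _.
  by apply/eqP => /dist2_eq0 ij; apply: n; exists j.
have Zs j : j \in s -> Z (z j) = 0.
  move=> js; apply/eqP; rewrite prodf_seq_eq0; apply/hasP; exists j => //=.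
  by rewrite subrr /dot /= !mulr0 addr0.
exists (fun p => Q p + (v i - Q (z i)) / Z (z i) * Z p).
  exact: (wC1eD QC (wC1eM (wC1e_cst _ _) ZC)).
move=> j; rewrite inE => /orP[/eqP ->|js]; first by rewrite divfK// addrC subrK.
by rewrite (Zs j js) mulr0 addr0 (Qs j js).
Qed.

End Interpolation.

(** * Sums over pairs of an element and an edge index *)

Section EdgeSums.
Context {R : realType}.
Notation mu := (@lebesgue_measure R).
Notation mR := (measurableTypeR R).
Variables (Omega : set (R * R)) (xb : R -> R * R) (L : R).
Hypothesis hOmega : C2_domain Omega xb L.
Variables (Th : triangulation R).
Hypothesis hTh : exact_conforming Omega Th.
Notation fr := (frontier Omega).
Notation T := (Th * 'I_3)%type.
Implicit Types (K : Th) (i : 'I_3) (x : T).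
Notation edg x := (edge x.1 x.2).

(** An edge is one set but may come from several pairs; exchanging the sums distributes [h F] over
    the pairs that represent [F]. *)
Lemma fsum_edges (S : set (set (R * R))) (h : set (R * R) -> R) (w : T -> R) :
  (forall F, S F -> exists x, F = edg x) ->
  (forall F, S F -> h F = \sum_(x : T | `[< edg x = F >]) w x) ->
  \sum_(F \in S) h F = \sum_(x : T | `[< S (edg x) >]) w x.
Proof.
move=> Sx hw.
have fS : finite_set S.
  apply: (sub_finite_set (B := (fun x : T => edg x) @` setT)).
    by move=> F /Sx[x ->]; exists x.
  by apply: finite_image.
rewrite fsbig_finite//=; set r := finmap.enum_fset _.
have rS F : F \in r -> S F by move=> Fr; have := in_fset_set fS F; rewrite Fr => /esym/set_mem.
have Sr F : S F -> F \in r.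
  by move=> SF; have := in_fset_set fS F; rewrite (mem_set SF).
have ru : uniq r by exact: finmap.fset_uniq.
transitivity (\sum_(F <- r) \sum_(x : T) (if `[< edg x = F >] then w x else 0)).
  by rewrite !big_seq; apply: eq_bigr => F /rS SF; rewrite hw// big_mkcond.
rewrite exchange_big /= [RHS]big_mkcond; apply: eq_bigr => x _.
case: asboolP => [Se|nS].
  rewrite (bigD1_seq (edg x)) ?Sr//= asboolT// big1 ?addr0// => F /eqP nF.
  by rewrite asboolF// => e; apply: nF.
by rewrite big_seq big1// => F /rS SF; rewrite asboolF// => e; apply: nS; rewrite e.
Qed.

Lemma boundary_edges_elt F : boundary_edges Omega Th F -> exists x, F = edg x.
Proof. by move=> [[K [i ->]] _]; exists (K, i). Qed.

Lemma boundary_edgesP x : boundary_edges Omega Th (edg x) <-> edg x `<=` fr.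
Proof. by split=> [[]//|h]; split=> //; exists x.1, x.2. Qed.

Lemma boundary_sum (h : set (R * R) -> R) :
  \sum_(F \in boundary_edges Omega Th) h F = \sum_(x : T | `[< edg x `<=` fr >]) h (edg x).
Proof.
rewrite (fsum_edges (w := fun x => h (edg x)) (S := boundary_edges Omega Th)).
- by apply: eq_bigl => x; apply/asboolP/asboolP => /boundary_edgesP.
- exact: boundary_edges_elt.
- move=> F /[dup] /boundary_edges_elt[x ->] /boundary_edgesP bd.
  rewrite (bigD1 x) /=; last exact/asboolP.
  rewrite big1 ?addr0// => y /andP[/asboolP e /eqP n]; case: n; apply/esym.
  have KK := bd_unique hOmega hTh bd (esym e).
  case: x y KK e {bd} => [K i] [K' j] /= <- e; congr pair.
  exact: (esym (edge_inj hTh e)).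
Qed.

Lemma interior_edges_elt F : interior_edges Th F -> exists x, F = edg x.
Proof. by move=> [K [_ [_ [i ->] _]]]; exists (K, i). Qed.

Lemma interior_edgesP x : interior_edges Th (edg x) <-> ~ edg x `<=` fr.
Proof.
case: x => K i /=; split.
  move=> [K1 [K2 [/eqP n [i1 e1] [i2 e2]]]] bd.
  rewrite e1 in bd; apply: (shared_nbd hOmega hTh n _ bd); rewrite -e1; exact: e2.
move=> nb; have [//|[K' [j [KK' e]]]] := shared_or_bd hOmega hTh K i.
by exists K, K'; split; [exact/eqP|exists i|exists j].
Qed.

Lemma interior_sum (h : set (R * R) -> R) (w : T -> R) :
  (forall K K' i j, K <> K' -> edge K i = edge K' j -> h (edge K i) = w (K, i) + w (K', j)) ->
  \sum_(F \in interior_edges Th) h F = \sum_(x : T | ~~ `[< edg x `<=` fr >]) w x.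
Proof.
move=> hw; rewrite (fsum_edges (w := w)).
- apply: eq_bigl => x; apply/asboolP/idP => [/interior_edgesP h0|]; first by apply/asboolPn.
  by move=> /asboolPn h0; apply/interior_edgesP.
- exact: interior_edges_elt.
- move=> F [K [K' [/eqP KK' [i ->] [j e]]]]; rewrite (hw _ _ _ _ KK' e).
  rewrite (bigD1 (K, i)) /=; last exact/asboolP.
  rewrite (bigD1 (K', j)) /=; last first.
    by apply/andP; split; [exact/asboolP|apply/eqP => -[/esym]].
  rewrite big1 ?addr0// => -[K2 i2] /andP[/andP[/asboolP /= e2 /eqP n1] /eqP n2].
  case: (shared_two hOmega hTh KK' e (esym e2)) => E; subst K2.
    by case: n1; congr pair; exact: edge_inj hTh _ _ _ e2.
  by case: n2; congr pair; exact: (edge_inj hTh (etrans e2 e)).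
Qed.

(** The parameter sets of the boundary edges cover [[0, L]] up to the finitely many parameters of
    vertices and overlap only there. The sum is thus the integral of [dQ] over a full period,
    [Q (xb L) - Q (xb 0)]. *)
Lemma boundary_telescope (Q q1 q2 : R * R -> R) : wC1 setT Q q1 q2 ->
  \sum_(x : T | `[< edg x `<=` fr >]) boundary_edge_int xb L (edg x) (dQ xb q1 q2) = 0.
Proof.
move=> QC; have L0 := dom_length hOmega; have dc := dQ_continuous hOmega QC.
pose S x := [set s : R | `[0, L]%classic s /\ edg x (xb s)].
have mS x : measurable (S x : set mR) := edge_params_measurable hOmega hTh x.1 x.2.
have SL x : S x `<=` `[0, L]%classic by move=> s [].
have mL : measurable (`[0, L]%classic : set mR) by exact: measurable_itv.
pose d := dQ xb q1 q2.
have rec (r : seq T) (P : pred T) :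
    mu.-integrable setT (EFin \o (fun s => \sum_(x <- r | P x) (d \_ (S x)) s)) /\
    \sum_(x <- r | P x) Rintegral mu (S x) d =
    Rintegral mu setT (fun s => \sum_(x <- r | P x) (d \_ (S x)) s).
  elim: r => [|x r [IH1 IH2]].
    have E0 : (fun s : R => \sum_(x <- [::] | P x) (d \_ (S x)) s) = cst 0.
      by apply/funext => s; rewrite big_nil.
    rewrite E0 big_nil; split; first exact: integrable0.
    by rewrite Rintegral_cst ?mul0r.
  have [Px|Px] := boolP (P x); last first.
    have E0 : (fun s : R => \sum_(x <- x :: r | P x) (d \_ (S x)) s) =
       (fun s => \sum_(x <- r | P x) (d \_ (S x)) s).
      by apply/funext => s; rewrite big_cons (negbTE Px).
    by rewrite E0 big_cons (negbTE Px).
  have E0 : (fun s : R => \sum_(x <- x :: r | P x) (d \_ (S x)) s) =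
     (fun s => (d \_ (S x)) s + \sum_(x <- r | P x) (d \_ (S x)) s).
    by apply/funext => s; rewrite big_cons Px.
  have i1 := patch_integrable dc (mS x) (@SL x).
  rewrite E0 big_cons Px; split.
    have := integrableD measurableT i1 IH1; by apply: eq_integrable.
  have D := RintegralD measurableT i1 IH1; transitivity (\int[mu]_s (d \_ (S x)) s +
      \int[mu]_s \sum_(x0 <- r | P x0) (d \_ (S x0)) s); last exact: esym D.
    by congr (_ + _); [exact: Rintegral_mkcond|exact: IH2].
have [_ E] := rec (index_enum T) (fun x => `[< edg x `<=` fr >]).
rewrite /boundary_edge_int /arc_int E.
(* One parameter per vertex, arbitrary if the vertex is not on the curve; [L] is added because [xb]
   is injective on [[0, L[] only. *)
pose sg (x : T) := get [set s | 0 <= s < L /\ xb s = vertex x.1 x.2].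
pose Z := L :: [seq sg x | x : T].
have inj := dom_simple hOmega.
have vZ s : 0 <= s <= L -> (exists K l, xb s = vertex K l) -> s \in Z.
  move=> sL [K [l sl]]; rewrite inE; have [//|nL] := eqVneq s L.
  have sL' : 0 <= s < L by have [? ?] := andP sL; rewrite lt_neqAle nL; apply/and3P.
  apply/orP; right; apply/mapP; exists (K, l); first by rewrite mem_enum.
  have [h1 h2] : [set s | 0 <= s < L /\ xb s = vertex K l] (sg (K, l)).
    by apply: (@getPex _ [set s | 0 <= s < L /\ xb s = vertex K l]); exists s.
  by apply: inj; rewrite ?inE /= ?in_itv //=; rewrite sl h2.
rewrite (@Rintegral_setD_seq _ setT Z _ (d \_ `[0, L]%classic))//; first last.
- move=> s _ sZ; have [sL|sL] := boolP (s \in `[0, L]%classic); last first.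
    rewrite patchE (negbTE sL) big1// => x _; rewrite patchE.
    by case: ifPn => // /set_mem/SL h; case/negP: sL; exact/mem_set.
  rewrite patchE sL; rewrite inE /= in_itv /= in sL.
  have nv K l : xb s <> vertex K l.
    by move=> e; apply: sZ; apply: vZ => //; exists K, l.
  have [[K [l e]]|[K [i [bd es]]]] := frontier_cover hOmega hTh s; first by case: (nv K l).
  rewrite (bigD1 (K, i)) /=; last exact/asboolP.
  rewrite patchE ifT; last by rewrite inE /S /= in_itv.
  rewrite big1 ?addr0// => -[K' j] /andP[/asboolP bd' /eqP n]; rewrite patchE ifF//.
  apply/negP; rewrite inE => -[_ /= es'].
  have [ee|ne] := pselect (edge K i = edge K' j).
    have KK := bd_unique hOmega hTh bd ee; subst K'.
    by case: n; congr pair; exact: (esym (edge_inj hTh ee)).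
  by have [l e] := bd_meet hOmega hTh bd ne es es'; exact: (nv K l).
- have := @patch_integrable _ _ 0 L _ dc mL (@subset_refl _ _) => /integrableP[m _].
  by move: m => /measurable_EFinP.
rewrite -Rintegral_mkcond.
have := itg_FTCc (F := fun s => Q (xb s)) (ltW L0) dc (fun s _ => Q_derive hOmega QC s).
rewrite /itg => ->.
by have := dom_periodic hOmega 0; rewrite add0r => ->; rewrite subrr.
Qed.

End EdgeSums.

(** * Lower bound for the determinants and [sh] together *)

Section GlobalInequality.
Context {R : realType}.
Notation mu := (@lebesgue_measure R).
Notation mR := (measurableTypeR R).
Notation mu2 := (mu \x mu)%E.
Variables (Omega : set (R * R)) (xb : R -> R * R) (L : R).
Hypothesis hOmega : C2_domain Omega xb L.
Variables (ell : R * R -> R * R) (theta : R -> R).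
Hypothesis hl : oblique_field Omega xb L ell theta.
Variable chi0 : R.
Hypothesis hchi0 : is_chi0 xb L theta chi0.
Variables (Th : triangulation R).
Hypothesis hTh : exact_conforming Omega Th.
Variables (nK : Th -> set (R * R) -> R * R) (tF : set (R * R) -> R * R).
Hypothesis hnK : forall (K : Th) (F : set (R * R)), interior_edges Th F ->
  is_edge K F -> outward_unit_normal (elt K) F (nK K F).
Hypothesis htF : forall F : set (R * R), interior_edges Th F -> unit_tangent F (tF F).
Variable vh : R * R -> R.
Variables (g1 g2 g11 g12 g21 g22 : Th -> R * R -> R).
Hypothesis vC : forall K, wC1 (elt K) vh (g1 K) (g2 K).
Hypothesis g1C : forall K, wC1 (elt K) (g1 K) (g11 K) (g12 K).
Hypothesis g2C : forall K, wC1 (elt K) (g2 K) (g21 K) (g22 K).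
Hypothesis C1v : C1_at_vertices Th vh.
Notation fr := (frontier Omega).
Notation T := (Th * 'I_3)%type.
Notation W := (wint g1 g2 g11 g12 g21 g22).
Notation edg x := (edge x.1 x.2).
Implicit Types (K : Th) (i : 'I_3) (x : T) (c : arc R).

(** A vertex shared by several elements carries a single value, since the gradients agree there; the
    interpolation problem is consistent. *)
Lemma vertex_interpolant : exists Q d1 d2, wC1 setT Q d1 d2 /\ forall K (l : 'I_3),
  Q (vertex K l) = dot (ell (vertex K l)) (g1 K (vertex K l), g2 K (vertex K l)) *
    dot (perp (ell (vertex K l))) (g1 K (vertex K l), g2 K (vertex K l)).
Proof.
pose z x := vertex x.1 x.2.
pose v x := dot (ell (z x)) (g1 x.1 (z x), g2 x.1 (z x)) *
    dot (perp (ell (z x))) (g1 x.1 (z x), g2 x.1 (z x)).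
have [|Q [d1 [d2 [QC Qv]]]] := @interpolation R T (index_enum T) z v.
  move=> [K i] [K' j] zz; have [h1 h2] := grad_vertex hTh vC C1v zz.
  by rewrite /v -zz /z /= h1 h2.
by exists Q, d1, d2; split=> // K l; have := Qv (K, l) (mem_index_enum _).
Qed.

(* An outward arc of the edge, the one that parametrizes the jump integral up
   to orientation when the edge is interior. *)
Definition adapted x c := [/\ edge_arc (epar x.1) x.2 c, outward (elt x.1) c &
  ~ edg x `<=` fr -> exists a b : R,
    (forall s : R, edg x (get (edg x) + s *: tF (edg x)) <-> a <= s <= b) /\
    (c = larc (get (edg x)) (tF (edg x)) a b \/
     c = arc_rev (larc (get (edg x)) (tF (edg x)) a b))].

Lemma adapted_arcs (d1 d2 Q : R * R -> R) : wC1 setT Q d1 d2 ->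
  (forall K (l : 'I_3),
    Q (vertex K l) = dot (ell (vertex K l)) (g1 K (vertex K l), g2 K (vertex K l)) *
      dot (perp (ell (vertex K l))) (g1 K (vertex K l), g2 K (vertex K l))) ->
  exists c : T -> arc R, forall x, adapted x (c x) /\
    (edg x `<=` fr ->
      chi0 * boundary_edge_int xb L (edg x) (fun s => enorm (bgrad Th vh (xb s)) ^+ 2) +
        boundary_edge_int xb L (edg x) (dQ xb d1 d2) <=
      W x.1 (c x) + 2 * boundary_edge_int xb L (edg x)
        (fun s => derive1 (d_ell Th xb ell vh) s * d_ellperp Th xb ell vh s)).
Proof.
move=> QC Qv; suff h x : exists c, adapted x c /\ (edg x `<=` fr ->
      chi0 * boundary_edge_int xb L (edg x) (fun s => enorm (bgrad Th vh (xb s)) ^+ 2) +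
        boundary_edge_int xb L (edg x) (dQ xb d1 d2) <=
      W x.1 c + 2 * boundary_edge_int xb L (edg x)
        (fun s => derive1 (d_ell Th xb ell vh) s * d_ellperp Th xb ell vh s)).
  by have [c cP] := choice h; exists c.
case: x => K i; rewrite /adapted /=.
have [bd|nb] := pselect (edge K i `<=` fr).
  have [c [ic oc le]] := bd_wint hOmega hl hchi0 hTh vC g1C g2C QC Qv bd.
  by exists c; split.
have [p pe _] := edge_mid_not_vertex hTh K i.
have ge : edge K i (get (edge K i)) by apply: (@getPex _ (edge K i)); exists p.
have tt := htF (proj2 (interior_edgesP hOmega hTh (K, i)) nb).
have [a [b [ic ab]]] := line_arc hTh (nbd_segment hTh nb) ge tt.
have [al [k H]] := elt_curved_tri hTh K.
have [oc|oc] := edge_arc_outward H ic.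
  by exists (larc (get (edge K i)) (tF (edge K i)) a b); split=> //; split=> // _; exists a, b; split=> //; left.
exists (arc_rev (larc (get (edge K i)) (tF (edge K i)) a b)); split=> //; split=> //.
  exact: edge_arc_rev ic.
by move=> _; exists a, b; split=> //; right.
Qed.

(** Both arcs run over the same parameters of the same line. They cannot be equal, for two elements
    would lie on one side of the edge, so one is the reverse of the other. *)
Lemma shared_pair (c : T -> arc R) K K' i j :
  (forall x, adapted x (c x)) ->
  K <> K' -> edge K i = edge K' j ->
  W K (c (K, i)) + W K' (c (K', j)) =
  2 * straight_edge_int tF (edge K i) (fun p => normal_jump nK vh (edge K i) p *
     'D_(tF (edge K i)) ('D_(tF (edge K i)) vh) p).
Proof.
move=> cP KK' EE; set F := edge K i; set q := get F; set ta := tF F.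
have nb : ~ F `<=` fr := shared_nbd hOmega hTh KK' EE.
have iF : interior_edges Th F by apply/(interior_edgesP hOmega hTh (K, i)).
have [ic o /(_ nb)[a [b [Fab cE]]]] := cP (K, i).
have [ic' o' ] := cP (K', j); rewrite /= in ic o Fab cE ic' o' *.
rewrite -EE -/F -/q -/ta in Fab cE * => /(_ nb)[a' [b' [Fab' cE']]].
have isK : is_edge K F by exists i.
have isK' : is_edge K' F by exists j.
have EE' : F = edge K' j := EE.
have ab c0 (u v : R) : (c0 = larc q ta u v \/ c0 = arc_rev (larc q ta u v)) -> arc_ok c0 -> u < v.
  by move=> [->|->] ok; have /= := arc_lohi ok; rewrite ?ltrN2.
have ab1 := ab _ _ _ cE ic.1; have ab2 := ltW (ab _ _ _ cE' ic'.1).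
have aa : a' = a /\ b' = b.
  have h1 : a' <= a <= b' by apply/Fab'/Fab; rewrite lexx ltW.
  have h2 : a' <= b <= b' by apply/Fab'/Fab; rewrite lexx ltW.
  have h3 : a <= a' <= b by apply/Fab/Fab'; rewrite lexx.
  have h4 : a <= b' <= b by apply/Fab/Fab'; rewrite lexx ab2.
  split; lra.
rewrite !aa.1 !aa.2 in cE' => {a' b' Fab' ab2 aa}.
have main (K1 K2 : Th) i1 j1 : K1 <> K2 -> F = edge K1 i1 -> F = edge K2 j1 ->
    is_edge K1 F -> is_edge K2 F ->
    edge_arc (epar K1) i1 (larc q ta a b) -> outward (elt K1) (larc q ta a b) ->
    outward (elt K2) (arc_rev (larc q ta a b)) ->
    W K1 (larc q ta a b) + W K2 (arc_rev (larc q ta a b)) =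
    2 * straight_edge_int tF F (fun p => normal_jump nK vh F p * 'D_ta ('D_ta vh) p).
  move=> K12 E1 E2 is1 is2 ic1 o1 o2.
  have := shared_edge_int hTh vC g1C g2C hOmega C1v (nK := nK) (tF := tF) (a := a) (b := b) K12
    (etrans (esym E1) E2).
  rewrite -E1; apply=> //; [exact: htF|exact: hnK|exact: hnK].
case: cE => cE; case: cE' => cE'; rewrite cE in ic o *; rewrite cE' in ic' o' *.
- by case: KK'; exact: (outward_unique hTh ic.1 o o').
- exact: (main K K' i j KK').
- rewrite addrC; apply: (main K' K j i) => //; exact: nesym.
- by case: KK'; exact: (outward_unique hTh ic.1 o o').
Qed.

Lemma det_sh_ge :
  chi0 * (\sum_(F \in boundary_edges Omega Th)
      boundary_edge_int xb L F (fun s => enorm (bgrad Th vh (xb s)) ^+ 2)) <=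
  \sum_K 2 * Rintegral mu2 (interior (elt K) : set (mR * mR)) (detg g11 g12 g21 g22 K) +
    sh Omega nK tF xb L ell vh vh.
Proof.
have [Q [d1 [d2 [QC Qv]]]] := vertex_interpolant.
have [c cP] := adapted_arcs QC Qv.
have cA x : adapted x (c x) := (cP x).1.
have -> : \sum_K 2 * Rintegral mu2 (interior (elt K) : set (mR * mR)) (detg g11 g12 g21 g22 K) =
    \sum_(x : T) W x.1 (c x).
  rewrite (eq_bigr (fun K => \sum_(i < 3) W K (c (K, i)))); last first.
    move=> K _; apply: (det_green hTh g1C g2C (c := fun i => c (K, i))) => i.
      by have [] := cA (K, i).
    by have [] := cA (K, i).
  by rewrite pair_bigA /=; apply: eq_bigr => -[K i].
rewrite (bigID (fun x => `[< edg x `<=` fr >])) /=.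
rewrite -(interior_sum hOmega hTh (w := fun x => W x.1 (c x)) (h := fun F => 2 *
  straight_edge_int tF F (fun p => normal_jump nK vh F p * 'D_(tF F) ('D_(tF F) vh) p))); last first.
  by move=> K K' i j KK' EE; rewrite -(shared_pair cA KK' EE).
rewrite /sh -mulr_fsumr !(boundary_sum hOmega hTh).
set SI := (X in _ + 2 * X + _); set SI' := (X in - 2 * X).
have -> : SI' = SI by [].
set B1 := \sum_(x | _) boundary_edge_int _ _ _ _; set B2 := \sum_(x | _) boundary_edge_int _ _ _ _.
set SW := \sum_(x | _) W _ _.
(* The interior terms have cancelled; the 0 is to be replaced by the sum of the integrals of [dQ],
   so that the inequality holds edge by edge. *)
suff : chi0 * B1 + 0 <= SW + 2 * B2 by lra.
rewrite -(boundary_telescope hOmega hTh QC) !mulr_sumr -!big_split /=.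
by apply: ler_sum => x /asboolP bd; exact: (cP x).2.
Qed.

End GlobalInequality.

(** * Cordes' condition *)

Section Coefficients.
Context {R : realType}.
Notation mu := (@lebesgue_measure R).
Notation mR := (measurableTypeR R).
Notation mu2 := (mu \x mu)%E.
Implicit Types (M H : 'M[R]_2).

Lemma mxfrob_ge0 M : 0 <= mxfrob M M.
Proof. by rewrite mxfrobE -!expr2 !addr_ge0 ?sqr_ge0. Qed.

Lemma sqr_tr_le M : (\tr M) ^+ 2 <= 2 * mxfrob M M.
Proof. rewrite trE mxfrobE; have := sqr_ge0 (M 0 0 - M 1 1); have := sqr_ge0 (M 0 1); have := sqr_ge0 (M 1 0); nra. Qed.

Lemma cauchy4 (a b c d x y z t : R) : (a * x + b * y + (c * z + d * t)) ^+ 2 <=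
  (a * a + b * b + (c * c + d * d)) * (x * x + y * y + (z * z + t * t)).
Proof.
rewrite -subr_ge0.
have -> : (a * a + b * b + (c * c + d * d)) * (x * x + y * y + (z * z + t * t)) -
    (a * x + b * y + (c * z + d * t)) ^+ 2 =
    (a * y - b * x) ^+ 2 + (a * z - c * x) ^+ 2 + (a * t - d * x) ^+ 2 +
    (b * z - c * y) ^+ 2 + (b * t - d * y) ^+ 2 + (c * t - d * z) ^+ 2 by ring.
by rewrite !addr_ge0 ?sqr_ge0.
Qed.

Lemma mxfrob_cauchy M H : mxfrob M H ^+ 2 <= mxfrob M M * mxfrob H H.
Proof. by rewrite !mxfrobE; exact: cauchy4. Qed.

(** Cauchy-Schwarz and [(tr M)^2 <= 2 |M|^2]; a zero [M] is covered by the convention [0^-1 = 0].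
    The bound is uniform in [M], so the first term of [bh] is integrable by domination. *)
Lemma gamma_frob_le M H : (\tr M / mxfrob M M * mxfrob M H) ^+ 2 <= 2 * mxfrob H H.
Proof.
have [->|M0] := eqVneq (mxfrob M M) 0.
  by rewrite invr0 mulr0 mul0r expr0n /= mulr_ge0 ?mxfrob_ge0.
have Mp : 0 < mxfrob M M by rewrite lt_neqAle eq_sym M0 mxfrob_ge0.
rewrite exprMn expr_div_n.
apply: (le_trans (y := (\tr M) ^+ 2 / mxfrob M M ^+ 2 * (mxfrob M M * mxfrob H H))).
  by rewrite ler_wpM2l ?divr_ge0 ?sqr_ge0 ?mxfrob_cauchy.
have -> : (\tr M) ^+ 2 / mxfrob M M ^+ 2 * (mxfrob M M * mxfrob H H) =
  (\tr M) ^+ 2 / mxfrob M M * mxfrob H H by field.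
by rewrite ler_wpM2r ?mxfrob_ge0// ler_pdivrMr ?sqr_tr_le.
Qed.

Lemma gamma_frob_tr_le M H : `|\tr M / mxfrob M M * mxfrob M H * \tr H| <= 2 * mxfrob H H.
Proof.
have h1 := gamma_frob_le M H; have h2 := sqr_tr_le H.
move: h1 h2; set x := _ * mxfrob M H; set y := \tr H; set h := mxfrob H H => h1 h2.
by rewrite ler_norml; have := sqr_ge0 (x - y); have := sqr_ge0 (x + y); nra.
Qed.

(* With [B = gamma A - I], Cordes' condition reads [|B|^2 = 2 - (tr A)^2 / |A|^2 <= 1 - eps]. *)
Lemma cordes_pointwise M H (eps : R) : 0 < eps <= 1 -> 0 < \tr M ->
  mxfrob M M / (\tr M) ^+ 2 <= (1 + eps)^-1 ->
  (1 - Num.sqrt (1 - eps) / 2) * (\tr H) ^+ 2 - Num.sqrt (1 - eps) / 2 * mxfrob H H <=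
  \tr M / mxfrob M M * mxfrob M H * \tr H.
Proof.
move=> /andP[e0 e1] t0 C.
have Mp : 0 < mxfrob M M by have := sqr_tr_le M; have := exprn_gt0 2 t0; nra.
have t2 : 0 < (\tr M) ^+ 2 by exact: exprn_gt0.
set s := Num.sqrt (1 - eps); have s0 : 0 <= s by exact: sqrtr_ge0.
have s2 : s ^+ 2 = 1 - eps by rewrite sqr_sqrtr// subr_ge0.
pose g := \tr M / mxfrob M M.
have gM : g * mxfrob M M = \tr M by rewrite /g divfK// gt_eqF.
have gt : 1 + eps <= g * \tr M.
  have : mxfrob M M * (1 + eps) <= (\tr M) ^+ 2.
    move: C; rewrite ler_pdivrMr// mulrC -ler_pdivlMr//; lra.
  by rewrite /g mulrAC ler_pdivlMr// mulrC -expr2.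
pose b := g * mxfrob M H - \tr H.
have b2 : b ^+ 2 <= s ^+ 2 * mxfrob H H.
  have := cauchy4 (g * M 0 0 - 1) (g * M 0 1) (g * M 1 0) (g * M 1 1 - 1) (H 0 0) (H 0 1) (H 1 0) (H 1 1).
  have -> : (g * M 0 0 - 1) * H 0 0 + g * M 0 1 * H 0 1 + (g * M 1 0 * H 1 0 + (g * M 1 1 - 1) * H 1 1) = b.
    by rewrite /b mxfrobE trE; ring.
  have -> : (g * M 0 0 - 1) * (g * M 0 0 - 1) + g * M 0 1 * (g * M 0 1) +
      (g * M 1 0 * (g * M 1 0) + (g * M 1 1 - 1) * (g * M 1 1 - 1)) = 2 - g * \tr M.
    transitivity (g * (g * mxfrob M M) - 2 * (g * \tr M) + 2).
      by rewrite mxfrobE trE; ring.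
    by rewrite gM; ring.
  rewrite -mxfrobE => h; apply: (le_trans h); rewrite ler_wpM2r ?mxfrob_ge0// s2; lra.
have h0 := mxfrob_ge0 H; set h := mxfrob H H in b2 h0 *; set t := \tr H in b b2 *.
have -> : \tr M / mxfrob M M * mxfrob M H * t = (b + t) * t by rewrite /b -/g subrK.
(* Young's inequality [s * sqrt h * |t| <= s / 2 * (h + t ^+ 2)], checked on squares. *)
have key : `|b * t| <= s / 2 * (h + t ^+ 2).
  rewrite -ler_sqr ?nnegrE ?normr_ge0 ?mulr_ge0 ?divr_ge0 ?addr_ge0 ?sqr_ge0//.
  rewrite real_normK ?num_real// exprMn.
  apply: (le_trans (y := s ^+ 2 * h * t ^+ 2)); first by rewrite ler_wpM2r ?sqr_ge0.
  rewrite -subr_ge0; have -> : (s / 2 * (h + t ^+ 2)) ^+ 2 - s ^+ 2 * h * t ^+ 2 =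
    (s / 2 * (h - t ^+ 2)) ^+ 2 by field.
  exact: sqr_ge0.
move: key; rewrite ler_norml => /andP[k _]; lra.
Qed.

(** The exceptional null set is removed from the domain, which changes neither integral. *)
Lemma ae_le_Rintegral (D : set (mR * mR)) (f g : mR * mR -> R) : measurable D ->
  mu2.-integrable D (EFin \o f) -> mu2.-integrable D (EFin \o g) ->
  {ae mu2, forall x, D x -> f x <= g x} -> Rintegral mu2 D f <= Rintegral mu2 D g.
Proof.
move=> mD fi gi [N [mN N0 fgN]].
have mDN : measurable (D `\` N) by exact: measurableD.
have E0 (h : mR * mR -> R) : mu2.-integrable D (EFin \o h) ->
    Rintegral mu2 D h = Rintegral mu2 (D `\` N) h.
  by move=> hi; rewrite /Rintegral (negligible_integral mN mD hi N0).
rewrite !E0//; apply: le_Rintegral => //.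
- by apply: (integrableS mD mDN _ fi); exact: subDsetl.
- by apply: (integrableS mD mDN _ gi); exact: subDsetl.
- by move=> x [Dx Nx]; apply: contrapT => h; apply: Nx; apply: fgN => /(_ Dx).
Qed.

Variables (Omega : set (R * R)) (A : R * R -> 'M[R]_2).
Hypothesis hA : Linfty_coef Omega A.

Lemma gamma_measurable : open Omega -> measurable_fun (Omega : set (mR * mR)) (cordes_gamma A : mR * mR -> mR).
Proof.
move=> Oo; have mA i j : measurable_fun (Omega : set (mR * mR)) ((fun x => A x i j) : mR * mR -> mR).
  by have [] := hA i j.
have mF : measurable_fun (Omega : set (mR * mR)) ((fun x => mxfrob (A x) (A x)) : mR * mR -> mR).
  rewrite (_ : (fun x => _) = (fun x => A x 0 0 * A x 0 0 + A x 0 1 * A x 0 1 +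
     (A x 1 0 * A x 1 0 + A x 1 1 * A x 1 1))); last by apply/funext => x; exact: mxfrobE.
  have M2 i j := measurable_funM (mA i j) (mA i j).
  exact: (measurable_funD (measurable_funD (M2 0 0) (M2 0 1)) (measurable_funD (M2 1 0) (M2 1 1))).
have mI : measurable_fun (Omega : set (mR * mR)) ((fun x => (mxfrob (A x) (A x))^-1) : mR * mR -> mR).
  (* The inverse is written as a power of exponent -1, which is measurable as a function of its
     base. *)
  rewrite (_ : (fun x => _) = (fun x => (mxfrob (A x) (A x)) `^ (-1))).
    exact: (measurableT_comp (measurable_powR (-1)) mF).
  by apply/funext => x; rewrite powR_inv1// mxfrob_ge0.
rewrite (_ : cordes_gamma A = (fun x => (A x 0 0 + A x 1 1) * (mxfrob (A x) (A x))^-1)).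
  exact: (measurable_funM (measurable_funD (mA 0 0) (mA 1 1)) mI).
by apply/funext => x; rewrite /cordes_gamma trE.
Qed.


Variables (xb : R -> R * R) (L : R) (Th : triangulation R).
Hypothesis hOmega : C2_domain Omega xb L.
Hypothesis hTh : exact_conforming Omega Th.
Variable vh : R * R -> R.
Variables (g1 g2 g11 g12 g21 g22 : Th -> R * R -> R).
Hypothesis vC : forall K, wC1 (elt K) vh (g1 K) (g2 K).
Hypothesis g1C : forall K, wC1 (elt K) (g1 K) (g11 K) (g12 K).
Hypothesis g2C : forall K, wC1 (elt K) (g2 K) (g21 K) (g22 K).
Implicit Types (K : Th).

Lemma gamma_integrable K : mu2.-integrable (interior (elt K) : set (mR * mR))
  (EFin \o (fun x => cordes_gamma A x * mxfrob (A x) (hess vh x) * laplace vh x)).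
Proof.
have mK : measurable (interior (elt K) : set (mR * mR)).
  by apply: open_measurable2; exact: open_interior.
have [_ c11 c12] := g1C K; have [_ c21 c22] := g2C K.
have cK f : cin (elt K) f -> cin (interior (elt K)) f.
  move=> fc p Kp; have := fc p (interior_subset Kp); apply: cvg_trans.
  apply: cvg_app => S h; have h2 : \forall q \near p, elt K q -> S q := h.
  have h3 : \forall q \near p, interior (elt K) q -> S q.
    by apply: filterS h2 => q qS /interior_subset; exact: qS.
  exact: h3.
have mg f : cin (elt K) f -> measurable_fun (interior (elt K) : set (mR * mR)) (f : mR * mR -> mR).
  by move=> /cK; apply: cin_measurable; exact: open_interior.
pose h2 p := g11 K p * g11 K p + g12 K p * g12 K p + (g12 K p * g12 K p + g22 K p * g22 K p).
have h2c : cin (elt K) (fun p => 2 * h2 p).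
  by apply: cinM; [exact: cin_cst|apply: cinD; apply: cinD; apply: cinM].
have Kint := elt_cin_integrable hTh h2c.
have mO : measurable (Omega : set (mR * mR)) by apply: open_measurable2; exact: dom_open hOmega.
have sub := interior_elt_Omega hOmega hTh (K := K).
have mgam : measurable_fun (interior (elt K) : set (mR * mR)) (cordes_gamma A : mR * mR -> mR).
  exact: measurable_funS mO sub (gamma_measurable (dom_open hOmega)).
have mA i j : measurable_fun (interior (elt K) : set (mR * mR)) ((fun x => A x i j) : mR * mR -> mR).
  by apply: (measurable_funS mO sub); have [] := hA i j.
have m11 := mg _ c11; have m12 := mg _ c12; have m22 := mg _ c22.
pose F x := cordes_gamma A x * (A x 0 0 * g11 K x + A x 0 1 * g12 K x +
  (A x 1 0 * g12 K x + A x 1 1 * g22 K x)) * (g11 K x + g22 K x).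
have mF : measurable_fun (interior (elt K) : set (mR * mR)) (F : mR * mR -> mR).
  exact: (measurable_funM (measurable_funM mgam (measurable_funD
    (measurable_funD (measurable_funM (mA 0 0) m11) (measurable_funM (mA 0 1) m12))
    (measurable_funD (measurable_funM (mA 1 0) m12) (measurable_funM (mA 1 1) m22))))
    (measurable_funD m11 m22)).
have FE x : interior (elt K) x ->
    cordes_gamma A x * mxfrob (A x) (hess vh x) * laplace vh x = F x /\
    2 * mxfrob (hess vh x) (hess vh x) = 2 * h2 x.
  move=> Kx; have [e0 e1 e2 e3] := hess_interior vC g1C g2C Kx.
  by rewrite /laplace !mxfrobE !trE e0 e1 e2 e3.
apply: (le_integrable mK _ _ Kint) => /=.
  apply/measurable_EFinP; apply: eq_measurable_fun mF => x /set_mem Kx.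
  by rewrite (FE x Kx).1.
move=> x Kx; rewrite lee_fin; apply: le_trans (ler_norm _).
by rewrite -(FE x Kx).2; exact: gamma_frob_tr_le.
Qed.

(** With [(tr H)^2 = |H|^2 + 2 det H] the pointwise bound regroups as
    [(1 - s) |H|^2 + (1 - s / 2) 2 det H], and [1 - s / 2] is the weight of [sh] in [bh]. *)
Lemma elt_int_ge K (eps : R) : uniformly_elliptic Omega A -> 0 < eps <= 1 -> cordes Omega A eps ->
  (1 - Num.sqrt (1 - eps)) * elt_int K (fun x => mxfrob (hess vh x) (hess vh x)) +
    (1 - Num.sqrt (1 - eps) / 2) *
      (2 * Rintegral mu2 (interior (elt K) : set (mR * mR)) (detg g11 g12 g21 g22 K)) <=
  elt_int K (fun x => cordes_gamma A x * mxfrob (A x) (hess vh x) * laplace vh x).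
Proof.
move=> [nu0 [nu1 [n0 _ ell]]] e0 C; set s := Num.sqrt _.
have mK : measurable (interior (elt K) : set (mR * mR)).
  by apply: open_measurable2; exact: open_interior.
have [_ c11 c12] := g1C K; have [_ c21 c22] := g2C K.
pose h2 p := g11 K p * g11 K p + g12 K p * g12 K p + (g12 K p * g12 K p + g22 K p * g22 K p).
have h2c : cin (elt K) h2 by apply: cinD; apply: cinD; apply: cinM.
have dc : cin (elt K) (detg g11 g12 g21 g22 K) by apply: cinD; [|apply: cinN]; apply: cinM.
have -> : elt_int K (fun x => mxfrob (hess vh x) (hess vh x)) =
    Rintegral mu2 (interior (elt K) : set (mR * mR)) h2.
  apply: eq_Rintegral => x /set_mem Kx; have [d0 d1 d2 d3] := hess_interior vC g1C g2C Kx.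
  by rewrite mxfrobE d0 d1 d2 d3.
have ih := elt_cin_integrable hTh h2c; have id := elt_cin_integrable hTh dc.
have ch : cin (elt K) (fun x => (1 - s) * h2 x) by apply: cinM => //; exact: cin_cst.
have cd : cin (elt K) (fun x => (1 - s / 2) * (2 * detg g11 g12 g21 g22 K x)).
  by apply: cinM; [exact: cin_cst|apply: cinM => //; exact: cin_cst].
have ich := elt_cin_integrable hTh ch; have icd := elt_cin_integrable hTh cd.
have -> : (1 - s) * Rintegral mu2 (interior (elt K) : set (mR * mR)) h2 +
    (1 - s / 2) * (2 * Rintegral mu2 (interior (elt K) : set (mR * mR)) (detg g11 g12 g21 g22 K)) =
    Rintegral mu2 (interior (elt K) : set (mR * mR))
      (fun x => (1 - s) * h2 x + (1 - s / 2) * (2 * detg g11 g12 g21 g22 K x)).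
  rewrite (RintegralD mK ich icd); congr (_ + _); first by rewrite (RintegralZl _ mK ih).
  have d2 : cin (elt K) (fun x => 2 * detg g11 g12 g21 g22 K x).
    by apply: cinM => //; exact: cin_cst.
  rewrite (RintegralZl _ mK (elt_cin_integrable hTh d2)).
  by rewrite (RintegralZl _ mK id).
apply: ae_le_Rintegral => //.
- exact: (elt_cin_integrable hTh (cinD ch cd)).
- exact: gamma_integrable.
have FF := ae_filter_ringOfSetsType mu2.
apply: (@filterS2 _ _ FF _ _ _ _ ell C) => x ellx Cx Kx.
have Ox := interior_elt_Omega hOmega hTh Kx.
(* Ellipticity tested on the two basis vectors makes both diagonal entries positive. *)
have tp : 0 < \tr (A x).
  have := ellx Ox (1, 0); have := ellx Ox (0, 1).
  rewrite !enorm_sqr /dot /mxact /= trE !(mulr0, mulr1, mul0r, mul1r, addr0, add0r).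
  by move=> /andP[h1 _] /andP[h3 _]; rewrite addr_gt0//; apply: lt_le_trans n0 _.
apply: le_trans (cordes_pointwise (hess vh x) e0 tp (Cx Ox)).
have [d0 d1 d2 d3] := hess_interior vC g1C g2C Kx.
have sch : g12 K x = g21 K x := wC1_schwarz Kx (vC K) (g1C K) (g2C K).
by rewrite -/s mxfrobE trE d0 d1 d2 d3 /h2 /detg -sch; lra.
Qed.

End Coefficients.

Theorem lemma4p2 (R : realType)
  (Omega : set (R * R)) (xb : R -> R * R) (L : R)
  (hOmega : C2_domain Omega xb L)
  (A : R * R -> 'M[R]_2) (eps : R)
  (hA : Linfty_coef Omega A)
  (hell : uniformly_elliptic Omega A)
  (heps : 0 < eps <= 1)
  (hcordes : cordes Omega A eps)
  (ell : R * R -> R * R) (theta : R -> R)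
  (hl : oblique_field Omega xb L ell theta)
  (chi0 : R) (hchi0 : is_chi0 xb L theta chi0) (hchi0_gt0 : 0 < chi0)
  (Th : triangulation R) (hTh : exact_conforming Omega Th)
  (nK : Th -> set (R * R) -> R * R)
  (hnK : forall (K : Th) (F : set (R * R)), interior_edges Th F ->
     is_edge K F -> outward_unit_normal (elt K) F (nK K F))
  (tF : set (R * R) -> R * R)
  (htF : forall F : set (R * R), interior_edges Th F -> unit_tangent F (tF F))
  (k : nat) (hk : (3 <= k)%N) (vh : R * R -> R) (hvh : Vh Omega Th k vh) :
  (1 - Num.sqrt (1 - eps)) * normh_sq Omega Th xb L chi0 vh
    <= bh Omega nK tF xb L ell A eps vh vh.
Proof.
have [_ vP C1v] := hvh.
have reg (K : Th) : exists g : (R * R -> R) * (R * R -> R) *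
    ((R * R -> R) * (R * R -> R) * ((R * R -> R) * (R * R -> R))),
    [/\ wC1 (elt K) vh g.1.1 g.1.2, wC1 (elt K) g.1.1 g.2.1.1 g.2.1.2 &
        wC1 (elt K) g.1.2 g.2.2.1 g.2.2.2].
  have [d1 [d2 [v1 [d11 [d12 v2]] [d21 [d22 v3]]]]] := in_PK_wC2e hTh (vP K).
  by exists (d1, d2, ((d11, d12), (d21, d22))).
have [g gP] := choice reg.
have vC K : wC1 (elt K) vh (g K).1.1 (g K).1.2 by have [] := gP K.
have g1C K : wC1 (elt K) (g K).1.1 (g K).2.1.1 (g K).2.1.2 by have [] := gP K.
have g2C K : wC1 (elt K) (g K).1.2 (g K).2.2.1 (g K).2.2.2 by have [] := gP K.
have D := det_sh_ge hOmega hl hchi0 hTh hnK htF vC g1C g2C C1v.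
have E := fun K => elt_int_ge hA hOmega hTh vC g1C g2C K hell heps hcordes.
rewrite /normh_sq /bh; set s := Num.sqrt (1 - eps) in E *.
have s0 : 0 <= s by exact: sqrtr_ge0.
have s1 : s <= 1.
  by rewrite -sqrtr1 ler_wsqrtr//; move/andP: heps => [? _]; lra.
set B := \sum_(F \in _) _ in D *; set S := sh _ _ _ _ _ _ _ _ in D *.
set N := \sum_(K : Th) elt_int K (fun x => mxfrob _ _).
set G := \sum_(K : Th) elt_int K _.
have B0 : 0 <= B.
  rewrite /B (boundary_sum hOmega hTh); apply: sumr_ge0 => x _.
  by apply: Rintegral_ge0 => t _; exact: sqr_ge0.
set W := \sum_K _ in D.
have NG : (1 - s) * N + (1 - s / 2) * W <= G.
  by rewrite /N /W !mulr_sumr -big_split; apply: ler_sum => K _; exact: E.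
(* The boundary term is available with the weight [1 - s / 2] and wanted with [1 - s]; as [0 <= s]
   and [0 <= chi0 * B], the former suffices. *)
have cB : 0 <= chi0 * B by rewrite mulr_ge0// ltW.
nra.
Qed.
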